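(* Let $\Omega,\Omega'\in\mathfrak H_n$ and let $\gamma$ be the unique geodesic in $\mathfrak H_n$ with $\gamma(0)=\Omega$ and $\gamma(1)=\Omega'$. Put $\Xi_{\Omega\Omega'}=\frac{\Omega-\bar\Omega'}{2\sqrt{-1}}$ and $\Xi_{\Omega'\Omega}=\frac{\Omega'-\bar\Omega}{2\sqrt{-1}}$. Let $\alpha\in\mathbb C^n$ and $c_\alpha(z_\Omega)=\exp({}^t\bar\alpha\,z_\Omega-\frac12|z_\Omega|^2)\in\mathcal H_\Omega$. 1. The parallel transport of $c_\alpha$ along $\gamma$ in $\mathcal H$ is, with $z'=z_{\Omega'}$, $$(U_{\Omega'\Omega}c_\alpha)(z')=\frac{(\det\Omega_2)^{1/4}(\det\Omega_2')^{1/4}}{|\det\Xi_{\Omega\Omega'}|^{1/2}}\exp\left[\tfrac12\,{}^t\!\begin{pmatrix}\bar\alpha\\ z'\end{pmatrix}\begin{pmatrix}I_n-\Omega_2^{1/2}\Xi_{\Omega\Omega'}^{-1}\Omega_2^{1/2}&\Omega_2^{1/2}\Xi_{\Omega\Omega'}^{-1}\Omega_2'^{1/2}\\ \Omega_2'^{1/2}\Xi_{\Omega\Omega'}^{-1}\Omega_2^{1/2}&I_n-\Omega_2'^{1/2}\Xi_{\Omega\Omega'}^{-1}\Omega_2'^{1/2}\end{pmatrix}\begin{pmatrix}\bar\alpha\\ z'\end{pmatrix}-\tfrac12|z'|^2\right].$$ 2. The parallel transport of $\sqrt{d^nz_\Omega}$ along $\gamma$ in $\sqrt{\mathcal K}$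 is $$\frac{(\det\Xi_{\Omega'\Omega})^{1/2}}{|\det\Xi_{\Omega'\Omega}|^{1/2}}\sqrt{d^nz_{\Omega'}}=\frac{|\det\Xi_{\Omega\Omega'}|^{1/2}}{(\det\Xi_{\Omega\Omega'})^{1/2}}\sqrt{d^nz_{\Omega'}}.$$ 3. The parallel transport of $c_\alpha(z_\Omega)\otimes\sqrt{d^nz_\Omega}$ along $\gamma$ in $\hat{\mathcal H}=\mathcal H\otimes\sqrt{\mathcal K}$ is the tensor product of the expressions in 1 and 2.
   Context: $V$ is a real vector space of dimension $2n$ with linear coordinates $x,y\in\mathbb R^n$ (columns) and symplectic form $\omega=\sum_i dx^i\wedge dy^i$. $\mathfrak H_n$ is the set of complex symmetric $n\times n$ matrices $\Omega=\Omega_1+\sqrt{-1}\,\Omega_2$ with $\Omega_2=\mathrm{Im}\,\Omega>0$, with the Riemannian (Kähler) metric $ds^2=\mathrm{Tr}(\Omega_2^{-1}\delta\Omega\,\Omega_2^{-1}\delta\bar\Omega)$. A point $\Omega$ corresponds to the compatible linear complex structure on $V$ whose $(1,0)$-space is $\{(\Omega w,w):w\in\mathbb C^n\}$; its holomorphic coordinates are $z_\Omega=(2\Omega_2)^{-1/2}(x-\bar\Omega y)$. Sections of the (trivialized) pre-quantum line bundle are functions on $V$; $\mathcal H^0=L^2(V,\varepsilon_\omega)$ with $\varepsilon_\omega=\omega^n/((2\pi)^n n!)$. $\mathcal H_\Omega=\{\phi(z_\Omega)e^{-\frac12|z_\Omega|^2}\in\mathcal H^0:\phi\text{ entire}\}$.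 The spaces $\mathcal H_\Omega$ form a Hilbert bundle $\mathcal H\to\mathfrak H_n$, whose connection is the orthogonal projection of the trivial connection on $\mathfrak H_n\times\mathcal H^0$: a $C^1$ family $\psi_t\in\mathcal H_{\gamma(t)}$ (as an $\mathcal H^0$-valued function) along a smooth path $\gamma$ is parallel if the orthogonal projection of $\frac{d}{dt}\psi_t$ onto $\mathcal H_{\gamma(t)}$ vanishes for all $t$. $U_{\Omega'\Omega}:\mathcal H_\Omega\to\mathcal H_{\Omega'}$ is the unitary operator of parallel transport along the unique geodesic from $\Omega$ to $\Omega'$. The line bundle $\mathcal K\to\mathfrak H_n$ has fibre $\bigwedge^n(V_J^{(1,0)})^*$, with global unitary section $d^nz_\Omega=dz_\Omega^1\wedge\cdots\wedge dz_\Omega^n$; $\sqrt{\mathcal K}$ is its square root bundle, with global unitary section $\sqrt{d^nz_\Omega}$. The connection on $\sqrt{\mathcal K}$ is, in this trivialization, $\delta+\frac{\sqrt{-1}}4\mathrm{Tr}(\Omega_2^{-1}\delta\Omega_1)$, i.e. $f(t)\sqrt{d^nz_{\gamma(t)}}$ is parallel iff $f'+\frac{\sqrt{-1}}4\mathrm{Tr}(\Omega_2^{-1}\dot\Omega_1)f=0$ along $\gamma$. $\hat{\mathcal H}=\mathcal H\otimes\sqrt{\mathcal K}$ carries the tensor product connection. $(\det M)^{1/2}$, for a complex symmetric matrix $M$ with positive definite real part, is the continuous branch that is positive at $M=I_n$. *)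

(* Defs.v *)
From HB Require Import structures.
From mathcomp Require Import all_boot all_order all_algebra.
From mathcomp Require Import complex.
From mathcomp Require Import all_classical all_reals all_analysis.

Set Implicit Arguments.
Unset Strict Implicit.
Unset Printing Implicit Defensive.

Import Order.TTheory GRing.Theory Num.Theory.
Import numFieldNormedType.Exports.

Local Open Scope classical_set_scope.
Local Open Scope complex_scope.
Local Open Scope ring_scope.

Section lebesgue_tuple.
Context {R : realType}.
Local Notation T := (measurableTypeR R).

(* Needed since the library's sigma-finiteness instance for product measures is
   not found by unification. *)
Lemma product_sigma_finite d1 d2 (T1 : measurableType d1)
    (T2 : measurableType d2) (m1 : {sigma_finite_measure set T1 -> \bar R})
    (m2 : {sigma_finite_measure set T2 -> \bar R}) :
  sigma_finite setT (m1 \x m2)%E.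
Proof.
have /sigma_finiteP[F [TF ndF Foo]] := sigma_finiteT m1.
have /sigma_finiteP[G [TG ndG Goo]] := sigma_finiteT m2.
exists (fun n => F n `*` G n).
  rewrite -setXTT TF TG predeqE => -[x y]; split.
    move=> [/= [n _ Fnx] [k _ Gky]]; exists (maxn n k) => //; split.
    - by move: x Fnx; exact/subsetPset/ndF/leq_maxl.
    - by move: y Gky; exact/subsetPset/ndG/leq_maxr.
  by move=> [n _ []/= ? ?]; split; exists n.
move=> k; have [? ?] := Foo k; have [? ?] := Goo k.
split; first exact: measurableX.
by rewrite product_measure1E// lte_mul_pinfty// ge0_fin_numE.
Qed.

Lemma pushforward_sigma_finite d d' (T1 : measurableType d)
    (T2 : measurableType d') (mu : set T1 -> \bar R)
    (f : T1 -> T2) (g : T2 -> T1) :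
  measurable_fun setT g -> cancel f g ->
  sigma_finite setT mu -> sigma_finite setT (pushforward mu f).
Proof.
move=> mg fK [F FT Ffin]; exists (fun i => g @^-1` F i).
  by rewrite -preimage_bigcup -FT preimage_setT.
move=> i; have [mF Foo] := Ffin i; split.
  by rewrite -[X in measurable X]setTI; exact: mg.
suff -> : pushforward mu f (g @^-1` F i) = mu (F i) by [].
by rewrite /pushforward -comp_preimage (_ : g \o f = id)//; apply/funext.
Qed.

Section cons.
Context {k : nat}.

Definition tcons (p : T * k.-tuple T) : k.+1.-tuple T :=
  [the k.+1.-tuple T of p.1 :: p.2].

Definition tuncons (t : k.+1.-tuple T) : T * k.-tuple T :=
  (tnth t ord0, [tuple of behead t]).

Lemma tconsK : cancel tcons tuncons.
Proof. by case=> x t; rewrite /tuncons tnth0; congr pair; exact: val_inj. Qed.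

Lemma measurable_tcons : measurable_fun setT tcons.
Proof. exact: measurable_cons. Qed.

Lemma measurable_tuncons : measurable_fun setT tuncons.
Proof.
apply/measurable_fun_pairP; split; first exact: measurable_tnth.
exact: measurable_behead.
Qed.

Variable mu : {sigma_finite_measure set (k.-tuple T) -> \bar R}.

Definition leb_cons : set (k.+1.-tuple T) -> \bar R :=
  pushforward (@lebesgue_measure R \x mu)%E tcons.

Let leb_cons0 : leb_cons set0 = 0%E.
Proof. by rewrite /leb_cons /pushforward preimage_set0 measure0. Qed.

Let leb_cons_ge0 A : (0 <= leb_cons A)%E.
Proof. by rewrite /leb_cons /pushforward measure_ge0. Qed.

Let leb_cons_sigma_additive : semi_sigma_additive leb_cons.
Proof.
pose nu : {measure set (k.+1.-tuple T) -> \bar R} :=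
  measure_function_pushforward__canonical__measure_function_Measure
    (@lebesgue_measure R \x mu)%E measurable_tcons.
exact: (@measure_semi_sigma_additive _ _ _ nu).
Qed.

HB.instance Definition _ := isMeasure.Build _ _ _ leb_cons
  leb_cons0 leb_cons_ge0 leb_cons_sigma_additive.

Let leb_cons_sigma_finite : sigma_finite setT leb_cons.
Proof.
apply: (pushforward_sigma_finite measurable_tuncons tconsK).
exact: product_sigma_finite.
Qed.

HB.instance Definition _ := @Measure_isSigmaFinite.Build _ _ _
  leb_cons leb_cons_sigma_finite.

End cons.

Fixpoint lebesgue_tuple (k : nat) :
    {sigma_finite_measure set (k.-tuple T) -> \bar R} :=
  if k is k'.+1 then leb_cons (lebesgue_tuple k') else \d_ [tuple].

End lebesgue_tuple.

Section defs.
Context {R : realType} {n : nat}.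
Local Notation C := R[i].
Local Notation normc := ComplexField.Normc.normc.
Local Notation toC := (map_mx (real_complex R)).
Local Notation conjmx := (map_mx (@conjc R)).
Local Notation Immx := (map_mx (@complex.Im R)).
Local Notation Remx := (map_mx (@complex.Re R)).

Definition cexp (z : C) : C :=
  (expR (complex.Re z))%:C * (cos (complex.Im z) +i* sin (complex.Im z)).

Definition sqnorm (z : 'cV[C]_n) : R := \sum_i normc (z i 0) ^+ 2.

Definition posdef (A : 'M[R]_n) : Prop :=
  A^T = A /\ forall u : 'cV[R]_n, u != 0 -> 0 < (u^T *m A *m u) 0 0.

(* The positive definite square root, meaningful for positive definite A. *)
Definition sqrtmx (A : 'M[R]_n) : 'M[R]_n :=
  xget 0 [set B | posdef B /\ B *m B = A].

Definition siegel : set 'M[C]_n :=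
  [set Omega | Omega^T = Omega /\ posdef (Immx Omega)].

(* Polarization of ds^2 = Tr (Omega_2^-1 dOmega Omega_2^-1 d(conj Omega)). *)
Definition metric (Omega X Y : 'M[C]_n) : R :=
  let A := toC (invmx (Immx Omega)) in
  complex.Re (\tr (A *m X *m A *m conjmx Y)).

(* Derivative at Omega of the function P |-> metric P X Y, in direction W. *)
Definition dmetric (Omega W X Y : 'M[C]_n) : R :=
  derive1 (fun s : R => metric (Omega + s%:C *: W) X Y) 0.

(* Koszul formula: the value of g(nabla_X Y, Z) for constant vector fields
   X, Y, Z, where nabla is the Levi-Civita connection of [metric]. *)
Definition christoffel (Omega X Y Z : 'M[C]_n) : R :=
  2^-1 * (dmetric Omega X Y Z + dmetric Omega Y X Z - dmetric Omega Z X Y).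

(* f' is the derivative of f on the interval [0, 1] (one-sided at the
   endpoints) with respect to the norm N, stated as
   N (f s - f t - (s - t) f' t) = o(|s - t|). *)
Definition deriv01 (E : lmodType C) (N : E -> \bar R) (f f' : R -> E) : Prop :=
  forall t : R, t \in `[0, 1] -> forall e : R, 0 < e -> exists2 d : R, 0 < d &
    forall s : R, s \in `[0, 1] -> `|s - t| < d ->
      (N (f s - f t - (s - t)%:C *: f' t)%R <= (e * `|s - t|)%:E)%E.

Definition cont01 (E : lmodType C) (N : E -> \bar R) (f : R -> E) : Prop :=
  forall t : R, t \in `[0, 1] -> forall e : R, 0 < e -> exists2 d : R, 0 < d &
    forall s : R, s \in `[0, 1] -> `|s - t| < d -> (N (f s - f t)%R <= e%:E)%E.

Definition deriv01C (f f' : R -> C) : Prop :=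
  deriv01 (fun z : C^o => (normc z)%:E) f f'.

Definition deriv01mx (f f' : R -> 'M[C]_n) : Prop :=
  forall i j, deriv01C (fun t => f t i j) (fun t => f' t i j).

(* Geodesic equation nabla_{gamma'} gamma' = 0 on [0, 1]; the tangent spaces
   of [siegel] are the space of all complex symmetric matrices. *)
Definition is_geodesic (gamma : R -> 'M[C]_n) : Prop :=
  (forall t : R, t \in `[0, 1] -> siegel (gamma t)) /\
  exists gamma' gamma'' : R -> 'M[C]_n,
    [/\ deriv01mx gamma gamma', deriv01mx gamma' gamma'' &
        forall t : R, t \in `[0, 1] -> forall Z : 'M[C]_n, Z^T = Z ->
          metric (gamma t) (gamma'' t) Z
          + christoffel (gamma t) (gamma' t) (gamma' t) Z = 0].

Definition V : Type :=
  (n.-tuple (measurableTypeR R) * n.-tuple (measurableTypeR R))%type.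

Definition xcoord (v : V) : 'cV[C]_n := \col_i (tnth v.1 i : R)%:C.
Definition ycoord (v : V) : 'cV[C]_n := \col_i (tnth v.2 i : R)%:C.

Lemma eps_factor_ge0 : 0 <= ((2 * pi)^-1) ^+ n :> R.
Proof. by rewrite exprn_ge0// invr_ge0 mulr_ge0// pi_ge0. Qed.

(* The Liouville measure omega^n / ((2 pi)^n n!): since
   omega^n / n! is dx^1 dy^1 ... dx^n dy^n, this is (2 pi)^-n times the
   Lebesgue measure. *)
Definition eps_omega : {measure set
    (n.-tuple (measurableTypeR R) * n.-tuple (measurableTypeR R))%type
    -> \bar R} :=
  mscale (NngNum eps_factor_ge0) (lebesgue_tuple n \x lebesgue_tuple n)%E.

Definition L2norm (f : V -> C) : \bar R :=
  Lnorm eps_omega 2%:E (fun v => (normc (f v))%:E).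

Definition H0 : set (V -> C) := [set f |
  [/\ measurable_fun setT (fun v : (_ * _)%type => complex.Re (f v)),
      measurable_fun setT (fun v : (_ * _)%type => complex.Im (f v)) &
      (L2norm f < +oo)%E]].

Definition inner (f g : V -> C) : C :=
  Rintegral eps_omega setT (fun v => complex.Re (f v * (g v)^*%C))
  +i* Rintegral eps_omega setT (fun v => complex.Im (f v * (g v)^*%C)).

Definition is_proj (S : set (V -> C)) (f p : V -> C) : Prop :=
  S p /\ forall g, S g -> inner (f - p) g = 0.

Definition zcoord (Omega : 'M[C]_n) (v : V) : 'cV[C]_n :=
  toC (invmx (sqrtmx (2 *: Immx Omega)))
    *m (xcoord v - conjmx Omega *m ycoord v).

Definition entire (phi : 'cV[C]_n -> C) : Prop :=
  forall z, differentiable (phi : 'cV[C^o]_n -> C^o) z.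

(* Elements of H_Omega are genuine (continuous) functions on V, so that
   their equality as elements of L^2 is their pointwise equality. *)
Definition HOmega (Omega : 'M[C]_n) : set (V -> C) := [set f | H0 f /\
  exists2 phi, entire phi & forall v,
    f v = phi (zcoord Omega v) * (expR (- (sqnorm (zcoord Omega v) / 2)))%:C].

(* D is the covariant derivative along gamma of the C^1 family psi: at each
   time it is the orthogonal projection of the L^2-derivative. *)
Definition nablaH (gamma : R -> 'M[C]_n) (psi D : R -> V -> C) : Prop :=
  (forall t : R, t \in `[0, 1] -> HOmega (gamma t) (psi t)) /\
  exists psi' : R -> V -> C,
    [/\ forall t : R, t \in `[0, 1] -> H0 (psi' t), deriv01 L2norm psi psi',
        cont01 L2norm psi' &
        forall t : R, t \in `[0, 1] -> is_proj (HOmega (gamma t)) (psi' t) (D t)].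

Definition parallelH (gamma : R -> 'M[C]_n) (psi : R -> V -> C) : Prop :=
  nablaH gamma psi (fun _ => 0).

(* A section of sqrt K along gamma is represented by its coefficient f(t) in
   the unitary frame sqrt (d^n z_(gamma t)), in which the connection form is
   (i / 4) Tr (Omega_2^-1 dOmega_1). *)
Definition nablaK (gamma : R -> 'M[C]_n) (f D : R -> C) : Prop :=
  exists gamma' : R -> 'M[C]_n, exists f' : R -> C,
    [/\ deriv01mx gamma gamma', deriv01C f f' &
        forall t : R, t \in `[0, 1] ->
          D t = f' t + 'i%C / 4 *
            (\tr (invmx (Immx (gamma t)) *m Remx (gamma' t)))%:C * f t].

Definition parallelK (gamma : R -> 'M[C]_n) (f : R -> C) : Prop :=
  nablaK gamma f (fun _ => 0).

(* The fibre of H (x) sqrt K is H_Omega (x) sqrt (d^n z_Omega); the element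
   psi (x) sqrt (d^n z_Omega) is represented by psi, hence
   psi (x) (a sqrt (d^n z_Omega)) by a psi. *)
Definition tensorHK (psi : V -> C) (a : C) : V -> C := fun v => psi v * a.

(* Leibniz rule:
   nabla (psi (x) sqrt) = (nabla psi) (x) sqrt + psi (x) (nabla sqrt). *)
Definition nablaHK (gamma : R -> 'M[C]_n) (psi D : R -> V -> C) : Prop :=
  exists D1 : R -> V -> C, exists a : R -> C,
    [/\ nablaH gamma psi D1, nablaK gamma (fun _ => 1) a &
        forall t : R, t \in `[0, 1] ->
          D t = tensorHK (D1 t) 1 + tensorHK (psi t) (a t)].

Definition parallelHK (gamma : R -> 'M[C]_n) (psi : R -> V -> C) : Prop :=
  nablaHK gamma psi (fun _ => 0).

(* w is the parallel transport of u from time 0 to time 1: there is a parallel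
   section starting at u, and every such section ends at w. *)
Definition transport (E : Type) (parallel : (R -> E) -> Prop) (u w : E) : Prop :=
  (exists psi, [/\ parallel psi, psi 0 = u & psi 1 = w]) /\
  (forall psi, parallel psi -> psi 0 = u -> psi 1 = w).

Definition coherent (Omega : 'M[C]_n) (alpha : 'cV[C]_n) : V -> C := fun v =>
  let z := zcoord Omega v in
  cexp (((conjmx alpha)^T *m z) 0 0 - (sqnorm z / 2)%:C).

Definition Xi (Omega Omega' : 'M[C]_n) : 'M[C]_n :=
  (2 * 'i%C)^-1 *: (Omega - conjmx Omega').

Definition posre : set 'M[C]_n := [set M | M^T = M /\ posdef (Remx M)].

Definition is_sqrtdet_branch (s : 'M[C]_n -> C) : Prop :=
  [/\ {within (posre : set 'M[C^o]_n), continuous (s : 'M[C^o]_n -> C^o)},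
      forall M, posre M -> s M ^+ 2 = \det M & 0 < s 1%:M].

(* The branch is unique on [posre] (which is convex); the values outside this
   set are irrelevant. *)
Definition sqrtdet : 'M[C]_n -> C := xget (fun _ => 0) is_sqrtdet_branch.

Definition transported (Omega Omega' : 'M[C]_n) (alpha : 'cV[C]_n) : V -> C :=
  fun v =>
  let S := toC (sqrtmx (Immx Omega)) in
  let S' := toC (sqrtmx (Immx Omega')) in
  let X := invmx (Xi Omega Omega') in
  let z' := zcoord Omega' v in
  let u := col_mx (conjmx alpha) z' in
  let M := block_mx (1%:M - S *m X *m S) (S *m X *m S')
                    (S' *m X *m S) (1%:M - S' *m X *m S') in
  (\det (Immx Omega) `^ 4^-1 * \det (Immx Omega') `^ 4^-1
    / normc (\det (Xi Omega Omega')) `^ 2^-1)%:C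
  * cexp (2^-1 * (u^T *m M *m u) 0 0 - (sqnorm z' / 2)%:C).

End defs.

(* Main.v *)
(* Along the geodesic Z from A, write X = (Xi A Z)^-1, Y = Im Z and
   q = x - A y - sqrt 2 (Im A)^(1/2) conj(alpha). The claimed transport is
   psi = N exp (- q^T X q / 4 + L), where only N and X depend on time, so that
   psi' = (N'/N + (X q)^T Xi' (X q) / 4) psi. Moving the contour of integration in complex
   directions shows that ((X q)_j (X q)_k - 2 (X - Y^-1)_jk) psi is orthogonal to H_Z, hence
   psi is parallel as soon as N'/N = - Tr (Xi' (X - Y^-1)) / 2. This reduces to
     Im Tr ((Z - conj A)^-1 Z') = - Tr (Y^-1 Re Z') / 2,
   which follows from the geodesic equation Z'' = 2 Z' (Z - conj Z)^-1 Z': it turns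
   (Z - conj A)^-1 B - (A - conj A)^-1 B with B = conj (Z'(0)) into a solution of a Riccati equation
   which is also solved by its adjoint for the hermitian form Im A, so its trace is real.
   The same identity says that (det Xi)^(1/2) / |det Xi|^(1/2) is parallel in sqrt K.
   Parallel sections of H have constant norm, which gives uniqueness; multiplication by a
   parallel section of sqrt K reduces the tensor product to H. *)

From HB Require Import structures.
Require Import Defs.
From mathcomp Require Import all_boot all_order all_algebra.
From mathcomp Require Import perm complex ring lra.
From mathcomp Require Import all_classical all_reals all_analysis.
From mathcomp Require Import measurable_realfun.

Set Implicit Arguments.
Unset Strict Implicit.
Unset Printing Implicit Defensive.

Import Order.TTheory GRing.Theory Num.Theory.
Import numFieldNormedType.Exports.

Local Open Scope classical_set_scope.
Local Open Scope complex_scope.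
Local Open Scope ring_scope.

(** The orthogonality relation must hold against every g in H_Z, about which only square
    integrability and the form entire times Gaussian are known, so no Gaussian integral can be
    evaluated. The directions rho c of the contour shift are complex, yet real translations of V
    realize them, because zeta = x - conj(Z) y maps V onto C^n. Translation invariance gives the
    integral J(rho) of the tilted integrand a second expression whose integrand is antiholomorphic
    in rho; Goursat's theorem on small squares then replaces differentiation under the integral
    sign. The domination comes from the positivity of Im A and Im Z: the transported function decays
    like a Gaussian, half of the decay pays for the tilt, and the other half is paired with g by
    Cauchy-Schwarz. Gaussian weights also turn pointwise time derivatives into L^2 derivatives. The
    Riccati equation appears because the geodesic equation has first integrals, by which Z' is a
    quadratic polynomial in Z - conj(Z(0)). A branch of the root of det is built by elimination and
    identified with the given one by continuity, its square and its sign at the identity. *)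

Local Notation normc := ComplexField.Normc.normc.
Local Notation toC := (map_mx (real_complex _)).
Local Notation conjmx := (map_mx (@conjc _)).
Local Notation Immx := (map_mx (@complex.Im _)).
Local Notation Remx := (map_mx (@complex.Re _)).
Local Notation "z ^*" := (conjc z) : ring_scope.
Local Notation "M ^H" := ((map_mx (@conjc _) M)^T)
  (at level 8, format "M ^H") : ring_scope.

(** * Complex numbers and limits *)

Section complex_numbers.
Context {R : realType}.
Local Notation C := R[i].
Implicit Types (x y : R) (z w : C).

Lemma normr_normc z : `|z| = (normc z)%:C.
Proof. by case: z. Qed.

Lemma normc_ge0 z : 0 <= normc z.
Proof. by case: z => a b /=; rewrite sqrtr_ge0. Qed.

Lemma sqr_normcE z : normc z ^+ 2 = complex.Re z ^+ 2 + complex.Im z ^+ 2.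
Proof. by case: z => a b /=; rewrite sqr_sqrtr// addr_ge0// sqr_ge0. Qed.

Lemma normc_real x : normc x%:C = `|x|.
Proof. by rewrite /= expr0n /= addr0 sqrtr_sqr. Qed.

Lemma normc_i : normc ('i : C) = 1.
Proof. by rewrite /= expr0n /= add0r expr1n sqrtr1. Qed.

Lemma normc_conj z : normc z^* = normc z.
Proof. by case: z => a b /=; rewrite sqrrN. Qed.

Lemma normcX z k : normc (z ^+ k) = normc z ^+ k.
Proof.
elim: k => [|k IH]; first by rewrite !expr0 normc_real normr1.
by rewrite !exprS ComplexField.Normc.normcM IH.
Qed.

Lemma normc_sub z w : normc (z - w) <= normc z + normc w.
Proof. by rewrite (le_trans (le_normcD _ _))// normcN. Qed.

Lemma normc_subC z w : normc (z - w) = normc (w - z).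
Proof. by rewrite -normcN opprB. Qed.

Lemma normc_eq0 z : (normc z == 0) = (z == 0).
Proof.
apply/eqP/eqP => [/ComplexField.Normc.eq0_normc //|->].
exact: ComplexField.Normc.normc0.
Qed.

Lemma normc_gt0 z : (0 < normc z) = (z != 0).
Proof. by rewrite lt_def normc_eq0 normc_ge0 andbT. Qed.

Lemma normc_sum (I : Type) (r : seq I) (P : pred I) (F : I -> C) :
  normc (\sum_(i <- r | P i) F i) <= \sum_(i <- r | P i) normc (F i).
Proof.
elim/big_ind2 : _ => [|a b c d ab cd|//]; first by rewrite ComplexField.Normc.normc0.
exact: (le_trans (le_normcD _ _) (lerD ab cd)).
Qed.

Lemma Re_le_normc z : `|complex.Re z| <= normc z.
Proof.
rewrite -[leLHS]ger0_norm// -ler_sqr ?nnegrE ?normc_ge0// sqr_normcE normr_id.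
by rewrite real_normK ?num_real// lerDl sqr_ge0.
Qed.

Lemma Im_le_normc z : `|complex.Im z| <= normc z.
Proof.
rewrite -[leLHS]ger0_norm// -ler_sqr ?nnegrE ?normc_ge0// sqr_normcE normr_id.
by rewrite real_normK ?num_real// lerDr sqr_ge0.
Qed.

Lemma normc_le_Re_Im z : normc z <= `|complex.Re z| + `|complex.Im z|.
Proof.
rewrite -ler_sqr ?nnegrE ?normc_ge0 ?addr_ge0// sqr_normcE sqrrD.
rewrite !real_normK ?num_real// lerD2r lerDl mulrn_wge0// mulr_ge0//.
Qed.

Lemma ReD z w : complex.Re (z + w) = complex.Re z + complex.Re w.
Proof. by case: z w => ? ? []. Qed.
Lemma ImD z w : complex.Im (z + w) = complex.Im z + complex.Im w.
Proof. by case: z w => ? ? []. Qed.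
Lemma ReN z : complex.Re (- z) = - complex.Re z.
Proof. by case: z. Qed.
Lemma ImN z : complex.Im (- z) = - complex.Im z.
Proof. by case: z. Qed.
Lemma Re_mul z w : complex.Re (z * w) =
  complex.Re z * complex.Re w - complex.Im z * complex.Im w.
Proof. by case: z w => ? ? []. Qed.
Lemma Im_mul z w : complex.Im (z * w) =
  complex.Re z * complex.Im w + complex.Im z * complex.Re w.
Proof. by case: z w => ? ? []. Qed.
Lemma Re_conjc z : complex.Re z^* = complex.Re z.
Proof. by case: z. Qed.
Lemma Im_conjc z : complex.Im z^* = - complex.Im z.
Proof. by case: z. Qed.
Lemma Re_real x : complex.Re x%:C = x. Proof. by []. Qed.
Lemma Im_real x : complex.Im x%:C = 0. Proof. by []. Qed.

Lemma Re_sum (I : Type) (r : seq I) (P : pred I) (F : I -> C) :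
  complex.Re (\sum_(i <- r | P i) F i) = \sum_(i <- r | P i) complex.Re (F i).
Proof. by elim/big_rec2 : _ => // i a b _ <-; rewrite ReD. Qed.

Lemma complex_ext z w : complex.Re z = complex.Re w ->
  complex.Im z = complex.Im w -> z = w.
Proof. by case: z w => ? ? [? ?] /= -> ->. Qed.

Lemma real_complexD x y : (x + y)%:C = x%:C + y%:C :> C. Proof. exact: rmorphD. Qed.
Lemma real_complexN x : (- x)%:C = - x%:C :> C. Proof. exact: rmorphN. Qed.
Lemma real_complexB x y : (x - y)%:C = x%:C - y%:C :> C. Proof. exact: rmorphB. Qed.
Lemma real_complexM x y : (x * y)%:C = x%:C * y%:C :> C. Proof. exact: rmorphM. Qed.
Lemma real_complexV x : (x^-1)%:C = (x%:C)^-1 :> C. Proof. exact: fmorphV. Qed.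
Lemma real_complexX x k : (x ^+ k)%:C = x%:C ^+ k :> C. Proof. exact: rmorphXn. Qed.
Lemma real_complex_nat k : (k%:R)%:C = k%:R :> C. Proof. exact: rmorph_nat. Qed.
Lemma real_complex_eq0 x : (x%:C == 0 :> C) = (x == 0).
Proof. exact: fmorph_eq0. Qed.

Lemma conjcD z w : (z + w)^* = z^* + w^*. Proof. exact: rmorphD. Qed.
Lemma conjcB z w : (z - w)^* = z^* - w^*. Proof. exact: rmorphB. Qed.
Lemma conjcN z : (- z)^* = - z^*. Proof. exact: rmorphN. Qed.
Lemma conjcM z w : (z * w)^* = z^* * w^*. Proof. exact: rmorphM. Qed.
Lemma conjcV z : (z^-1)^* = (z^*)^-1. Proof. exact: fmorphV. Qed.
Lemma conjci : ('i : C)^* = - 'i.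
Proof. by apply: complex_ext => //=; rewrite oppr0. Qed.
Lemma mulii : 'i * 'i = -1 :> C.
Proof. by rewrite -expr2 sqr_i. Qed.
Lemma i_neq0 : 'i != 0 :> C.
Proof. by rewrite -normc_eq0 normc_i oner_eq0. Qed.
Lemma two_neq0 : 2 != 0 :> C. Proof. by rewrite pnatr_eq0. Qed.
Lemma invi : 'i^-1 = - 'i :> C.
Proof. by apply: (mulfI i_neq0); rewrite mulfV ?i_neq0// mulrN mulii opprK. Qed.
Lemma mul_conj z : z * z^* = (normc z ^+ 2)%:C.
Proof. by rewrite real_complexX -normr_normc sqr_normc. Qed.

Lemma Re_i : complex.Re ('i : C) = 0. Proof. by []. Qed.
Lemma Im_i : complex.Im ('i : C) = 1. Proof. by []. Qed.
Lemma Re1 : complex.Re (1 : C) = 1. Proof. by []. Qed.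
Lemma Im1 : complex.Im (1 : C) = 0. Proof. by []. Qed.
Lemma Re0 : complex.Re (0 : C) = 0. Proof. by []. Qed.
Lemma Im0 : complex.Im (0 : C) = 0. Proof. by []. Qed.
Definition reimE := (ReD, ReN, Re_mul, ImD, ImN, Im_mul, Re_conjc, Im_conjc,
  Re_real, Im_real, Re_i, Im_i, Re1, Im1, Re0, Im0).

Lemma cexp0 : cexp 0 = 1 :> C.
Proof. by apply: complex_ext; rewrite /cexp ?expR0 /= ?cos0 ?sin0 ?expR0; ring. Qed.

Lemma cexpD z w : cexp (z + w) = cexp z * cexp w.
Proof.
case: z w => a b [c d]; apply: complex_ext; rewrite /cexp /=;
  rewrite expRD ?cosD ?sinD; ring.
Qed.

Lemma cexp_real x : cexp x%:C = (expR x)%:C.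
Proof. by apply: complex_ext; rewrite /cexp /= cos0 sin0; ring. Qed.

Lemma normc_cexp z : normc (cexp z) = expR (complex.Re z).
Proof.
rewrite /cexp ComplexField.Normc.normcM normc_real ger0_norm ?expR_ge0//.
by rewrite /= cos2Dsin2 sqrtr1 mulr1.
Qed.

Lemma conjc_cexp z : (cexp z)^* = cexp z^*.
Proof. by case: z => a b; apply: complex_ext; rewrite /cexp /= ?cosN ?sinN; ring. Qed.

(** The bound is tested at u = conj z / |z|, where the real part of u z is |z|. This reduces complex
    mean value estimates to real ones. *)
Lemma normc_le_bound z M : 0 <= M ->
  (forall u, normc u <= 1 -> complex.Re (u * z) <= M) -> normc z <= M.
Proof.
move=> M0 H; have [->|z0] := eqVneq z 0; first by rewrite ComplexField.Normc.normc0.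
have zp : 0 < normc z by rewrite normc_gt0.
have := H (z^* / (normc z)%:C).
rewrite ComplexField.Normc.normcM normc_conj ComplexField.Normc.normcV normc_real.
rewrite (ger0_norm (normc_ge0 _)) divff ?gt_eqF// => /(_ (lexx _)).
rewrite mulrAC [z^* * z]mulrC mul_conj -real_complexV -real_complexM /=.
by rewrite expr2 mulfK// gt_eqF.
Qed.

End complex_numbers.

Section limits.
Context {R : realType}.
Local Notation C := R[i].

(** Convergence measured by the real-valued modulus: the norm of [C^o] takes values in [R[i]]
    itself, and the radii of its balls are positive complex numbers. *)
Definition tends (T : Type) (F : set_system T) (f : T -> C) (l : C) : Prop :=
  forall e : R, 0 < e -> F [set s | normc (f s - l) < e].

(** In the order of [R[i]], comparable numbers have equal imaginary parts. *)
Lemma gt0_complexP (e : C) : 0 < e -> exists2 e' : R, 0 < e' & e = e'%:C.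
Proof.
move=> e0; have: e \is Num.real by rewrite realE (ltW e0).
by move/complex_realP => [k ek]; exists k => //; rewrite -ltcR -ek.
Qed.

Lemma nbhs_normc (l : C) (A : set C) : @nbhs _ (C^o : topologicalType) l A <->
  exists2 e : R, 0 < e & forall z, normc (z - l) < e -> A z.
Proof.
split=> [/(@nbhs_ballP C (C^o : pseudoMetricType C)) [e /= e0 eA]|[e e0 eA]].
  have [e' e'0 ee] := gt0_complexP e0; exists e' => // z zl; apply: eA.
  rewrite -ball_normE /ball_ /=.
  by rewrite normr_normc ee ltcR normc_subC.
apply/(@nbhs_ballP C (C^o : pseudoMetricType C)).
exists e%:C; first by rewrite /= ltcR.
move=> z; rewrite -ball_normE /ball_ /= normr_normc ltcR normc_subC; exact: eA.
Qed.

Lemma tendsP (T : Type) (F : set_system T) {FF : Filter F} (f : T -> C) (l : C) :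
  tends F f l <-> (f : T -> C^o) @ F --> (l : C^o).
Proof.
split=> [H A /nbhs_normc[e e0 eA]|H e e0].
  by apply: (filterS _ (H e e0)) => s /=; exact: eA.
by apply: (H [set z | normc (z - l) < e]); apply/nbhs_normc; exists e.
Qed.

Section rules.
Context (T : Type) (F : set_system T) {FF : Filter F}.
Implicit Types (f g : T -> C) (a b : C).

Lemma tends_cst a : tends F (fun=> a) a.
Proof. by apply/tendsP; exact: cvg_cst. Qed.

Lemma tendsD f g a b : tends F f a -> tends F g b -> tends F (fun s => f s + g s) (a + b).
Proof.
move=> fa gb e e0; have h0 : 0 < e / 2 by rewrite divr_gt0.
apply: filterS (filterI (fa _ h0) (gb _ h0)) => s /= [fs gs].
rewrite opprD addrACA; apply: le_lt_trans (le_normcD _ _) _.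
by rewrite (splitr e) ltrD.
Qed.

Lemma tendsM f g a b : tends F f a -> tends F g b -> tends F (fun s => f s * g s) (a * b).
Proof.
move=> fa gb e e0; have a0 := normc_ge0 a; have b0 := normc_ge0 b.
have k0 : 0 < 2 + normc a + normc b by lra.
(* For d <= 1 the error of the product is at most d (1 + |a| + |b|); the constant 2 in place of 1
   makes the inequality strict. *)
pose d := Num.min 1 (e / (2 + normc a + normc b)).
have d0 : 0 < d by rewrite lt_min ltr01 divr_gt0.
have d1 : d <= 1 by rewrite ge_min lexx.
have de : d * (2 + normc a + normc b) <= e by rewrite -ler_pdivlMr// ge_min lexx orbT.
apply: filterS (filterI (fa d d0) (gb d d0)) => s /= [fs gs].
rewrite (_ : f s * g s - a * b = (f s - a) * (g s - b) + (a * (g s - b) + b * (f s - a))); last by ring.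
apply: le_lt_trans (le_normcD _ _) _; apply: le_lt_trans (lerD (lexx _) (le_normcD _ _)) _.
rewrite 3!ComplexField.Normc.normcM.
have := normc_ge0 (f s - a); have := normc_ge0 (g s - b); move: fs gs.
move: (normc (f s - a)) (normc (g s - b)) a0 b0 de => x y a0 b0 de xd yd y0 x0.
have xy : x * y <= d by apply: le_trans (_ : x * 1 <= _); [rewrite ler_wpM2l// ltW// (lt_le_trans yd)|rewrite mulr1 ltW].
have ay : normc a * y <= normc a * d by rewrite ler_wpM2l// ltW.
have bx : normc b * x <= normc b * d by rewrite ler_wpM2l// ltW.
by lra.
Qed.

Lemma tendsV f a : a != 0 -> tends F f a -> tends F (fun s => (f s)^-1) a^-1.
Proof.
move=> a0 fa e e0; have n0 : 0 < normc a by rewrite normc_gt0.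
have h0 : 0 < normc a / 2 by rewrite divr_gt0.
have k0 : 0 < e * (normc a ^+ 2 / 2) by rewrite mulr_gt0// divr_gt0// exprn_gt0.
apply: filterS (filterI (fa _ h0) (fa _ k0)) => s /= [fs1 fs2].
have fh : normc a / 2 < normc (f s).
  by have := le_normcD (a - f s) (f s); rewrite subrK normc_subC; lra.
have fn0 : f s != 0 by rewrite -normc_gt0 (lt_trans h0).
rewrite (_ : (f s)^-1 - a^-1 = - (f s - a) / (f s * a)); last by field; rewrite a0 fn0.
rewrite ComplexField.Normc.normcM normcN ComplexField.Normc.normcV ComplexField.Normc.normcM.
rewrite ltr_pdivrMr ?mulr_gt0//; last exact: lt_trans fh.
apply: lt_le_trans fs2 _; rewrite ler_wpM2l ?(ltW e0)// expr2 mulrAC ler_wpM2r// ltW//.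
Qed.

Lemma tendsN f a : tends F f a -> tends F (fun s => - f s) (- a).
Proof. by move=> /tendsP fa; apply/tendsP; exact: cvgN. Qed.

Lemma tends_conj f a : tends F f a -> tends F (fun s => (f s)^*) a^*.
Proof.
move=> fa e e0; apply: (filterS _ (fa e e0)) => s /=.
by rewrite -conjcB normc_conj.
Qed.

Lemma tends_near f g a : F [set s | f s = g s] -> tends F f a -> tends F g a.
Proof. by move=> fg fa e e0; apply: (filterS _ (filterI fg (fa e e0))) => s [/= <-]. Qed.

Lemma tends_unique {PF : ProperFilter F} f a b : tends F f a -> tends F f b -> a = b.
Proof.
move=> fa fb; apply/eqP; rewrite -subr_eq0 -normc_eq0 eq_le normc_ge0 andbT.
apply/ler_addgt0Pr => e e0; rewrite add0r.
have e2 : 0 < e / 2 by rewrite divr_gt0.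
have [s [/= s1 s2]] : exists s, [set s | normc (f s - a) < e / 2] s /\ [set s | normc (f s - b) < e/2] s.
  exact: filter_ex (filterI (fa _ e2) (fb _ e2)).
rewrite (_ : a - b = (f s - b) - (f s - a)); last by ring.
by rewrite (le_trans (normc_sub _ _))// (splitr e) lerD// ltW.
Qed.

Lemma tends_sum (I : Type) (r : seq I) (P : pred I) (f : I -> T -> C) (a : I -> C) :
  (forall i, P i -> tends F (f i) (a i)) ->
  tends F (fun s => \sum_(i <- r | P i) f i s) (\sum_(i <- r | P i) a i).
Proof.
move=> H; elim: r => [|i r IH].
  by rewrite big_nil; under eq_fun do rewrite big_nil; exact: tends_cst.
rewrite big_cons; under eq_fun do rewrite big_cons.
by case: ifPn => // Pi; apply: tendsD => //; exact: H.
Qed.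

End rules.
End limits.

(** * Derivatives within a set of times *)

#[global] Arguments real_complex_def : simpl never.
#[global] Arguments ComplexField.Normc.normc : simpl never.
#[global] Arguments conjc : simpl never.

Section derivatives.
Context {R : realType}.
Local Notation C := R[i].

(** Excluding t keeps difference quotients meaningful; with D = [0, 1] the quotients at the
    endpoints are one-sided. *)
Definition punct (D : set R) (t : R) : set_system R :=
  within [set s | D s /\ s != t] (nbhs t).

Instance punct_filter D t : Filter (punct D t).
Proof. exact: within_filter. Qed.

Lemma punctP D t A : punct D t A <->
  exists2 d : R, 0 < d & forall s, D s -> s != t -> `|s - t| < d -> A s.
Proof.
rewrite /punct /within /=; split.
  move=> /nbhs_ballP[d /= d0 H]; exists d => // s Ds st sd.
  by apply: (H s) => //; rewrite /ball /= distrC.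
move=> [d d0 H]; apply/nbhs_ballP; exists d => //= s.
by rewrite /ball /= distrC => sd [Ds st]; exact: H.
Qed.

(** From any t in [0, 1] a step of length at most 1/2 stays inside, to the right or to the left.
    Properness makes derivatives unique, also at the endpoints. *)
Instance punct01_proper (t : R) : t \in `[0, 1] -> ProperFilter (punct `[0, 1]%classic t).
Proof.
rewrite in_itv /= => /andP[t0 t1]; apply: Build_ProperFilter_ex.
move=> A /punctP[d d0 H].
pose h := Order.min (d / 2) (1 / 2).
have h0 : 0 < h by rewrite lt_min !divr_gt0.
have hd : h < d by rewrite gt_min ltr_pdivrMr// ltr_pMr// ltr1n.
have h2 : h <= 1 / 2 by rewrite ge_min lexx orbT.
have [t2|t2] := leP t (1 / 2).
  exists (t + h); apply: H.
  - by rewrite /= in_itv /=; lra.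
  - by rewrite -subr_eq0 addrAC subrr add0r gt_eqF.
  - by rewrite addrAC subrr add0r ger0_norm// ltW.
exists (t - h); apply: H.
- by rewrite /= in_itv /=; lra.
- by rewrite -subr_eq0 addrAC subrr add0r oppr_eq0 gt_eqF.
- by rewrite addrAC subrr add0r normrN ger0_norm// ltW.
Qed.

Definition derc (D : set R) (f : R -> C) (t : R) (l : C) : Prop :=
  tends (punct D t) (fun s => (f s - f t) / (s - t)%:C) l.

Lemma normc_divR (z : C) (x : R) : normc (z / x%:C) = normc z / `|x|.
Proof. by rewrite ComplexField.Normc.normcM ComplexField.Normc.normcV normc_real. Qed.

(** Passage between the quotient form, to which limit rules apply, and the increment form of
    [deriv01]; the latter includes s = t, where both sides vanish. *)
Lemma dercP D f t l : derc D f t l <-> forall e : R, 0 < e -> exists2 d : R, 0 < d &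
  forall s, D s -> `|s - t| < d ->
    normc (f s - f t - (s - t)%:C * l) <= e * `|s - t|.
Proof.
have key (s : R) : s != t -> normc (f s - f t - (s - t)%:C * l) =
    normc ((f s - f t) / (s - t)%:C - l) * `|s - t|.
  move=> st; have st0 : (s - t)%:C != 0 :> C by rewrite real_complex_eq0 subr_eq0.
  rewrite -(normc_real (s - t)) -ComplexField.Normc.normcM; congr normc.
  by rewrite mulrBl divfK// [l * _]mulrC.
split=> H e e0.
  have /punctP[d d0 Hd] := H e e0.
  exists d => // s Ds sd; have [->|st] := eqVneq s t.
    by rewrite !subrr mul0r subrr ComplexField.Normc.normc0 normr0 mulr0.
  by rewrite key// ler_wpM2r// ltW// Hd.
have [d d0 Hd] := H (e / 2) (divr_gt0 e0 (ltr0Sn _ _)).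
apply/punctP; exists d => // s Ds st sd /=.
have := Hd s Ds sd; rewrite key// ler_pM2r ?normr_gt0 ?subr_eq0// => /le_lt_trans; apply.
by rewrite ltr_pdivrMr// ltr_pMr// ltr1n.
Qed.

Section rules.
Variables (D : set R) (t : R).
Implicit Types (f g : R -> C) (a b : C).

Lemma derc_tends f a : derc D f t a -> tends (punct D t) f (f t).
Proof.
move=> fa.
have id : tends (punct D t) (fun s => (s - t)%:C) 0.
  move=> e e0; apply/punctP; exists e => // s _ _ /=.
  by rewrite subr0 normc_real.
pose proof (tendsD (tendsM fa id) (tends_cst (T:=R) (F:=punct D t) (f t))) as H.
rewrite mulr0 add0r in H; apply: (tends_near _ H).
apply/punctP; exists 1 => // s _ st _ /=.
by rewrite divfK ?subrK// real_complex_eq0 subr_eq0.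
Qed.

Lemma derc_cst a : derc D (fun=> a) t 0.
Proof.
by apply/dercP => e e0; exists 1 => // s _ _; rewrite subrr mulr0 subrr ComplexField.Normc.normc0 mulr_ge0// ltW.
Qed.

Lemma derc_real : derc D (fun s => s%:C) t 1.
Proof.
by apply/dercP => e e0; exists 1 => // s _ _; rewrite mulr1 -real_complexB subrr ComplexField.Normc.normc0 mulr_ge0// ltW.
Qed.

Lemma dercD f g a b : derc D f t a -> derc D g t b -> derc D (fun s => f s + g s) t (a + b).
Proof.
move=> fa gb; pose proof (tendsD fa gb) as H; apply: (tends_near _ H).
by apply: filterE => s /=; ring.
Qed.

Lemma dercN f a : derc D f t a -> derc D (fun s => - f s) t (- a).
Proof.
move=> fa; pose proof (tendsN fa) as H; apply: (tends_near _ H).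
by apply: filterE => s /=; ring.
Qed.

Lemma dercB f g a b : derc D f t a -> derc D g t b -> derc D (fun s => f s - g s) t (a - b).
Proof. by move=> fa gb; apply: dercD => //; exact: dercN. Qed.

Lemma dercM f g a b : derc D f t a -> derc D g t b ->
  derc D (fun s => f s * g s) t (a * g t + f t * b).
Proof.
move=> fa gb.
pose proof (tendsD (tendsM fa (derc_tends gb)) (tendsM (tends_cst (T:=R) (F:=punct D t) (f t)) gb)) as H.
by apply: (tends_near _ H); apply: filterE => s /=; ring.
Qed.

Lemma dercZ c f a : derc D f t a -> derc D (fun s => c * f s) t (c * a).
Proof. by move=> fa; have := dercM (derc_cst c) fa; rewrite mul0r add0r. Qed.

Lemma derc_conj f a : derc D f t a -> derc D (fun s => (f s)^*) t a^*.
Proof.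
move=> fa; pose proof (tends_conj fa) as H; apply: (tends_near _ H).
by apply: filterE => s /=; rewrite conjcM conjcV conjc_real conjcB.
Qed.

Lemma dercV f a : f t != 0 -> derc D f t a -> derc D (fun s => (f s)^-1) t (- a / f t ^+ 2).
Proof.
move=> f0 fa.
have nz : punct D t [set s | f s != 0].
  have n0 : 0 < normc (f t) by rewrite normc_gt0.
  apply: (filterS _ (derc_tends fa n0)) => s /=; apply: contraPneq => ->.
  by rewrite sub0r normcN ltxx.
pose proof (tendsM (tendsN fa) (tendsM (tendsV f0 (derc_tends fa)) (tends_cst (T:=R) (F:=punct D t) (f t)^-1))) as H.
rewrite (_ : - a * _ = - a / f t ^+ 2) in H; last by field.
apply: (tends_near _ H).
have st0 : punct D t [set s | s != t] by apply/punctP; exists 1.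
apply: (filterS _ (filterI nz st0)) => s [/= fs st].
have st' : (s - t)%:C != 0 :> C by rewrite real_complex_eq0 subr_eq0.
have -> : (f s)^-1 - (f t)^-1 = - (f s - f t) * ((f s)^-1 * (f t)^-1).
  rewrite mulNr mulrBl mulrA mulfV// mul1r [_^-1 * _^-1]mulrC mulrA mulfV// mul1r.
  by rewrite opprB.
by rewrite -!mulNr mulrAC.
Qed.

Lemma derc_eq f g a : D t -> (forall s, D s -> f s = g s) -> derc D f t a -> derc D g t a.
Proof.
move=> Dt fg /dercP fa; apply/dercP => e e0; have [d d0 H] := fa e e0.
by exists d => // s Ds sd; rewrite -!fg//; exact: H.
Qed.

Lemma derc_val f a b : a = b -> derc D f t a -> derc D f t b.
Proof. by move=> ->. Qed.

Lemma derc_sum (I : Type) (r : seq I) (P : pred I) (f : I -> R -> C) (a : I -> C) :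
  (forall i, P i -> derc D (f i) t (a i)) ->
  derc D (fun s => \sum_(i <- r | P i) f i s) t (\sum_(i <- r | P i) a i).
Proof.
move=> H; pose proof (tends_sum r H) as H'; apply: (tends_near _ H').
by apply: filterE => s /=; rewrite -mulr_suml sumrB.
Qed.

Lemma derc_ReP f a : derc D f t a -> derc D (fun s => (complex.Re (f s))%:C) t (complex.Re a)%:C.
Proof.
move=> fa; have := dercZ 2^-1 (dercD fa (derc_conj fa)).
have E z : 2^-1 * (z + z^*) = (complex.Re z)%:C :> C by rewrite ReJ_add mulrC.
by rewrite E; under eq_fun do rewrite E.
Qed.

End rules.

Lemma derc_unique f (t : R) a b : t \in `[0, 1] ->
  derc `[0, 1]%classic f t a -> derc `[0, 1]%classic f t b -> a = b.
Proof. by move=> t01; apply: tends_unique; exact: punct01_proper. Qed.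

Lemma is_derive_derc D (g : R -> R) (t l : R) : is_derive t 1 g l ->
  derc D (fun s => (g s)%:C) t l%:C.
Proof.
move=> [dg dgl]; have : (fun h => h^-1 *: ((g \o shift t) (h *: (1 : R)) - g t)) @ 0^' --> l.
  by rewrite -dgl; exact: dg.
move=> /cvgrPdist_lt H e e0; apply/punctP.
have := H e e0; rewrite near_withinE => /nbhs_ballP[d /= d0 Hd]; exists d => // s Ds st sd /=.
have := Hd (s - t); rewrite /ball /= sub0r normrN => /(_ sd); rewrite subr_eq0 => /(_ st).
rewrite /= [(s - t) *: _]mulr1 subrK distrC.
rewrite -!real_complexB -real_complexV -real_complexM -real_complexB normc_real.
by rewrite mulrC.
Qed.

Lemma derc_is_derive (g : R -> R) (t l : R) : t \in `]0, 1[ ->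
  derc `[0, 1]%classic (fun s => (g s)%:C) t l%:C -> is_derive t 1 g l.
Proof.
rewrite in_itv /= => /andP[t0 t1] H.
suff E : (fun h => h^-1 *: ((g \o shift t) (h *: (1 : R)) - g t)) @ 0^' --> l.
  by split; [apply/cvgP; exact: E|apply/cvg_lim => //; exact: E].
apply/cvgrPdist_lt => e e0; rewrite near_withinE.
have /punctP[d d0 Hd] := H e e0.
apply/nbhs_ballP; exists (Order.min d (Order.min t (1 - t))).
  by rewrite /= !lt_min d0 t0 subr_gt0.
move=> h; rewrite /ball /= sub0r normrN !lt_min => /and3P[hd ht ht1] h0.
have Hx : normc (((g (h + t))%:C - (g t)%:C) / h%:C - l%:C) < e.
  have := Hd (h + t); rewrite /= addrK; apply => //; last by rewrite -subr_eq0 addrK.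
  by move: ht ht1; rewrite in_itv /= !ltr_norml; lra.
rewrite [h *: _]mulr1 distrC.
move: Hx; rewrite -!real_complexB -real_complexV -real_complexM -real_complexB normc_real.
by rewrite mulrC.
Qed.

(** In the interior [derc] on [0, 1] is the usual derivative; at the endpoints the mean value
    theorem asks only for continuity, which the one-sided derivative provides. *)
Lemma derc01_mean_value (g g' : R -> R) :
  (forall t : R, t \in `[0, 1] -> derc `[0, 1]%classic (fun s => (g s)%:C) t (g' t)%:C) ->
  forall a b : R, 0 <= a -> a <= b -> b <= 1 -> exists2 c, c \in `[a, b] &
  g b - g a = g' c * (b - a).
Proof.
move=> H a b a0 ab b1.
have sub (x : R) : x \in `]a, b[ -> x \in `]0, 1[ by rewrite !in_itv /=; lra.
have sub' (x : R) : x \in `[a, b] -> x \in `[0, 1] by rewrite !in_itv /=; lra.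
apply: (MVT_segment ab).
  move=> x xab; apply: derc_is_derive; first exact: sub.
  by apply: H; apply: sub'; move: xab; rewrite !in_itv /=; lra.
apply/subspace_continuousP => x xab.
apply/cvgrPdist_lt => e e0.
have xab' : x \in `[a, b] by [].
have /punctP[d d0 Hd] := derc_tends (H x (sub' x xab')) e0.
rewrite near_withinE; apply/nbhs_ballP; exists d => // y; rewrite /ball /= => xy yab.
have [->|yx] := eqVneq y x; first by rewrite subrr normr0.
have yab' : y \in `[a, b] by [].
have := Hd y (sub' y yab') yx; rewrite distrC => /(_ xy) /=.
by rewrite -real_complexB normc_real distrC.
Qed.

(** The mean value theorem is real, so it is applied to Re (u f); u = 1 and u = - i give the real
    and imaginary parts. *)
Lemma derc01_constant (f : R -> C) :
  (forall t : R, t \in `[0, 1] -> derc `[0, 1]%classic f t 0) ->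
  forall t : R, t \in `[0, 1] -> f t = f 0.
Proof.
move=> H; have K (u : C) (t : R) : t \in `[0, 1] -> complex.Re (u * f t) = complex.Re (u * f 0).
  rewrite in_itv /= => /andP[t0 t1]; apply/eqP; rewrite -subr_eq0.
  have H' (s : R) : s \in `[0, 1] ->
      derc `[0, 1]%classic (fun s => (complex.Re (u * f s))%:C) s (0 : R)%:C.
    by move=> s01; have := derc_ReP (dercZ u (H s s01)); rewrite mulr0.
  have [c _ ->] := derc01_mean_value H' (lexx 0) t0 t1.
  by rewrite mul0r.
move=> t t01; apply: complex_ext.
  by have := K 1 t t01; rewrite !mul1r.
by have := K (- 'i) t t01; rewrite !mulNr !ReN ![_ * f _]mulrC !ReiNIm !opprK.
Qed.

(** The real mean value theorem for Re (u f), uniformly in |u| <= 1, bounds the modulus. *)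
Lemma derc01_bound (f f' : R -> C) (M : R) : 0 <= M ->
  (forall t : R, t \in `[0, 1] -> derc `[0, 1]%classic f t (f' t)) ->
  (forall t : R, t \in `[0, 1] -> normc (f' t) <= M) ->
  forall t : R, t \in `[0, 1] -> normc (f t - f 0) <= M.
Proof.
move=> M0 H HM t; rewrite in_itv /= => /andP[t0 t1]; apply: normc_le_bound => // u u1.
have H' (s : R) : s \in `[0, 1] ->
    derc `[0, 1]%classic (fun s => (complex.Re (u * f s))%:C) s (complex.Re (u * f' s))%:C.
  by move=> s01; exact: (derc_ReP (dercZ u (H s s01))).
have [c cI] := derc01_mean_value H' (lexx 0) t0 t1.
rewrite subr0 (mulrBr u) ReD ReN => ->.
have c01 : c \in `[0, 1] by move: cI; rewrite !in_itv /=; lra.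
rewrite (@le_trans _ _ (M * t))//; last by rewrite ler_piMr.
rewrite ler_wpM2r//; apply: (le_trans (ler_norm _)); apply: (le_trans (Re_le_normc _)).
by rewrite ComplexField.Normc.normcM -[M]mul1r ler_pM ?normc_ge0// HM.
Qed.

(** As [cexp] is defined by the real exponential, cosine and sine, its calculus starts on real
    lines; complex differentiability is recovered later from the Taylor bounds. *)
Lemma derc_cexp_line D (w : C) (t : R) :
  derc D (fun s => cexp (s%:C * w)) t (w * cexp (t%:C * w)).
Proof.
case: w => a b.
have E (s : R) : cexp (s%:C * (a +i* b)) =
   (expR (a * s))%:C * ((cos (b * s))%:C + 'i * (sin (b * s))%:C).
  apply: complex_ext; rewrite /cexp /= ?mul0r ?subr0 ?addr0 ?add0r ?mulr0;
    by rewrite ![_ * s]mulrC; ring.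
under eq_fun do rewrite E.
have dl (c : R) : is_derive t 1 ( *%R c) c.
  have H := is_deriveZ c (is_derive_id t (1 : R)).
    by rewrite [c *: 1]mulr1 in H; exact: H.
have de : is_derive t 1 (fun s => expR (a * s)) (a * expR (a * t)).
  have := is_derive1_comp (is_derive_expR (a * t)) (dl a).
  by rewrite mulrC.
have dc : is_derive t 1 (fun s => cos (b * s)) (- b * sin (b * t)).
  have := is_derive1_comp (is_derive_cos (b * t)) (dl b).
  by rewrite mulNr mulrC mulNr.
have ds : is_derive t 1 (fun s => sin (b * s)) (b * cos (b * t)).
  have := is_derive1_comp (is_derive_sin (b * t)) (dl b).
  by rewrite mulrC.
have := dercM (is_derive_derc D de)
  (dercD (is_derive_derc D dc) (dercZ 'i (is_derive_derc D ds))).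
apply: derc_val; rewrite E; apply: complex_ext; rewrite /= ?mul0r ?subr0 ?addr0 ?add0r ?mulr0 ?oppr0; ring.
Qed.

(** Along s -> s w each remainder has as derivative w times the preceding one, so each bound is a
    mean value estimate on the one before. The constants carry no factorials. *)
Lemma cexp_taylor (w : C) :
  [/\ normc (cexp w - 1) <= normc w * expR (normc w),
      normc (cexp w - 1 - w) <= normc w ^+ 2 * expR (normc w) &
      normc (cexp w - 1 - w - w ^+ 2 / 2) <= normc w ^+ 3 * expR (normc w)].
Proof.
have nw := normc_ge0 w; have ew := expR_ge0 (normc w).
have e01 : (1 : R) \in `[0, 1] by rewrite in_itv /= ler01 lexx.
have dline (t : R) : derc `[0, 1]%classic (fun s => s%:C * w) t w.
  by have := dercM (derc_real _ t) (derc_cst _ t w); rewrite mul1r mulr0 addr0.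
have H1 (t : R) : t \in `[0, 1] -> normc (cexp (t%:C * w) - 1) <= normc w * expR (normc w).
  move=> t01; have := @derc01_bound (fun s => cexp (s%:C * w)) (fun s => w * cexp (s%:C * w)) (normc w * expR (normc w)) (mulr_ge0 nw ew) _ _ t t01.
  rewrite mul0r cexp0; apply => s s01; first exact: derc_cexp_line.
  rewrite ComplexField.Normc.normcM normc_cexp ler_wpM2l// ler_expR.
  apply: (le_trans (ler_norm _)); apply: (le_trans (Re_le_normc _)).
  rewrite ComplexField.Normc.normcM normc_real -[leRHS]mul1r ler_wpM2r//.
  by move: s01; rewrite in_itv /= ler_norml; lra.
have H2 (t : R) : t \in `[0, 1] -> normc (cexp (t%:C * w) - 1 - t%:C * w) <= normc w ^+ 2 * expR (normc w).
  move=> t01; have := @derc01_bound (fun s => cexp (s%:C * w) - 1 - s%:C * w) (fun s => w * (cexp (s%:C * w) - 1)) (normc w ^+ 2 * expR (normc w)) (mulr_ge0 (exprn_ge0 _ nw) ew) _ _ t t01.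
  rewrite mul0r cexp0 !subrr subr0; apply => s s01.
    have := dercB (dercB (derc_cexp_line `[0, 1]%classic w s) (derc_cst _ s 1)) (dline s).
    by apply: derc_val; ring.
  by rewrite ComplexField.Normc.normcM expr2 -mulrA ler_wpM2l// H1.
have H3 (t : R) : t \in `[0, 1] -> normc (cexp (t%:C * w) - 1 - t%:C * w - (t%:C * w) ^+ 2 / 2) <= normc w ^+ 3 * expR (normc w).
  move=> t01; have := @derc01_bound (fun s => cexp (s%:C * w) - 1 - s%:C * w - (s%:C * w) ^+ 2 / 2) (fun s => w * (cexp (s%:C * w) - 1 - s%:C * w)) (normc w ^+ 3 * expR (normc w)) (mulr_ge0 (exprn_ge0 _ nw) ew) _ _ t t01.
  rewrite mul0r cexp0 !subrr expr0n /= mul0r !subr0; apply => s s01.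
    have := dercB (dercB (dercB (derc_cexp_line `[0, 1]%classic w s) (derc_cst _ s 1)) (dline s)) (dercZ 2^-1 (dercM (dline s) (dline s))).
    under [X in derc _ X]eq_fun => x do rewrite -expr2 [2^-1 * _]mulrC.
    by apply: derc_val; field.
  by rewrite ComplexField.Normc.normcM exprS -mulrA ler_wpM2l// H2.
have E : (1 : R)%:C * w = w by rewrite mul1r.
by have := (H1 1 e01, H2 1 e01, H3 1 e01); rewrite !E => -[[]].
Qed.

Lemma derc_cexp D f t a : derc D f t a -> derc D (fun s => cexp (f s)) t (cexp (f t) * a).
Proof.
move=> fa.
(* [k] is the second order Taylor remainder divided by s - t; it tends to 0 because f s - f t is
   O(|s - t|). *)
pose k s := (cexp (f s - f t) - 1 - (f s - f t)) / (s - t)%:C.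
have k0 : tends (punct D t) k 0.
  have bdd : punct D t [set s | normc (f s - f t) <= (normc a + 1) * `|s - t| ].
    have /dercP/(_ 1 ltr01) [d d0 Hd] := fa.
    apply/punctP; exists d => // s Ds st sd /=.
    rewrite -[f s - f t](subrK ((s - t)%:C * a)) (le_trans (le_normcD _ _))//.
    rewrite mulrDl addrC lerD ?Hd//.
    by rewrite ComplexField.Normc.normcM normc_real mulrC.
  move=> e e0.
  pose K := (normc a + 1) ^+ 2 * expR (normc a + 1).
  have a1 : 0 < normc a + 1 by rewrite ltr_wpDl// normc_ge0.
  have K0 : 0 < K by rewrite mulr_gt0 ?expR_gt0// exprn_gt0.
  have near1 : punct D t [set s | s != t /\ `|s - t| < Order.min 1 (e / K)].
    by apply/punctP; exists (Order.min 1 (e / K)); rewrite ?lt_min ?ltr01 ?divr_gt0.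
  apply: (filterS _ (filterI bdd near1)) => s [/= b [st]].
  rewrite lt_min => /andP[s1 se].
  have st0 : 0 < `|s - t| by rewrite normr_gt0 subr_eq0.
  rewrite subr0 normc_divR ltr_pdivrMr//.
  have [_ T _] := cexp_taylor (f s - f t); apply: (le_lt_trans T).
  apply: (@le_lt_trans _ _ (((normc a + 1) * `|s - t|) ^+ 2 * expR (normc a + 1))).
    rewrite ler_pM ?expR_ge0 ?exprn_ge0 ?normc_ge0//.
      by rewrite ler_sqr ?nnegrE ?normc_ge0// mulr_ge0// ltW.
    rewrite ler_expR (le_trans b)// -[leRHS]mulr1 ler_wpM2l// ltW//.
  rewrite exprMn mulrAC -/K expr2 mulrA ltr_pM2r// mulrC -ltr_pdivlMr//.
pose proof (tendsM (tends_cst (T:=R) (F:=punct D t) (cexp (f t))) (tendsD k0 fa)) as H.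
rewrite add0r in H; apply: (tends_near _ H); apply: filterE => s /=.
rewrite /k -mulrDl subrK mulrA mulrBr mulr1 -cexpD.
by rewrite [f t + _]addrC subrK; congr (_ / _); ring.
Qed.

End derivatives.
#[global] Existing Instance punct_filter.

(** * Positive definite matrices *)

Section quadratic_forms.
Context {R : realType}.
Local Notation C := R[i].

Lemma unitmx_inj (F : fieldType) n (M : 'M[F]_n) :
  (forall u : 'cV[F]_n, M *m u = 0 -> u = 0) -> M \in unitmx.
Proof.
move=> H; rewrite -unitmx_tr -row_free_unit -kermx_eq0; apply/rowV0P => v /sub_kermxP vM.
have : v^T = 0 by apply: H; rewrite -[M]trmxK -trmx_mul vM trmx0.
by move/(congr1 trmx); rewrite trmxK trmx0.
Qed.

Definition sqn n (u : 'cV[R]_n) : R := \sum_i u i 0 ^+ 2.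
Definition qf n (A : 'M[R]_n) (u : 'cV[R]_n) : R := (u^T *m A *m u) 0 0.

Lemma sqn_ge0 n (u : 'cV[R]_n) : 0 <= sqn u.
Proof. by apply: sumr_ge0 => i _; exact: sqr_ge0. Qed.

Lemma sqnE n (u : 'cV[R]_n) : sqn u = (u^T *m u) 0 0.
Proof. by rewrite mxE; apply: eq_bigr => i _; rewrite mxE expr2. Qed.

Lemma sqn_eq0 n (u : 'cV[R]_n) : sqn u = 0 -> u = 0.
Proof.
move/eqP; rewrite psumr_eq0 => [/allP H|i _]; last exact: sqr_ge0.
apply/colP => i; rewrite mxE; apply/eqP; rewrite -sqrf_eq0.
by apply: (implyP (H i _)); rewrite ?mem_index_enum.
Qed.

Lemma sqn_gt0 n (u : 'cV[R]_n) : u != 0 -> 0 < sqn u.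
Proof.
move=> u0; rewrite lt_def sqn_ge0 andbT; apply: contra u0 => /eqP h.
by apply/eqP; exact: sqn_eq0.
Qed.

Lemma posdef_qf_ge0 n (A : 'M[R]_n) u : posdef A -> 0 <= qf A u.
Proof.
move=> [_ H]; have [->|u0] := eqVneq u 0; last exact/ltW/H.
by rewrite /qf mulmx0 mxE.
Qed.

Lemma posdef_unit n (A : 'M[R]_n) : posdef A -> A \in unitmx.
Proof.
move=> [_ H]; apply: unitmx_inj => u Au; apply/eqP; apply: contraPT Au => u0 Au.
by have := H u u0; rewrite -mulmxA Au mulmx0 mxE ltxx.
Qed.

Lemma posdef1 n : posdef (1%:M : 'M[R]_n).
Proof. by split=> [|u u0]; rewrite ?trmx1// mulmx1 -sqnE sqn_gt0. Qed.

Lemma posdefD n (A B : 'M[R]_n) : posdef A -> posdef B -> posdef (A + B).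
Proof.
move=> [sA pA] [sB pB]; split; first by rewrite linearD /= sA sB.
by move=> u u0; rewrite mulmxDr mulmxDl mxE addr_gt0 ?pA ?pB.
Qed.

Lemma posdefZ n (A : 'M[R]_n) c : 0 < c -> posdef A -> posdef (c *: A).
Proof.
move=> c0 [sA pA]; split; first by rewrite linearZ /= sA.
by move=> u u0; rewrite -scalemxAr -scalemxAl mxE mulr_gt0 ?pA.
Qed.

Lemma posdef_congr n (A B : 'M[R]_n) : B \in unitmx -> posdef A -> posdef (B^T *m A *m B).
Proof.
move=> uB [sA pA]; split; first by rewrite !trmx_mul trmxK sA mulmxA.
move=> u u0; have : B *m u != 0.
  by apply: contra u0 => /eqP h; rewrite -[u](mulKmx uB) h mulmx0.
by move/pA; rewrite trmx_mul !mulmxA.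
Qed.

Lemma posdefV n (A : 'M[R]_n) : posdef A -> posdef (invmx A).
Proof.
move=> pA; have uA := posdef_unit pA; have [sA _] := pA.
have uB : invmx A \in unitmx by rewrite unitmx_inv.
have := posdef_congr uB pA; rewrite trmx_inv sA.
by rewrite mulVmx// mul1mx.
Qed.

Lemma qf_col n m (B : 'M[R]_n) (D : 'M[R]_(n, m)) j :
  qf B (col j D) = (D^T *m B *m D) j j.
Proof.
by rewrite /qf tr_col -row_mul [LHS]mxE [RHS]mxE; apply: eq_bigr => k _; rewrite !mxE.
Qed.

Lemma mxtrace_posdef n (B D : 'M[R]_n) : posdef B -> 0 <= \tr (D^T *m B *m D).
Proof. by move=> pB; apply: sumr_ge0 => j _; rewrite -qf_col; exact: posdef_qf_ge0. Qed.

(** The trace is the sum of the values of the form B on the columns of D. *)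
Lemma mxtrace_posdef_eq0 n (B D : 'M[R]_n) : posdef B -> \tr (D^T *m B *m D) = 0 -> D = 0.
Proof.
move=> pB /eqP; rewrite psumr_eq0 => [/allP H|j _]; last by rewrite -qf_col posdef_qf_ge0.
apply/matrixP => i j; rewrite mxE; have := implyP (H j (mem_index_enum j)) isT.
rewrite -qf_col => /eqP q0; have [/colP/(_ i)|c0] := eqVneq (col j D) 0; first by rewrite !mxE.
by have := pB.2 _ c0; rewrite -/(qf _ _) q0 ltxx.
Qed.

(** For D = B - E the hypothesis gives D B = - E D, so tr (D B D) and tr (D E D) are opposite; both
    being nonnegative, they vanish. *)
Lemma sqrt_posdef_unique n (B E : 'M[R]_n) : posdef B -> posdef E ->
  B *m B = E *m E -> B = E.
Proof.
move=> pB pE h; pose D := B - E.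
have sD : D^T = D by rewrite linearB /= pB.1 pE.1.
have DB : D *m B = - (E *m D) by rewrite mulmxBl mulmxBr h opprB.
have t1 : \tr (D^T *m B *m D) + \tr (D^T *m E *m D) = 0.
  by rewrite sD DB mulNmx raddfN /= -(mulmxA D) (mxtrace_mulC D) addNr.
have : \tr (D^T *m B *m D) = 0.
  apply/eqP; rewrite eq_le mxtrace_posdef// andbT -t1 lerDl mxtrace_posdef//.
by move/(mxtrace_posdef_eq0 pB)/eqP; rewrite subr_eq0 => /eqP.
Qed.

End quadratic_forms.

(** * Complex symmetric matrices and their Hermitian forms *)

Section complex_forms.
Context {R : realType}.
Local Notation C := R[i].

Lemma conjmxK m n (A : 'M[C]_(m, n)) : conjmx (conjmx A) = A.
Proof. by apply/matrixP => i j; rewrite !mxE conjcK. Qed.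

Lemma conjmx_toC m n (A : 'M[R]_(m, n)) : conjmx (toC A) = toC A.
Proof. by apply/matrixP => i j; rewrite !mxE conjc_real. Qed.

Lemma conjmxM m n p (A : 'M[C]_(m, n)) (B : 'M[C]_(n, p)) :
  conjmx (A *m B) = conjmx A *m conjmx B.
Proof. exact: map_mxM. Qed.

Lemma conjmxZ m n a (A : 'M[C]_(m, n)) : conjmx (a *: A) = a^* *: conjmx A.
Proof. by apply/matrixP => i j; rewrite !mxE conjcM. Qed.

Lemma conjmxD m n (A B : 'M[C]_(m, n)) : conjmx (A + B) = conjmx A + conjmx B.
Proof. by apply/matrixP => i j; rewrite !mxE conjcD. Qed.

Lemma conjmxB m n (A B : 'M[C]_(m, n)) : conjmx (A - B) = conjmx A - conjmx B.
Proof. by apply/matrixP => i j; rewrite !mxE conjcB. Qed.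

Lemma conjmxV n (A : 'M[C]_n) : conjmx (invmx A) = invmx (conjmx A).
Proof. exact: map_invmx. Qed.

Lemma toCM m n p (A : 'M[R]_(m, n)) (B : 'M[R]_(n, p)) : toC (A *m B) = toC A *m toC B :> 'M[C]_(_, _).
Proof. exact: map_mxM. Qed.

Lemma toCV n (A : 'M[R]_n) : toC (invmx A) = invmx (toC A) :> 'M[C]_n.
Proof. exact: map_invmx. Qed.

Lemma toC_unit n (A : 'M[R]_n) : ((toC A : 'M[C]_n) \in unitmx) = (A \in unitmx).
Proof. exact: map_unitmx. Qed.

Lemma ReImmx m n (A : 'M[C]_(m, n)) : A = toC (Remx A) + 'i *: toC (Immx A).
Proof. by apply/matrixP => i j; rewrite !mxE [LHS]complexE. Qed.

Lemma Immx_sub m n (A : 'M[C]_(m, n)) : toC (Immx A) = (2 * 'i)^-1 *: (A - conjmx A).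
Proof.
apply/matrixP => i j; rewrite !mxE ImJ_sub invfM invi.
by rewrite mulrN mulNr -mulrN opprB [RHS]mulrC mulrA.
Qed.

Lemma toC_inj m n : injective (fun A : 'M[R]_(m, n) => toC A : 'M[C]_(m, n)).
Proof. by move=> A B /matrixP h; apply/matrixP => i j; have := h i j; rewrite !mxE => -[]. Qed.

(** For u = a + i b the mixed terms are i (a^T P b - b^T P a), which vanish by symmetry. *)
Lemma hform_real n (P : 'M[R]_n) (u : 'cV[C]_n) : P^T = P ->
  (u^H *m toC P *m u) 0 0 = (qf P (Remx u) + qf P (Immx u))%:C.
Proof.
move=> sP; rewrite {1 2}[u]ReImmx /qf.
move: (Remx u) (Immx u) => a b.
have -> : (toC a + 'i *: toC b)^H = toC a^T - 'i *: toC b^T.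
  by apply/matrixP => i j; rewrite !mxE conjcD conjcM !conjc_real conjci mulNr.
rewrite mulmxBl mulmxDr !mulmxBl -!scalemxAl -!scalemxAr -!toCM.
have -> : b^T *m P *m a = a^T *m P *m b.
  have <- : (b^T *m P *m a)^T = a^T *m P *m b by rewrite !trmx_mul trmxK sP mulmxA.
  by apply/matrixP => i j; rewrite [RHS]mxE (ord1 i) (ord1 j).
by rewrite !mxE real_complexD mulrA mulii; ring.
Qed.

Lemma hform1 n (u : 'cV[C]_n) : (u^H *m u) 0 0 = (sqnorm u)%:C.
Proof.
rewrite mxE /sqnorm (big_morph _ (@real_complexD R) (erefl _)).
by apply: eq_bigr => i _; rewrite !mxE mulrC mul_conj.
Qed.

Lemma sqnorm_ge0 n (u : 'cV[C]_n) : 0 <= sqnorm u.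
Proof. by apply: sumr_ge0 => i _; exact: sqr_ge0. Qed.

Lemma sqnorm_sqn n (u : 'cV[C]_n) : sqnorm u = sqn (Remx u) + sqn (Immx u).
Proof.
by rewrite /sqnorm /sqn -big_split; apply: eq_bigr => i _; rewrite sqr_normcE !mxE.
Qed.

(** A symmetric M has symmetric real and imaginary parts, and the Hermitian form separates them.
    Positivity of either part therefore makes M invertible. *)
Lemma Im_hform n (M : 'M[C]_n) (u : 'cV[C]_n) : M^T = M ->
  (u^H *m M *m u) 0 0 = (qf (Remx M) (Remx u) + qf (Remx M) (Immx u))%:C
   + 'i * (qf (Immx M) (Remx u) + qf (Immx M) (Immx u))%:C.
Proof.
move=> sM; rewrite {1}[M]ReImmx mulmxDr mulmxDl -scalemxAr -scalemxAl mxE [X in _ + X]mxE.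
by rewrite !hform_real//; apply/matrixP => i j; rewrite !mxE -[in RHS]sM mxE.
Qed.

Lemma Re_pair (a b : R) : complex.Re (a%:C + 'i * b%:C) = a.
Proof. by rewrite ReD Re_real mulrC ReiNIm Im_real oppr0 addr0. Qed.

Lemma Im_pair (a b : R) : complex.Im (a%:C + 'i * b%:C) = b.
Proof. by rewrite ImD Im_real mulrC ImiRe Re_real add0r. Qed.

Lemma Remx_pair m n (X Y : 'M[R]_(m, n)) : Remx (toC X + 'i *: toC Y) = X.
Proof. by apply/matrixP => i j; rewrite !mxE Re_pair. Qed.

Lemma Immx_pair m n (X Y : 'M[R]_(m, n)) : Immx (toC X + 'i *: toC Y) = Y.
Proof. by apply/matrixP => i j; rewrite !mxE Im_pair. Qed.

Lemma ReIm_eq0 n (u : 'cV[C]_n) : Remx u = 0 -> Immx u = 0 -> u = 0.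
Proof.
move=> a b; rewrite [u]ReImmx a b; apply/matrixP => i j.
by rewrite !mxE mulr0 addr0.
Qed.

Lemma posdef_hform n (P : 'M[R]_n) (u : 'cV[C]_n) : posdef P -> u != 0 ->
  0 < qf P (Remx u) + qf P (Immx u).
Proof.
move=> pP u0; have [a0|a0] := eqVneq (Remx u) 0.
  have b0 : Immx u != 0 by apply: contra u0 => /eqP b0; rewrite [u]ReIm_eq0.
  by rewrite ltr_wpDl ?posdef_qf_ge0//; apply: pP.2.
by rewrite ltr_wpDr ?posdef_qf_ge0//; apply: pP.2.
Qed.

Lemma posdef_Im_unit n (M : 'M[C]_n) : M^T = M -> posdef (Immx M) -> M \in unitmx.
Proof.
move=> sM pM; apply: unitmx_inj => u Mu; apply/eqP; apply: contraPT Mu => u0 Mu.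
have := posdef_hform pM u0.
have := congr1 (@complex.Im R) (Im_hform u sM); rewrite -mulmxA Mu mulmx0 mxE.
rewrite Im_pair => <-.
by rewrite ltxx.
Qed.

Lemma posre_unit n (M : 'M[C]_n) : posre M -> M \in unitmx.
Proof.
move=> [sM pM]; apply: unitmx_inj => u Mu; apply/eqP; apply: contraPT Mu => u0 Mu.
have := posdef_hform pM u0.
have := congr1 (@complex.Re R) (Im_hform u sM); rewrite -mulmxA Mu mulmx0 mxE.
rewrite Re_pair => <-.
by rewrite ltxx.
Qed.

End complex_forms.

(** * Positive definite square roots and coercivity *)

Section square_root.
Context {R : realType}.
Local Notation C := R[i].

Lemma herm_parts n (B : 'M[C]_n) : B^H = B ->
  (Remx B)^T = Remx B /\ (Immx B)^T = - Immx B.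
Proof.
move=> BH; split; apply/matrixP => i j; rewrite !mxE -[in RHS]BH !mxE ?Re_conjc//.
by rewrite Im_conjc opprK.
Qed.

Lemma Re_form n (B : 'M[C]_n) (u : 'cV[R]_n) :
  qf (Remx B) u = complex.Re (((toC u)^T *m B *m toC u) 0 0).
Proof.
rewrite /qf {2}[B]ReImmx mulmxDr mulmxDl -scalemxAr -scalemxAl map_trmx -!toCM.
set M := toC _ + _; have <- : Remx M 0 0 = complex.Re (M 0 0) by rewrite mxE.
by rewrite /M Remx_pair.
Qed.

(** Unitary diagonalization over [R[i]] yields a Hermitian root X + i Y with X positive definite.
    Comparing imaginary parts gives X Y + Y X = 0, which forces tr (Y^T X Y) = 0, so Y = 0 and X is
    a real root. *)
Lemma posdef_sqrt_exists n (A : 'M[R]_n) : posdef A -> exists2 B, posdef B & B *m B = A.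
Proof.
move=> pA; pose P := spectralmx (toC A : 'M[C]_n).
have PV : invmx P = P^H.
  by rewrite map_trmx; exact: invmx_unitary (spectral_unitarymx _).
have uP : P \in unitmx by exact: spectral_unit.
have nA : (toC A : 'M[C]_n) \is normalmx.
  apply/normalmxP; suff -> : ((toC A)^T ^ Num.conj)%sesqui = toC A :> 'M[C]_n by [].
  by apply/matrixP => i j; rewrite !mxE -[in RHS]pA.1 mxE; exact: conjc_real.
have /orthomx_spectralP := nA; rewrite -/P PV; set sp := spectral_diag _ => AE.
have PPH : P *m P^H = 1%:M by rewrite -PV mulmxV.
have PHP : P^H *m P = 1%:M by rewrite -PV mulVmx.
have spE : diag_mx sp = P *m toC A *m P^H.
  by rewrite AE !mulmxA PPH mul1mx -mulmxA PPH mulmx1.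
(* The eigenvalue is the Hermitian form of A at the i-th column of P^H. *)
have sp_pos i : exists2 x : R, 0 < x & sp 0 i = x%:C.
  pose u : 'cV[C]_n := col i P^H.
  have uE : u^H = row i P.
    by apply/matrixP => a b; rewrite !mxE conjcK.
  have u0 : u != 0.
    apply/eqP => u0; have := congr1 (fun M : 'M[_]_n => M i i) PPH.
    rewrite mxE [X in _ = X]mxE eqxx /= => /esym/eqP; rewrite -[1%:R]/(1 : C).
    rewrite big1 ?oner_eq0// => j _; have := congr1 (fun M : 'cV[_]_n => M j 0) u0.
    by rewrite mxE [X in _ = X]mxE => ->; rewrite mulr0.
  exists (qf A (Remx u) + qf A (Immx u)); first exact: posdef_hform.
  rewrite -hform_real ?pA.1// uE.
  have := congr1 (fun M : 'M[_]_n => M i i) spE; rewrite mxE eqxx mulr1n => ->.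
  by rewrite -row_mul [LHS]mxE [RHS]mxE; apply: eq_bigr => k _; rewrite !mxE.
pose s : 'rV[R]_n := \row_i Num.sqrt (complex.Re (sp 0 i)).
have s_pos i : 0 < s 0 i.
  by rewrite mxE; have [x x0 ->] := sp_pos i; rewrite Re_real sqrtr_gt0.
have ss : diag_mx (toC s) *m diag_mx (toC s) = diag_mx sp.
  rewrite mulmx_diag; congr diag_mx; apply/rowP => i; rewrite !mxE.
  have [x x0 ->] := sp_pos i.
  by rewrite Re_real -real_complexM -expr2 sqr_sqrtr// ltW.
pose B := P^H *m diag_mx (toC s) *m P.
have BB : B *m B = toC A.
  rewrite /B !mulmxA -(mulmxA _ P) PPH mulmx1 -(mulmxA P^H) ss.
  by rewrite -AE.
have BH : B^H = B.
  have h1 : (conjmx P^H)^T = P by apply/matrixP => i j; rewrite !mxE conjcK.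
  have h2 : (conjmx (diag_mx (toC s)))^T = diag_mx (toC s).
    apply/matrixP => i j; rewrite !mxE eq_sym; case: eqP => [->|_].
      by rewrite !mulr1n conjc_real.
    by rewrite !mulr0n conjc0.
  by rewrite /B !conjmxM !trmx_mul h1 h2 mulmxA.
have [B1 B2] := herm_parts BH.
have pB : posdef (Remx B).
  split=> // u u0.
  (* In the coordinates w = P u the form of B is diagonal with the positive weights s. *)
  pose w := P *m toC u.
  have w0 : w != 0.
    apply: contra u0 => /eqP w0; have := mulKmx uP (toC u); rewrite -/w w0 mulmx0.
    by move=> /esym h; apply/eqP; apply: toC_inj; rewrite h; apply/matrixP => i j; rewrite !mxE.
  have E : ((toC u)^T *m B *m toC u) 0 0 = (\sum_i s 0 i * normc (w i 0) ^+ 2)%:C.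
    have -> : (toC u)^T *m B *m toC u = w^H *m (diag_mx (toC s) *m w).
      by rewrite /w /B conjmxM trmx_mul conjmx_toC !mulmxA.
    rewrite mxE (big_morph _ (@real_complexD R) (erefl _)).
    apply: eq_bigr => i _; rewrite mul_diag_mx !mxE real_complexM -mul_conj; ring.
  rewrite -/(qf _ _) Re_form.
  rewrite E Re_real lt_def; apply/andP; split; last first.
    by apply: sumr_ge0 => i _; rewrite mulr_ge0 ?sqr_ge0 ?ltW.
  apply: contra w0 => /eqP/eqP; rewrite psumr_eq0 => [/allP H|i _]; last first.
    by rewrite mulr_ge0 ?sqr_ge0 ?ltW.
  apply/eqP/colP => i; have := implyP (H i (mem_index_enum i)) isT.
  rewrite mulf_eq0 gt_eqF//= sqrf_eq0 normc_eq0 => /eqP ->.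
  by rewrite mxE.
have {}BB : (toC (Remx B) + 'i *: toC (Immx B)) *m (toC (Remx B) + 'i *: toC (Immx B)) = toC A.
  by rewrite -ReImmx.
move: (Remx B) (Immx B) B1 B2 pB BB => X Y B1 B2 pX.
have -> : (toC X + 'i *: toC Y) *m (toC X + 'i *: toC Y) =
    toC (X *m X - Y *m Y) + 'i *: toC (X *m Y + Y *m X) :> 'M[C]_n.
  rewrite mulmxDl !mulmxDr -!scalemxAl -!scalemxAr scalerA mulii scaleN1r -!toCM.
  rewrite !map_mxB !map_mxD scalerDr /=; rewrite addrA -!addrA; congr (_ + _).
  by rewrite addrA addrC.
move=> XY; have e1 : X *m X - Y *m Y = A.
  by have := congr1 (fun M : 'M[C]_n => Remx M) XY; rewrite Remx_pair => ->; apply/matrixP => i j; rewrite !mxE.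
have e2 : X *m Y + Y *m X = 0.
  by have := congr1 (fun M : 'M[C]_n => Immx M) XY; rewrite Immx_pair => ->; apply/matrixP => i j; rewrite !mxE.
have Y0 : Y = 0.
  apply: (mxtrace_posdef_eq0 pX); rewrite B2 !mulNmx raddfN /=.
  (* Cyclicity of the trace together with Y X = - X Y. *)
  have : \tr (Y *m X *m Y) = - \tr (Y *m X *m Y).
    have e2' : Y *m X = - (X *m Y) by apply/eqP; rewrite -addr_eq0 addrC e2.
    by rewrite {1}e2' mulNmx raddfN /= -(mulmxA X Y Y) (mxtrace_mulC X (Y *m Y)) -(mulmxA Y Y X) (mxtrace_mulC Y (Y *m X)).
  by move=> h; apply/eqP; rewrite oppr_eq0; apply/eqP; lra.
by exists X => //; rewrite -e1 Y0 mulmx0 subr0.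
Qed.

Lemma sqrtmxP n (A : 'M[R]_n) : posdef A -> posdef (sqrtmx A) /\ sqrtmx A *m sqrtmx A = A.
Proof.
move=> pA; have [B pB BB] := posdef_sqrt_exists pA.
by rewrite /sqrtmx; case: xgetP => [_ _ //|/(_ B)]; case.
Qed.

Lemma sqrtmx_eq n (A B : 'M[R]_n) : posdef B -> B *m B = A -> sqrtmx A = B.
Proof.
move=> pB BB; have pA : posdef A.
  have := posdef_congr (posdef_unit pB) (posdef1 n); rewrite mulmx1 pB.1 BB.
  by [].
have [pS SS] := sqrtmxP pA; apply: sqrt_posdef_unique => //.
by rewrite SS BB.
Qed.

Lemma posdef_det_gt0 n (A : 'M[R]_n) : posdef A -> 0 < \det A.
Proof.
move=> /sqrtmxP[pS <-]; rewrite det_mulmx -expr2 lt_def sqr_ge0 andbT sqrf_eq0.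
by have := posdef_unit pS; rewrite unitmxE unitfE.
Qed.

Lemma sqn_mulmx_le n (M : 'M[R]_n) : exists2 K : R, 0 < K & forall v, sqn (M *m v) <= K * sqn v.
Proof.
pose a i := \sum_j `|M i j|; have a0 i : 0 <= a i by apply: sumr_ge0.
exists (1 + \sum_i a i ^+ 2).
  by rewrite ltr_wpDr// sumr_ge0// => i _; exact: sqr_ge0.
move=> v; rewrite mulrDl mul1r ler_wpDl ?sqn_ge0// mulr_suml; apply: ler_sum => i _.
rewrite -[sqn v]sqr_sqrtr ?sqn_ge0// -exprMn -[leLHS]real_normK ?num_real//.
rewrite ler_sqr ?nnegrE ?mulr_ge0 ?sqrtr_ge0// mxE (le_trans (ler_norm_sum _ _ _))//.
rewrite mulr_suml; apply: ler_sum => j _; rewrite normrM ler_wpM2l//.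
rewrite -sqrtr_sqr ler_wsqrtr// /sqn (bigD1 j)//= lerDl.
by apply: sumr_ge0 => k _; exact: sqr_ge0.
Qed.

(** With S the positive root the form is |S u|^2, and a bound K for the inverse of S gives |u|^2 <=
    K |S u|^2. *)
Lemma posdef_coercive n (A : 'M[R]_n) : posdef A ->
  exists2 c : R, 0 < c & forall u, c * sqn u <= qf A u.
Proof.
move=> /sqrtmxP[pS SS]; have [K K0 HK] := sqn_mulmx_le (invmx (sqrtmx A)).
exists K^-1; first by rewrite invr_gt0.
move=> u; have -> : qf A u = sqn (sqrtmx A *m u).
  by rewrite [RHS]sqnE trmx_mul pS.1 mulmxA -(mulmxA u^T) SS.
by rewrite ler_pdivrMl//; have := HK (sqrtmx A *m u); rewrite mulKmx// posdef_unit.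
Qed.

End square_root.

(** * Differentiable matrix families *)

Section matrix_derivatives.
Context {R : realType}.
Local Notation C := R[i].

Definition dercmx (D : set R) m n (F : R -> 'M[C]_(m, n)) (t : R) (L : 'M[C]_(m, n)) : Prop :=
  forall i j, derc D (fun s => F s i j) t (L i j).

Section rules.
Variables (D : set R) (t : R).

Lemma dercmx_val m n (F : R -> 'M[C]_(m, n)) A B : A = B -> dercmx D F t A -> dercmx D F t B.
Proof. by move=> ->. Qed.

Lemma dercmx_eq m n (F G : R -> 'M[C]_(m, n)) A : D t -> (forall s, D s -> F s = G s) ->
  dercmx D F t A -> dercmx D G t A.
Proof. by move=> Dt FG FA i j; apply: (derc_eq Dt _ (FA i j)) => s /FG ->. Qed.

Lemma dercmx_cst m n (A : 'M[C]_(m, n)) : dercmx D (fun=> A) t 0.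
Proof. by move=> i j; rewrite mxE; exact: derc_cst. Qed.

Lemma dercmxD m n (F G : R -> 'M[C]_(m, n)) A B : dercmx D F t A -> dercmx D G t B ->
  dercmx D (fun s => F s + G s) t (A + B).
Proof.
by move=> FA GB i j; rewrite mxE; under eq_fun do rewrite mxE; exact: dercD.
Qed.

Lemma dercmxN m n (F : R -> 'M[C]_(m, n)) A : dercmx D F t A -> dercmx D (fun s => - F s) t (- A).
Proof. by move=> FA i j; rewrite mxE; under eq_fun do rewrite mxE; exact: dercN. Qed.

Lemma dercmxB m n (F G : R -> 'M[C]_(m, n)) A B : dercmx D F t A -> dercmx D G t B ->
  dercmx D (fun s => F s - G s) t (A - B).
Proof. by move=> FA GB; apply: dercmxD => //; exact: dercmxN. Qed.

Lemma dercmxZ m n (F : R -> 'M[C]_(m, n)) c A : dercmx D F t A ->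
  dercmx D (fun s => c *: F s) t (c *: A).
Proof. by move=> FA i j; rewrite mxE; under eq_fun do rewrite mxE; exact: dercZ. Qed.

Lemma dercmx_tr m n (F : R -> 'M[C]_(m, n)) A : dercmx D F t A -> dercmx D (fun s => (F s)^T) t A^T.
Proof. by move=> FA i j; rewrite mxE; under eq_fun do rewrite mxE; exact: FA. Qed.

Lemma dercmx_conj m n (F : R -> 'M[C]_(m, n)) A : dercmx D F t A ->
  dercmx D (fun s => conjmx (F s)) t (conjmx A).
Proof. by move=> FA i j; rewrite mxE; under eq_fun do rewrite mxE; exact: derc_conj. Qed.

Lemma dercmxM m n p (F : R -> 'M[C]_(m, n)) (G : R -> 'M[C]_(n, p)) A B :
  dercmx D F t A -> dercmx D G t B ->
  dercmx D (fun s => F s *m G s) t (A *m G t + F t *m B).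
Proof.
move=> FA GB i j; rewrite !mxE; under eq_fun do rewrite mxE.
by rewrite -big_split /=; apply: derc_sum => k _; exact: dercM.
Qed.

Lemma dercmxMl m n p (E : 'M[C]_(m, n)) (G : R -> 'M[C]_(n, p)) B :
  dercmx D G t B -> dercmx D (fun s => E *m G s) t (E *m B).
Proof. by move=> GB; have := dercmxM (dercmx_cst E) GB; rewrite mul0mx add0r. Qed.

Lemma dercmxMr m n p (F : R -> 'M[C]_(m, n)) (E : 'M[C]_(n, p)) A :
  dercmx D F t A -> dercmx D (fun s => F s *m E) t (A *m E).
Proof. by move=> FA; have := dercmxM FA (dercmx_cst E); rewrite mulmx0 addr0. Qed.

Lemma derc_mxtrace n (F : R -> 'M[C]_n) A : dercmx D F t A -> derc D (fun s => \tr (F s)) t (\tr A).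
Proof. by move=> FA; apply: derc_sum. Qed.

Lemma derc_prod (I : eqType) (r : seq I) (f : I -> R -> C) (a : I -> C) : uniq r ->
  (forall i, derc D (f i) t (a i)) ->
  derc D (fun s => \prod_(i <- r) f i s) t
    (\sum_(k <- r) \prod_(i <- r) (if i == k then a i else f i t)).
Proof.
move=> + H; elim: r => [_|x r IH /= /andP[xr ur]].
  by rewrite big_nil; under eq_fun do rewrite big_nil; exact: derc_cst.
under eq_fun do rewrite big_cons; have := dercM (H x) (IH ur); apply: derc_val.
rewrite !big_cons eqxx; congr (_ * _ + _).
  by rewrite !big_seq; apply: eq_bigr => i ir; case: eqP => // ix; rewrite -ix ir in xr.
rewrite mulr_sumr !big_seq; apply: eq_bigr => k kr; rewrite big_cons.
by case: eqP => // xk; rewrite xk kr in xr.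
Qed.

(** Differentiating row k in the Leibniz formula gives the determinant of F with row k replaced by
    that of A; expanded along this row it involves only cofactors of F. *)
Lemma derc_det n (F : R -> 'M[C]_n) A : dercmx D F t A ->
  derc D (fun s => \det (F s)) t (\tr (A *m \adj (F t))).
Proof.
move=> FA.
have H1 : derc D (fun s => \det (F s)) t
    (\sum_(s : 'S_n) (-1) ^+ s * \sum_k \prod_i (if i == k then A i (s i) else F t i (s i))).
  apply: derc_sum => s _; apply: dercZ; apply: (derc_prod (f := fun i u => F u i (s i))).
    exact: index_enum_uniq.
  by move=> i; exact: FA.
apply: derc_val H1.
under eq_bigr do rewrite mulr_sumr.
rewrite exchange_big; apply: eq_bigr => k _ /=.
pose M := \matrix_(i, j) (if i == k then A i j else F t i j).
transitivity (\det M).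
  by apply: eq_bigr => s _; congr (_ * _); apply: eq_bigr => i _; rewrite mxE.
rewrite (expand_det_row _ k) mxE; apply: eq_bigr => j _.
rewrite !mxE eqxx; congr (_ * _).
rewrite /cofactor; congr (_ * \det _); apply/matrixP => a b; rewrite !mxE.
by rewrite eq_sym (negPf (neq_lift _ _)).
Qed.

(** The cofactor formula shows that the inverse is differentiable; the value of the derivative then
    comes from differentiating F F^-1 = 1. *)
Lemma dercmx_inv n (F : R -> 'M[C]_n) A : D t -> (forall s, D s -> F s \in unitmx) ->
  dercmx D F t A -> dercmx D (fun s => invmx (F s)) t (- (invmx (F t) *m A *m invmx (F t))).
Proof.
move=> Dt uF FA.
have [B HB] : exists B, dercmx D (fun s => invmx (F s)) t B.
  pose a i j : C := \tr ((\matrix_(k, l) A (lift j k) (lift i l)) *m \adj (row' j (col' i (F t)))).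
  have adjd i j : derc D (fun s => \adj (F s) i j) t ((-1) ^+ (j + i) * a i j).
    under eq_fun do rewrite mxE /cofactor.
    apply: dercZ; apply: derc_det => k l; rewrite mxE.
    by under eq_fun do rewrite !mxE; exact: FA.
  pose d := \tr (A *m \adj (F t)).
  have detd := derc_det FA.
  have dn0 s : D s -> \det (F s) != 0 by move=> /uF; rewrite unitmxE unitfE.
  exists (\matrix_(i, j) (- d / \det (F t) ^+ 2 * \adj (F t) i j + (\det (F t))^-1 * ((-1) ^+ (j + i) * a i j))) => i j.
  rewrite mxE; apply: derc_eq (dercM (dercV (dn0 _ Dt) detd) (adjd i j)) => // s Ds.
  by rewrite /invmx uF// [RHS]mxE.
(* If t is isolated in D the filter is improper and every derivative statement holds; otherwise
   limits are unique. *)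
have P : ProperFilter (punct D t) \/ ~ ProperFilter (punct D t) by exact: EM.
case: P => [P|nP]; last first.
  have all (Q : set R) : punct D t Q.
    apply: contrapT => nQ; apply: nP; split; last exact: punct_filter.
    by move=> f0; apply: nQ; apply: filterS f0.
  by move=> i j e e0; exact: all.
have H := dercmxM FA HB.
have H0 : dercmx D (fun s => F s *m invmx (F s)) t 0.
  by apply: (dercmx_eq Dt _ (dercmx_cst 1%:M)) => s Ds; rewrite mulmxV ?uF.
suff E : A *m invmx (F t) + F t *m B = 0.
  apply: dercmx_val HB; have := congr1 (mulmx (invmx (F t))) E.
  rewrite mulmxDr mulKmx ?uF// mulmx0 mulmxA => /eqP.
  by rewrite addrC addr_eq0 => /eqP.
by apply/matrixP => i j; exact: (tends_unique (H i j) (H0 i j)).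
Qed.

End rules.

Lemma dercmx_unique m n (F : R -> 'M[C]_(m, n)) (t : R) A B : t \in `[0, 1] ->
  dercmx `[0, 1]%classic F t A -> dercmx `[0, 1]%classic F t B -> A = B.
Proof.
by move=> t01 FA FB; apply/matrixP => i j; exact: (derc_unique t01 (FA i j) (FB i j)).
Qed.

Lemma dercmx01_constant m n (F : R -> 'M[C]_(m, n)) :
  (forall t : R, t \in `[0, 1] -> dercmx `[0, 1]%classic F t 0) ->
  forall t : R, t \in `[0, 1] -> F t = F 0.
Proof.
move=> H t t01; apply/matrixP => i j; apply: (derc01_constant (f := fun s => F s i j)) => // s s01.
by have := H s s01 i j; rewrite mxE.
Qed.

Lemma deriv01C_derc (f f' : R -> C) : deriv01C f f' <->
  forall t : R, t \in `[0, 1] -> derc `[0, 1]%classic f t (f' t).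
Proof.
split=> H t t01.
  apply/dercP => e e0; have [d d0 Hd] := H t t01 e e0; exists d => // s s01 sd.
move=> e e0; have /dercP/(_ e e0)[d d0 Hd] := H t t01; exists d => //.
Qed.

Lemma deriv01mx_dercmx n (F F' : R -> 'M[C]_n) : deriv01mx F F' <->
  forall t : R, t \in `[0, 1] -> dercmx `[0, 1]%classic F t (F' t).
Proof.
split=> [H t t01 i j|H i j]; first by have /deriv01C_derc := H i j; exact.
by apply/deriv01C_derc => t t01; exact: H.
Qed.

(** Real and imaginary parts of f are continuous on [0, 1], where a continuous function attains its
    maximum. *)
Lemma derc01_bounded (f f' : R -> C) :
  (forall t : R, t \in `[0, 1] -> derc `[0, 1]%classic f t (f' t)) ->
  exists2 M : R, 0 <= M & forall t : R, t \in `[0, 1] -> normc (f t) <= M.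
Proof.
move=> H.
have cf (g : C -> R) : (forall z w, `|g z - g w| <= normc (z - w)) ->
    exists2 M : R, 0 <= M & forall t : R, t \in `[0, 1] -> `|g (f t)| <= M.
  move=> gl; have cg : {within `[0, 1]%classic, continuous (fun s => `|g (f s)|)}.
    apply/subspace_continuousP => x x01; apply/cvgrPdist_lt => e e0.
    have x01' : x \in `[0, 1] by [].
    have /punctP[d d0 Hd] := derc_tends (H x x01') e0.
    rewrite near_withinE; apply/nbhs_ballP; exists d => // y; rewrite /ball /= => xy y01.
    have [->|yx] := eqVneq y x; first by rewrite subrr normr0.
    apply: (le_lt_trans (ler_dist_dist _ _)); apply: (le_lt_trans (gl _ _)).
    by rewrite normc_subC; apply: Hd => //; rewrite distrC.
  have [c c01 Hc] := EVT_max ler01 cg.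
  by exists `|g (f c)| => // t t01; exact: Hc.
have cRe (z w : C) : `|complex.Re z - complex.Re w| <= normc (z - w).
  by rewrite -ReN -ReD; exact: Re_le_normc.
have cIm (z w : C) : `|complex.Im z - complex.Im w| <= normc (z - w).
  by rewrite -ImN -ImD; exact: Im_le_normc.
have [M1 M10 H1] := cf _ cRe; have [M2 M20 H2] := cf _ cIm.
exists (M1 + M2); first exact: addr_ge0.
by move=> t t01; apply: (le_trans (normc_le_Re_Im _)); rewrite lerD ?H1 ?H2.
Qed.

Lemma derc01_nonincreasing (g g' : R -> R) :
  (forall t : R, t \in `[0, 1] -> derc `[0, 1]%classic (fun s => (g s)%:C) t (g' t)%:C) ->
  (forall t : R, t \in `[0, 1] -> g' t <= 0) ->
  forall t : R, t \in `[0, 1] -> g t <= g 0.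
Proof.
move=> H H' t; rewrite in_itv /= => /andP[t0 t1].
have [c cI E] := derc01_mean_value H (lexx 0) t0 t1.
rewrite -subr_le0 E subr0 mulr_le0_ge0// H'//.
by move: cI; rewrite !in_itv /=; lra.
Qed.

(* Gronwall: the squared norm of e, multiplied by exp (- K t), is nonincreasing. *)
Lemma linear_ode_zero (I : finType) (e e' : I -> R -> C) (K : R) :
  (forall (t : R) i, t \in `[0, 1] -> derc `[0, 1]%classic (e i) t (e' i t)) ->
  (forall (t : R) i, t \in `[0, 1] -> normc (e' i t) <= K * \sum_k normc (e k t)) ->
  (forall i, e i 0 = 0) ->
  forall (t : R) i, t \in `[0, 1] -> e i t = 0.
Proof.
move=> H HK H0.
pose N t := \sum_i normc (e i t) ^+ 2.
pose N' t := \sum_i complex.Re (e' i t * (e i t)^* + e i t * (e' i t)^*).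
have NC s : (N s)%:C = \sum_i e i s * (e i s)^*.
  by rewrite (big_morph _ (@real_complexD R) (erefl _)); apply: eq_bigr => i _; rewrite mul_conj.
have dN (t : R) : t \in `[0, 1] -> derc `[0, 1]%classic (fun s => (N s)%:C) t (N' t)%:C.
  move=> t01; rewrite (_ : (fun s => (N s)%:C) = (fun s => \sum_i e i s * (e i s)^*)); last exact/funext.
  rewrite (big_morph _ (@real_complexD R) (erefl _)); apply: derc_sum => i _.
  have := dercM (H t i t01) (derc_conj (H t i t01)); apply: derc_val.
  have -> : e i t * (e' i t)^* = (e' i t * (e i t)^*)^* by rewrite conjcM conjcK mulrC.
  by apply: complex_ext; rewrite ?Re_real ?Im_real// ImD Im_conjc subrr.
pose m : R := #|I|%:R.
have NS (t : R) i k : normc (e i t) * normc (e k t) <= N t.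
  have h j : normc (e j t) ^+ 2 <= N t.
    by rewrite /N (bigD1 j)//= lerDl sumr_ge0// => l _; exact: sqr_ge0.
  have := h i; have := h k; have := sqr_ge0 (normc (e i t) - normc (e k t)); nra.
pose L := 2 * (`|K| * m * m).
have N'L (t : R) : t \in `[0, 1] -> N' t <= L * N t.
  move=> t01.
  have P i : normc (e' i t) * normc (e i t) <= `|K| * (m * N t).
    apply: (@le_trans _ _ (`|K| * (\sum_k normc (e k t)) * normc (e i t))).
      rewrite ler_wpM2r ?normc_ge0// (le_trans (HK t i t01))// ler_wpM2r ?ler_norm//.
      by apply: sumr_ge0 => k _; exact: normc_ge0.
    rewrite -mulrA ler_wpM2l// mulr_suml /m mulr_natl -sumr_const.
    by apply: ler_sum => k _; rewrite mulrC; exact: NS.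
  have Hi i : complex.Re (e' i t * (e i t)^* + e i t * (e' i t)^*) <= 2 * (`|K| * (m * N t)).
    apply: (le_trans (ler_norm _)); apply: (le_trans (Re_le_normc _)).
    apply: (le_trans (le_normcD _ _)); rewrite !ComplexField.Normc.normcM !normc_conj.
    by rewrite [X in _ + X]mulrC mulr2n mulrDl !mul1r lerD.
  apply: (le_trans (ler_sum _ (fun i _ => Hi i))); rewrite sumr_const -mulr_natl -/m /L.
  by rewrite le_eqVlt; apply/orP; left; apply/eqP; ring.
pose g t := expR (- (L * t)) * N t.
have dexp (t : R) : derc `[0, 1]%classic (fun s => (expR (- (L * s)))%:C) t (- L * expR (- (L * t)))%:C.
  have := @derc_cexp_line R `[0, 1]%classic ((- L)%:C) t.
  have E s : cexp (s%:C * (- L)%:C) = (expR (- (L * s)))%:C.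
    by rewrite -real_complexM cexp_real mulrN mulrC.
  by rewrite (funext E) E -real_complexM.
have dg (t : R) : t \in `[0, 1] -> derc `[0, 1]%classic (fun s => (g s)%:C) t
    (expR (- (L * t)) * (N' t - L * N t))%:C.
  move=> t01; rewrite (_ : (fun s => (g s)%:C) = (fun s => (expR (- (L * s)))%:C * (N s)%:C)); last first.
    by apply/funext => s; rewrite /g real_complexM.
  by have := dercM (dexp t) (dN t t01); apply: derc_val; rewrite -!real_complexM -real_complexD; congr (_ %:C); ring.
move=> t i t01.
have gt0 : g t <= g 0.
  apply: (derc01_nonincreasing dg) => // s s01.
  by rewrite mulr_ge0_le0 ?expR_ge0// subr_le0 N'L.
have N0 : N 0 = 0 by apply: big1 => k _; rewrite H0 ComplexField.Normc.normc0 expr0n.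
have : N t <= 0.
  by move: gt0; rewrite /g N0 mulr0 pmulr_rle0 ?expR_gt0.
have := NS t i i; have := normc_ge0 (e i t) => h0 h1 h2.
apply: ComplexField.Normc.eq0_normc; apply/eqP; rewrite -sqrf_eq0 eq_le sqr_ge0 andbT.
by rewrite expr2 (le_trans h1 h2).
Qed.

End matrix_derivatives.

(** * The geodesic equation *)

Lemma addmxE (V : nmodType) m n (A B : 'M[V]_(m, n)) i j : (A + B) i j = A i j + B i j.
Proof. by rewrite mxE. Qed.

Lemma oppmxE (V : zmodType) m n (A : 'M[V]_(m, n)) i j : (- A) i j = - A i j.
Proof. by rewrite mxE. Qed.

(* Elaboration produces many convertible structure instances inside [mulmx]; [cmul] has
   only one, so that equal products become syntactically equal. *)
Section expansion.
Context {R : realType}.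
Local Notation C := R[i].

Definition cmul m n p (A : 'M[C]_(m, n)) (B : 'M[C]_(n, p)) : 'M[C]_(m, p) := A *m B.

Lemma cmulDl m n p (A B : 'M[C]_(m, n)) (D : 'M[C]_(n, p)) :
  cmul (A + B) D = cmul A D + cmul B D.
Proof. exact: mulmxDl. Qed.
Lemma cmulDr m n p (A : 'M[C]_(m, n)) (D E : 'M[C]_(n, p)) :
  cmul A (D + E) = cmul A D + cmul A E.
Proof. exact: mulmxDr. Qed.
Lemma cmulNl m n p (A : 'M[C]_(m, n)) (D : 'M[C]_(n, p)) : cmul (- A) D = - cmul A D.
Proof. exact: mulNmx. Qed.
Lemma cmulNr m n p (A : 'M[C]_(m, n)) (D : 'M[C]_(n, p)) : cmul A (- D) = - cmul A D.
Proof. exact: mulmxN. Qed.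
Lemma cmulA m n p q (A : 'M[C]_(m, n)) (D : 'M[C]_(n, p)) (F : 'M[C]_(p, q)) :
  cmul A (cmul D F) = cmul (cmul A D) F.
Proof. exact: mulmxA. Qed.

End expansion.

(** Proves noncommutative polynomial identities: after expansion each monomial is a left-nested
    product, each product becomes an opaque matrix, and [ring] checks the remaining linear identity
    entrywise. *)
Ltac mxabel :=
  repeat match goal with |- context [@mulmx ?K ?a ?b ?c ?A ?B] =>
    change (@mulmx K a b c A B) with (cmul A B) end;
  try rewrite !(cmulDl, cmulDr, cmulNl, cmulNr, cmulA);
  repeat match goal with |- context [cmul ?A ?B] => generalize (cmul A B) end;
  intros; apply/matrixP => ? ?; rewrite !mxE; ring.

Section geodesic_equation.
Context {R : realType} {n : nat}.
Local Notation C := R[i].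

Lemma derc_derive1 (D : set R) (g : R -> R) (l : R) : nbhs (0 : R) D ->
  derc D (fun s => (g s)%:C) 0 l%:C -> derive1 g 0 = l.
Proof.
move=> nD H; rewrite derive1E /derive; apply/cvg_lim => //.
apply/cvgrPdist_lt => e e0; rewrite near_withinE.
have /punctP[d d0 Hd] := H e e0; have /nbhs_ballP[d' /= d'0 Hd'] := nD.
apply/nbhs_ballP; exists (Order.min d d'); first by rewrite /= lt_min d0.
move=> h hd h0; have : `|h| < d /\ `|h| < d'.
  by apply/andP; rewrite -lt_min; move: hd; rewrite /ball /= sub0r normrN.
move=> [h1 h2]; have Dh : D h by apply: Hd'; rewrite /ball /= sub0r normrN.
have := Hd h Dh h0; rewrite !subr0 => /(_ h1) /=.
rewrite [h *: _]mulr1 addr0 distrC.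
rewrite -!real_complexB -real_complexV -real_complexM -real_complexB normc_real.
by rewrite subr0 mulrC.
Qed.

Lemma dercmx_line (D : set R) (A B : 'M[C]_n) (t : R) : dercmx D (fun s => A + s%:C *: B) t B.
Proof.
move=> i j; under eq_fun do rewrite !mxE.
by have := dercD (derc_cst D t (A i j)) (dercM (derc_real D t) (derc_cst D t (B i j)));
  rewrite mulr0 addr0 add0r mul1r.
Qed.

Lemma Immx_line (A B : 'M[C]_n) (s : R) : Immx (A + s%:C *: B) = Immx A + s *: Immx B.
Proof. by apply/matrixP => i j; rewrite !mxE ImD Im_mul Re_real Im_real mul0r addr0. Qed.

(** The base point enters [metric] only through the inverse of its imaginary part, whose derivative
    is - A V A. *)
Lemma dmetricE (Omega W X Y : 'M[C]_n) (A := toC (invmx (Immx Omega))) (V := toC (Immx W)) :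
  Immx Omega \in unitmx ->
  dmetric Omega W X Y = - complex.Re (\tr (A *m V *m A *m X *m A *m conjmx Y)
     + \tr (A *m X *m A *m V *m A *m conjmx Y)).
Proof.
move=> uO; pose F s : 'M[C]_n := toC (Immx Omega) + s%:C *: V.
have FE s : F s = toC (Immx (Omega + s%:C *: W)).
  by apply/matrixP => i j; rewrite Immx_line /F /V !mxE real_complexD real_complexM.
(* The inverse is differentiated inside this set, a neighbourhood of 0 by continuity of the
   determinant. *)
pose D := [set s | F s \in unitmx].
have F0 : F 0 = toC (Immx Omega) by rewrite /F scale0r addr0.
have D0 : D 0 by rewrite /D /= F0 toC_unit.
have nD : nbhs (0 : R) D.
  have det0 : \det (F 0) != 0 by move: D0; rewrite /D /= unitmxE unitfE.
  have := derc_tends (derc_det (dercmx_line setT (toC (Immx Omega)) V 0)).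
  rewrite -/(F 0) => /(_ (normc (\det (F 0)))); rewrite normc_gt0 => /(_ det0) /punctP[d d0 Hd].
  apply/nbhs_ballP; exists d; first exact: d0.
  move=> s; rewrite /ball /= sub0r normrN => sd.
  have [->|s0] := eqVneq s 0; first exact: D0.
  have := Hd s I s0; rewrite subr0 => /(_ sd) /=; rewrite -/(F s) /D /= unitmxE unitfE.
  by apply: contraPneq => ->; rewrite sub0r normcN ltxx.
have dA := dercmx_inv D0 (fun s Ds => Ds) (dercmx_line D (toC (Immx Omega)) V 0).
have dM := dercmxMr (conjmx Y) (dercmxM (dercmxMr X dA) dA).
have dT := derc_ReP (derc_mxtrace dM).
rewrite /dmetric; apply: (derc_derive1 nD).
have E s : (metric (Omega + s%:C *: W) X Y)%:C = (complex.Re (\tr (invmx (F s) *m X *m invmx (F s) *m conjmx Y)))%:C.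
  by rewrite /metric FE toCV.
rewrite (funext E); apply: derc_val dT.
rewrite -/(F 0) F0 -toCV -/A; congr (_ %:C); rewrite -ReN; congr complex.Re.
rewrite -mxtraceD -[RHS](raddfN (@mxtrace _ n)) /=; congr (\tr _).
by move: (conjmx Y) => Z; mxabel.
Qed.

(** With T the positive root of the inverse imaginary part, the metric at (Z, Z) is the squared
    Frobenius norm of T Z T. *)
Lemma metric_eq0 (Omega Z : 'M[C]_n) : posdef (Immx Omega) -> Z^T = Z ->
  metric Omega Z Z = 0 -> Z = 0.
Proof.
move=> /posdefV pA sZ; have [pT TT] := sqrtmxP pA; rewrite /metric -{1 2}TT.
move: (sqrtmx _) pT => T pT {TT pA}; rewrite toCM.
have uU : (toC T : 'M[C]_n) \in unitmx by rewrite toC_unit posdef_unit.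
have sU : (toC T : 'M[C]_n)^T = toC T by rewrite map_trmx pT.1.
have cU : conjmx (toC T : 'M[C]_n) = toC T by rewrite conjmx_toC.
move: (toC T : 'M[C]_n) uU sU cU => U uU sU cU.
have [N NE] : exists N, N = U *m Z *m U by exists (U *m Z *m U).
have -> : \tr (U *m U *m Z *m (U *m U) *m conjmx Z) = \tr (N *m N^H).
  have -> : N^H = U *m conjmx Z *m U.
    by rewrite NE !conjmxM !trmx_mul cU sU map_trmx sZ mulmxA.
  have -> : U *m U *m Z *m (U *m U) *m conjmx Z = U *m (U *m Z *m U *m U *m conjmx Z).
    by rewrite !mulmxA.
  by rewrite mxtrace_mulC NE !mulmxA.
have -> : complex.Re (\tr (N *m N^H)) = \sum_i \sum_j normc (N i j) ^+ 2.
  rewrite Re_sum; apply: eq_bigr => i _; rewrite mxE Re_sum; apply: eq_bigr => j _.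
  by rewrite !mxE mul_conj Re_real.
move/eqP; rewrite psumr_eq0 => [/allP H|i _]; last by apply: sumr_ge0 => j _; exact: sqr_ge0.
have N0 : N = 0.
  apply/matrixP => i j; have := implyP (H i (mem_index_enum i)) isT.
  rewrite psumr_eq0 => [/allP H'|k _]; last exact: sqr_ge0.
  have := implyP (H' j (mem_index_enum j)) isT.
  by rewrite sqrf_eq0 normc_eq0 [X in _ -> _ = X]mxE => /eqP.
have : invmx U *m N *m invmx U = 0 by rewrite N0 mulmx0 mul0mx.
by rewrite NE -!mulmxA mulKmx// mulmxV// mulmx1.
Qed.

(** Scalar skeleton of the Koszul identity. The numbers t1, t2, t3 are the traces of A P A P A
    conj(Z), A conj(P) A P A conj(Z) and A P A conj(P) A conj(Z); cyclicity and conjugation reduce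
    the other cubic traces to these. *)
Lemma koszul_numbers (z q t1 t2 t3 s1 s1' s2 s2' l1 l2 l3 l4 : C) (c := (2 * 'i)^-1) :
  s1 = t2^* -> s1' = t3 -> s2 = t3^* -> s2' = t2 -> z = q + 'i * t1 ->
  l1 = c * (t1 - t2) -> l2 = c * (t1 - t3) -> l3 = c * (s1 - s1') -> l4 = c * (s2 - s2') ->
  complex.Re z = complex.Re q + 2^-1 *
   (- complex.Re (l1 + l2) - complex.Re (l1 + l2) - - complex.Re (l3 + l4)).
Proof.
move=> -> -> -> -> -> -> -> -> ->; rewrite /c invfM invi -real_complex_nat -real_complexV.
by rewrite !reimE; field.
Qed.

Lemma koszul_trace (A P Q Z : 'M[C]_n) : conjmx A = A -> Z = Q + 'i *: (P *m A *m P) ->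
  complex.Re (\tr (A *m Z *m A *m conjmx Z)) =
  complex.Re (\tr (A *m Q *m A *m conjmx Z)) + 2^-1 *
   (- complex.Re
     (\tr (A *m ((2 * 'i)^-1 *: (P - conjmx P)) *m A *m P *m A *m conjmx Z) +
      \tr (A *m P *m A *m ((2 * 'i)^-1 *: (P - conjmx P)) *m A *m conjmx Z)) -
    complex.Re
     (\tr (A *m ((2 * 'i)^-1 *: (P - conjmx P)) *m A *m P *m A *m conjmx Z) +
      \tr (A *m P *m A *m ((2 * 'i)^-1 *: (P - conjmx P)) *m A *m conjmx Z)) -
    - complex.Re
     (\tr (A *m ((2 * 'i)^-1 *: (Z - conjmx Z)) *m A *m P *m A *m conjmx P) +
      \tr (A *m P *m A *m ((2 * 'i)^-1 *: (Z - conjmx Z)) *m A *m conjmx P))).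
Proof.
move=> cA ZE.
have cj X Y T : (\tr (A *m X *m A *m Y *m A *m T))^* =
    \tr (A *m conjmx X *m A *m conjmx Y *m A *m conjmx T).
  have -> : A *m conjmx X *m A *m conjmx Y *m A *m conjmx T =
      conjmx (A *m X *m A *m Y *m A *m T) by rewrite !conjmxM cA.
  exact: esym (trace_map_mx _ _).
have cyc X Y T : \tr (A *m X *m A *m Y *m A *m T) = \tr (A *m Y *m A *m T *m A *m X).
  have -> : A *m X *m A *m Y *m A *m T = (A *m X) *m (A *m Y *m A *m T) by rewrite !mulmxA.
  by rewrite mxtrace_mulC !mulmxA.
have S1 : \tr (A *m Z *m A *m P *m A *m conjmx P) = (\tr (A *m conjmx P *m A *m P *m A *m conjmx Z))^*.
  by rewrite cj !conjmxK cyc.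
have S1' : \tr (A *m conjmx Z *m A *m P *m A *m conjmx P) = \tr (A *m P *m A *m conjmx P *m A *m conjmx Z) by rewrite cyc.
have S2 : \tr (A *m P *m A *m Z *m A *m conjmx P) = (\tr (A *m P *m A *m conjmx P *m A *m conjmx Z))^*.
  by rewrite cj !conjmxK cyc cyc.
have S2' : \tr (A *m P *m A *m conjmx Z *m A *m conjmx P) = \tr (A *m conjmx P *m A *m P *m A *m conjmx Z).
  by rewrite cyc cyc.
have eL c X Y U V : \tr (A *m (c *: (X - Y)) *m A *m U *m A *m V) =
    c * (\tr (A *m X *m A *m U *m A *m V) - \tr (A *m Y *m A *m U *m A *m V)).
  by rewrite -scalemxAr -!scalemxAl mxtraceZ mulmxBr !mulmxBl raddfB.
have eR c X Y U V : \tr (A *m U *m A *m (c *: (X - Y)) *m A *m V) =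
    c * (\tr (A *m U *m A *m X *m A *m V) - \tr (A *m U *m A *m Y *m A *m V)).
  by rewrite cyc eL (cyc U X V) (cyc U Y V).
have TZ : \tr (A *m Z *m A *m conjmx Z) = \tr (A *m Q *m A *m conjmx Z) +
    'i * \tr (A *m P *m A *m P *m A *m conjmx Z).
  rewrite {1}ZE mulmxDr !mulmxDl mxtraceD -scalemxAr -!scalemxAl mxtraceZ.
  by rewrite !mulmxA.
apply: (koszul_numbers S1 S1' S2 S2' TZ); first exact: eL.
- exact: eR.
- exact: eL.
- exact: eR.
Qed.

(** The equation is tested on the residual Z = Q + i P A P itself, where it says that Z has metric
    length 0. *)
Lemma koszul_geodesic (Omega P Q : 'M[C]_n) (A := toC (invmx (Immx Omega))) :
  posdef (Immx Omega) -> P^T = P -> Q^T = Q ->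
  (forall Z : 'M[C]_n, Z^T = Z -> metric Omega Q Z + christoffel Omega P P Z = 0) ->
  Q = - ('i *: (P *m A *m P)).
Proof.
move=> pO sP sQ H; have uO := posdef_unit pO.
have sA : A^T = A by rewrite /A map_trmx trmx_inv pO.1.
have cA : conjmx A = A by rewrite conjmx_toC.
pose Z := Q + 'i *: (P *m A *m P).
have sZ : Z^T = Z.
  by rewrite /Z linearD linearZ /= !trmx_mul sQ sP sA mulmxA.
suff : Z = 0 by move/eqP; rewrite addr_eq0 => /eqP.
apply: (metric_eq0 pO sZ); rewrite -[RHS](H Z sZ) /christoffel !dmetricE// -/A.
rewrite /metric -/A !Immx_sub.
exact: koszul_trace.
Qed.

End geodesic_equation.

Lemma invmx_scale (F : fieldType) n (a : F) (A : 'M[F]_n) : A \in unitmx -> a != 0 ->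
  invmx (a *: A) = a^-1 *: invmx A.
Proof.
move=> uA a0; have e : (a *: A) *m (a^-1 *: invmx A) = 1%:M.
  by rewrite -scalemxAl -scalemxAr scalerA mulfV// scale1r mulmxV.
have [uB _] := mulmx1_unit e.
by rewrite -[RHS](mulKmx uB) e mulmx1.
Qed.

Lemma invmxN (F : fieldType) n (A : 'M[F]_n) : A \in unitmx -> invmx (- A) = - invmx A.
Proof.
by move=> uA; rewrite -[- A]scaleN1r invmx_scale ?oppr_eq0 ?oner_eq0// invrN1 scaleN1r.
Qed.

(** * First integrals of the geodesic equation and the Riccati argument *)

Section geodesic_phase.
Local Opaque mulmx trmx invmx mxtrace determinant.
Context {R : realType} {n : nat}.
Local Notation C := R[i].
Local Notation I01 := (`[0, 1]%classic : set R).

(** Conjugation turns the difference into a sum of imaginary parts: Im (A - conj B) = Im A + Im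
    B. *)
Lemma siegel_sub_conj (A B : 'M[C]_n) : siegel A -> siegel B ->
  [/\ (A - conjmx B)^T = A - conjmx B, posdef (Immx (A - conjmx B)) &
      A - conjmx B \in unitmx].
Proof.
move=> [sA pA] [sB pB].
have s : (A - conjmx B)^T = A - conjmx B by rewrite linearB /= map_trmx sA sB.
have p : posdef (Immx (A - conjmx B)).
  suff -> : Immx (A - conjmx B) = Immx A + Immx B by exact: posdefD.
  by apply/matrixP => i j; rewrite !mxE !reimE opprK.
by split=> //; exact: posdef_Im_unit.
Qed.

Lemma siegel_sub_self (A : 'M[C]_n) : A - conjmx A = (2 * 'i) *: toC (Immx A).
Proof. by rewrite Immx_sub scalerA mulfV ?scale1r// mulf_neq0 ?two_neq0 ?i_neq0. Qed.

Variables Z P : R -> 'M[C]_n.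
(** These are conj Z, conj Z' and (Z - conj Z)^-1, introduced through equations so that they remain
    atoms in the matrix computations. *)
Variables W Q G : R -> 'M[C]_n.
Variable WE : forall s, W s = conjmx (Z s).
Variable QE : forall s, Q s = conjmx (P s).
Variable GE : forall s, G s = invmx (Z s - W s).
Variable hZ : forall t : R, t \in `[0, 1] -> siegel (Z t).
Variable dZ : forall t : R, t \in `[0, 1] -> dercmx I01 Z t (P t).
Variable dP : forall t : R, t \in `[0, 1] ->
  dercmx I01 P t (P t *m G t *m P t + P t *m G t *m P t).
Variable sP : forall t : R, t \in `[0, 1] -> (P t)^T = P t.

Let z01 : (0 : R) \in `[0, 1]. Proof. by rewrite in_itv /= lexx ler01. Qed.

Let uG t : t \in `[0, 1] -> Z t - W t \in unitmx.
Proof. by move=> /hZ h; rewrite WE; have [] := siegel_sub_conj h h. Qed.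

Let mulVG t : t \in `[0, 1] -> G t *m (Z t - W t) = 1%:M.
Proof. by move=> t01; rewrite GE mulVmx// uG. Qed.

Let mulGV t : t \in `[0, 1] -> (Z t - W t) *m G t = 1%:M.
Proof. by move=> t01; rewrite GE mulmxV// uG. Qed.

Let sG t : t \in `[0, 1] -> (G t)^T = G t.
Proof. by move=> /hZ h; have [s _ _] := siegel_sub_conj h h; rewrite GE WE trmx_inv s. Qed.

Let cG t : t \in `[0, 1] -> conjmx (G t) = - G t.
Proof.
move=> t01; have := uG t01; rewrite GE WE conjmxV conjmxB conjmxK -[conjmx _ - _]opprB.
move: (Z t - conjmx (Z t)) => M; exact: invmxN.
Qed.

Let dW t : t \in `[0, 1] -> dercmx I01 W t (Q t).
Proof. by move=> /dZ; rewrite (funext WE) QE; exact: dercmx_conj. Qed.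

Let dQ t : t \in `[0, 1] -> dercmx I01 Q t (- (Q t *m G t *m Q t + Q t *m G t *m Q t)).
Proof.
move=> t01; rewrite (funext QE); apply: dercmx_val (dercmx_conj (dP t01)).
by rewrite conjmxD !conjmxM cG// -QE; mxabel.
Qed.

Let dG t : t \in `[0, 1] -> dercmx I01 G t (- (G t *m (P t - Q t) *m G t)).
Proof.
move=> t01; rewrite (funext GE); apply: dercmx_inv => //; last by apply: dercmxB; [exact: dZ|exact: dW].
Qed.

Variable C0 : 'M[C]_n.
Variable C0_def : C0 = G 0 *m (P 0 + Q 0) *m G 0.

(** A first integral: the derivative 2 (P G P - Q G Q) of P + Q cancels the terms in which G is
    differentiated. *)
Let C0E t : t \in `[0, 1] -> G t *m (P t + Q t) *m G t = C0.
Proof.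
rewrite C0_def; apply: (dercmx01_constant (F := fun s => G s *m (P s + Q s) *m G s)) => s s01.
apply: dercmx_val (dercmxM (dercmxM (dG s01) (dercmxD (dP s01) (dQ s01))) (dG s01)).
by mxabel.
Qed.

Let sC0 : C0^T = C0.
Proof. by rewrite C0_def !trmx_mul linearD /= QE map_trmx sP// sG// mulmxA. Qed.

Variables D r0 p0 : 'M[C]_n.
Variable Delta : R -> 'M[C]_n.
Variable D_def : D = Z 0 - W 0.
Variable r0_def : r0 = G 0 *m Q 0.
Variable p0_def : p0 = G 0 *m P 0.
Variable Delta_def : forall t, Delta t = Z t - W 0.

Let GD : G 0 *m D = 1%:M. Proof. by rewrite D_def mulVG. Qed.
Let DG : D *m G 0 = 1%:M. Proof. by rewrite D_def mulGV. Qed.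
Let Delta0 : Delta 0 = D. Proof. by rewrite D_def Delta_def. Qed.

Let C0D : C0 *m D = p0 + r0.
Proof. by rewrite C0_def -mulmxA GD mulmx1 mulmxDr r0_def p0_def. Qed.

(** Since (G P)' = G (P + Q) G P = C0 P, the difference C0 Z - G P is constant; its value at time 0
    supplies [r0]. *)
Let pE t : t \in `[0, 1] -> G t *m P t = C0 *m Delta t - r0.
Proof.
move=> t01; have H : C0 *m Z t - G t *m P t = C0 *m Z 0 - G 0 *m P 0.
  apply: (dercmx01_constant (F := fun s => C0 *m Z s - G s *m P s)) => // s s01.
  apply: dercmx_val (dercmxB (dercmxMl C0 (dZ s01)) (dercmxM (dG s01) (dP s01))).
  by rewrite -(C0E s01); mxabel.
have -> : C0 *m Delta t = C0 *m Z t - C0 *m Z 0 + C0 *m D.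
  by rewrite Delta_def D_def; mxabel.
by rewrite C0D -(subrK (G t *m P t) (C0 *m Z t)) H p0_def; mxabel.
Qed.

Let PE t : t \in `[0, 1] -> P t *m G t = Delta t *m C0 - r0^T.
Proof.
move=> t01; have := congr1 trmx (pE t01).
rewrite trmx_mul sP// sG// linearB /= trmx_mul sC0 => ->.
congr (_ *m _ - _); rewrite Delta_def WE.
by have [] := siegel_sub_conj (hZ t01) (hZ z01).
Qed.

Let r0T : r0^T = Q 0 *m G 0.
Proof. by rewrite r0_def trmx_mul sG// QE map_trmx sP. Qed.

Let Dr0 : D *m r0 = Q 0.
Proof. by rewrite r0_def mulmxA DG mul1mx. Qed.

Let r0TD : r0^T *m D = Q 0.
Proof. by rewrite r0T -mulmxA GD mulmx1. Qed.

(** A second integration makes the velocity a quadratic polynomial in Delta with constant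
    coefficients. The two expressions of P G P, through G P and through P G, give the derivative of
    the quadratic part. *)
Let PDelta t : t \in `[0, 1] ->
  P t = Q 0 + Delta t *m C0 *m Delta t - Delta t *m r0 - r0^T *m Delta t.
Proof.
move=> t01.
pose N s := P s - Delta s *m C0 *m Delta s + Delta s *m r0 + r0^T *m Delta s.
have dD s : s \in `[0, 1] -> dercmx I01 Delta s (P s).
    by move=> s01; rewrite (funext Delta_def); have := dercmxB (dZ s01) (dercmx_cst I01 s (W 0)); rewrite subr0.
have : N t = N 0.
  apply: dercmx01_constant => // s s01.
  apply: dercmx_val (dercmxD (dercmxD (dercmxB (dP s01)
    (dercmxM (dercmxMr C0 (dD s s01)) (dD s s01))) (dercmxMr r0 (dD s s01)))
    (dercmxMl r0^T (dD s s01))).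
  have e1 : P s *m G s *m P s = P s *m C0 *m Delta s - P s *m r0.
    by rewrite -mulmxA pE//; mxabel.
  have e2 : P s *m G s *m P s = Delta s *m C0 *m P s - r0^T *m P s.
    by rewrite PE//; mxabel.
  by rewrite {1}e1 e2; mxabel.
have -> : N 0 = Q 0.
  rewrite /N Delta0 -mulmxA C0D mulmxDr Dr0 r0TD.
  have -> : D *m p0 = P 0 by rewrite p0_def mulmxA DG mul1mx.
  by mxabel.
by move=> <-; rewrite /N; mxabel.
Qed.

Let uD t : t \in `[0, 1] -> Delta t \in unitmx.
Proof. by move=> t01; rewrite Delta_def WE; have [] := siegel_sub_conj (hZ t01) (hZ z01). Qed.

Variables H m md : R -> 'M[C]_n.
Variable H_def : forall t, H t = invmx (Delta t).
Variable m_def : forall t, m t = H t *m Q 0 - r0.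
Variable md_def : forall t, md t = G 0 *m (m t)^H *m D.

Let HD t : t \in `[0, 1] -> H t *m Delta t = 1%:M.
Proof. by move=> t01; rewrite H_def mulVmx// uD. Qed.

Let DH t : t \in `[0, 1] -> Delta t *m H t = 1%:M.
Proof. by move=> t01; rewrite H_def mulmxV// uD. Qed.

(** Inserting the quadratic formula for P into H' = - H P H and using C0 D = p0 + r0, D r0 = r0^T D
    = Q 0, all terms collect into an autonomous Riccati equation. *)
Let dm t : t \in `[0, 1] -> dercmx I01 m t (- (m t *m m t + p0 *m r0)).
Proof.
move=> t01.
have dD : dercmx I01 Delta t (P t).
  by rewrite (funext Delta_def); have := dercmxB (dZ t01) (dercmx_cst I01 t (W 0)); rewrite subr0.
have dH : dercmx I01 H t (- (H t *m P t *m H t)).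
  rewrite (funext H_def); apply: dercmx_inv => // s s01; exact: uD.
rewrite (funext m_def); have := dercmxB (dercmxMr (Q 0) dH) (dercmx_cst I01 t r0); apply: dercmx_val.
rewrite subr0 mulNmx; congr (- _).
have HP : H t *m P t = H t *m Q 0 + C0 *m Delta t - r0 - H t *m r0^T *m Delta t.
  by rewrite PDelta// mulmxBr mulmxBr mulmxDr !mulmxA HD// !mul1mx.
have e : H t *m P t *m H t *m Q 0 = H t *m Q 0 *m H t *m Q 0 + C0 *m Q 0 - r0 *m H t *m Q 0 - H t *m r0^T *m Q 0.
  have c1 : C0 *m Delta t *m H t = C0 by rewrite -mulmxA (DH t01) mulmx1.
  have c2 : H t *m r0^T *m Delta t *m H t = H t *m r0^T by rewrite -mulmxA (DH t01) mulmx1.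
  by rewrite HP 4!mulmxBl 2!mulmxDl c1 c2.
rewrite e.
have -> : C0 *m Q 0 = p0 *m r0 + r0 *m r0 by rewrite -Dr0 mulmxA C0D mulmxDl.
have -> : H t *m r0^T *m Q 0 = H t *m Q 0 *m r0.
  by rewrite -{1}Dr0 -mulmxA (mulmxA r0^T) r0TD mulmxA.
by mxabel.
Qed.

(** The product p0 r0 equals its own adjoint G(0) (p0 r0)^H D, so taking adjoints reproduces the
    same equation. *)
Let dmd t : t \in `[0, 1] -> dercmx I01 md t (- (md t *m md t + p0 *m r0)).
Proof.
move=> t01; rewrite (funext md_def); have := dercmxMr D (dercmxMl (G 0) (dercmx_tr (dercmx_conj (dm t01)))).
apply: dercmx_val.
have e1 : md t *m md t = G 0 *m ((m t)^H *m (m t)^H) *m D.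
  by rewrite md_def !mulmxA -(mulmxA _ D) DG mulmx1.
have e2 : p0 *m r0 = G 0 *m (p0 *m r0)^H *m D.
  rewrite p0_def r0_def QE 3!conjmxM (cG z01) conjmxK 3!trmx_mul !linearN /= (sG z01) map_trmx (sP z01).
  rewrite !(mulmxN, mulNmx) opprK !mulmxA.
  by rewrite -[in RHS](mulmxA _ (G 0) D) GD mulmx1.
have e0 : conjmx (- (m t *m m t + p0 *m r0)) =
    - (conjmx (m t) *m conjmx (m t) + conjmx (p0 *m r0)).
  by rewrite -conjmxM -conjmxD; apply/matrixP => i j; rewrite !mxE conjcN.
have e3 (X Y : 'M[C]_n) : (- (X + Y))^T = - (X^T + Y^T).
  by apply/matrixP => i j; rewrite !mxE.
by rewrite -md_def e1 [in RHS]e2 e0 e3 trmx_mul mulmxN mulNmx mulmxDr mulmxDl.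
Qed.

Let H0 : m 0 = 0.
Proof.
by rewrite m_def -{1}Dr0 -Delta0 mulmxA HD// mul1mx subrr.
Qed.

(* [md] is the adjoint of [m] for the hermitian form of [Immx (Z 0)]; both solve the
   Riccati equation m' = - (m^2 + p0 r0) with initial value 0. *)
Lemma riccati_self_adjoint t : t \in `[0, 1] -> m t = md t.
Proof.
move=> t01.
have bdd (F F' : R -> 'M[C]_n) : (forall t : R, t \in `[0, 1] -> dercmx I01 F t (F' t)) ->
    exists2 M : R, 0 <= M & forall (t : R) i j, t \in `[0, 1] -> normc (F t i j) <= M.
  move=> dF.
  have /choice[M HM] : forall ij : 'I_n * 'I_n, exists M : R, 0 <= M /\
      forall t : R, t \in `[0, 1] -> normc (F t ij.1 ij.2) <= M.
    move=> [i j]; have [M M0 HM] := derc01_bounded (fun t t01 => dF t t01 i j).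
    by exists M.
  exists (\sum_ij M ij); first by apply: sumr_ge0 => ij _; exact: (HM ij).1.
  move=> s i j s01; apply: (le_trans ((HM (i, j)).2 s s01)).
  by rewrite (bigD1 (i, j))//= lerDl sumr_ge0// => ij _; exact: (HM ij).1.
have [M1 M10 HM1] := bdd _ _ dm; have [M2 M20 HM2] := bdd _ _ dmd.
(* The difference of the two solutions satisfies a linear equation with bounded coefficients and
   vanishes at time 0. *)
pose e (ij : 'I_n * 'I_n) s := (m s - md s) ij.1 ij.2.
pose e' (ij : 'I_n * 'I_n) s := (- (m s *m (m s - md s) + (m s - md s) *m md s)) ij.1 ij.2.
apply/eqP; rewrite -subr_eq0; apply/eqP/matrixP => i j; rewrite [RHS]mxE.
apply: (@linear_ode_zero _ _ e e' (M1 + M2) _ _ _ t (i, j) t01).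
- move=> s ij s01; have := dercmxB (dm s01) (dmd s01) => /(_ ij.1 ij.2).
  by apply: derc_val; rewrite /e'; congr (fun_of_matrix _ _ _); mxabel.
- move=> s [k l] s01; rewrite /e' oppmxE normcN addmxE mulrDl.
  have le1 k' l' : normc (e (k', l') s) <= \sum_ij normc (e ij s).
    by rewrite (bigD1 (k', l'))//= lerDl sumr_ge0// => ij _; exact: normc_ge0.
  apply: (le_trans (le_normcD _ _)); rewrite /= ![(_ *m _) k l]mxE.
  apply: lerD; apply: (le_trans (normc_sum _ _ _)).
    apply: (@le_trans _ _ (\sum_j M1 * normc (e (j, l) s))).
      by apply: ler_sum => j' _; rewrite ComplexField.Normc.normcM ler_wpM2r ?normc_ge0// HM1.
    rewrite -mulr_sumr ler_wpM2l// [leRHS](eq_bigr (fun ij => normc (e (ij.1, ij.2) s))); last by case.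
    rewrite -(pair_bigA _ (fun i j => normc (e (i, j) s))) /=; apply: ler_sum => j' _.
    by rewrite (bigD1 l)//= lerDl sumr_ge0// => ? _; exact: normc_ge0.
  apply: (@le_trans _ _ (\sum_j M2 * normc (e (k, j) s))).
    by apply: ler_sum => j' _; rewrite ComplexField.Normc.normcM mulrC ler_wpM2r ?normc_ge0// HM2.
  rewrite -mulr_sumr ler_wpM2l// [leRHS](eq_bigr (fun ij => normc (e (ij.1, ij.2) s))); last by case.
  rewrite -(pair_bigA _ (fun i j => normc (e (i, j) s))) /= [leRHS](bigD1 k)//= lerDl.
  by apply: sumr_ge0 => ? _; apply: sumr_ge0 => ? _; exact: normc_ge0.
- move=> [k l]; rewrite /e md_def H0.
  have -> : (0 : 'M[C]_n)^H = 0 by apply/matrixP => a b; rewrite !mxE conjc0.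
  by rewrite mulmx0 mul0mx subrr mxE.
Qed.

(** The traces of H P and G P differ by tr m, because tr (H r0^T Delta) = tr r0. As m is similar to
    its conjugate transpose, tr m is real. *)
Lemma riccati_phase t : t \in `[0, 1] ->
  complex.Im (\tr (H t *m P t)) = complex.Im (\tr (G t *m P t)).
Proof.
move=> t01; have tr_m : complex.Im (\tr (m t)) = 0.
  have : \tr (m t) = (\tr (m t))^*.
    rewrite {1}riccati_self_adjoint// md_def mxtrace_mulC mulmxA DG mul1mx.
    by rewrite mxtrace_tr; exact: trace_map_mx.
  by move=> /(congr1 (@complex.Im R)); rewrite Im_conjc; lra.
suff -> : \tr (H t *m P t) = \tr (G t *m P t) + \tr (m t) by rewrite ImD tr_m addr0.
have HP : H t *m P t = H t *m Q 0 + C0 *m Delta t - r0 - H t *m r0^T *m Delta t.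
  by rewrite PDelta// mulmxBr mulmxBr mulmxDr !mulmxA HD// !mul1mx.
rewrite HP pE// m_def; move: (C0 *m Delta t) (H t *m Q 0) => X Y; rewrite !(raddfB, raddfD) /=.
have -> : \tr (H t *m r0^T *m Delta t) = \tr r0.
  by rewrite mxtrace_mulC mulmxA DH// mul1mx mxtrace_tr.
by ring.
Qed.

End geodesic_phase.

(** * From the geodesic equation to the phase identity *)

Section geodesics.
Context {R : realType} {n : nat}.
Local Notation C := R[i].
Local Notation I01 := (`[0, 1]%classic : set R).

Lemma tr_inv_sub_conj (Z P : 'M[C]_n) : Immx Z \in unitmx ->
  complex.Im (\tr (invmx (Z - conjmx Z) *m P)) = - (2^-1 * \tr (invmx (Immx Z) *m Remx P)).
Proof.
move=> Y0; rewrite siegel_sub_self.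
rewrite invmx_scale ?toC_unit// ?mulf_neq0 ?two_neq0 ?i_neq0// -toCV -scalemxAl mxtraceZ {1}[P]ReImmx mulmxDr -scalemxAr -!toCM mxtraceD mxtraceZ.
rewrite !trace_map_mx invfM invi -real_complex_nat -real_complexV.
by rewrite !reimE; ring.
Qed.

(** Uniqueness of derivatives makes gamma' and gamma'' symmetric. The Koszul form - i P Y^-1 P of
    the acceleration equals 2 P (Z - conj Z)^-1 P because Z - conj Z = 2 i Y. *)
Lemma is_geodesic_ode (gamma : R -> 'M[C]_n) : is_geodesic gamma ->
  exists gamma' : R -> 'M[C]_n,
  [/\ forall t : R, t \in `[0, 1] -> dercmx I01 gamma t (gamma' t),
      forall t : R, t \in `[0, 1] -> (gamma' t)^T = gamma' t &
      forall t : R, t \in `[0, 1] -> dercmx I01 gamma' t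
       (gamma' t *m invmx (gamma t - conjmx (gamma t)) *m gamma' t +
        gamma' t *m invmx (gamma t - conjmx (gamma t)) *m gamma' t)].
Proof.
move=> [gS [g' [g'' [/deriv01mx_dercmx d1 /deriv01mx_dercmx d2 E]]]]; exists g'.
have s1 t : t \in `[0, 1] -> (g' t)^T = g' t.
  move=> t01; apply: (dercmx_unique t01 (dercmx_tr (d1 t t01))).
  by apply: dercmx_eq (d1 t t01) => // s /gS[].
have s2 t : t \in `[0, 1] -> (g'' t)^T = g'' t.
  move=> t01; apply: (dercmx_unique t01 (dercmx_tr (d2 t t01))).
  by apply: dercmx_eq (d2 t t01) => // s /s1.
split=> // t t01; have [_ pY] := gS t t01.
have := koszul_geodesic pY (s1 t t01) (s2 t t01) (E t t01) => e.
apply: dercmx_val (d2 t t01); rewrite e siegel_sub_self.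
rewrite invmx_scale ?toC_unit ?posdef_unit// ?mulf_neq0 ?two_neq0 ?i_neq0// -toCV -!(scalemxAr, scalemxAl) -scalerDl -scaleNr.
congr (_ *: _); rewrite invfM invi -mulrDl.
have h2 : 2^-1 + 2^-1 = 1 :> C by rewrite -[2^-1]mul1r -splitr.
by rewrite h2 mul1r.
Qed.

(** The Riccati argument allows conj (gamma 0) to be replaced by conj (gamma t), and then the
    inverse is Y^-1 / (2 i). *)
Lemma geodesic_phase (gamma gamma' : R -> 'M[C]_n) :
  (forall t : R, t \in `[0, 1] -> siegel (gamma t)) ->
  (forall t : R, t \in `[0, 1] -> dercmx I01 gamma t (gamma' t)) ->
  (forall t : R, t \in `[0, 1] -> (gamma' t)^T = gamma' t) ->
  (forall t : R, t \in `[0, 1] -> dercmx I01 gamma' t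
       (gamma' t *m invmx (gamma t - conjmx (gamma t)) *m gamma' t +
        gamma' t *m invmx (gamma t - conjmx (gamma t)) *m gamma' t)) ->
  forall t : R, t \in `[0, 1] ->
  complex.Im (\tr (invmx (gamma t - conjmx (gamma 0)) *m gamma' t)) =
  - (2^-1 * \tr (invmx (Immx (gamma t)) *m Remx (gamma' t))).
Proof.
move=> hS d1 s1 d2 t t01; have [_ /posdef_unit uY] := hS t t01.
apply: etrans (tr_inv_sub_conj _ uY).
pose proof (riccati_phase (W := fun s => conjmx (gamma s))
  (Q := fun s => conjmx (gamma' s)) (G := fun s => invmx (gamma s - conjmx (gamma s)))
  (fun=> erefl) (fun=> erefl) (fun=> erefl) hS d1 d2 s1 (erefl _) (erefl _) (erefl _) (erefl _)
  (Delta := fun s => gamma s - conjmx (gamma 0)) (fun=> erefl)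
  (H := fun s => invmx (gamma s - conjmx (gamma 0))) (fun=> erefl)
  (m := fun s => invmx (gamma s - conjmx (gamma 0)) *m conjmx (gamma' 0)
     - invmx (gamma 0 - conjmx (gamma 0)) *m conjmx (gamma' 0)) (fun=> erefl)
  (fun=> erefl) t01) as E; exact: E.
Qed.

End geodesics.

(** * Integrals of complex functions *)

Section complex_integration.
Context d (T : measurableType d) (R : realType).
Local Notation C := R[i].
Implicit Types (f g : T -> C).

Definition mC f : Prop := measurable_fun setT (fun x => complex.Re (f x)) /\
  measurable_fun setT (fun x => complex.Im (f x)).

Lemma mC_cst (c : C) : mC (fun=> c).
Proof. by split; exact: measurable_cst. Qed.

Lemma mC_real (f : T -> R) : measurable_fun setT f -> mC (fun x => (f x)%:C).
Proof. by move=> mf; split; [exact: mf | exact: measurable_cst]. Qed.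

Lemma mCD f g : mC f -> mC g -> mC (fun x => f x + g x).
Proof.
move=> [f1 f2] [g1 g2]; split; under eq_fun do rewrite !reimE.
  exact: measurable_funD.
exact: measurable_funD.
Qed.

Lemma mCN f : mC f -> mC (fun x => - f x).
Proof.
move=> [f1 f2]; split; under eq_fun do rewrite !reimE.
  exact: measurable_funN.
exact: measurable_funN.
Qed.

Lemma mCB f g : mC f -> mC g -> mC (fun x => f x - g x).
Proof. by move=> mf mg; apply: mCD => //; exact: mCN. Qed.

Lemma mCM f g : mC f -> mC g -> mC (fun x => f x * g x).
Proof.
move=> [f1 f2] [g1 g2]; split; under eq_fun do rewrite !reimE.
  by apply: measurable_funB; apply: measurable_funM.
by apply: measurable_funD; apply: measurable_funM.
Qed.

Lemma mC_conj f : mC f -> mC (fun x => (f x)^*).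
Proof.
move=> [f1 f2]; split; under eq_fun do rewrite !reimE; first exact: f1.
exact: measurable_funN.
Qed.

Lemma mC_cexp f : mC f -> mC (fun x => cexp (f x)).
Proof.
move=> [f1 f2]; apply: mCM.
  by apply: mC_real; exact: measurableT_comp.
split.
  apply: (measurableT_comp (f := cos)) => //.
  by apply: continuous_measurable_fun; exact: continuous_cos.
apply: (measurableT_comp (f := sin)) => //.
by apply: continuous_measurable_fun; exact: continuous_sin.
Qed.

Lemma mC_sum (I : Type) (r : seq I) (f : I -> T -> C) :
  (forall i, mC (f i)) -> mC (fun x => \sum_(i <- r) f i x).
Proof.
move=> H; elim: r => [|i r IH]; under eq_fun do rewrite ?big_nil ?big_cons.
  exact: mC_cst.
exact: mCD.
Qed.

Lemma mC_eq f g : (forall x, f x = g x) -> mC f -> mC g.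
Proof. by move=> /funext ->. Qed.

Lemma mC_normc_sqr f : mC f -> measurable_fun setT (fun x => normc (f x) ^+ 2).
Proof.
move=> [f1 f2]; under eq_fun do rewrite sqr_normcE.
by apply: measurable_funD; apply: measurable_funX.
Qed.

Lemma mC_normc f : mC f -> measurable_fun setT (fun x => normc (f x)).
Proof.
move=> /mC_normc_sqr mf.
rewrite (_ : (fun x => normc (f x)) = Num.sqrt \o (fun x => normc (f x) ^+ 2)).
  by apply: measurableT_comp => //; apply: continuous_measurable_fun; exact: sqrt_continuous.
by apply/funext => x /=; rewrite sqrtr_sqr ger0_norm// normc_ge0.
Qed.

Variable mu : {measure set T -> \bar R}.

Definition intC f : Prop := mC f /\ (\int[mu]_x (normc (f x))%:E < +oo)%E.

Definition cint f : C := Rintegral mu setT (fun x => complex.Re (f x))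
  +i* Rintegral mu setT (fun x => complex.Im (f x)).

Lemma intC_dom f (g : T -> R) : mC f -> measurable_fun setT g ->
  (forall x, normc (f x) <= g x) -> (\int[mu]_x (g x)%:E < +oo)%E -> intC f.
Proof.
move=> mf mg fg goo; split=> //; apply: le_lt_trans goo.
apply: ge0_le_integral => //.
- by move=> x _; rewrite lee_fin normc_ge0.
- by apply/measurable_EFinP; exact: mC_normc.
- exact/measurable_EFinP.
- by move=> x _; rewrite lee_fin.
Qed.

Lemma intC_Re f : intC f -> mu.-integrable setT (EFin \o (fun x => complex.Re (f x))).
Proof.
move=> [[f1 f2] foo]; apply/integrableP; split; first exact/measurable_EFinP.
apply: le_lt_trans foo; apply: ge0_le_integral => //.
- by apply/measurable_EFinP; apply: measurableT_comp => //.
- by apply/measurable_EFinP; exact: mC_normc.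
- by move=> x _; rewrite lee_fin; exact: Re_le_normc.
Qed.

Lemma intC_Im f : intC f -> mu.-integrable setT (EFin \o (fun x => complex.Im (f x))).
Proof.
move=> [[f1 f2] foo]; apply/integrableP; split; first exact/measurable_EFinP.
apply: le_lt_trans foo; apply: ge0_le_integral => //.
- by apply/measurable_EFinP; apply: measurableT_comp => //.
- by apply/measurable_EFinP; exact: mC_normc.
- by move=> x _; rewrite lee_fin; exact: Im_le_normc.
Qed.

Lemma intC_ReIm f : mu.-integrable setT (EFin \o (fun x => complex.Re (f x))) ->
  mu.-integrable setT (EFin \o (fun x => complex.Im (f x))) -> intC f.
Proof.
move=> i1 i2; have /integrableP[/measurable_EFinP m1 b1] := i1.
have /integrableP[/measurable_EFinP m2 b2] := i2.
apply: (intC_dom (g := fun x => `|complex.Re (f x)| + `|complex.Im (f x)|)) => //.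
- by apply: measurable_funD; apply: measurableT_comp.
- by move=> x; exact: normc_le_Re_Im.
- under eq_integral do rewrite EFinD; rewrite ge0_integralD//.
  + exact: lte_add_pinfty.
  + by apply/measurable_EFinP; apply: measurableT_comp.
  + by apply/measurable_EFinP; apply: measurableT_comp.
Qed.

Lemma intCD f g : intC f -> intC g -> intC (fun x => f x + g x).
Proof.
move=> fi gi; apply: intC_ReIm.
  under [X in _ \o X]eq_fun do rewrite ReD.
  exact: (integrableD _ (intC_Re fi) (intC_Re gi)).
under [X in _ \o X]eq_fun do rewrite ImD.
exact: (integrableD _ (intC_Im fi) (intC_Im gi)).
Qed.

Lemma intCZ (c : C) f : intC f -> intC (fun x => c * f x).
Proof.
move=> [mf foo]; split; first by apply: mCM => //; exact: mC_cst.
under eq_integral do rewrite ComplexField.Normc.normcM EFinM.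
rewrite ge0_integralZl//.
- by rewrite lte_mul_pinfty// lee_fin normc_ge0.
- by apply/measurable_EFinP; exact: mC_normc.
- by move=> x _; rewrite lee_fin normc_ge0.
- by rewrite lee_fin normc_ge0.
Qed.

Lemma intC_sum (I : Type) (r : seq I) (F : I -> T -> C) :
  (forall i, intC (F i)) -> intC (fun x => \sum_(i <- r) F i x).
Proof.
move=> H; elim: r => [|i r IH].
  under eq_fun do rewrite big_nil.
  split; first exact: mC_cst.
  by under eq_integral do rewrite ComplexField.Normc.normc0; rewrite integral0.
by under eq_fun do rewrite big_cons; exact: intCD.
Qed.

Lemma cint_eq f g : (forall x, f x = g x) -> cint f = cint g.
Proof. by move=> /funext ->. Qed.

Lemma cint0 : cint (fun=> 0) = 0.
Proof. by rewrite /cint /Rintegral !integral0. Qed.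

Lemma cintD f g : intC f -> intC g -> cint (fun x => f x + g x) = cint f + cint g.
Proof.
move=> fi gi; apply: complex_ext => /=.
  rewrite -RintegralD//; [|exact: intC_Re|exact: intC_Re].
  by apply: eq_Rintegral => x _; rewrite ReD.
rewrite -RintegralD//; [|exact: intC_Im|exact: intC_Im].
by apply: eq_Rintegral => x _; rewrite ImD.
Qed.

Lemma cintZ (c : C) f : intC f -> cint (fun x => c * f x) = c * cint f.
Proof.
move=> fi; have i1 := intC_Re fi; have i2 := intC_Im fi.
have z1 (k : R) := integrableZl measurableT k i1.
have z2 (k : R) := integrableZl measurableT k i2.
apply: complex_ext.
  rewrite [RHS]Re_mul /cint /= -!RintegralZl// -RintegralB//; [|exact: z1|exact: z2].
  by apply: eq_Rintegral => x _; rewrite Re_mul.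
rewrite [RHS]Im_mul /cint /= -!RintegralZl// -RintegralD//; [|exact: z2|exact: z1].
by apply: eq_Rintegral => x _; rewrite Im_mul.
Qed.

Lemma cintB f g : intC f -> intC g -> cint (fun x => f x - g x) = cint f - cint g.
Proof.
move=> fi gi; rewrite -[- cint g]mulN1r -cintZ// -cintD//; last exact: intCZ.
by apply: cint_eq => x; rewrite mulN1r.
Qed.

Lemma intCB f g : intC f -> intC g -> intC (fun x => f x - g x).
Proof.
move=> fi gi; have := intCD fi (intCZ (-1) gi).
by under eq_fun do rewrite mulN1r.
Qed.

Lemma cint_sum (I : Type) (r : seq I) (F : I -> T -> C) :
  (forall i, intC (F i)) -> cint (fun x => \sum_(i <- r) F i x) = \sum_(i <- r) cint (F i).
Proof.
move=> H; elim: r => [|i r IH].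
  by rewrite big_nil; under eq_fun do rewrite big_nil; exact: cint0.
rewrite big_cons; under eq_fun do rewrite big_cons.
by rewrite cintD ?IH//; exact: intC_sum.
Qed.

Lemma intC_conj f : intC f -> intC (fun x => (f x)^*).
Proof.
move=> [mf foo]; split; first exact: mC_conj.
by under eq_integral do rewrite normc_conj.
Qed.

Lemma cint_conj f : intC f -> cint (fun x => (f x)^*) = (cint f)^*.
Proof.
move=> fi; apply: complex_ext; rewrite ?Re_conjc ?Im_conjc /cint /=.
  by apply: eq_Rintegral => x _; rewrite Re_conjc.
rewrite -mulN1r -RintegralZl//; last exact: intC_Im.
by apply: eq_Rintegral => x _; rewrite Im_conjc mulN1r.
Qed.

(** Real and imaginary parts are bounded separately, whence the factor 2. *)
Lemma normc_cint_le f (M : R) : intC f -> (\int[mu]_x (normc (f x))%:E <= M%:E)%E ->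
  normc (cint f) <= 2 * M.
Proof.
move=> fi fM; apply: (le_trans (normc_le_Re_Im _)); rewrite mulr_natl mulr2n.
have le (g : T -> R) : mu.-integrable setT (EFin \o g) ->
    (forall x, `|g x| <= normc (f x)) -> `|Rintegral mu setT g| <= M.
  move=> ig gf; have /integrableP[/measurable_EFinP mg _] := ig.
  apply: (le_trans (le_normr_Rintegral _ ig)) => //.
  rewrite -lee_fin; apply: le_trans fM; rewrite /Rintegral fineK.
    apply: ge0_le_integral => //.
    - by apply/measurable_EFinP; apply: measurableT_comp.
    - by apply/measurable_EFinP; exact: mC_normc fi.1.
    - by move=> x _; rewrite lee_fin.
  by apply: integrable_fin_num => //; have := integrable_abse ig.
apply: lerD; apply: le.
- exact: intC_Re.
- by move=> x; exact: Re_le_normc.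
- exact: intC_Im.
- by move=> x; exact: Im_le_normc.
Qed.

Definition fL2 f : Prop := mC f /\ (\int[mu]_x (normc (f x) ^+ 2)%:E < +oo)%E.

Definition N2 f : R := fine (\int[mu]_x (normc (f x) ^+ 2)%:E).

Lemma N2_ge0 f : 0 <= N2 f.
Proof. by rewrite fine_ge0// integral_ge0// => x _; rewrite lee_fin sqr_ge0. Qed.

Lemma N2E f : fL2 f -> (\int[mu]_x (normc (f x) ^+ 2)%:E = (N2 f)%:E)%E.
Proof.
move=> [mf foo]; rewrite /N2 fineK// ge0_fin_numE//.
by apply: integral_ge0 => x _; rewrite lee_fin sqr_ge0.
Qed.

Lemma fL2_dom f (g : T -> R) : mC f -> measurable_fun setT g ->
  (forall x, normc (f x) ^+ 2 <= g x) -> (\int[mu]_x (g x)%:E < +oo)%E -> fL2 f.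
Proof.
move=> mf mg fg goo; split=> //; apply: le_lt_trans goo.
apply: ge0_le_integral => //.
- by move=> x _; rewrite lee_fin sqr_ge0.
- by apply/measurable_EFinP; exact: mC_normc_sqr.
- exact/measurable_EFinP.
- by move=> x _; rewrite lee_fin.
Qed.

Lemma fL2_add_sqr f g : fL2 f -> fL2 g ->
  (\int[mu]_x (2 * normc (f x) ^+ 2 + 2 * normc (g x) ^+ 2)%:E = (2 * N2 f + 2 * N2 g)%:E)%E.
Proof.
move=> fl gl; under eq_integral do rewrite EFinD !EFinM.
have mf : measurable_fun setT (fun x => (normc (f x) ^+ 2)%:E).
  by apply/measurable_EFinP; exact: mC_normc_sqr fl.1.
have mg : measurable_fun setT (fun x => (normc (g x) ^+ 2)%:E).
  by apply/measurable_EFinP; exact: mC_normc_sqr gl.1.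
have f0 x : setT x -> (0 <= (normc (f x) ^+ 2)%:E)%E by rewrite lee_fin sqr_ge0.
have g0 x : setT x -> (0 <= (normc (g x) ^+ 2)%:E)%E by rewrite lee_fin sqr_ge0.
rewrite ge0_integralD//.
- by rewrite !ge0_integralZl// (N2E fl) (N2E gl).
- by move=> x _; rewrite mule_ge0// lee_fin sqr_ge0.
- exact: measurable_funeM.
- by move=> x _; rewrite mule_ge0// lee_fin sqr_ge0.
- exact: measurable_funeM.
Qed.

Lemma sqr_normcD (z w : C) : normc (z + w) ^+ 2 <= 2 * normc z ^+ 2 + 2 * normc w ^+ 2.
Proof.
have := le_normcD z w; have := normc_ge0 (z + w); have := normc_ge0 z; have := normc_ge0 w.
by have := sqr_ge0 (normc z - normc w); nra.
Qed.

Lemma fL2D f g : fL2 f -> fL2 g -> fL2 (fun x => f x + g x) /\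
  N2 (fun x => f x + g x) <= 2 * N2 f + 2 * N2 g.
Proof.
move=> fl gl; have mfg := mCD fl.1 gl.1.
have ml : measurable_fun setT (fun x => 2 * normc (f x) ^+ 2 + 2 * normc (g x) ^+ 2).
  by apply: measurable_funD; apply: measurable_funM => //; apply: mC_normc_sqr; [exact: fl.1|exact: gl.1].
have l : fL2 (fun x => f x + g x).
  apply: (fL2_dom mfg ml); first by move=> x; exact: sqr_normcD.
  by rewrite fL2_add_sqr// ltey.
split=> //; rewrite -lee_fin -N2E// -fL2_add_sqr//; apply: ge0_le_integral => //.
- by move=> x _; rewrite lee_fin sqr_ge0.
- by apply/measurable_EFinP; exact: mC_normc_sqr.
- exact/measurable_EFinP.
- by move=> x _; rewrite lee_fin; exact: sqr_normcD.
Qed.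

Lemma fL2Z (c : C) f : fL2 f -> fL2 (fun x => c * f x) /\
  N2 (fun x => c * f x) = normc c ^+ 2 * N2 f.
Proof.
move=> fl; have E : (\int[mu]_x (normc (c * f x) ^+ 2)%:E = (normc c ^+ 2 * N2 f)%:E)%E.
  under eq_integral do rewrite ComplexField.Normc.normcM exprMn EFinM.
  rewrite ge0_integralZl ?N2E//.
  - by apply/measurable_EFinP; exact: mC_normc_sqr fl.1.
  - by move=> x _; rewrite lee_fin sqr_ge0.
  - by rewrite lee_fin sqr_ge0.
split; last by rewrite /N2 E.
split; first by apply: mCM fl.1; exact: mC_cst.
by rewrite E ltey.
Qed.

Lemma fL2N f : fL2 f -> fL2 (fun x => - f x) /\ N2 (fun x => - f x) = N2 f.
Proof.
move=> fl; have [] := fL2Z (-1) fl.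
rewrite normcN ComplexField.Normc.normc1 expr1n mul1r.
by under eq_fun do rewrite mulN1r.
Qed.

Lemma fL2B f g : fL2 f -> fL2 g -> fL2 (fun x => f x - g x) /\
  N2 (fun x => f x - g x) <= 2 * N2 f + 2 * N2 g.
Proof. by move=> fl gl; have [h <-] := fL2N gl; exact: fL2D. Qed.

(** Cauchy-Schwarz in the weighted form |f g| <= (l |f|^2 + |g|^2 / l) / 2, which avoids roots of
    norms; l balances a small f against a fixed g. *)
Lemma fL2_mul f g (l : R) : 0 < l -> fL2 f -> fL2 g -> intC (fun x => f x * (g x)^*) /\
  normc (cint (fun x => f x * (g x)^*)) <= l * N2 f + l^-1 * N2 g.
Proof.
move=> l0 fl gl.
have mfg : mC (fun x => f x * (g x)^*) by apply: mCM fl.1 _; exact: mC_conj gl.1.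
have sl : 0 < Num.sqrt (l / 4) by rewrite sqrtr_gt0 divr_gt0.
(* With a^2 = l / 4 the dominating function is l |f|^2 / 2 + |g|^2 / (2 l), and the factor 2 of
   [normc_cint_le] restores the stated constants. *)
pose a := Num.sqrt (l / 4); have aa : a ^+ 2 = l / 4 by rewrite sqr_sqrtr// divr_ge0// ltW.
have [fl' fE] := fL2Z a%:C fl; have [gl' gE] := fL2Z ((2 * a)^-1 / 2)%:C gl.
have aE : normc (a%:C : C) ^+ 2 = l / 4 by rewrite normc_real real_normK ?num_real.
have bE : normc (((2 * a)^-1 / 2)%:C : C) ^+ 2 = l^-1 / 4.
  rewrite normc_real real_normK ?num_real// expr_div_n exprVn exprMn aa.
  by field; rewrite gt_eqF.
have := fL2_add_sqr fl' gl'; rewrite fE gE aE bE => E.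
have ml : measurable_fun setT (fun x => 2 * normc (a%:C * f x) ^+ 2 + 2 * normc (((2 * a)^-1 / 2)%:C * g x) ^+ 2).
  by apply: measurable_funD; apply: measurable_funM => //; apply: mC_normc_sqr; [exact: fl'.1|exact: gl'.1].
have le x : normc (f x * (g x)^*) <=
    2 * normc (a%:C * f x) ^+ 2 + 2 * normc (((2 * a)^-1 / 2)%:C * g x) ^+ 2.
  rewrite !ComplexField.Normc.normcM normc_conj !exprMn aE bE.
  have := sqr_ge0 (l * normc (f x) - normc (g x)); rewrite sqrrB => h.
  have : 0 <= l^-1 * ((l * normc (f x)) ^+ 2 - l * normc (f x) * normc (g x) *+ 2 + normc (g x) ^+ 2).
    by rewrite mulr_ge0// invr_ge0 ltW.
  have -> : l^-1 * ((l * normc (f x)) ^+ 2 - l * normc (f x) * normc (g x) *+ 2 + normc (g x) ^+ 2) =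
     l * normc (f x) ^+ 2 - 2 * (normc (f x) * normc (g x)) + l^-1 * normc (g x) ^+ 2.
    by field; rewrite gt_eqF.
  by lra.
have fi : intC (fun x => f x * (g x)^*).
  by apply: (intC_dom mfg ml le); rewrite E ltey.
split=> //.
have -> : l * N2 f + l^-1 * N2 g = 2 * (2 * (l / 4 * N2 f) + 2 * (l^-1 / 4 * N2 g)) by field; rewrite gt_eqF.
apply: normc_cint_le => //; rewrite -E; apply: ge0_le_integral => //.
- by move=> x _; rewrite lee_fin normc_ge0.
- by apply/measurable_EFinP; exact: mC_normc.
- exact/measurable_EFinP.
- by move=> x _; rewrite lee_fin.
Qed.

Lemma cint_sqr f : fL2 f -> cint (fun x => f x * (f x)^*) = (N2 f)%:C.
Proof.
move=> fl; rewrite (cint_eq (g := fun x => (normc (f x) ^+ 2)%:C)); last by move=> x; rewrite mul_conj.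
by rewrite /cint /= /Rintegral integral0.
Qed.

End complex_integration.

(** * Lebesgue measure on tuples *)

Section lebesgue_measure_translation.
Context {R : realType}.
Local Notation T := (measurableTypeR R).
Local Notation mu := (@lebesgue_measure R).

Lemma measurable_addr (a : R) : measurable_fun setT (fun x : T => x + a : T).
Proof. by apply: measurable_funD. Qed.

(** The translated measure agrees with Lebesgue measure on half-open intervals, which determine
    it. *)
Lemma lebesgue_measure_translation (a : R) (A : set T) : measurable A ->
  mu ((fun x : T => x + a : T) @^-1` A) = mu A.
Proof.
move=> mA; pose nu : {measure set T -> \bar R} :=
  measure_function_pushforward__canonical__measure_function_Measure mu (measurable_addr a).
rewrite -[LHS]/(nu A); apply/esym/lebesgue_measure_unique => // X [[x y] _ <-].
rewrite /nu /= /pushforward.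
rewrite (_ : _ @^-1` _ = `]x - a, y - a]%classic); last first.
  by apply/seteqP; split => z /=; rewrite !in_itv /= ltrBlDr lerBrDr.
by rewrite !lebesgue_measure_itv /= !lte_fin ltrD2r -!EFinB; congr (if _ then _%:E else _); ring.
Qed.

Lemma ge0_integral_translation (a : R) (f : T -> \bar R) : measurable_fun setT f ->
  (forall x, 0 <= f x)%E -> (\int[mu]_x f ((x : R) + a)%R = \int[mu]_x f x)%E.
Proof.
move=> mf f0; have := ge0_integral_pushforward (measurable_addr a) mu measurableT mf.
rewrite preimage_setT => H.
have {}H := H (fun y _ => f0 y); apply: etrans (esym H) _.
apply: eq_measure_integral; first exact: measurable_addr.
by move=> ? A mA _; exact: lebesgue_measure_translation.
Qed.

(** A multiple of the normal density with variance 1 / (2 c). *)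
Lemma integral_gauss_lty (c : R) : 0 < c -> (\int[mu]_x (expR (- (c * x ^+ 2)))%:E < +oo)%E.
Proof.
move=> c0; pose s := Num.sqrt ((2 * c)^-1).
have c20 : 0 < 2 * c by rewrite mulr_gt0.
have ss : s ^+ 2 = (2 * c)^-1 by rewrite sqr_sqrtr// invr_ge0 ltW.
have s0 : s != 0 by rewrite gt_eqF// sqrtr_gt0 invr_gt0.
have pk : 0 < normal_peak s by exact: normal_peak_gt0.
have E x : expR (- (c * x ^+ 2)) = (normal_peak s)^-1 * normal_pdf 0 s x.
  rewrite normal_pdfE// -[X in _ = _^-1 * X]/(normal_peak s * normal_fun 0 s x) /normal_fun mulKf ?gt_eqF// subr0 ss; congr expR.
  by field; rewrite gt_eqF.
under eq_integral do rewrite E EFinM.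
rewrite ge0_integralZl//.
- by rewrite integral_normal_pdf mule1 ltey.
- by apply/measurable_EFinP; exact: measurable_normal_pdf.
- by move=> x _; rewrite lee_fin normal_pdf_ge0.
- by rewrite lee_fin invr_ge0 ltW.
Qed.

End lebesgue_measure_translation.

Section tuples.
Context {R : realType}.
Local Notation T := (measurableTypeR R).

Definition tshift k (a t : k.-tuple T) : k.-tuple T := [tuple (tnth t i + tnth a i : T) | i < k].
Definition tsqr k (t : k.-tuple T) : R := \sum_(i < k) tnth t i ^+ 2.
Definition tbox k (a : k.-tuple T) (e : R) : set (k.-tuple T) :=
  [set t | forall i, `|tnth t i - tnth a i| < e].

Lemma measurable_tshift k (a : k.-tuple T) : measurable_fun setT (tshift a).
Proof.
apply/measurable_fun_tnthP => i; rewrite (_ : _ \o _ = fun t : k.-tuple T => (tnth t i + tnth a i : T)).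
  by apply: measurable_funD => //; exact: measurable_tnth.
by apply/funext => t /=; rewrite tnth_mktuple.
Qed.

Lemma measurable_tsqr k : measurable_fun setT (@tsqr k).
Proof. by apply: measurable_sum => i; apply: measurable_funX; exact: measurable_tnth. Qed.

Lemma ge0_integral_tcons k (f : k.+1.-tuple T -> \bar R) : measurable_fun setT f ->
  (forall x, 0 <= f x)%E ->
  (\int[lebesgue_tuple k.+1]_t f t =
   \int[@lebesgue_measure R]_x \int[lebesgue_tuple k]_t f (tcons (x, t)))%E.
Proof.
move=> mf f0 /=; rewrite /leb_cons.
have := ge0_integral_pushforward (@measurable_tcons R k) (@lebesgue_measure R \x lebesgue_tuple k)%E measurableT mf.
rewrite preimage_setT => ->; last by move=> y _; exact: f0.
rewrite fubini_tonelli1//; last by move=> x; exact: f0.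
by apply: measurableT_comp => //; exact: measurable_tcons.
Qed.

Lemma measurable_tcons_r k (f : k.+1.-tuple T -> \bar R) (x : T) : measurable_fun setT f ->
  measurable_fun setT (fun t : k.-tuple T => f (tcons (x, t))).
Proof.
move=> mf; apply: (measurableT_comp mf); apply: (measurableT_comp (@measurable_tcons R k)).
exact: measurable_pair1.
Qed.

(** Induction on the length: Tonelli splits off the first coordinate, where one-dimensional
    invariance applies. *)
Lemma ge0_integral_tshift k (a : k.-tuple T) (f : k.-tuple T -> \bar R) : measurable_fun setT f ->
  (forall x, 0 <= f x)%E ->
  (\int[lebesgue_tuple k]_t f (tshift a t) = \int[lebesgue_tuple k]_t f t)%E.
Proof.
elim: k a f => [|k IH] a f mf f0.
  by apply: eq_integral => t _; rewrite (tuple0 t) (tuple0 (tshift _ _)).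
have mfa : measurable_fun setT (fun t => f (tshift a t)).
  by apply: measurableT_comp => //; exact: measurable_tshift.
rewrite [LHS]ge0_integral_tcons// [RHS]ge0_integral_tcons//.
pose a' : k.-tuple T := [tuple of behead a].
have E x t : tshift a (tcons (x, t)) = tcons (x + tnth a ord0, tshift a' t).
  apply: eq_from_tnth => i; rewrite tnth_mktuple.
  case: (unliftP ord0 i) => [j ->|->]; last by rewrite !tnth0.
  rewrite !tnthS tnth_mktuple; congr (_ + _).
  rewrite tnth_behead (_ : inord _ = lift ord0 j)//.
  by apply: val_inj; rewrite /= inordK// /bump /= ltnS.
under eq_integral => x _.
  under eq_integral => t _ do rewrite E.
  rewrite (IH a' (fun t => f (tcons (x + tnth a ord0, t)))) //.
    over.
  exact: measurable_tcons_r.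
rewrite -[RHS](ge0_integral_translation (tnth a ord0)) //.
  apply: (@measurable_fun_fubini_tonelli_F _ _ T _ R (lebesgue_tuple k) (fun p => f (tcons p))) => //.
  by apply: measurableT_comp => //; exact: measurable_tcons.
by move=> x; apply: integral_ge0 => t _; exact: f0.
Qed.

Lemma integral_gauss_tuple_lty k (c : R) : 0 < c ->
  (\int[lebesgue_tuple k]_t (expR (- (c * tsqr t)))%:E < +oo)%E.
Proof.
move=> c0; elim: k => [|k IH].
  rewrite /= integral_dirac//; first by rewrite diracT mul1e ltey.
  by apply/measurable_EFinP; apply: measurableT_comp => //; apply: measurable_funN;
    apply: measurable_funM => //; exact: measurable_tsqr.
have m k' : measurable_fun setT (fun t : k'.-tuple T => (expR (- (c * tsqr t)))%:E).
  apply/measurable_EFinP; apply: measurableT_comp => //; apply: measurable_funN.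
  by apply: measurable_funM => //; exact: measurable_tsqr.
rewrite ge0_integral_tcons//.
have E (x : T) (t : k.-tuple T) : (expR (- (c * tsqr (tcons (x, t)))))%:E =
    ((expR (- (c * x ^+ 2)))%:E * (expR (- (c * tsqr t)))%:E)%E.
  rewrite -EFinM -expRD; congr (expR _)%:E; rewrite /tsqr big_ord_recl tnth0.
  rewrite (eq_bigr (fun i => tnth t i ^+ 2)); last by move=> i _; rewrite tnthS.
  by rewrite mulrDr opprD.
have Ei (x : T) : (\int[lebesgue_tuple k]_t (expR (- (c * tsqr (tcons (x, t)))))%:E =
    (expR (- (c * x ^+ 2)))%:E * \int[lebesgue_tuple k]_t (expR (- (c * tsqr t)))%:E)%E.
  under eq_integral do rewrite E.
  apply: ge0_integralZl => //; solve [exact: m | by move=> t _; rewrite lee_fin expR_ge0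
    | by rewrite lee_fin expR_ge0].
under eq_integral do rewrite Ei.
have fin : (\int[lebesgue_tuple k]_t (expR (- (c * tsqr t)))%:E)%E \is a fin_num.
  by rewrite ge0_fin_numE//; apply: integral_ge0 => t _; rewrite lee_fin expR_ge0.
rewrite -(fineK fin); under eq_integral do rewrite muleC.
rewrite ge0_integralZl//.
- rewrite lte_mul_pinfty//.
    by rewrite lee_fin fine_ge0//; apply: integral_ge0 => t _; rewrite lee_fin expR_ge0.
  exact: integral_gauss_lty.
- apply/measurable_EFinP; apply: measurableT_comp => //; apply: measurable_funN.
  by apply: measurable_funM => //; exact: measurable_funX.
- by rewrite lee_fin fine_ge0//; apply: integral_ge0 => t _; rewrite lee_fin expR_ge0.
Qed.

(** Serves to turn a vanishing L^2 norm into pointwise vanishing of a continuous function. *)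
Lemma lebesgue_tuple_box_gt0 k (a : k.-tuple T) (e : R) : 0 < e ->
  measurable (tbox a e) /\ (0 < lebesgue_tuple k (tbox a e))%E.
Proof.
move=> e0; have mbox k' (b : k'.-tuple T) : measurable (tbox b e).
  rewrite (_ : tbox b e = \bigcap_(i : 'I_k') ((fun t => tnth t i) @^-1` ball (tnth b i) e)).
    apply: fin_bigcap_measurable => // i _; rewrite -[X in measurable X]setTI.
    by apply: measurable_tnth => //; exact: measurable_ball.
  apply/seteqP; split => t /= H i; first by move=> _; rewrite /ball /= distrC; exact: H.
  by have := H i I; rewrite /ball /= distrC.
split=> //; elim: k a => [|k IH] a.
  by rewrite /= diracE mem_set// => -[].
pose a' : k.-tuple T := [tuple of behead a].
rewrite /= /leb_cons /pushforward.
rewrite (_ : _ @^-1` _ = ball (tnth a ord0) e `*` tbox a' e); last first.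
  apply/seteqP; split => [[x t] /= H|[x t] /= [H1 H2] i].
    split; first by have := H ord0; rewrite tnth0 /ball /= distrC.
    move=> i; have := H (lift ord0 i); rewrite tnthS tnth_behead.
    by rewrite (_ : inord _ = lift ord0 i)//; apply: val_inj; rewrite /= inordK// /bump /= ltnS.
  case: (unliftP ord0 i) => [j ->|->]; last by move: H1; rewrite tnth0 /ball /= distrC.
  rewrite tnthS; have := H2 j; rewrite tnth_behead.
  by rewrite (_ : inord _ = lift ord0 j)//; apply: val_inj; rewrite /= inordK// /bump /= ltnS.
have -> : (@lebesgue_measure R \x lebesgue_tuple k)%E (ball (tnth a ord0) e `*` tbox a' e) =
    (@lebesgue_measure R (ball (tnth a ord0) e) * lebesgue_tuple k (tbox a' e))%E.
  by apply: product_measure1E; [exact: (measurable_ball (tnth a ord0 : R) e)|exact: mbox].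
apply: mule_gt0; last exact: IH.
rewrite ball_itv lebesgue_measure_itv /= lte_fin ltrBlDr -addrA ltrDl addr_gt0//.
by rewrite -EFinB lte_fin; lra.
Qed.

End tuples.

(** * The Liouville measure: translations, Gaussians and L^2 norms *)

Section liouville_measure.
Context {R : realType} {n : nat}.
Local Notation C := R[i].
Local Notation T := (measurableTypeR R).
Local Notation VT := (n.-tuple T * n.-tuple T)%type.
Local Notation eps := (@eps_omega R n).
Local Notation leb2 := (lebesgue_tuple n \x lebesgue_tuple n)%E.

Let k : {nonneg R} := NngNum (@eps_factor_ge0 R n).

Lemma eps_factor_gt0 : 0 < k%:num.
Proof. by rewrite /= exprn_gt0// invr_gt0 mulr_gt0// pi_gt0. Qed.

Lemma ge0_integral_eps (f : VT -> \bar R) : measurable_fun setT f -> (forall v, 0 <= f v)%E ->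
  (\int[eps]_v f v = k%:num%:E * \int[leb2]_v f v)%E.
Proof. by move=> mf f0; apply: ge0_integral_mscale. Qed.

Definition vshift (a v : VT) : VT := (tshift a.1 v.1, tshift a.2 v.2).
Definition vsqr (v : VT) : R := tsqr v.1 + tsqr v.2.
Definition vbox (a : VT) (e : R) : set VT := tbox a.1 e `*` tbox a.2 e.
Definition gau (c : R) (v : VT) : R := expR (- (c * vsqr v)).

Lemma vsqr_ge0 v : 0 <= vsqr v.
Proof. by apply: addr_ge0; apply: sumr_ge0 => i _; exact: sqr_ge0. Qed.

Lemma measurable_vshift a : measurable_fun setT (vshift a).
Proof.
apply/measurable_fun_pairP; split.
  by apply: (measurableT_comp (measurable_tshift a.1)); exact: measurable_fst.
by apply: (measurableT_comp (measurable_tshift a.2)); exact: measurable_snd.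
Qed.

Lemma measurable_vsqr : measurable_fun setT vsqr.
Proof.
apply: measurable_funD; apply: (measurableT_comp (measurable_tsqr (k := n))) => //.
Qed.

Lemma measurable_gau c : measurable_fun setT (gau c).
Proof.
apply: measurableT_comp => //; apply: measurable_funN; apply: measurable_funM => //.
exact: measurable_vsqr.
Qed.

Lemma ge0_integral_vshift (a : VT) (f : VT -> \bar R) : measurable_fun setT f ->
  (forall v, 0 <= f v)%E -> (\int[eps]_v f (vshift a v) = \int[eps]_v f v)%E.
Proof.
move=> mf f0; rewrite !ge0_integral_eps//; last first.
  by apply: (measurableT_comp mf); exact: measurable_vshift.
congr (_ * _)%E; rewrite fubini_tonelli1//; last first.
  by apply: (measurableT_comp mf); exact: measurable_vshift.
rewrite fubini_tonelli1// /fubini_F /=.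
under eq_integral => x _.
  rewrite (ge0_integral_tshift a.2 (f := fun y => f (tshift a.1 x, y))) //.
    over.
  by apply: (measurableT_comp mf); exact: measurable_pair1.
rewrite (ge0_integral_tshift a.1 (f := fun x => \int[lebesgue_tuple n]_y f (x, y))%E)//.
  exact: (@measurable_fun_fubini_tonelli_F _ _ _ _ R (lebesgue_tuple n) f).
by move=> x; apply: integral_ge0.
Qed.

Lemma integral_vshift (a : VT) (f : VT -> R) : measurable_fun setT f ->
  Rintegral eps setT (fun v => f (vshift a v)) = Rintegral eps setT f.
Proof.
move=> mf; rewrite /Rintegral; congr fine.
have mf' : measurable_fun setT (EFin \o f) by exact/measurable_EFinP.
rewrite integralE [RHS]integralE.
have := ge0_integral_vshift a (measurable_funepos mf') (fun v => funepos_ge0 _ v).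
have := ge0_integral_vshift a (measurable_funeneg mf') (fun v => funeneg_ge0 _ v).
move=> hn hp; rewrite -hn -hp.
by congr (_ - _)%E; apply: eq_integral => v _; rewrite ?funeposE ?funenegE.
Qed.

Lemma cint_vshift (a : VT) (f : VT -> C) : mC f ->
  cint eps (fun v => f (vshift a v)) = cint eps f.
Proof.
move=> [m1 m2]; rewrite /cint (integral_vshift a m1).
by rewrite (integral_vshift a m2).
Qed.

Lemma integral_gau_lty (c : R) : 0 < c -> (\int[eps]_v (gau c v)%:E < +oo)%E.
Proof.
move=> c0; have mg : measurable_fun setT (fun v => (gau c v)%:E).
  by apply/measurable_EFinP; exact: measurable_gau.
have g0 v : (0 <= (gau c v)%:E)%E by rewrite lee_fin expR_ge0.
have mt : measurable_fun setT (fun t : n.-tuple T => (expR (- (c * tsqr t)))%:E).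
  apply/measurable_EFinP; apply: measurableT_comp => //; apply: measurable_funN.
  by apply: measurable_funM => //; exact: measurable_tsqr.
have t0 (t : n.-tuple T) : (0 <= (expR (- (c * tsqr t)))%:E)%E by rewrite lee_fin expR_ge0.
have I0 := integral_gauss_tuple_lty n c0.
have fin : (\int[lebesgue_tuple n]_t (expR (- (c * tsqr t)))%:E)%E \is a fin_num.
  by rewrite ge0_fin_numE//; apply: integral_ge0.
rewrite ge0_integral_eps// lte_mul_pinfty//.
rewrite fubini_tonelli1// /fubini_F.
have E x y : ((gau c (x, y))%:E = (expR (- (c * tsqr x)))%:E * (expR (- (c * tsqr y)))%:E)%E.
  by rewrite -EFinM -expRD /gau /vsqr /=; congr (expR _)%:E; ring.
have Ei x : (\int[lebesgue_tuple n]_y (gau c (x, y))%:E =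
    (expR (- (c * tsqr x)))%:E * \int[lebesgue_tuple n]_t (expR (- (c * tsqr t)))%:E)%E.
  by under eq_integral do rewrite E; apply: ge0_integralZl.
under eq_integral do rewrite Ei -(fineK fin) muleC.
rewrite ge0_integralZl//.
  by rewrite lte_mul_pinfty// lee_fin fine_ge0//; apply: integral_ge0.
by rewrite lee_fin fine_ge0//; apply: integral_ge0.
Qed.

Lemma eps_box_gt0 (a : VT) (e : R) : 0 < e -> measurable (vbox a e) /\ (0 < eps (vbox a e))%E.
Proof.
move=> e0; have [m1 p1] := lebesgue_tuple_box_gt0 a.1 e0.
have [m2 p2] := lebesgue_tuple_box_gt0 a.2 e0.
split; first exact: measurableX.
rewrite /eps_omega /mscale /= /mscale /=.
have -> : leb2 (vbox a e) = (lebesgue_tuple n (tbox a.1 e) * lebesgue_tuple n (tbox a.2 e))%E.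
  by apply: product_measure1E.
by rewrite !mule_gt0// lte_fin eps_factor_gt0.
Qed.

Lemma eps_sigma_finite : sigma_finite setT eps.
Proof.
have [F FT Ffin] := product_sigma_finite (lebesgue_tuple n) (lebesgue_tuple n) (R := R).
exists F => // i; have [mF Foo] := Ffin i; split=> //.
by rewrite /eps_omega /= /mscale /= lte_mul_pinfty// lee_fin eps_factor_ge0.
Qed.

(** The Liouville measure with its sigma-finiteness attached, as the interchange of integrals
    requires. *)
Definition eps_sf : {sigma_finite_measure set VT -> \bar R} :=
  HB.pack (Measure.sort eps)
    (@Measure_isSigmaFinite.Build _ _ _ (Measure.sort eps) eps_sigma_finite).

Lemma L2norm_poweR (f : VT -> C) :
  L2norm f = ((\int[eps]_v (normc (f v) ^+ 2)%:E) `^ 2^-1)%E.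
Proof.
rewrite /L2norm unlock; congr (_ `^ _)%E; apply: eq_integral => v _.
rewrite abse_EFin ger0_norm ?normc_ge0// poweR_EFin.
by rewrite powR_mulrn// normc_ge0.
Qed.

Lemma H0_fL2 (f : VT -> C) : H0 f <-> fL2 eps f.
Proof.
have E : (L2norm f < +oo)%E <-> (\int[eps]_v (normc (f v) ^+ 2)%:E < +oo)%E.
  rewrite L2norm_poweR; have : (0 <= \int[eps]_v (normc (f v) ^+ 2)%:E)%E.
    by apply: integral_ge0 => v _; rewrite lee_fin sqr_ge0.
  move: (\int[eps]_v _)%E => [r|//|//] r0.
    by split=> _; rewrite ?poweR_EFin ltey.
  by rewrite poweRyr// invr_neq0.
by split=> [[m1 m2 /E h]|[[m1 m2] /E h]].
Qed.

Lemma L2norm_N2 (f : VT -> C) : fL2 eps f -> L2norm f = (Num.sqrt (N2 eps f))%:E.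
Proof. by move=> fl; rewrite L2norm_poweR N2E// poweR_EFin powR12_sqrt// N2_ge0. Qed.

Lemma L2norm_le (f : VT -> C) (e : R) : 0 <= e -> fL2 eps f ->
  (L2norm f <= e%:E)%E <-> N2 eps f <= e ^+ 2.
Proof.
move=> e0 fl; rewrite L2norm_N2// lee_fin; split=> h.
  by rewrite -(sqr_sqrtr (N2_ge0 eps f)) ler_sqr ?nnegrE ?sqrtr_ge0.
by rewrite -[leRHS]ger0_norm// -sqrtr_sqr ler_wsqrtr.
Qed.

(** Squaring the Gaussian bound doubles its rate. The factor K^2 is kept explicit, since a small K
    has to yield a small norm. *)
Lemma fL2_gau (c K : R) (f : VT -> C) : 0 < c -> mC f ->
  (forall v, normc (f v) <= K * gau c v) -> fL2 eps f /\
  N2 eps f <= K ^+ 2 * fine (\int[eps]_v (gau (2 * c) v)%:E).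
Proof.
move=> c0 mf fK; have c20 : 0 < 2 * c by rewrite mulr_gt0.
have K0 : 0 <= K.
  have := fK (nseq_tuple n (0 : T), nseq_tuple n (0 : T)) => /(le_trans (normc_ge0 _)).
  by rewrite pmulr_lge0// expR_gt0.
have sq v : normc (f v) ^+ 2 <= K ^+ 2 * gau (2 * c) v.
  have -> : gau (2 * c) v = gau c v ^+ 2.
    by rewrite /gau -expRM_natl; congr expR; rewrite -mulr_natl; ring.
  by rewrite -exprMn ler_sqr ?nnegrE ?normc_ge0// mulr_ge0// /gau expR_ge0.
have mg : measurable_fun setT (fun v => K ^+ 2 * gau (2 * c) v).
  by apply: measurable_funM => //; exact: measurable_gau.
have g0 v : (0 <= (gau (2 * c) v)%:E)%E by rewrite lee_fin expR_ge0.
have E : (\int[eps]_v (K ^+ 2 * gau (2 * c) v)%:E =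
    (K ^+ 2 * fine (\int[eps]_v (gau (2 * c) v)%:E))%:E)%E.
  under eq_integral do rewrite EFinM.
  have I2 : (\int[eps]_v (gau (2 * c) v)%:E = (fine (\int[eps]_v (gau (2 * c) v)%:E))%:E)%E.
    by rewrite fineK// ge0_fin_numE ?integral_gau_lty//; apply: integral_ge0.
  rewrite ge0_integralZl//; solve [by rewrite {1}I2 -EFinM | by rewrite lee_fin sqr_ge0
    | by apply/measurable_EFinP; exact: measurable_gau].
have fl : fL2 eps f by apply: (fL2_dom mf mg sq); rewrite E ltey.
split=> //; rewrite -lee_fin -N2E// -E; apply: ge0_le_integral => //.
- by move=> v _; rewrite lee_fin sqr_ge0.
- by apply/measurable_EFinP; exact: mC_normc_sqr.
- exact/measurable_EFinP.
- by move=> v _; rewrite lee_fin.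
Qed.

Definition vcontinuous (f : VT -> C) : Prop := forall v (e : R), 0 < e ->
  exists2 d : R, 0 < d & forall w, vbox v d w -> normc (f w - f v) < e.

(** If f v were nonzero, |f| would exceed |f v| / 2 on a box of positive measure. *)
Lemma vcontinuous_N2_eq0 (f : VT -> C) : vcontinuous f -> fL2 eps f -> N2 eps f = 0 ->
  forall v, f v = 0.
Proof.
move=> cf fl f0 v; apply/eqP; rewrite -normc_eq0; apply: contraT => nz.
have p : 0 < normc (f v) by rewrite lt_def nz normc_ge0.
pose m := normc (f v) / 2; have m0 : 0 < m by rewrite divr_gt0.
have [d d0 Hd] := cf v m m0; have [mb pb] := eps_box_gt0 v d0.
have : (\int[eps]_(w in vbox v d) (m ^+ 2)%:E <= \int[eps]_w (normc (f w) ^+ 2)%:E)%E.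
  rewrite [leLHS]integral_mkcond; apply: ge0_le_integral => //.
  - by move=> w _; rewrite patchE; case: ifP => // _; rewrite lee_fin sqr_ge0.
  - apply/(measurable_restrict _ mb measurableT); rewrite setTI; exact: measurable_cst.
  - by apply/measurable_EFinP; exact: mC_normc_sqr fl.1.
  - move=> w _; rewrite patchE; case: ifPn; last by rewrite lee_fin sqr_ge0.
    rewrite inE => /Hd h; rewrite lee_fin ler_sqr ?nnegrE ?normc_ge0 ?ltW//.
    have := normc_sub (f w) (f w - f v); rewrite opprB addrC subrK => h2.
    rewrite /m in h *; lra.
rewrite N2E// f0 integral_cst//; apply: contraTT => _.
by rewrite -ltNge mule_gt0// lte_fin exprn_gt0.
Qed.

End liouville_measure.

(** * Goursat's theorem on squares *)

Section unit_interval_integral.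
Context {R : realType}.
Local Notation C := R[i].
Local Notation leb := (@lebesgue_measure R).
Local Notation I01 := (`[0, 1]%classic : set R).

(** Integrals over [0, 1] are taken against a probability on the whole line, so that the calculus of
    [cint] and Fubini's theorem apply to them. *)
Definition mu01 : probability (measurableTypeR R) R := uniform_prob (@ltr01 R).

Definition rcont (g : R -> C) : Prop := forall (t e : R), 0 < e ->
  exists2 d : R, 0 < d & forall s : R, `|s - t| < d -> normc (g s - g t) < e.

Lemma rcont_continuous (g : R -> C) (k : C -> R) : rcont g ->
  (forall z w, `|k z - k w| <= normc (z - w)) -> continuous (fun t => k (g t)).
Proof.
move=> gc kl t; apply/cvgrPdist_lt => e e0; have [d d0 Hd] := gc t e e0.
apply/nbhs_ballP; exists d => // s; rewrite /ball /= distrC => st.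
by rewrite distrC; apply: le_lt_trans (kl _ _) (Hd s st).
Qed.

Lemma rcont_Re g : rcont g -> continuous (fun t => complex.Re (g t)).
Proof.
move=> gc; apply: rcont_continuous => // z w.
by rewrite -ReN -ReD; exact: Re_le_normc.
Qed.

Lemma rcont_Im g : rcont g -> continuous (fun t => complex.Im (g t)).
Proof.
move=> gc; apply: rcont_continuous => // z w.
by rewrite -ImN -ImD; exact: Im_le_normc.
Qed.

Lemma rcont_mC (g : R -> C) : rcont g -> mC (g : measurableTypeR R -> C).
Proof.
move=> gc; split; apply: continuous_measurable_fun; first exact: rcont_Re.
exact: rcont_Im.
Qed.

Lemma continuous_itv_integrable (g : R -> R) (a b : R) : continuous g ->
  leb.-integrable `[a, b] (EFin \o g).
Proof.
move=> gc; apply: continuous_compact_integrable; first exact: segment_compact.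
exact: continuous_subspaceT.
Qed.

Lemma Rintegral_mu01 (g : R -> R) : continuous g ->
  Rintegral mu01 setT g = Rintegral leb `[0, 1] g.
Proof.
move=> gc; have mg : measurable_fun setT (g : measurableTypeR R -> R).
  exact: continuous_measurable_fun.
have mg' : measurable_fun setT (EFin \o (g : measurableTypeR R -> R)) by exact/measurable_EFinP.
rewrite /Rintegral; congr fine; rewrite integralE [RHS]integralE.
rewrite /mu01 !integral_uniform//.
- by rewrite subr0 invr1 !mul1e.
- exact: measurable_funeneg.
- exact: measurable_funepos.
Qed.

Lemma real_primitive (g : R -> R) : continuous g -> exists2 p : R -> R,
  (forall t : R, t \in `[0, 1] -> is_derive t 1 p (g t)) &
  Rintegral mu01 setT g = p 1 - p 0.
Proof.
(* Starting at -1 makes [0, 1] interior to [-1, 2], so the derivative is two-sided at both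
   endpoints. *)
move=> gc; pose p x := (\int[leb]_(t in [set` Interval (BLeft (-1 : R)) (BRight x)]) g t)%R.
exists p => [t|].
  rewrite in_itv /= => /andP[t0 t1].
  have := @continuous_FTC1_closed R g (-1) t 2 _ _ _ (gc t).
  case=> [|||dp <-].
  - by rewrite (le_lt_trans t1)// ltr1n.
  - exact: continuous_itv_integrable.
  - by lra.
  - by rewrite derive1E; exact: derivableP.
rewrite Rintegral_mu01// /p Rintegral_itvB; [| |by rewrite bnd_simp lerN10|by rewrite bnd_simp ler01].
  apply/esym; apply: Rintegral_itv_obnd_cbnd.
  apply: (integrableS _ _ _ (continuous_itv_integrable 0 1 gc)) => //.
  by move=> x; rewrite /= !in_itv /= => /andP[/ltW -> ->].
exact: (continuous_itv_integrable (-1) 1 gc).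
Qed.

Lemma rcont_primitive (g : R -> C) : rcont g -> exists2 p : R -> C,
  (forall t : R, t \in `[0, 1] -> derc I01 p t (g t)) & cint mu01 g = p 1 - p 0.
Proof.
move=> gc; have [p1 d1 e1] := real_primitive (rcont_Re gc).
have [p2 d2 e2] := real_primitive (rcont_Im gc).
exists (fun t => (p1 t)%:C + 'i * (p2 t)%:C) => [t t01|].
  rewrite [g t]complexE; apply: dercD; first by apply: is_derive_derc; exact: d1.
  by apply: dercZ; apply: is_derive_derc; exact: d2.
rewrite /cint e1 e2; apply: complex_ext; rewrite /= ?reimE; ring.
Qed.

Lemma cint_mu01 (g p : R -> C) : rcont g ->
  (forall t : R, t \in `[0, 1] -> derc I01 p t (g t)) -> cint mu01 g = p 1 - p 0.
Proof.
move=> gc dp; have [q dq ->] := rcont_primitive gc.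
have : forall t : R, t \in `[0, 1] -> derc I01 (fun s => q s - p s) t 0.
  by move=> t t01; have := dercB (dq t t01) (dp t t01); rewrite subrr.
move=> /derc01_constant/(_ 1); rewrite in_itv /= ler01 lexx => /(_ isT) /eqP.
rewrite subr_eq => /eqP ->; ring.
Qed.

Lemma intC_mu01 (g : R -> C) (M : R) : mC (g : measurableTypeR R -> C) ->
  (forall t, normc (g t) <= M) -> intC mu01 g.
Proof.
move=> mg gM; apply: (intC_dom (g := fun=> M)) => //.
have m1 : mu01 setT = 1%E :> \bar R by exact: probability_setT.
by rewrite integral_cst// [X in (_ * X)%E]probability_setT mule1 ltey.
Qed.

End unit_interval_integral.

Section goursat.
Context {R : realType}.
Local Notation C := R[i].
Local Notation I01 := (`[0, 1]%classic : set R).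

Lemma derc_affine (D D' : set R) (p : R -> C) (t al be : R) (l : C) :
  (forall s, D s -> D' (al * s + be)) -> derc D' p (al * t + be) l ->
  derc D (fun s => p (al * s + be)) t (al%:C * l).
Proof.
move=> DD /dercP dp; apply/dercP => e e0.
pose k := `|al| + 1; have k0 : 0 < k by rewrite ltr_wpDl.
have [d d0 Hd] := dp (e / k) (divr_gt0 e0 k0).
exists (d / k); first exact: divr_gt0.
move=> s Ds sd; have E : al * s + be - (al * t + be) = al * (s - t) by ring.
have kle : `|al * (s - t)| <= k * `|s - t| by rewrite normrM ler_wpM2r// lerDl.
have := Hd _ (DD s Ds); rewrite E => /(_ _).
have lt : `|al * (s - t)| < d.
  by apply: le_lt_trans kle _; rewrite mulrC -ltr_pdivlMr.
move=> /(_ lt) h.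
have -> : (s - t)%:C * (al%:C * l) = (al * (s - t))%:C * l by rewrite real_complexM; ring.
apply: le_trans h _; apply: (@le_trans _ _ (e / k * (k * `|s - t|))).
  by rewrite ler_wpM2l// divr_ge0 ?ltW.
by rewrite mulrA divfK// gt_eqF.
Qed.

Definition ccont (f : C -> C) : Prop := forall z (e : R), 0 < e ->
  exists2 d : R, 0 < d & forall w, normc (w - z) < d -> normc (f w - f z) < e.

(** Complex differentiability at each point, with no continuity of the derivative; hence the
    subdivision argument of Goursat. *)
Definition cdiff (f : C -> C) : Prop := forall z, exists l : C, forall e : R, 0 < e ->
  exists2 d : R, 0 < d & forall w, normc (w - z) < d ->
    normc (f w - f z - l * (w - z)) <= e * normc (w - z).

Lemma cdiff_ccont f : cdiff f -> ccont f.
Proof.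
move=> fd z e e0; have [l /(_ 1 ltr01)[d d0 Hd]] := fd z.
pose k := normc l + 1; have k0 : 0 < k by rewrite ltr_wpDl// normc_ge0.
exists (Num.min d (e / k)); first by rewrite lt_min d0 divr_gt0.
move=> w; rewrite lt_min => /andP[wd we].
rewrite -[f w - f z](subrK (l * (w - z))).
apply: (@le_lt_trans _ _ (k * normc (w - z))); last by rewrite mulrC -ltr_pdivlMr.
apply: (le_trans (le_normcD _ _)); rewrite mulrDl addrC lerD ?Hd//.
by rewrite ComplexField.Normc.normcM.
Qed.

Lemma ccont_line f a b : ccont f -> rcont (fun t => f (a + t%:C * (b - a))).
Proof.
move=> fc t e e0; have [d d0 Hd] := fc (a + t%:C * (b - a)) e e0.
pose k := normc (b - a) + 1; have k0 : 0 < k by rewrite ltr_wpDl// normc_ge0.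
exists (d / k); first exact: divr_gt0.
move=> s st; apply: Hd.
rewrite (_ : a + s%:C * (b - a) - (a + t%:C * (b - a)) = (s - t)%:C * (b - a)); last by rewrite real_complexB; ring.
rewrite ComplexField.Normc.normcM normc_real.
apply: (@le_lt_trans _ _ (`|s - t| * k)); last by rewrite -ltr_pdivlMr.
by rewrite ler_wpM2l// lerDl.
Qed.

(** The contour integral of f along the oriented segment from a to b. *)
Definition seg (f : C -> C) (a b : C) : C := (b - a) * cint mu01 (fun t => f (a + t%:C * (b - a))).

Lemma segP f a b : ccont f -> exists2 p : R -> C,
  (forall t : R, t \in `[0, 1] -> derc I01 p t (f (a + t%:C * (b - a)))) &
  seg f a b = (b - a) * (p 1 - p 0).
Proof.
move=> fc; have [p dp e] := rcont_primitive (ccont_line a b fc).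
by exists p => //; rewrite /seg e.
Qed.

Lemma seg_eq f a b p : ccont f ->
  (forall t : R, t \in `[0, 1] -> derc I01 p t (f (a + t%:C * (b - a)))) ->
  seg f a b = (b - a) * (p 1 - p 0).
Proof. by move=> fc dp; rewrite /seg (cint_mu01 _ dp)//; exact: ccont_line. Qed.

Lemma seg_mid f a b : ccont f -> seg f a b = seg f a ((a + b) / 2) + seg f ((a + b) / 2) b.
Proof.
move=> fc; have [p dp ->] := segP a b fc; set m := (a + b) / 2.
have E1 : m - a = (2^-1)%:C * (b - a) by rewrite real_complexV real_complex_nat /m; field.
have E2 : b - m = (2^-1)%:C * (b - a) by rewrite real_complexV real_complex_nat /m; field.
rewrite (@seg_eq f a m (fun t => 2 * p (2^-1 * t + 0)))//; last first.
  move=> t t01; have t01' : 2^-1 * t + 0 \in `[0, 1] by move: t01; rewrite !in_itv /=; lra.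
  have D s : I01 s -> I01 (2^-1 * s + 0) by rewrite /= !in_itv /=; lra.
  have := dercZ 2 (derc_affine D (dp _ t01')); apply: derc_val.
  rewrite addr0 real_complexM real_complexV real_complex_nat mulrA mulfV ?two_neq0// mul1r.
  by congr f; rewrite E1 real_complexV real_complex_nat; ring.
rewrite (@seg_eq f m b (fun t => 2 * p (2^-1 * t + 2^-1)))//; last first.
  move=> t t01; have t01' : 2^-1 * t + 2^-1 \in `[0, 1] by move: t01; rewrite !in_itv /=; lra.
  have D s : I01 s -> I01 (2^-1 * s + 2^-1) by rewrite /= !in_itv /=; lra.
  have := dercZ 2 (derc_affine D (dp _ t01')); apply: derc_val.
  rewrite real_complexD real_complexM real_complexV real_complex_nat mulrA mulfV ?two_neq0// mul1r.
  by congr f; rewrite E2 real_complexV real_complex_nat /m; field.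
rewrite E1 E2 mulr0 !addr0 mulr1 add0r real_complexV real_complex_nat.
have -> : 2^-1 + 2^-1 = 1 :> R by field.
by field.
Qed.

Lemma seg_rev f a b : ccont f -> seg f b a = - seg f a b.
Proof.
move=> fc; have [p dp ->] := segP a b fc.
rewrite (@seg_eq f b a (fun t => - p (- 1 * t + 1)))//; last first.
  move=> t t01; have t01' : - 1 * t + 1 \in `[0, 1] by move: t01; rewrite !in_itv /=; lra.
  have D s : I01 s -> I01 (- 1 * s + 1) by rewrite /= !in_itv /=; lra.
  have := dercN (derc_affine D (dp _ t01')); apply: derc_val.
  have m1 : (- 1)%:C = - 1 :> C by rewrite real_complexN.
  rewrite m1 (mulN1r (f _)) opprK; congr f.
  by rewrite mulN1r real_complexD real_complexN; ring.
rewrite mulr0 mulr1 add0r addNr; ring.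
Qed.

(** An affine function integrates over a segment to b - a times its value at the midpoint; p carries
    the remainder, which differentiability makes small. *)
Lemma seg_affine_sub f al be c a b : ccont f ->
  exists2 p : R -> C, (forall t : R, t \in `[0, 1] -> derc I01 p t
      (f (a + t%:C * (b - a)) - al - be * (a + t%:C * (b - a) - c))) &
  seg f a b = (b - a) * (al + be * ((a + b) / 2 - c)) + (b - a) * (p 1 - p 0).
Proof.
move=> fc; have [p dp ->] := segP a b fc.
exists (fun t => p t - (al + be * (a - c)) * t%:C - be * (b - a) / 2 * (t%:C * t%:C)).
  move=> t t01; have dt := derc_real I01 t.
  have := dercB (dercB (dp t t01) (dercZ (al + be * (a - c)) dt))
    (dercZ (be * (b - a) / 2) (dercM dt dt)).
  by apply: derc_val; field.
by field.
Qed.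

Definition quad f (a b c d : C) : C := seg f a b + seg f b c + seg f c d + seg f d a.

(** The integral around the square of centre c and half side h, counterclockwise from the lower left
    corner. *)
Definition sq f (c : C) (h : R) : C := quad f
  (c + h%:C * (-1 - 'i)) (c + h%:C * (1 - 'i)) (c + h%:C * (1 + 'i)) (c + h%:C * (-1 + 'i)).

(** Each inner edge between o and the midpoint of a side is traversed twice, in opposite
    directions. *)
Lemma quad_split f a b c d o : ccont f ->
  quad f a b c d =
    quad f a ((a + b) / 2) o ((d + a) / 2) + quad f ((a + b) / 2) b ((b + c) / 2) o
  + quad f o ((b + c) / 2) c ((c + d) / 2) + quad f ((d + a) / 2) o ((c + d) / 2) d.
Proof.
move=> fc; rewrite /quad (seg_mid a b fc) (seg_mid b c fc) (seg_mid c d fc) (seg_mid d a fc).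
rewrite (seg_rev o ((a + b) / 2) fc) (seg_rev ((b + c) / 2) o fc).
by rewrite (seg_rev o ((c + d) / 2) fc) (seg_rev ((d + a) / 2) o fc); ring.
Qed.

Lemma sq_split f c h : ccont f -> sq f c h =
    sq f (c + (h / 2)%:C * (-1 - 'i)) (h / 2) + sq f (c + (h / 2)%:C * (1 - 'i)) (h / 2)
  + sq f (c + (h / 2)%:C * (1 + 'i)) (h / 2) + sq f (c + (h / 2)%:C * (-1 + 'i)) (h / 2).
Proof.
move=> fc; rewrite {1}/sq (quad_split _ _ _ _ c fc) /sq.
rewrite real_complexM real_complexV real_complex_nat.
have q (a b c1 d a' b' c' d' : C) : a = a' -> b = b' -> c1 = c' -> d = d' -> quad f a b c1 d = quad f a' b' c' d'.
  by move=> -> -> -> ->.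
move: ('i : C) h%:C => I H.
apply: (f_equal2 (@GRing.add C)); [apply: (f_equal2 (@GRing.add C)); [apply: (f_equal2 (@GRing.add C))|]|]; apply: q; by field.
Qed.

(** Centre of a quarter whose boundary integral has at least a quarter of the modulus. The fourth
    quarter is the default: if the other three fail, the triangle inequality leaves only this
    one. *)
Definition next f (c : C) (h : R) : C :=
  let s k := c + (h / 2)%:C * k in
  let ok k := normc (sq f c h) <= 4 * normc (sq f (s k) (h / 2)) in
  if ok (-1 - 'i) then s (-1 - 'i) else if ok (1 - 'i) then s (1 - 'i)
  else if ok (1 + 'i) then s (1 + 'i) else s (-1 + 'i).

Lemma nextP f c h : ccont f -> 0 <= h ->
  [/\ normc (sq f c h) <= 4 * normc (sq f (next f c h) (h / 2)),
      `|complex.Re (next f c h) - complex.Re c| <= h / 2 &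
      `|complex.Im (next f c h) - complex.Im c| <= h / 2].
Proof.
move=> fc h0.
have dist k : `|complex.Re k| = 1 -> `|complex.Im k| = 1 ->
    `|complex.Re (c + (h / 2)%:C * k) - complex.Re c| <= h / 2 /\
    `|complex.Im (c + (h / 2)%:C * k) - complex.Im c| <= h / 2.
  move=> k1 k2; rewrite !reimE !mul0r subr0 addr0 ![_ + _ * _]addrC !addrK !(normrM (h / 2)) k1 k2 !mulr1.
  by rewrite ger0_norm ?divr_ge0.
have r1 : `|complex.Re (-1 - 'i : C)| = 1 /\ `|complex.Im (-1 - 'i : C)| = 1.
  by rewrite !reimE subr0 oppr0 add0r normrN1.
have r2 : `|complex.Re (1 - 'i : C)| = 1 /\ `|complex.Im (1 - 'i : C)| = 1.
  by rewrite !reimE subr0 add0r normrN1 normr1.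
have r3 : `|complex.Re (1 + 'i : C)| = 1 /\ `|complex.Im (1 + 'i : C)| = 1.
  by rewrite !reimE addr0 add0r normr1.
have r4 : `|complex.Re (-1 + 'i : C)| = 1 /\ `|complex.Im (-1 + 'i : C)| = 1.
  by rewrite !reimE addr0 oppr0 add0r normrN1 normr1.
rewrite /next; case: ifPn => [ o1|/negP o1]; first by have [] := dist _ r1.1 r1.2.
case: ifPn => [ o2|/negP o2]; first by have [] := dist _ r2.1 r2.2.
case: ifPn => [ o3|/negP o3]; first by have [] := dist _ r3.1 r3.2.
have [d1 d2] := dist _ r4.1 r4.2; split=> //.
move: o1 o2 o3 => /negP; rewrite -ltNge => o1 /negP; rewrite -ltNge => o2 /negP; rewrite -ltNge => o3.
have := sq_split c h fc; move: (sq f _ (h / 2)) (sq f _ (h / 2)) (sq f _ (h / 2)) (sq f _ (h / 2)) o1 o2 o3.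
move=> s1 s2 s3 s4 o1 o2 o3 E.
have t1 := le_normcD s1 s2; have t2 := le_normcD (s1 + s2) s3; have t3 := le_normcD (s1 + s2 + s3) s4.
rewrite (_ : s1 + s2 + s3 + s4 = sq f c h) in t3; [lra|by rewrite E; ring].
Qed.

(** The intervals [x - h, x + h] are nested, and the supremum of their left endpoints lies in all of
    them. *)
Lemma nested_limit (x h : nat -> R) : (forall m, 0 <= h m) ->
  (forall m, `|x m.+1 - x m| <= h m - h m.+1) -> exists y, forall m, `|y - x m| <= h m.
Proof.
move=> h0 H.
have up m k : x m - h m <= x (m + k)%N - h (m + k)%N.
  elim: k => [|k IH]; first by rewrite addn0.
  by apply: le_trans IH _; have := H (m + k)%N; rewrite addnS ler_norml; lra.
have dn m k : x (m + k)%N + h (m + k)%N <= x m + h m.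
  elim: k => [|k IH]; first by rewrite addn0.
  by apply: le_trans _ IH; have := H (m + k)%N; rewrite addnS ler_norml; lra.
have ab m k : x m - h m <= x k + h k.
  have h1 := up m k; have h2 := dn k m; rewrite addnC in h2; have h3 := h0 (m + k)%N.
  lra.
pose S := [set x m - h m | m in [set: nat]].
have Sub m : ubound S (x m + h m) by move=> _ [k _ <-]; exact: ab.
have S0 : S !=set0 by exists (x 0%N - h 0%N), 0%N.
exists (sup S) => m; rewrite ler_distl; apply/andP; split.
  by apply: ub_le_sup; [exists (x 0%N + h 0%N)|exists m].
exact: ge_sup.
Qed.

End goursat.

Section goursat_theorem.
Context {R : realType}.
Local Notation C := R[i].
Local Notation I01 := (`[0, 1]%classic : set R).

(** The affine part of f contributes 0 around the square. Each of the four sides has length 2 r and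
    carries an error of at most 4 r e', as the boundary lies within 4 r of z; whence 32. *)
Lemma goursat_local f (z l o : C) (r e' : R) : ccont f -> 0 < r -> 0 < e' ->
  `|complex.Re z - complex.Re o| <= r -> `|complex.Im z - complex.Im o| <= r ->
  (forall w, normc (w - z) <= 4 * r -> normc (f w - f z - l * (w - z)) <= e' * normc (w - z)) ->
  normc (sq f o r) <= 32 * (e' * r ^+ 2).
Proof.
move=> fc r0 e'0 Hr Hi Hd.
have est a b : (forall t : R, t \in `[0, 1] -> normc (a + t%:C * (b - a) - z) <= 4 * r) ->
    normc (seg f a b - (b - a) * (f z + l * ((a + b) / 2 - z))) <= normc (b - a) * (e' * (4 * r)).
  move=> H; have [p dp ->] := seg_affine_sub (f z) l z a b fc.
  rewrite addrAC subrr add0r ComplexField.Normc.normcM ler_wpM2l ?normc_ge0//.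
  have r40 : 0 <= e' * (4 * r) by rewrite !mulr_ge0 ?ltW.
  apply: (derc01_bound r40 dp); last by rewrite in_itv /= ler01 lexx.
  move=> t t01; apply: (le_trans (Hd _ (H t t01))).
  by apply: ler_wpM2l (H t t01); rewrite ltW.
have near (k k' : C) : `|complex.Re k| <= 1 -> `|complex.Im k| <= 1 ->
    `|complex.Re k'| <= 1 -> `|complex.Im k'| <= 1 ->
    normc (k' - k) = 2 ->
    normc (seg f (o + r%:C * k) (o + r%:C * k') - (o + r%:C * k' - (o + r%:C * k)) *
      (f z + l * ((o + r%:C * k + (o + r%:C * k')) / 2 - z))) <= 2 * r * (e' * (4 * r)).
  move=> k1 k2 k1' k2' kk; apply: (le_trans (est _ _ _)); last first.
    rewrite (_ : _ + _ - _ = r%:C * (k' - k)); last by ring.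
    by rewrite ComplexField.Normc.normcM kk normc_real gtr0_norm// [r * 2]mulrC.
  move=> t; rewrite in_itv /= => /andP[t0 t1].
  apply: (le_trans (normc_le_Re_Im _)).
  have conv x y : `|x| <= 1 -> `|y| <= 1 -> `|x + t * (y - x)| <= 1.
    by move=> x1 y1; move: x1 y1; rewrite !ler_norml => /andP[? ?] /andP[? ?]; nra.
  have c1 := conv _ _ k1 k1'; have c2 := conv _ _ k2 k2'.
  rewrite (_ : _ - z = o - z + r%:C * (k + t%:C * (k' - k))); last by ring.
  rewrite !reimE !mul0r !subr0 !addr0.
  have side (x y w : R) : `|y - x| <= r -> `|w| <= 1 -> `|x - y + r * w| <= 2 * r.
    move=> xy w1; apply: (le_trans (ler_normD _ _)); rewrite distrC normrM gtr0_norm//.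
    by have := ler_wpM2l (ltW r0) w1; lra.
  have s1 := side _ _ _ Hr c1; have s2 := side _ _ _ Hi c2.
  by lra.
have n2 : normc (2 : C) = 2 by rewrite -real_complex_nat normc_real normr_nat.
have n2i : normc (2 * 'i : C) = 2 by rewrite ComplexField.Normc.normcM n2 normc_i mulr1.
have sum4 (s1 s2 s3 s4 a1 a2 a3 a4 : C) E : normc (s1 - a1) <= E -> normc (s2 - a2) <= E ->
    normc (s3 - a3) <= E -> normc (s4 - a4) <= E -> a1 + a2 + a3 + a4 = 0 ->
    normc (s1 + s2 + s3 + s4) <= 4 * E.
  move=> N1 N2 N3 N4 a0.
  rewrite (_ : s1 + s2 + s3 + s4 = (s1 - a1) + (s2 - a2) + (s3 - a3) + (s4 - a4)); last first.
    by rewrite -[LHS]subr0 -a0; ring.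
  have t1 := le_normcD (s1 - a1) (s2 - a2).
  have t2 := le_normcD (s1 - a1 + (s2 - a2)) (s3 - a3).
  have t3 := le_normcD (s1 - a1 + (s2 - a2) + (s3 - a3)) (s4 - a4).
  by lra.
have h1 : normc (sq f o r) <= 32 * (e' * r ^+ 2).
  have Z1 : `|1 : R| <= 1 by rewrite normr1.
  have Z2 : `|-1 : R| <= 1 by rewrite normrN1.
  have N1 := near (-1 - 'i) (1 - 'i); have N2 := near (1 - 'i) (1 + 'i).
  have N3 := near (1 + 'i) (-1 + 'i); have N4 := near (-1 + 'i) (-1 - 'i).
  move: N1 N2 N3 N4; rewrite !reimE !(subr0, addr0, oppr0, add0r).
  rewrite (_ : 1 - 'i - (-1 - 'i) = 2); last by ring.
  rewrite (_ : 1 + 'i - (1 - 'i) = 2 * 'i); last by ring.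
  rewrite (_ : -1 + 'i - (1 + 'i) = - 2); last by ring.
  rewrite (_ : -1 - 'i - (-1 + 'i) = - (2 * 'i)); last by ring.
  rewrite !normcN n2 n2i => /(_ Z2 Z2 Z1 Z2 erefl) N1 /(_ Z1 Z2 Z1 Z1 erefl) N2.
  move=> /(_ Z1 Z1 Z2 Z1 erefl) N3 /(_ Z2 Z1 Z2 Z2 erefl) N4; rewrite /sq /quad.
  apply: le_trans (sum4 _ _ _ _ _ _ _ _ _ N1 N2 N3 N4 _) _; first by field.
  by rewrite le_eqVlt; apply/orP; left; apply/eqP; ring.
exact: h1.
Qed.

Lemma goursat f c (h : R) : cdiff f -> 0 < h -> sq f c h = 0.
Proof.
move=> fd h0; have fc := cdiff_ccont fd.
pose hn m : R := h / 2 ^+ m.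
have hn0 m : 0 < hn m by rewrite divr_gt0// exprn_gt0.
have hnS m : hn m.+1 = hn m / 2.
  by rewrite /hn exprS invfM mulrA mulrAC.
pose cn := fix cn m := if m is m'.+1 then next f (cn m') (hn m') else c.
have step m := nextP (cn m) fc (ltW (hn0 m)).
have [xr Hr] : exists y, forall m, `|y - complex.Re (cn m)| <= hn m.
  apply: nested_limit => m; first exact: ltW.
  by have [_ + _] := step m; rewrite hnS /=; lra.
have [xi Hi] : exists y, forall m, `|y - complex.Im (cn m)| <= hn m.
  apply: nested_limit => m; first exact: ltW.
  by have [_ _ +] := step m; rewrite hnS /=; lra.
pose z : C := xr +i* xi.
have big m : normc (sq f c h) <= 4 ^+ m * normc (sq f (cn m) (hn m)).
  elim: m => [|m IH]; first by rewrite expr0 mul1r /hn expr0 divr1.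
  apply: le_trans IH _; rewrite exprSr -mulrA ler_wpM2l ?exprn_ge0//.
  by have [+ _ _] := step m; rewrite hnS.
apply/eqP; rewrite -normc_eq0 eq_le normc_ge0 andbT; apply/ler_addgt0Pr => e e0; rewrite add0r.
(* Chosen so that 4^m times 32 e' (h / 2^m)^2 is exactly e. *)
pose e' := e / (32 * h ^+ 2); have h20 : 0 < 32 * h ^+ 2 by rewrite mulr_gt0// exprn_gt0.
have e'0 : 0 < e' by rewrite divr_gt0.
have [l /(_ e' e'0)[d d0 Hd]] := fd z.
have [m Hm] : exists m, 4 * hn m < d.
  have q0 : 0 <= 4 * h / d by rewrite divr_ge0 ?mulr_ge0 ?ltW.
  exists (Num.bound (4 * h / d)); set N := Num.bound _.
  have : 4 * h / d < 2 ^+ N.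
    apply: (lt_le_trans (archi_boundP q0)); rewrite -natrX ler_nat ltnW//.
    exact: ltn_expl.
  by rewrite ltr_pdivrMr// /hn mulrA ltr_pdivrMr ?exprn_gt0// [d * _]mulrC.
set r := hn m in Hm *; have r0 : 0 < r by exact: hn0.
have h1 : normc (sq f (cn m) r) <= 32 * (e' * r ^+ 2) by apply: (@goursat_local f z l _ r e' fc r0 e'0 (Hr m) (Hi m)) => w wz; exact/Hd/(le_lt_trans wz).
apply: le_trans (big m) _; rewrite -/r.
apply: (@le_trans _ _ (4 ^+ m * (32 * (e' * r ^+ 2)))); first by rewrite ler_wpM2l// exprn_ge0.
have -> : 4 ^+ m = 2 ^+ m * 2 ^+ m :> R by rewrite -exprMn; congr (_ ^+ _); ring.
have p0 : 2 ^+ m != 0 :> R by rewrite expf_neq0.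
rewrite /r /hn /e' le_eqVlt; apply/orP; left; apply/eqP.
by field; rewrite p0 gt_eqF.
Qed.

End goursat_theorem.

(** * Contour integrals of parameter integrals *)

Section fubini_zero.
Context d1 d2 (T1 : measurableType d1) (T2 : measurableType d2) (R : realType).
Local Notation C := R[i].
Variables (m1 : probability T1 R) (m2 : {sigma_finite_measure set T2 -> \bar R}).

Lemma mC_comp d d' (X : measurableType d) (Y : measurableType d') (f : Y -> C) (g : X -> Y) :
  mC f -> measurable_fun setT g -> mC (fun x => f (g x)).
Proof.
move=> [f1 f2] mg; split.
  exact: (measurableT_comp f1).
exact: (measurableT_comp f2).
Qed.

(** The inner absolute integrals are uniformly bounded and the outer measure is a probability, so h
    is integrable on the product; in the other order the inner integral is already 0. *)
Lemma Rintegral_fubini_zero (h : T1 * T2 -> R) (M : R) : measurable_fun setT h ->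
  (forall x, m2.-integrable setT (fun y => (h (x, y))%:E)) ->
  (forall x, (\int[m2]_y (`|h (x, y)|%:E) <= M%:E)%E) ->
  (forall y, m1.-integrable setT (fun x => (h (x, y))%:E)) ->
  (forall y, Rintegral m1 setT (fun x => h (x, y)) = 0) ->
  measurable_fun setT (fun x => Rintegral m2 setT (fun y => h (x, y))) /\
  Rintegral m1 setT (fun x => Rintegral m2 setT (fun y => h (x, y))) = 0.
Proof.
move=> mh i2 hM i1 z.
have mh' : measurable_fun setT (EFin \o h) by exact/measurable_EFinP.
have hi : (m1 \x m2)%E.-integrable setT (EFin \o h).
  have [_ E] := @integrable12ltyP _ _ T1 T2 R m1 m2 _ mh'. apply: E. apply: (@le_lt_trans _ _ (\int[m1]_x (cst M%:E x))%E); last first.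
    by rewrite integral_cst// [X in (_ * X)%E]probability_setT mule1 ltey.
  apply: ge0_le_integral => //.
  - by move=> x _; apply: integral_ge0.
  - apply: (measurable_fun_fubini_tonelli_F (abse \o (EFin \o h))).
      exact: measurableT_comp.
    by move=> x; exact: abse_ge0.
  - by move=> x _; exact: hM.
have E2 x : (Rintegral m2 setT (fun y => h (x, y)))%:E = (\int[m2]_y (h (x, y))%:E)%E.
  by rewrite /Rintegral fineK//; apply: integrable_fin_num => //; exact: i2.
have E1 y : (\int[m1]_x (h (x, y))%:E = 0%R%:E)%E.
  by rewrite -(z y) /Rintegral fineK//; apply: integrable_fin_num => //; exact: i1.
split.
  apply/measurable_EFinP; rewrite (_ : _ \o _ = fun x => (\int[m2]_y (h (x, y))%:E)%E); last exact/funext.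
  exact: (measurable_fubini_F hi).
rewrite {1}/Rintegral.
under eq_integral do rewrite E2.
by rewrite (Fubini hi) /=; under eq_integral do rewrite E1; rewrite integral0.
Qed.

Lemma cint_fubini_zero (h : T1 * T2 -> C) (M : R) : mC h ->
  (forall x, intC m2 (fun y => h (x, y))) ->
  (forall x, (\int[m2]_y (normc (h (x, y)))%:E <= M%:E)%E) ->
  (forall y, intC m1 (fun x => h (x, y))) ->
  (forall y, cint m1 (fun x => h (x, y)) = 0) ->
  mC (fun x => cint m2 (fun y => h (x, y))) /\
  cint m1 (fun x => cint m2 (fun y => h (x, y))) = 0.
Proof.
move=> [mr mi] i2 hM i1 z.
have dom (k : C -> R) x : (forall w, `|k w| <= normc w) ->
    measurable_fun setT (fun z => k (h z)) ->
    (\int[m2]_y (`|k (h (x, y))|%:E) <= M%:E)%E.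
  move=> kn mk; apply: le_trans (hM x); apply: ge0_le_integral => //.
  - apply/measurable_EFinP; apply: measurableT_comp => //.
    exact: (measurableT_comp mk).
  - by apply/measurable_EFinP; apply: mC_normc; have [] := i2 x.
  - by move=> y _; rewrite lee_fin.
have z1 y : Rintegral m1 setT (fun x => complex.Re (h (x, y))) = 0 by have [] := z y.
have z2 y : Rintegral m1 setT (fun x => complex.Im (h (x, y))) = 0 by have [] := z y.
have [m1' Z1] := @Rintegral_fubini_zero _ M mr (fun x => intC_Re (i2 x))
  (fun x => dom _ x (@Re_le_normc _) mr) (fun y => intC_Re (i1 y)) z1.
have [m2' Z2] := @Rintegral_fubini_zero _ M mi (fun x => intC_Im (i2 x))
  (fun x => dom _ x (@Im_le_normc _) mi) (fun y => intC_Im (i1 y)) z2.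
by split => //; rewrite /cint /= Z1 Z2.
Qed.

End fubini_zero.

Section clamped.
Context {R : realType}.
Local Notation C := R[i].

(** Retraction of the line onto [0, 1]. It keeps the parametrized sides bounded, so that the
    hypotheses of the Fubini argument hold for all real parameters. *)
Definition clamp (t : R) : R := Num.max 0 (Num.min 1 t).

Lemma clamp01 t : 0 <= clamp t <= 1.
Proof. by rewrite /clamp le_max lexx /= ge_max ler01 ge_min lexx. Qed.

Lemma clamp_id t : t \in `[0, 1] -> clamp t = t.
Proof.
rewrite in_itv /= => /andP[t0 t1]; rewrite /clamp minEle.
by case: (leP 1 t) => [t1'|_]; [rewrite (@le_anti _ _ t 1) ?t1// max_r|rewrite max_r].
Qed.

Lemma clamp_lip s t : `|clamp s - clamp t| <= `|s - t|.
Proof.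
have a1 := ler_norm (s - t); have a2 := ler_norm (t - s); rewrite [`|t - s|]distrC in a2.
by rewrite ler_norml /clamp; case: (leP 1 s) => h1; case: (leP 1 t) => h2;
  case: (leP 0 _) => h3; try case: (leP 0 _) => h4; lra.
Qed.

Lemma rcont_clamp (g : R -> C) : rcont g -> rcont (fun t => g (clamp t)).
Proof.
move=> gc t e e0; have [d d0 H] := gc (clamp t) e e0; exists d => // s sd.
exact/H/(le_lt_trans (clamp_lip _ _)).
Qed.

Lemma cint_mu01_clamp (g : R -> C) : rcont g -> cint mu01 (fun t => g (clamp t)) = cint mu01 g.
Proof.
move=> gc; have [p dp ->] := rcont_primitive gc.
by apply: cint_mu01 (rcont_clamp gc) _ => t t01; rewrite clamp_id//; exact: dp.
Qed.

Lemma cdiffM (f g : C -> C) : cdiff f -> cdiff g -> cdiff (fun z => f z * g z).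
Proof.
move=> df dg z; have [a Ha] := df z; have [b Hb] := dg z.
have gc := cdiff_ccont dg; exists (a * g z + f z * b) => e e0.
pose k := normc a + normc (f z) + normc (g z) + 1.
have k0 : 0 < k by rewrite ltr_wpDl// !addr_ge0 ?normc_ge0.
pose e' := Num.min 1 (e / (3 * k)); have e'0 : 0 < e' by rewrite lt_min ltr01 divr_gt0// mulr_gt0.
have [d1 d10 H1] := Ha e' e'0; have [d2 d20 H2] := Hb e' e'0; have [d3 d30 H3] := gc z e' e'0.
exists (Num.min d1 (Num.min d2 d3)); first by rewrite !lt_min d10 d20.
move=> w; rewrite !lt_min => /andP[/H1 h1 /andP[/H2 h2 /H3 h3]].
rewrite (_ : _ - _ = (f w - f z - a * (w - z)) * g z + f z * (g w - g z - b * (w - z))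
  + (f w - f z - a * (w - z)) * (g w - g z) + a * (w - z) * (g w - g z)); last by ring.
set u := f w - f z - a * (w - z) in h1 *; set v := g w - g z - b * (w - z) in h2 *.
have t1 := le_normcD (u * g z + f z * v + u * (g w - g z)) (a * (w - z) * (g w - g z)).
have t2 := le_normcD (u * g z + f z * v) (u * (g w - g z)); have t3 := le_normcD (u * g z) (f z * v).
move: t1 t2 t3; rewrite !ComplexField.Normc.normcM => t1 t2 t3.
have x0 := normc_ge0 (w - z); move: (normc (w - z)) x0 h1 h2 t1 => x x0 h1 h2 t1.
have e'1 : e' <= 1 by rewrite ge_min lexx.
have e'k : e' * (3 * k) <= e by rewrite -ler_pdivlMr ?mulr_gt0// /e' ge_min lexx orbT.
have gz := normc_ge0 (g z); have fz := normc_ge0 (f z); have na := normc_ge0 a.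
have nu := normc_ge0 u; have ngw := normc_ge0 (g w - g z).
have b1 : normc u * normc (g z) <= e' * x * k by apply: ler_pM => //; rewrite /k; lra.
have b2 : normc (f z) * normc v <= k * (e' * x) by apply: ler_pM => //; [exact: normc_ge0|rewrite /k; lra].
have b3 : normc u * normc (g w - g z) <= e' * x * 1 by apply: ler_pM => //; lra.
have b4 : normc a * x * normc (g w - g z) <= normc a * x * e' by apply: ler_wpM2l; [exact: mulr_ge0|exact: ltW].
have b5 : e' * (3 * k) * x <= e * x by rewrite ler_wpM2r.
have b6 : 0 <= e' * x by rewrite mulr_ge0// ltW.
have b7 : e' * x * (normc a + 1) <= e' * x * k by rewrite ler_wpM2l// /k; lra.
lra.
Qed.

Lemma cdiff_id : cdiff (fun z : C => z).
Proof.
move=> z; exists 1 => e e0; exists 1 => // w _.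
by rewrite mul1r subrr ComplexField.Normc.normc0 mulr_ge0 ?normc_ge0// ltW.
Qed.

End clamped.

Section contour_integrals.
Context {R : realType}.
Local Notation C := R[i].

Lemma rcontD (f g : R -> C) : rcont f -> rcont g -> rcont (fun t => f t + g t).
Proof.
move=> cf cg t e e0; have e20 : 0 < e / 2 by rewrite divr_gt0.
have [d1 d10 H1] := cf t _ e20; have [d2 d20 H2] := cg t _ e20.
exists (Num.min d1 d2) => [|s]; first by rewrite lt_min d10.
rewrite lt_min => /andP[/H1 h1 /H2 h2].
rewrite (_ : _ - _ = f s - f t + (g s - g t)); last by ring.
by apply: le_lt_trans (le_normcD _ _) _; lra.
Qed.

Lemma rcontZ (c : C) (f : R -> C) : rcont f -> rcont (fun t => c * f t).
Proof.
move=> cf t e e0; pose k := normc c + 1; have k0 : 0 < k by rewrite ltr_wpDl// normc_ge0.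
have [d d0 H] := cf t (e / k) (divr_gt0 e0 k0); exists d => // s /H h.
rewrite -mulrBr ComplexField.Normc.normcM; apply: (@le_lt_trans _ _ (k * normc (f s - f t))).
  by rewrite ler_wpM2r ?normc_ge0// lerDl.
by rewrite mulrC -ltr_pdivlMr.
Qed.

Lemma rcont_affine (f : C -> C) a c : ccont f -> rcont (fun t => f (a + t%:C * c)).
Proof.
move=> /(ccont_line a (a + c)) H; rewrite (_ : (fun t => _) = fun t => f (a + t%:C * (a + c - a)))//.
by apply/funext => t; rewrite addrAC subrr add0r.
Qed.

Lemma derc_rcont (g g' : R -> C) : (forall t, derc setT g t (g' t)) -> rcont g.
Proof.
move=> dg t e e0; have [d d0 H] := (dercP _ _ _ _).1 (dg t) 1 ltr01.
pose k := normc (g' t) + 1; have k0 : 0 < k by rewrite ltr_wpDl// normc_ge0.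
exists (Num.min d (e / k)) => [|s]; first by rewrite lt_min d0 divr_gt0.
rewrite lt_min => /andP[sd se]; have h := H s I sd.
rewrite -[g s - g t](subrK ((s - t)%:C * g' t)).
apply: (@le_lt_trans _ _ (k * `|s - t|)); last by rewrite mulrC -ltr_pdivlMr.
apply: le_trans (le_normcD _ _) _; rewrite ComplexField.Normc.normcM normc_real.
by rewrite /k mulrDl addrC lerD// mulrC.
Qed.

Lemma rcont_clamp_intC (g : R -> C) : rcont g -> intC mu01 (fun t => g (clamp t)).
Proof.
move=> gc; have nc : continuous (fun t => normc (g t)).
  apply: rcont_continuous => // z w; rewrite ler_norml; apply/andP; split.
    by have := le_normcD (w - z) z; rewrite subrK normc_subC; lra.
  by have := le_normcD (z - w) w; rewrite subrK; lra.
have [c _ H] := EVT_max (@ler01 R) (continuous_subspaceT nc).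
apply: (@intC_mu01 _ _ (normc (g c))) => [|t]; first exact/rcont_mC/rcont_clamp.
by apply: H; rewrite in_itv /= clamp01.
Qed.

(** The lower side of the square of half side r about 0; quarter turns give the other three
    sides. *)
Definition pline (r t : R) : C := r%:C * ((2 * t - 1)%:C - 'i).

Lemma plineE r t : pline r t = r%:C * (- 1 - 'i) + t%:C * (2 * r%:C).
Proof. by rewrite /pline real_complexB real_complexM real_complex_nat; ring. Qed.

Lemma normc_pline r t : 0 <= r -> 0 <= t <= 1 -> normc (pline r t) <= 2 * r.
Proof.
move=> r0 /andP[t0 t1]; rewrite /pline ComplexField.Normc.normcM normc_real ger0_norm// mulrC.
rewrite ler_wpM2r//; apply: le_trans (normc_sub _ _) _.
rewrite normc_i normc_real; suff : `|2 * t - 1| <= 1 by lra.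
by rewrite ler_norml; lra.
Qed.

(** The sides are the lower one multiplied by 1, i, -1, - i, so Goursat's theorem, divided by the
    side length 2 r, becomes one integral over [0, 1] with these weights. *)
Lemma sq_center (f : C -> C) (r : R) : cdiff f -> 0 < r ->
  cint mu01 (fun t => f (pline r t) + 'i * f ('i * pline r t)
    + (- 1) * f (- pline r t) + (- 'i) * f (- 'i * pline r t)) = 0.
Proof.
move=> df r0; have fc := cdiff_ccont df.
have rc (k : C) : rcont (fun t => f (k * pline r t)).
  have := @rcont_affine f (k * (r%:C * (-1 - 'i))) (k * (2 * r%:C)) fc.
  rewrite (_ : (fun t => _) = fun t => f (k * pline r t))//.
  by apply/funext => t; rewrite plineE; congr f; ring.
have rc1 : rcont (fun t => f (pline r t)).
  by rewrite (_ : (fun t => _) = fun t => f (1 * pline r t))//; apply/funext => t; rewrite mul1r.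
have rcm : rcont (fun t => f (- pline r t)).
  by rewrite (_ : (fun t => _) = fun t => f (- 1 * pline r t))//; apply/funext => t; rewrite mulN1r.
have [p0 d0 e0] := rcont_primitive rc1; have [p1 d1 e1] := rcont_primitive (rc 'i).
have [p2 d2 e2] := rcont_primitive rcm; have [p3 d3 e3] := rcont_primitive (rc (- 'i)).
rewrite (@cint_mu01 _ _ (fun t => p0 t + 'i * p1 t + (- 1) * p2 t + (- 'i) * p3 t)); last first.
- by move=> t t01; apply: dercD (dercZ _ (d3 t t01)); apply: dercD (dercZ _ (d2 t t01));
    apply: dercD (dercZ _ (d1 t t01)); exact: d0.
- by apply: rcontD; [apply: rcontD; [apply: rcontD; [|apply: rcontZ]|apply: rcontZ]|apply: rcontZ].
rewrite (_ : _ - _ = (p0 1 - p0 0) + 'i * (p1 1 - p1 0) - (p2 1 - p2 0) - 'i * (p3 1 - p3 0)); last by ring.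
rewrite -e0 -e1 -e2 -e3.
have := goursat 0 df r0; rewrite /sq /quad /seg.
have i2 : 'i * 'i = - 1 :> C by exact: mulii.
rewrite (@cint_eq _ _ _ mu01 (fun t => f (0 + r%:C * (-1 - 'i) + _ * _)) (fun t => f (pline r t))); last first.
  by move=> t; rewrite plineE; congr f; ring.
rewrite (@cint_eq _ _ _ mu01 (fun t => f (0 + r%:C * (1 - 'i) + _ * _)) (fun t => f ('i * pline r t))); last first.
  move=> t; rewrite plineE; congr f.
  by rewrite (_ : 'i * _ = - r%:C * 'i - r%:C * ('i * 'i) + t%:C * (2 * r%:C * 'i)); [rewrite i2|]; ring.
rewrite (@cint_eq _ _ _ mu01 (fun t => f (0 + r%:C * (1 + 'i) + _ * _)) (fun t => f (- pline r t))); last first.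
  by move=> t; rewrite plineE; congr f; ring.
rewrite (@cint_eq _ _ _ mu01 (fun t => f (0 + r%:C * (-1 + 'i) + _ * _)) (fun t => f (- 'i * pline r t))); last first.
  move=> t; rewrite plineE; congr f.
  by rewrite (_ : - 'i * _ = r%:C * 'i + r%:C * ('i * 'i) - t%:C * (2 * r%:C * 'i)); [rewrite i2|]; ring.
move: (cint _ _) (cint _ _) (cint _ _) (cint _ _) => X3 X2 X1 X0 E.
have E2 : (2 * r%:C) * (X0 + 'i * X1 - X2 - 'i * X3) = 0 by rewrite -[RHS]E; ring.
have r2 : 2 * r%:C != 0 :> C by rewrite mulf_neq0 ?two_neq0// real_complex_eq0 gt_eqF.
by move/eqP: E2; rewrite mulf_eq0 (negPf r2) /= => /eqP.
Qed.

(** With s = 2 t - 1 the integrand is r^3 (s^2 + 1) (s - i), whose odd part drops out. The value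
    matters as a nonzero multiple of r^3, because it multiplies the second moment. *)
Lemma moment_pline (r : R) :
  cint mu01 (fun t => (pline r (clamp t))^* * pline r (clamp t) ^+ 2) = - (4 / 3) * 'i * (r ^+ 3)%:C.
Proof.
have i2 : 'i * 'i = - 1 :> C by exact: mulii.
pose g (t : R) : C := (pline r t)^* * pline r t ^+ 2.
pose s (t : R) : C := 2 * t%:C - 1.
have ds D t : derc D s t 2.
  by have := dercB (dercZ 2 (derc_real D t)) (derc_cst D t 1); apply: derc_val; ring.
have gE t : g t = (r ^+ 3)%:C * ((s t * s t + 1) * (s t - 'i)).
  rewrite /g /pline conjcM conjcB conjci conjc_real conjc_real expr2.
  rewrite real_complexB real_complexM real_complex_nat -/(s t) real_complexX.
  rewrite [LHS](_ : _ = r%:C ^+ 3 * ((s t * s t - 'i * 'i) * (s t - 'i))); last by ring.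
  by rewrite i2; ring.
have dg t : exists l, derc setT g t l.
  have h := dercZ (r ^+ 3)%:C (dercM (dercD (dercM (ds setT t) (ds setT t)) (derc_cst setT t 1))
    (dercB (ds setT t) (derc_cst setT t 'i))).
  by eexists; apply: (derc_eq _ _ h) => // u _; rewrite gE.
have [g' Hg'] := choice dg.
rewrite (cint_mu01_clamp (derc_rcont Hg')).
pose p t : C := (r ^+ 3)%:C / 2 * (s t * s t * s t * s t / 4 + s t * s t / 2 - 'i * (s t * s t * s t) / 3 - 'i * s t).
rewrite (@cint_mu01 _ _ p (derc_rcont Hg')); last first.
  move=> t t01; rewrite -/(g t) gE; have S := ds `[0, 1]%classic t.
  have S2 := dercM S S; have S3 := dercM S2 S; have S4 := dercM S3 S.
  have h := dercZ ((r ^+ 3)%:C / 2) (dercB (dercB (dercD (dercZ 4^-1 S4) (dercZ 2^-1 S2)) (dercZ ('i / 3) S3)) (dercZ 'i S)).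
  apply: (derc_val _ (derc_eq _ _ h)); [by field|exact: t01|].
  by move=> u _; rewrite /p; field.
by rewrite /p /s; field.
Qed.

End contour_integrals.

Section integral_of_norm.
Context d (X : measurableType d) (R : realType) (mu : {measure set X -> \bar R}).
Local Notation C := R[i].

Lemma integral_normcD (f g : X -> C) (A B : R) : intC mu f -> intC mu g ->
  (\int[mu]_x (normc (f x))%:E <= A%:E)%E -> (\int[mu]_x (normc (g x))%:E <= B%:E)%E ->
  (\int[mu]_x (normc (f x + g x))%:E <= (A + B)%:E)%E.
Proof.
move=> [mf _] [mg _] fA gB; have n0 (k : X -> C) x : (0 <= (normc (k x))%:E)%E by rewrite lee_fin normc_ge0.
have mn (k : X -> C) : mC k -> measurable_fun setT (fun x => (normc (k x))%:E).
  by move=> mk; apply/measurable_EFinP; exact: mC_normc.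
apply: (@le_trans _ _ (\int[mu]_x ((normc (f x))%:E + (normc (g x))%:E))%E).
  apply: ge0_le_integral => //.
  - by move=> x _; exact: (n0 (fun x => f x + g x)).
  - exact: (mn (fun x => f x + g x) (mCD mf mg)).
  - by apply: emeasurable_funD; exact: mn.
  - by move=> x _; rewrite -EFinD lee_fin le_normcD.
rewrite ge0_integralD//; [|exact: mn..].
by rewrite EFinD leeD.
Qed.

Lemma integral_normcZ (c : C) (f : X -> C) : intC mu f ->
  (\int[mu]_x (normc (c * f x))%:E = (normc c)%:E * \int[mu]_x (normc (f x))%:E)%E.
Proof.
move=> [mf _]; under eq_integral do rewrite ComplexField.Normc.normcM EFinM.
by rewrite ge0_integralZl_EFin// ?normc_ge0//; [move=> x _; rewrite lee_fin normc_ge0|apply/measurable_EFinP; exact: mC_normc].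
Qed.

End integral_of_norm.

(** * Vanishing of a second moment by contours in the tilt parameter *)

Section second_moment.
Context {R : realType} {n : nat}.
Local Notation C := R[i].
Local Notation T := (measurableTypeR R).
Local Notation VT := (n.-tuple T * n.-tuple T)%type.
Local Notation eps := (@eps_omega R n).

Definition tlin (u w : VT) (rho : C) : VT :=
  ([tuple (complex.Re rho * tnth u.1 j + complex.Im rho * tnth w.1 j : T) | j < n],
   [tuple (complex.Re rho * tnth u.2 j + complex.Im rho * tnth w.2 j : T) | j < n]).

Lemma measurable_vshift_tlin (u w : VT) (rho : T -> C) : mC rho ->
  measurable_fun setT (fun z : T * VT => vshift (tlin u w (rho z.1)) z.2).
Proof.
move=> [r1 r2]; have c (k : VT -> n.-tuple T) : measurable_fun setT k ->
  measurable_fun setT (fun z : T * VT => tshift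
    [tuple (complex.Re (rho z.1) * tnth (k u) j + complex.Im (rho z.1) * tnth (k w) j : T) | j < n] (k z.2)).
  move=> mk; apply/measurable_fun_tnthP => j.
  rewrite (_ : _ \o _ = fun z : T * VT => tnth (k z.2) j +
      (complex.Re (rho z.1) * tnth (k u) j + complex.Im (rho z.1) * tnth (k w) j)); last first.
    by apply/funext => z /=; rewrite !tnth_mktuple.
  apply: measurable_funD.
    apply: (measurableT_comp (measurable_tnth j)).
    by apply: (measurableT_comp mk); exact: measurable_snd.
  apply: measurable_funD; apply: measurable_funM => //.
    by apply: (measurableT_comp r1); exact: measurable_fst.
  by apply: (measurableT_comp r2); exact: measurable_fst.
apply/measurable_fun_pairP; split; first by apply: (c fst); exact: measurable_fst.
by apply: (c snd); exact: measurable_snd.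
Qed.

(** P is a weight, b and m are the first and second order coefficients of its tilt, and e1, e2 are
    the translations attached to the parameters 1 and i. *)
Variables (P b : VT -> C) (m : C) (e1 e2 : VT).
Hypotheses (mP : mC P) (mb : mC b).

Definition tilt (rho : C) (v : VT) : C := P v * cexp (rho * b v + rho ^+ 2 * m).
Definition moved (v : VT) (rho : C) : C := tilt rho (vshift (tlin e1 e2 rho) v).

Hypothesis hol : forall v, cdiff (fun rho => (moved v rho)^*).

(** The rate 4 covers the exponential itself and, through 1 + x <= exp x, the cube in the third
    order Taylor remainder. *)
Definition envelope (v : VT) : R := normc (P v) * expR (4 * normc (b v)).

Hypothesis dom : (\int[eps]_v (envelope v)%:E < +oo)%E.

Lemma measurable_envelope : measurable_fun setT envelope.
Proof.
apply: measurable_funM; first exact: mC_normc.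
by apply: measurableT_comp => //; apply: measurable_funM => //; exact: mC_normc.
Qed.

Lemma envelope_ge0 v : 0 <= envelope v.
Proof. by rewrite mulr_ge0 ?normc_ge0 ?expR_ge0. Qed.

Let I : R := fine (\int[eps]_v (envelope v)%:E).

Lemma envelopeE : (\int[eps]_v (envelope v)%:E = I%:E)%E.
Proof.
by rewrite /I fineK// ge0_fin_numE// integral_ge0// => v _; rewrite lee_fin envelope_ge0.
Qed.

Lemma intC_envelope (f : VT -> C) (k : R) : 0 <= k -> mC f ->
  (forall v, normc (f v) <= k * envelope v) ->
  intC eps f /\ (\int[eps]_v (normc (f v))%:E <= (k * I)%:E)%E.
Proof.
move=> k0 mf H; have kE : (\int[eps]_v (k * envelope v)%:E = (k * I)%:E)%E.
  under eq_integral do rewrite EFinM.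
  rewrite ge0_integralZl//; first by rewrite envelopeE.
  - by apply/measurable_EFinP; exact: measurable_envelope.
  - by move=> v _; rewrite lee_fin envelope_ge0.
have mk : measurable_fun setT (fun v => k * envelope v) by apply: measurable_funM => //; exact: measurable_envelope.
split; first by apply: (intC_dom mf mk H); rewrite kE ltey.
rewrite -kE; apply: ge0_le_integral => //.
- by move=> v _; rewrite lee_fin normc_ge0.
- by apply/measurable_EFinP; exact: mC_normc.
- exact/measurable_EFinP.
- by move=> v _; rewrite lee_fin.
Qed.

Let mexp (rho : VT -> C) : mC rho -> mC (fun v => cexp (rho v * b v + rho v ^+ 2 * m)).
Proof.
move=> mr; apply: mC_cexp; apply: mCD; first exact: mCM.
by apply: mCM; [rewrite (_ : (fun v => _) = fun v => rho v * rho v) ?expr2//; exact: mCM|exact: mC_cst].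
Qed.

Lemma mC_tilt rho : mC (tilt rho).
Proof. by apply: mCM => //; apply: (@mexp (fun=> rho)); exact: mC_cst. Qed.

Let wle (rho : C) v : normc rho <= 1 ->
  normc (rho * b v + rho ^+ 2 * m) <= normc rho * (normc (b v) + normc m).
Proof.
move=> r1; apply: le_trans (le_normcD _ _) _.
rewrite !ComplexField.Normc.normcM mulrDr lerD2l -mulrA.
by rewrite ler_wpM2l ?normc_ge0// -[leRHS]mul1r ler_wpM2r ?normc_ge0.
Qed.

Let wle1 (rho : C) v : normc rho <= 1 ->
  normc (rho * b v + rho ^+ 2 * m) <= normc (b v) + normc m.
Proof.
move=> r1; apply: le_trans (wle v r1) _.
by rewrite -[leRHS]mul1r ler_wpM2r// addr_ge0 ?normc_ge0.
Qed.

Lemma tilt_le rho v : normc rho <= 1 -> normc (tilt rho v) <= expR (normc m) * envelope v.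
Proof.
move=> r1; rewrite /tilt ComplexField.Normc.normcM normc_cexp /envelope mulrCA.
rewrite ler_wpM2l ?normc_ge0// -expRD ler_expR.
apply: le_trans (le_trans (ler_norm _) (Re_le_normc _)) _.
by apply: le_trans (wle1 v r1) _; have := normc_ge0 (b v); lra.
Qed.

Lemma intC_tilt rho : normc rho <= 1 -> intC eps (tilt rho) /\
  (\int[eps]_v (normc (tilt rho v))%:E <= (expR (normc m) * I)%:E)%E.
Proof.
by move=> r1; apply: intC_envelope => [||v]; [exact: expR_ge0|exact: mC_tilt|exact: tilt_le].
Qed.

Lemma intC_moved rho : normc rho <= 1 -> intC eps (moved ^~ rho) /\
  (\int[eps]_v (normc (moved v rho))%:E <= (expR (normc m) * I)%:E)%E.
Proof.
move=> r1; have [[mt it] le] := intC_tilt r1.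
have E : (\int[eps]_v (normc (moved v rho))%:E = \int[eps]_v (normc (tilt rho v))%:E)%E.
  apply: (@ge0_integral_vshift _ _ _ (fun v => (normc (tilt rho v))%:E)).
    by apply/measurable_EFinP; exact: mC_normc.
  by move=> v; rewrite lee_fin normc_ge0.
split; last by rewrite E.
by split; [apply: (mC_comp mt); exact: measurable_vshift|rewrite E].
Qed.

Lemma cint_moved rho : cint eps (moved ^~ rho) = cint eps (tilt rho).
Proof. by apply: (@cint_vshift _ _ _ (tilt rho)); exact: mC_tilt. Qed.

(** An alternating sum over quarter turns: of the powers of p only those of degree 2 modulo 4
    survive. *)
Definition alt (F : C -> C) (p : C) : C := F p - F ('i * p) + F (- p) - F (- 'i * p).

Lemma alt_conj (F : C -> C) p : (alt F p)^* = alt (fun z => (F z)^*) p.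
Proof. by rewrite /alt !(conjcB, conjcD). Qed.

(** Goursat's theorem is applied to z conj (moved v z): the factor z turns the side weights 1, i,
    -1, - i into 1, -1, 1, -1, which are those of [alt]. *)
Lemma contour_moved v (r : R) : 0 < r ->
  intC mu01 (fun t => (pline r (clamp t))^* * alt (moved v) (pline r (clamp t))) /\
  cint mu01 (fun t => (pline r (clamp t))^* * alt (moved v) (pline r (clamp t))) = 0.
Proof.
move=> r0; pose f z := z * (moved v z)^*.
have df : cdiff f by apply: cdiffM (hol v); exact: cdiff_id.
have fc := cdiff_ccont df.
pose g t := f (pline r t) + 'i * f ('i * pline r t) + (- 1) * f (- pline r t) + (- 'i) * f (- 'i * pline r t).
have rc (k : C) : rcont (fun t => f (k * pline r t)).
  have := @rcont_affine _ f (k * (r%:C * (-1 - 'i))) (k * (2 * r%:C)) fc.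
  rewrite (_ : (fun t => _) = fun t => f (k * pline r t))//.
  by apply/funext => t; rewrite plineE; congr f; ring.
have rg : rcont g.
  have rc1 : rcont (fun t => f (pline r t)).
    by rewrite (_ : (fun t => _) = fun t => f (1 * pline r t))//; apply/funext => t; rewrite mul1r.
  have rcm : rcont (fun t => f (- pline r t)).
    by rewrite (_ : (fun t => _) = fun t => f (- 1 * pline r t))//; apply/funext => t; rewrite mulN1r.
  by apply: rcontD; [apply: rcontD; [apply: rcontD; [|apply: rcontZ]|apply: rcontZ]|apply: rcontZ].
have i2 : 'i * 'i = - 1 :> C by exact: mulii.
rewrite (_ : (fun t => _) = fun t => (g (clamp t))^*); last first.
  apply/funext => t; rewrite /g /f; move: (pline r (clamp t)) => p.
  apply: (inv_inj (@conjcK _)); rewrite conjcM conjcK alt_conj conjcK /alt.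
  move: ((moved v p)^*) ((moved v ('i * p))^*) ((moved v (- p))^*) ((moved v (- 'i * p))^*) => X0 X1 X2 X3.
  rewrite [RHS](_ : _ = p * (X0 + ('i * 'i) * X1 + X2 + ('i * 'i) * X3)); last by ring.
  by rewrite i2; ring.
split; first exact: intC_conj (rcont_clamp_intC rg).
by rewrite (cint_conj (rcont_clamp_intC rg)) (cint_mu01_clamp rg) (sq_center df r0) conjc0.
Qed.

Definition taylor3 (w : C) : C := cexp w - 1 - w - w ^+ 2 / 2.

Lemma cint_alt (F : C -> VT -> C) p : intC eps (F p) -> intC eps (F ('i * p)) ->
  intC eps (F (- p)) -> intC eps (F (- 'i * p)) -> cint eps (fun v => alt (F ^~ v) p) =
  cint eps (F p) - cint eps (F ('i * p)) + cint eps (F (- p)) - cint eps (F (- 'i * p)).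
Proof.
move=> i0 i1 i2 i3; rewrite [LHS](cintB (intCD (intCB i0 i1) i2) i3).
by rewrite (cintD (intCB i0 i1) i2) (cintB i0 i1).
Qed.

(** The second order Taylor polynomial of the exponential has degree at most 4 in rho; only the term
    rho^2 (m + b^2 / 2) survives, four times. *)
Lemma alt_tilt p v : alt (tilt ^~ v) p =
  2 * p ^+ 2 * (P v * (b v ^+ 2 + 2 * m)) +
  P v * alt (fun rho => taylor3 (rho * b v + rho ^+ 2 * m)) p.
Proof.
have i2 : 'i ^+ 2 = - 1 :> C by rewrite expr2 mulii.
have E rho : tilt rho v = P v * (1 + rho * b v + rho ^+ 2 * (m + b v ^+ 2 / 2)
    + rho * rho ^+ 2 * (b v * m) + rho ^+ 2 * rho ^+ 2 * (m ^+ 2 / 2))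
    + P v * taylor3 (rho * b v + rho ^+ 2 * m) by rewrite /tilt /taylor3; field.
rewrite /alt !E; move: (taylor3 _) (taylor3 _) (taylor3 _) (taylor3 _) => t0 t1 t2 t3.
have e1' : ('i * p) ^+ 2 = - p ^+ 2 by rewrite exprMn i2 mulN1r.
have e3' : (- 'i * p) ^+ 2 = - p ^+ 2 by rewrite exprMn sqrrN i2 mulN1r.
by rewrite e1' e3' sqrrN; field.
Qed.

(** With x = |b| + |m| the remainder is at most (|rho| x)^3 exp x, and x^3 <= exp (3 x). *)
Lemma taylor3_le (rho : C) v : normc rho <= 1 ->
  normc (taylor3 (rho * b v + rho ^+ 2 * m)) <=
  normc rho ^+ 3 * (expR (4 * normc m) * expR (4 * normc (b v))).
Proof.
move=> r1; set w := rho * b v + _.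
have [_ _ T3] := cexp_taylor w; apply: le_trans T3 _.
set x := normc (b v) + normc m; have x0 : 0 <= x by rewrite addr_ge0 ?normc_ge0.
apply: (@le_trans _ _ ((normc rho * x) ^+ 3 * expR x)).
  rewrite ler_pM ?exprn_ge0 ?normc_ge0 ?expR_ge0//; last by rewrite ler_expR wle1.
  by rewrite lerXn2r ?nnegrE ?normc_ge0 ?wle// mulr_ge0 ?normc_ge0.
rewrite exprMn -mulrA ler_wpM2l ?exprn_ge0 ?normc_ge0// -expRD.
rewrite (_ : 4 * normc m + 4 * normc (b v) = 3%:R * x + x); last by rewrite /x; ring.
rewrite (expRD (3%:R * x)) ler_wpM2r ?expR_ge0// mulr_natl -[x *+ 3]mulr_natl expRM_natl.
rewrite lerXn2r ?nnegrE ?expR_ge0//; have := expR_ge1Dx x; lra.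
Qed.

Definition rest (p : C) (v : VT) : C :=
  P v * alt (fun rho => taylor3 (rho * b v + rho ^+ 2 * m)) p.

Lemma mC_rest p : mC (rest p).
Proof.
have mt rho : mC (fun v => taylor3 (rho * b v + rho ^+ 2 * m)).
  have mw : mC (fun v => rho * b v + rho ^+ 2 * m) by apply: mCD; [apply: mCM => //|]; exact: mC_cst.
  apply: mCB; first by apply: mCB => //; apply: mCB; [exact: mC_cexp|exact: mC_cst].
  by apply: mCM; [|exact: mC_cst]; exact: (mCM mw mw).
exact: mCM mP (mCB (mCD (mCB (mt p) (mt _)) (mt _)) (mt _)).
Qed.

(** Four Taylor remainders give the inner 4, and [normc_cint_le] the outer 2. The order p^3, against
    p^2 in the main term, is what isolates the second moment as r tends to 0. *)
Lemma rest_le p : normc p <= 1 -> intC eps (rest p) /\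
  normc (cint eps (rest p)) <= 2 * (4 * normc p ^+ 3 * expR (4 * normc m) * I).
Proof.
move=> p1; have k0 : 0 <= 4 * normc p ^+ 3 * expR (4 * normc m).
  by rewrite !mulr_ge0 ?exprn_ge0 ?normc_ge0 ?expR_ge0.
have [] := @intC_envelope (rest p) _ k0 (mC_rest p); last first.
  by move=> ip le; split => //; exact: normc_cint_le.
move=> v; rewrite /rest ComplexField.Normc.normcM /envelope mulrCA ler_wpM2l ?normc_ge0//.
set B := expR (4 * normc (b v)).
have b0 := taylor3_le v p1.
have b1 : normc ('i * p) <= 1 by rewrite ComplexField.Normc.normcM normc_i mul1r.
have b2 : normc (- p) <= 1 by rewrite normcN.
have b3 : normc (- 'i * p) <= 1 by rewrite ComplexField.Normc.normcM normcN normc_i mul1r.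
have := taylor3_le v b1; have := taylor3_le v b2; have := taylor3_le v b3; move: b0.
rewrite !(ComplexField.Normc.normcM _ p) !normcN normc_i !mul1r -/B /alt.
move: (taylor3 _) (taylor3 _) (taylor3 _) (taylor3 _) => t1 t2 t3 t0 h0 h3 h2 h1.
have s1 := normc_sub (t0 - t1 + t2) t3; have s2 := le_normcD (t0 - t1) t2; have s3 := normc_sub t0 t1.
have E : 4 * normc p ^+ 3 * expR (4 * normc m) * B = 4 * (normc p ^+ 3 * (expR (4 * normc m) * B)) by ring.
by rewrite E; lra.
Qed.

Lemma intC_second : intC eps (fun v => P v * (b v ^+ 2 + 2 * m)).
Proof.
have [] := @intC_envelope (fun v => P v * (b v ^+ 2 + 2 * m)) (1 + 2 * normc m) => //.
- by rewrite addr_ge0// mulr_ge0// normc_ge0.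
- by apply: mCM => //; apply: mCD; [exact: (mCM mb mb)|exact: mC_cst].
move=> v; rewrite ComplexField.Normc.normcM /envelope mulrCA ler_wpM2l ?normc_ge0//.
apply: le_trans (le_normcD _ _) _; rewrite normcX ComplexField.Normc.normcM.
have x0 := normc_ge0 (b v); set x := normc (b v) in x0 *.
have n2 : normc (2 : C) = 2 by rewrite -real_complex_nat normc_real normr_nat.
have e1' : 1 <= expR (4 * x) by rewrite -[leLHS]expR0 ler_expR; lra.
have e2' : x ^+ 2 <= expR (4 * x).
  apply: (@le_trans _ _ (expR x ^+ 2)).
    by rewrite lerXn2r ?nnegrE ?expR_ge0//; have := expR_ge1Dx x; lra.
  by rewrite -expRM_natl ler_expR; lra.
rewrite n2 [leRHS]mulrDl mul1r; apply: lerD => //.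
by rewrite -[leLHS]mulr1 ler_wpM2l// mulr_ge0// normc_ge0.
Qed.

(* After a translation the integral J(rho) of [tilt rho] has an antiholomorphic integrand, so
   the contour integral of [rho * (J rho)^*] over a square of half side [r] vanishes. Grouping
   the four sides cancels the Taylor terms of J of order 0 and 1, so the second order
   coefficient is O(r). *)
Lemma second_moment_eq0 : cint eps (fun v => P v * (b v ^+ 2 + 2 * m)) = 0.
Proof.
set M2 := cint _ _.
have I0 : 0 <= I by rewrite -lee_fin -envelopeE integral_ge0// => v _; rewrite lee_fin envelope_ge0.
pose K := expR (4 * normc m) * I; have K0 : 0 <= K by rewrite mulr_ge0 ?expR_ge0.
(* The main term has modulus 8/3 r^3 |M2| and the remainder is at most 256 K r^4, whence 96; r <=
   1/2 keeps |p| <= 1 on the contour. *)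
suff H r : 0 < r -> r <= 2^-1 -> normc M2 <= 96 * K * r.
  apply/eqP; rewrite -normc_eq0 eq_le normc_ge0 andbT; apply/ler_addgt0Pr => e e0; rewrite add0r.
  pose r := Num.min 2^-1 (e / (96 * K + 1)).
  have K1 : 0 < 96 * K + 1 by rewrite ltr_wpDl// mulr_ge0.
  have r0 : 0 < r by rewrite lt_min divr_gt0// invr_gt0 ltr0n.
  apply: le_trans (H r r0 _) _; first by rewrite ge_min lexx.
  have re : r <= e / (96 * K + 1) by rewrite ge_min lexx orbT.
  rewrite ler_pdivlMr// in re; apply: le_trans re; by rewrite mulrDr mulr1 [r * _]mulrC lerDl ltW.
move=> r0 r2; pose p t := pline r (clamp t).
have p2 t : normc (p t) <= 2 * r by apply: normc_pline; [exact: ltW|exact: clamp01].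
have p1 t : normc (p t) <= 1 by apply: le_trans (p2 t) _; lra.
have kp1 (k : C) t : normc k = 1 -> normc (k * p t) <= 1 by move=> k1; rewrite ComplexField.Normc.normcM k1 mul1r.
have ni : normc (- 'i : C) = 1 by rewrite normcN normc_i.
pose h (z : T * VT) := (p z.1)^* * alt (moved z.2) (p z.1).
have rp : rcont (pline r).
  have fc : ccont (fun z : C => z) by exact/cdiff_ccont/cdiff_id.
  have := @rcont_affine _ _ (r%:C * (-1 - 'i)) (2 * r%:C) fc.
  by rewrite (_ : (fun t => _) = pline r)//; apply/funext => t; rewrite plineE.
have mp : mC (p : T -> C) by exact/rcont_mC/rcont_clamp.
have mh : mC h.
  have mp' : mC (fun z : T * VT => p z.1) by apply: (mC_comp mp); exact: measurable_fst.
  have mm (k : C) : mC (fun z : T * VT => moved z.2 (k * p z.1)).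
    have mk : mC (fun t : T => k * p t) by apply: mCM => //; exact: mC_cst.
    have mv := measurable_vshift_tlin e1 e2 mk.
    apply: mCM; first exact: (mC_comp mP mv).
    have mk' : mC (fun z : T * VT => k * p z.1) by apply: mCM => //; exact: mC_cst.
    apply: mC_cexp; apply: mCD; first by apply: mCM => //; exact: (mC_comp mb mv).
    by apply: mCM; [exact: (mCM mk' mk')|exact: mC_cst].
  apply: mCM; first exact: mC_conj.
  apply: mCB => //; apply: mCD.
    by apply: mCB => //; apply: mC_eq (mm 1) => z; rewrite mul1r.
  by apply: mC_eq (mm (- 1)) => z; rewrite mulN1r.
have im t : [/\ intC eps (moved ^~ (p t)), intC eps (moved ^~ ('i * p t)),
    intC eps (moved ^~ (- p t)) & intC eps (moved ^~ (- 'i * p t))].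
  split; apply: (intC_moved _).1 => //; first exact/kp1/normc_i.
    by rewrite normcN.
  exact: kp1.
have ia t : intC eps (fun v => alt (moved v) (p t)).
  have [i0 i1 i2 i3] := im t.
  by apply: intCB => //; apply: intCD => //; exact: intCB.
have hE t : cint eps (fun v => h (t, v)) = (p t)^* * (2 * p t ^+ 2 * M2 + cint eps (rest (p t))).
  have [i0 i1 i2 i3] := im t; rewrite /h /= cintZ; last exact: ia.
  congr (_ * _); rewrite [LHS](cint_alt i0 i1 i2 i3) !cint_moved.
  have [j0 _] := intC_tilt (p1 t); have [j1 _] := intC_tilt (kp1 'i t (@normc_i R)).
  have [j3 _] := intC_tilt (kp1 (- 'i) t ni).
  have j2 : intC eps (tilt (- p t)) by apply: (intC_tilt _).1; rewrite normcN.
  rewrite -[LHS](cint_alt j0 j1 j2 j3) (cint_eq _ (fun v => alt_tilt (p t) v)).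
  have [ir _] := rest_le (p1 t).
  by rewrite cintD//; [rewrite cintZ//; exact: intC_second|apply: intCZ; exact: intC_second].
have hM t : (\int[eps_sf]_v (normc (h (t, v)))%:E <= (4 * (expR (normc m) * I))%:E)%E.
  have q0 : (0 <= expR (normc m) * I) by rewrite mulr_ge0 ?expR_ge0.
  have [i0 i1 i2 i3] := im t.
  have B rho : normc rho <= 1 -> (\int[eps]_v (normc (moved v rho))%:E <= (expR (normc m) * I)%:E)%E.
    by move=> /intC_moved[].
  have BN rho : normc rho <= 1 -> (\int[eps]_v (normc (- 1 * moved v rho))%:E <= (expR (normc m) * I)%:E)%E.
    move=> r1; rewrite integral_normcZ; last by have [] := intC_moved r1.
    have -> : normc (- 1 : C) = 1 by rewrite normcN (_ : 1 = 1%:C)// normc_real normr1.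
    by rewrite mul1e; exact: B.
  have -> : 4 * (expR (normc m) * I) = expR (normc m) * I + expR (normc m) * I
     + expR (normc m) * I + expR (normc m) * I by ring.
  have S := integral_normcD (intCD (intCD i0 (intCZ (- 1) i1)) i2) (intCZ (- 1) i3)
    (integral_normcD (intCD i0 (intCZ (- 1) i1)) i2 (integral_normcD i0 (intCZ (- 1) i1)
     (B _ (p1 t)) (BN _ (kp1 _ _ (@normc_i R)))) (B (- p t) _)) (BN _ (kp1 _ t ni)).
  have nm : normc (- p t) <= 1 by rewrite normcN.
  have E : (\int[eps]_v (normc (moved v (p t) + -1 * moved v ('i * p t) + moved v (- p t) +
      -1 * moved v (- 'i * p t)))%:E = \int[eps]_v (normc (alt (moved v) (p t)))%:E)%E.
    by apply: eq_integral => v _; rewrite /alt !mulN1r.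
  move: (S nm); rewrite E => {}S; apply: le_trans S.
  rewrite (_ : (\int[eps_sf]_v _)%E = (\int[eps]_v (normc ((p t)^* * alt (moved v) (p t)))%:E)%E)//.
  rewrite (integral_normcZ _ (ia t)) -[leRHS]mul1e lee_wpmul2r//; last by rewrite lee_fin normc_conj.
  by apply: integral_ge0 => v _; rewrite lee_fin normc_ge0.
have [mF F0] := @cint_fubini_zero _ _ T VT R mu01 eps_sf h _ mh (fun t => intCZ (p t)^* (ia t)) hM
  (fun v => (contour_moved v r0).1) (fun v => (contour_moved v r0).2).
have F0' : cint mu01 (fun t => (p t)^* * (2 * p t ^+ 2 * M2 + cint eps (rest (p t)))) = 0.
  by rewrite -[RHS]F0; apply: cint_eq => t; rewrite -hE.
have mF' : mC (fun t : T => (p t)^* * (2 * p t ^+ 2 * M2 + cint eps (rest (p t)))).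
  by apply: mC_eq mF => t; rewrite -hE.
pose g1 t := (p t)^* * p t ^+ 2; pose g2 t := (p t)^* * cint eps (rest (p t)).
have np t := normc_ge0 (p t).
have mg1 : mC (g1 : T -> C).
  by apply: mCM; [exact: mC_conj|exact: (mCM mp mp)].
have ig1 : intC mu01 g1.
  apply: (@intC_mu01 _ _ 1) => // t; rewrite /g1 ComplexField.Normc.normcM normc_conj normcX.
  by rewrite mulr_ile1 ?exprn_ge0// exprn_ile1.
(* Measurability in t of the integrated remainder is obtained by difference, from that of the full
   integral. *)
have mg2 : mC (g2 : T -> C).
  apply: (@mC_eq _ _ _ (fun t => (p t)^* * (2 * p t ^+ 2 * M2 + cint eps (rest (p t))) - 2 * M2 * g1 t)).
    by move=> t; rewrite /g1 /g2; ring.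
  by apply: mCB => //; apply: mCM => //; exact: mC_cst.
have r0' : 0 <= r by exact: ltW.
have b2 t : normc (g2 t) <= 128 * K * r ^+ 4.
  rewrite /g2 ComplexField.Normc.normcM normc_conj; have [_ le] := rest_le (p1 t).
  apply: (@le_trans _ _ (2 * r * (2 * (4 * (2 * r) ^+ 3 * expR (4 * normc m) * I)))).
    apply: ler_pM => //; first exact: normc_ge0.
    apply: le_trans le _; rewrite ler_wpM2l// ler_wpM2r// ler_wpM2r ?expR_ge0// ler_wpM2l//.
    by rewrite lerXn2r ?nnegrE// mulr_ge0.
  by rewrite le_eqVlt; apply/orP; left; apply/eqP; rewrite /K; ring.
have ig2 : intC mu01 g2 by exact: intC_mu01 b2.
have I2 : normc (cint mu01 g2) <= 2 * (128 * K * r ^+ 4).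
  apply: normc_cint_le => //; apply: (@le_trans _ _ (\int[mu01]_x (cst (128 * K * r ^+ 4)%:E x))%E); last first.
    by rewrite integral_cst// [X in (_ * X)%E]probability_setT mule1.
  apply: ge0_le_integral => //.
  - by move=> t _; rewrite lee_fin normc_ge0.
  - by apply/measurable_EFinP; exact: mC_normc.
  - by move=> t _; rewrite lee_fin.
have E0 : 2 * M2 * (- (4 / 3) * 'i * (r ^+ 3)%:C) + cint mu01 g2 = 0.
  rewrite -[RHS]F0' -moment_pline -cintZ// -cintD//; last exact: intCZ.
  by apply: cint_eq => t; rewrite /g1 /g2 /p; ring.
have E1 : normc (cint mu01 g2) = 8 / 3 * r ^+ 3 * normc M2.
  have -> : cint mu01 g2 = (8 / 3 * r ^+ 3)%:C * ('i * M2).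
    move: E0 => /eqP; rewrite addrC addr_eq0 => /eqP ->.
    by rewrite !real_complexM real_complexV !real_complex_nat; field.
  rewrite !ComplexField.Normc.normcM normc_i mul1r normc_real ger0_norm//.
  by rewrite mulr_ge0 ?exprn_ge0.
move: I2; rewrite E1 => H2; have r3 : 0 < 8 / 3 * r ^+ 3 by rewrite mulr_gt0// exprn_gt0.
rewrite -(ler_pM2l r3); apply: le_trans H2 _.
by rewrite le_eqVlt; apply/orP; left; apply/eqP; field.
Qed.

End second_moment.

(** * The transported Gaussian *)

Section dot_product.
Context {R : realType} {n : nat}.
Local Notation C := R[i].
Implicit Types (u v w : 'cV[C]_n) (M : 'M[C]_n) (c : C).

(** Bilinear and not Hermitian, as the exponents are complex quadratic forms. *)
Definition dot u v : C := (u^T *m v) 0 0.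

Lemma dotE u v : dot u v = \sum_i u i 0 * v i 0.
Proof. by rewrite /dot mxE; apply: eq_bigr => i _; rewrite mxE. Qed.

Lemma dotC u v : dot u v = dot v u.
Proof. by rewrite !dotE; apply: eq_bigr => i _; rewrite mulrC. Qed.

Lemma dotDr u v w : dot u (v + w) = dot u v + dot u w.
Proof. by rewrite /dot mulmxDr mxE. Qed.

Lemma dotNr u v : dot u (- v) = - dot u v.
Proof. by rewrite /dot mulmxN mxE. Qed.

Lemma dotZr u c v : dot u (c *: v) = c * dot u v.
Proof. by rewrite /dot -scalemxAr mxE. Qed.

Lemma dotDl u v w : dot (v + w) u = dot v u + dot w u.
Proof. by rewrite dotC dotDr !(dotC u). Qed.

Lemma dotNl u v : dot (- v) u = - dot v u.
Proof. by rewrite dotC dotNr (dotC u). Qed.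

Lemma dotZl u c v : dot (c *: v) u = c * dot v u.
Proof. by rewrite dotC dotZr (dotC u). Qed.

Lemma dot0r u : dot u 0 = 0.
Proof. by rewrite /dot mulmx0 mxE. Qed.

Definition dot_linear := (dotDl, dotDr, dotNl, dotNr, dotZl, dotZr).

Lemma dot_mulmx M u v : dot u (M *m v) = dot (M^T *m u) v.
Proof. by rewrite /dot trmx_mul trmxK mulmxA. Qed.

Lemma dot_sym M u v : M^T = M -> dot u (M *m v) = dot v (M *m u).
Proof. by move=> sM; rewrite dot_mulmx sM dotC. Qed.

Lemma dot_conj u v : (dot u v)^* = dot (conjmx u) (conjmx v).
Proof. by rewrite /dot map_trmx -conjmxM [RHS]mxE. Qed.

Lemma dot_sqnorm u : dot u (conjmx u) = (sqnorm u)%:C.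
Proof. by rewrite dotC -hform1 /dot map_trmx. Qed.

Lemma sqnorm_conj u : sqnorm (conjmx u) = sqnorm u.
Proof. by apply: eq_bigr => i _; rewrite mxE normc_conj. Qed.

Lemma normc_dot_le u v : 2 * normc (dot u v) <= sqnorm u + sqnorm v.
Proof.
rewrite dotE /sqnorm -big_split /=; apply: (@le_trans _ _ (2 * \sum_i normc (u i 0 * v i 0))).
  by rewrite ler_wpM2l//; exact: normc_sum.
rewrite mulr_sumr; apply: ler_sum => i _; rewrite ComplexField.Normc.normcM.
have := sqr_ge0 (normc (u i 0) - normc (v i 0)); rewrite sqrrB; lra.
Qed.

Lemma sqnormZ c u : sqnorm (c *: u) = normc c ^+ 2 * sqnorm u.
Proof.
by rewrite /sqnorm mulr_sumr; apply: eq_bigr => i _; rewrite mxE ComplexField.Normc.normcM exprMn.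
Qed.

Lemma sqnormD_le u v : sqnorm (u + v) <= 2 * sqnorm u + 2 * sqnorm v.
Proof.
rewrite /sqnorm !mulr_sumr -big_split /=; apply: ler_sum => i _.
by rewrite addmxE; exact: sqr_normcD.
Qed.

Lemma sqnormN u : sqnorm (- u) = sqnorm u.
Proof. by apply: eq_bigr => i _; rewrite oppmxE normcN. Qed.

Lemma sqnorm_mulmx_le M : exists2 K : R, 0 < K & forall u, sqnorm (M *m u) <= K * sqnorm u.
Proof.
pose k i := \sum_j normc (M i j); have k0 i : 0 <= k i by apply: sumr_ge0 => j _; exact: normc_ge0.
have K0 : 0 <= \sum_i k i ^+ 2 by apply: sumr_ge0 => i _; exact: sqr_ge0.
exists (\sum_i k i ^+ 2 + 1); first by rewrite ltr_wpDl.
move=> u; have u0 := sqnorm_ge0 u; rewrite mulrDl mul1r; apply: (@le_trans _ _ ((\sum_i k i ^+ 2) * sqnorm u)); last by rewrite lerDl.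
rewrite {1}/sqnorm mulr_suml; apply: ler_sum => i _.
have uj j : normc (u j 0) <= Num.sqrt (sqnorm u).
  rewrite -(@ler_sqr _ (normc _)) ?nnegrE ?normc_ge0 ?sqrtr_ge0// sqr_sqrtr//.
  by rewrite /sqnorm (bigD1 j)//= lerDl; apply: sumr_ge0 => l _; exact: sqr_ge0.
have h : normc ((M *m u) i 0) <= k i * Num.sqrt (sqnorm u).
  rewrite mxE; apply: le_trans (normc_sum _ _ _) _; rewrite /k mulr_suml; apply: ler_sum => j _.
  by rewrite ComplexField.Normc.normcM ler_wpM2l// normc_ge0.
rewrite -[X in _ * X]sqr_sqrtr// -exprMn lerXn2r ?nnegrE ?normc_ge0//.
by rewrite mulr_ge0 ?sqrtr_ge0.
Qed.

End dot_product.

Section transported_formula.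
Context {R : realType} {n : nat}.
Local Notation C := R[i].
Local Notation V := (@V R n).
Implicit Types (A Z : 'M[C]_n) (al : 'cV[C]_n) (v : V).

Definition sq2 : C := (Num.sqrt 2)%:C.

Lemma sq2_sqr : sq2 * sq2 = 2.
Proof. by rewrite -real_complexM -expr2 sqr_sqrtr// real_complex_nat. Qed.

Lemma sq2_neq0 : sq2 != 0.
Proof. by rewrite real_complex_eq0 sqrtr_eq0 -ltNge. Qed.

Lemma sq2V : sq2^-1 = sq2 / 2.
Proof. by rewrite -[in RHS]sq2_sqr invfM mulrA mulfV ?sq2_neq0// mul1r. Qed.

(** The holomorphic coordinate before normalization by (2 Im Z)^(-1/2), which is [rootm]. *)
Definition zeta Z v : 'cV[C]_n := xcoord v - conjmx Z *m ycoord v.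
Definition rootm Z : 'M[C]_n := toC (invmx (sqrtmx (2 *: Immx Z))).
Definition amp A Z : R := \det (Immx A) `^ 4^-1 * \det (Immx Z) `^ 4^-1
    / normc (\det (Xi A Z)) `^ 2^-1.
Definition center A al : 'cV[C]_n := sq2 *: (toC (sqrtmx (Immx A)) *m conjmx al).
Definition qcoord A al v : 'cV[C]_n := xcoord v - A *m ycoord v - center A al.
Definition lin A al v : C := 2^-1 * dot (conjmx al) (conjmx al) + 'i * dot (center A al) (ycoord v)
   - 'i / 2 * dot (ycoord v) (xcoord v - A *m ycoord v).

Lemma zcoordE Z v : zcoord Z v = rootm Z *m zeta Z v. Proof. by []. Qed.

Lemma conj_xcoord v : conjmx (xcoord v) = xcoord v.
Proof. by apply/matrixP => i j; rewrite !mxE conjc_real. Qed.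

Lemma conj_ycoord v : conjmx (ycoord v) = ycoord v.
Proof. by apply/matrixP => i j; rewrite !mxE conjc_real. Qed.

Lemma conj_rootm Z : conjmx (rootm Z) = rootm Z.
Proof. exact: conjmx_toC. Qed.

Section siegel_point.
Variables (Z : 'M[C]_n) (hZ : siegel Z).
Let Y := Immx Z.
Let S := sqrtmx Y.

Lemma sqrtmx_posdef2 : sqrtmx (2 *: Y) = Num.sqrt 2 *: S.
Proof.
have [pS SS] := sqrtmxP hZ.2; apply: sqrtmx_eq.
  by apply: posdefZ => //; rewrite sqrtr_gt0.
by rewrite -scalemxAl -scalemxAr scalerA -expr2 sqr_sqrtr// SS.
Qed.

Lemma sqrtmx_tr : (toC S)^T = toC S :> 'M[C]_n.
Proof. by have [[sS _] _] := sqrtmxP hZ.2; rewrite map_trmx sS. Qed.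

Lemma toC_sqrtmx : toC S *m toC S = toC Y :> 'M[C]_n.
Proof. by have [_ SS] := sqrtmxP hZ.2; rewrite -toCM SS. Qed.

Lemma rootmE : rootm Z = sq2^-1 *: toC (invmx S).
Proof.
have [pS _] := sqrtmxP hZ.2; rewrite /rootm sqrtmx_posdef2 invmx_scale ?posdef_unit//.
by apply/matrixP => i j; rewrite !mxE real_complexM real_complexV.
Qed.

Lemma rootm_tr : (rootm Z)^T = rootm Z.
Proof.
have [[sS _] _] := sqrtmxP hZ.2.
by rewrite rootmE linearZ /= map_trmx trmx_inv sS.
Qed.

Lemma mul_sqrtmx_rootm : toC S *m rootm Z = sq2^-1%:M.
Proof.
have [pS _] := sqrtmxP hZ.2.
rewrite rootmE -scalemxAr -toCM mulmxV ?posdef_unit//.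
by apply/matrixP => i j; rewrite !mxE; case: eqP => _; rewrite ?mulr1 ?mulr0.
Qed.

Lemma mul_rootm_sqrtmx : rootm Z *m toC S = sq2^-1%:M.
Proof.
by rewrite -[LHS]trmxK trmx_mul rootm_tr sqrtmx_tr mul_sqrtmx_rootm tr_scalar_mx.
Qed.

Lemma mul_rootm2_Im : rootm Z *m (rootm Z *m toC Y) = 2^-1%:M.
Proof.
rewrite -toC_sqrtmx (mulmxA (rootm Z) (toC S)) mul_rootm_sqrtmx mul_scalar_mx -scalemxAr mul_rootm_sqrtmx.
by apply/matrixP => i j; rewrite !mxE mulrnAr -invfM sq2_sqr.
Qed.

Lemma dot_rootm2 (u w : 'cV[C]_n) : dot (rootm Z *m u) (rootm Z *m w) = dot u (rootm Z *m (rootm Z *m w)).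
Proof. by rewrite [RHS]dot_mulmx rootm_tr. Qed.

Lemma zeta_sub_conj v : zeta Z v - conjmx (zeta Z v) = (2 * 'i) *: (toC Y *m ycoord v).
Proof.
rewrite /zeta conjmxB conjmxM conjmxK conj_xcoord conj_ycoord.
rewrite scalemxAl -siegel_sub_self mulmxBl.
by apply/matrixP => i j; rewrite !(addmxE, oppmxE); ring.
Qed.

(** Here rootm^2 Im Z = 1/2 and zeta - conj zeta = 2 i (Im Z) y. For u = zeta the identity reads z.z
    - |z|^2 = i zeta.y and trades the nonholomorphic Gaussian factor for y. *)
Lemma dot_zcoord_sub_conj v u : dot (rootm Z *m u) (zcoord Z v - conjmx (zcoord Z v)) = 'i * dot u (ycoord v).
Proof.
rewrite zcoordE conjmxM conj_rootm -mulmxBr zeta_sub_conj dot_rootm2 -!scalemxAr !dotZr.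
by rewrite !mulmxA -[rootm Z *m _ *m _]mulmxA mul_rootm2_Im mul_scalar_mx dotZr; field.
Qed.

End siegel_point.

Lemma Xi_facts A Z : siegel A -> siegel Z ->
  [/\ Xi A Z \in unitmx, (Xi A Z)^T = Xi A Z & (invmx (Xi A Z))^T = invmx (Xi A Z)].
Proof.
move=> hA hZ; have [s _ u] := siegel_sub_conj hA hZ.
have c0 : (2 * 'i)^-1 != 0 :> C by rewrite invr_eq0 mulf_neq0 ?two_neq0 ?i_neq0.
have sX : (Xi A Z)^T = Xi A Z by rewrite /Xi linearZ /= s.
split => //; last by rewrite trmx_inv sX.
by rewrite /Xi unitmxZ// unitfE.
Qed.

Lemma block_form (u w : 'cV[C]_n) (M1 M2 M3 M4 : 'M[C]_n) :
  ((col_mx u w)^T *m block_mx M1 M2 M3 M4 *m col_mx u w) 0 0 =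
  dot u (M1 *m u) + dot u (M2 *m w) + dot w (M3 *m u) + dot w (M4 *m w).
Proof.
rewrite tr_col_mx mul_row_block mul_row_col !mulmxDl !addmxE -!mulmxA /dot; ring.
Qed.

(** Because A = conj Z + 2 i Xi. *)
Lemma coord_facts A Z v : siegel A -> siegel Z ->
  xcoord v - A *m ycoord v = zeta Z v - (2 * 'i) *: (Xi A Z *m ycoord v).
Proof.
move=> hA hZ; rewrite /zeta /Xi -scalemxAl scalerA divff ?scale1r; last first.
  by rewrite mulf_neq0 ?two_neq0 ?i_neq0.
rewrite mulmxBl; apply/matrixP => i j; rewrite !(addmxE, oppmxE); ring.
Qed.

(** Completion of the square. With h = Xi y one has X h = y and x - A y = zeta - 2 i h, so the right
    side depends on Z only through X. *)
Lemma exponent_identity (X : 'M[C]_n) (ze h y c1 a : 'cV[C]_n) :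
  X^T = X -> X *m h = y ->
  2^-1 * (dot a a - dot c1 (X *m c1) + 2 * (sq2^-1 * dot c1 (X *m ze)) - 2^-1 * dot ze (X *m ze))
  + 2^-1 * ('i * dot ze y) =
  - 4^-1 * dot (ze - (2 * 'i) *: h - sq2 *: c1) (X *m (ze - (2 * 'i) *: h - sq2 *: c1)) +
  (2^-1 * dot a a + 'i * dot (sq2 *: c1) y - 'i / 2 * dot y (ze - (2 * 'i) *: h)).
Proof.
move=> sX hy.
rewrite !mulmxBr -!scalemxAr hy !dot_linear.
rewrite (dot_sym h ze sX) (dot_sym c1 ze sX) (dot_sym h c1 sX) (dot_sym ze c1 sX) hy.
rewrite (dotC h y) (dotC y ze) sq2V.
have i2 : 'i * 'i = - 1 :> C by exact: mulii.
move: (dot a a) (dot c1 (X *m c1)) (dot c1 (X *m ze)) (dot ze (X *m ze)) (dot ze y) (dot c1 y) (dot y h).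
move=> d1 d2 d3 d4 d5 d6 d7.
have s2 := sq2_sqr; move: sq2 s2 => s s2.
(* The products i i and s s are displayed separately because [field] treats i and s as free symbols;
   the relation s s = 2 is then substituted. *)
rewrite [RHS](_ : _ = - 4^-1 * d4 + ('i * d5 - 'i / 2 * d5) + ('i * 'i) * d7 - ('i * 'i) * d7
   + 2^-1 * s * d3 - 4^-1 * (s * s) * d2 + 2^-1 * d1); last by field.
by rewrite s2; field.
Qed.

Lemma transportedE A Z al v : siegel A -> siegel Z ->
  transported A Z al v = (amp A Z)%:C *
    cexp (- 4^-1 * dot (qcoord A al v) (invmx (Xi A Z) *m qcoord A al v) + lin A al v).
Proof.
move=> hA hZ; rewrite /transported -/(amp A Z); congr (_ * cexp _).
have [uX sXi sX] := Xi_facts hA hZ.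
rewrite /qcoord /lin !(coord_facts v hA hZ) /center.
have E := exponent_identity (zeta Z v) (toC (sqrtmx (Immx A)) *m conjmx al) (conjmx al) sX
  (mulKmx uX (ycoord v)).
rewrite -E {E} block_form.
move: (invmx (Xi A Z)) sX => X sX; set y := ycoord v; set a := conjmx al.
have sA := sqrtmx_tr hA; have sZ := sqrtmx_tr hZ.
move: (toC (sqrtmx (Immx A))) sA => S sA.
have zd := dot_zcoord_sub_conj hZ v (zeta Z v); rewrite -zcoordE in zd.
have zS : toC (sqrtmx (Immx Z)) *m zcoord Z v = sq2^-1 *: zeta Z v.
  by rewrite zcoordE mulmxA mul_sqrtmx_rootm// mul_scalar_mx.
move: (toC (sqrtmx (Immx Z))) sZ zS => S' sZ zS.
move: (zcoord Z v) zS zd => z zS zd; move: (zeta Z v) zS zd => ze zS zd.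
have e1 : dot a ((1%:M - S *m X *m S) *m a) = dot a a - dot (S *m a) (X *m (S *m a)).
  by rewrite mulmxBl mul1mx dotDr dotNr -!mulmxA dot_mulmx sA.
have e2 : dot a (S *m X *m S' *m z) = sq2^-1 * dot (S *m a) (X *m ze).
  by rewrite -!mulmxA zS dot_mulmx sA -scalemxAr dotZr.
have e3 : dot z (S' *m X *m S *m a) = sq2^-1 * dot (S *m a) (X *m ze).
  by rewrite -!mulmxA dot_mulmx sZ zS dotZl (dot_sym ze _ sX).
have e4 : dot z ((1%:M - S' *m X *m S') *m z) = dot z z - 2^-1 * dot ze (X *m ze).
  rewrite mulmxBl mul1mx dotDr dotNr -!mulmxA zS dot_mulmx sZ zS -scalemxAr dotZl dotZr mulrA.
  by rewrite -invfM sq2_sqr.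
rewrite e1 e2 e3 e4 (_ : (sqnorm z / 2)%:C = 2^-1 * (sqnorm z)%:C); last first.
  by rewrite real_complexM real_complexV real_complex_nat mulrC.
rewrite -dot_sqnorm -zd dotDr dotNr; ring.
Qed.

End transported_formula.

(** * Gaussian decay of the transported functions *)

Section gaussian_decay.
Context {R : realType} {n : nat}.
Local Notation C := R[i].
Local Notation V := (@V R n).
Implicit Types (A Z : 'M[C]_n) (al : 'cV[C]_n) (v : V).

Lemma vsqrE v : vsqr v = sqnorm (xcoord v) + sqnorm (ycoord v).
Proof.
by rewrite /vsqr /tsqr /sqnorm; congr (_ + _); apply: eq_bigr => i _; rewrite mxE normc_real real_normK ?num_real.
Qed.

Definition hqf (P : 'M[R]_n) (t : 'cV[C]_n) : R := qf P (Remx t) + qf P (Immx t).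

Lemma qfD (P Q : 'M[R]_n) u : qf (P + Q) u = qf P u + qf Q u.
Proof. by rewrite /qf mulmxDr mulmxDl mxE. Qed.

Lemma qfZ c (P : 'M[R]_n) u : qf (c *: P) u = c * qf P u.
Proof. by rewrite /qf -scalemxAr -scalemxAl mxE. Qed.

Lemma hqf_dot (P : 'M[R]_n) t : P^T = P -> dot (conjmx t) (toC P *m t) = (hqf P t)%:C.
Proof. by move=> sP; rewrite /dot mulmxA hform_real. Qed.

Lemma Re_dot_sym (M : 'M[C]_n) t : M^T = M -> complex.Re (dot (conjmx t) (M *m t)) = hqf (Remx M) t.
Proof. by move=> sM; rewrite /dot mulmxA Im_hform// Re_pair. Qed.

Lemma hqfD (P Q : 'M[R]_n) t : hqf (P + Q) t = hqf P t + hqf Q t.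
Proof. by rewrite /hqf !qfD; ring. Qed.

Lemma hqfZ c (P : 'M[R]_n) t : hqf (c *: P) t = c * hqf P t.
Proof. by rewrite /hqf !qfZ mulrDr. Qed.

Lemma Remx_Xi A Z : Remx (Xi A Z) = 2^-1 *: (Immx A + Immx Z).
Proof.
apply/matrixP => i j; rewrite !mxE invfM invi; set a := A i j; set z := Z i j.
rewrite (_ : 2^-1 = (2^-1)%:C :> C); last by rewrite real_complexV real_complex_nat.
by rewrite !reimE; ring.
Qed.

(** For u = (Im Z)^(1/2) t / sqrt 2 the left side is Re z.(z - u) / 2 - |z|^2 / 2. The product is
    bounded by (|z|^2 + |z - u|^2) / 2; expanding |z - u|^2 with Re Xi = (Im A + Im Z) / 2, the
    terms in Im Z cancel. *)
Lemma quadratic_decay A Z v t : siegel A -> siegel Z -> zeta Z v = Xi A Z *m t ->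
  complex.Re (- 4^-1 * dot (zeta Z v) t + 2^-1 * ('i * dot (zeta Z v) (ycoord v)))
    <= - (8^-1 * hqf (Immx A) t).
Proof.
move=> hA hZ zt; have [uX sXi _] := Xi_facts hA hZ.
have zd := dot_zcoord_sub_conj hZ v (zeta Z v); rewrite -zcoordE in zd.
have zS : toC (sqrtmx (Immx Z)) *m zcoord Z v = sq2^-1 *: zeta Z v.
  by rewrite zcoordE mulmxA mul_sqrtmx_rootm// mul_scalar_mx.
have sZ := sqrtmx_tr hZ; have SS := toC_sqrtmx hZ.
have cS : conjmx (toC (sqrtmx (Immx Z))) = toC (sqrtmx (Immx Z)) :> 'M[C]_n by exact: conjmx_toC.
have HR := Re_dot_sym t sXi; have Xr := Remx_Xi A Z; rewrite -zt in HR.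
have HY := hqf_dot t hZ.2.1; have cs : sq2^* = sq2 :> C by exact: conjc_real.
move: (toC (sqrtmx (Immx Z))) zS sZ SS cS => S zS sZ SS cS.
rewrite -zd; move: (zcoord Z v) zS zd => z zS _; move: (zeta Z v) zS HR => ze zS HR.
have [u uE] : exists u, u = sq2^-1 *: (S *m t) by eexists.
have du w : dot w u = sq2^-1 * dot (S *m w) t.
  by rewrite uE dotZr dot_mulmx sZ.
have ss : sq2^-1 * sq2^-1 = 2^-1 :> C by rewrite -invfM sq2_sqr.
have e1 : 2 * dot z u = dot ze t.
  by rewrite du zS dotZl (mulrA sq2^-1) ss mulrA mulfV ?two_neq0// mul1r.
have cu : conjmx u = sq2^-1 *: (S *m conjmx t).
  by rewrite uE conjmxZ conjmxM cS conjcV cs.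
have e2 : 2 * dot (conjmx u) z = dot (conjmx t) ze.
  by rewrite cu dotZl -[S in S *m _]sZ -dot_mulmx zS dotZr (mulrA sq2^-1) ss mulrA mulfV ?two_neq0// mul1r.
have e3 : 2 * (sqnorm u)%:C = dot (conjmx t) (toC (Immx Z) *m t).
  rewrite -dot_sqnorm dotC du cu -scalemxAr dotZl [in RHS]dot_mulmx map_trmx hZ.2.1 -SS mulmxA.
  by rewrite (mulrA sq2^-1) ss mulrA mulfV ?two_neq0// mul1r.
have n1 : sqnorm (z - u) = sqnorm z - 2 * complex.Re (dot (conjmx u) z) + sqnorm u.
  have -> : sqnorm (z - u) = complex.Re (dot (z - u) (conjmx (z - u))) by rewrite dot_sqnorm Re_real.
  rewrite conjmxB !dot_linear !dot_sqnorm (dotC u (conjmx z)) (_ : dot (conjmx z) u = (dot (conjmx u) z)^*); last first.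
    by rewrite dot_conj conjmxK dotC.
  by rewrite (dotC z) !reimE; ring.
have e2' : 2 * complex.Re (dot (conjmx u) z) = 2^-1 * hqf (Immx A) t + 2^-1 * hqf (Immx Z) t.
  rewrite -mulrDr -hqfD -hqfZ -Xr -HR -e2 !reimE.
  by ring.
have e3' : 2 * sqnorm u = hqf (Immx Z) t.
  have H : (2 * sqnorm u)%:C = (hqf (Immx Z) t)%:C :> C by rewrite real_complexM real_complex_nat e3 HY.
  by have := congr1 (@complex.Re R) H; rewrite !Re_real.
rewrite -e1 dotDr dotNr dot_sqnorm.
have -> : - 4^-1 * (2 * dot z u) + 2^-1 * (dot z z - (sqnorm z)%:C) =
    (2^-1)%:C * dot z (z - u) - (2^-1 * sqnorm z)%:C.
  by rewrite dotDr dotNr real_complexM real_complexV real_complex_nat; field.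
have N := normc_dot_le z (z - u); rewrite n1 in N.
have le := le_trans (ler_norm _) (Re_le_normc (dot z (z - u))).
by rewrite !reimE mul0r !subr0; lra.
Qed.

(** zeta is bounded through t, then y through zeta - conj zeta, then x through zeta and y. *)
Lemma sqnorm_coords A Z : siegel A -> siegel Z -> exists2 k : R, 0 < k &
  forall v t, zeta Z v = Xi A Z *m t -> vsqr v <= k * sqnorm t.
Proof.
move=> hA hZ; have [k1 k10 H1] := sqnorm_mulmx_le ((2 * 'i)^-1 *: toC (invmx (Immx Z)) : 'M[C]_n).
have [k2 k20 H2] := sqnorm_mulmx_le (conjmx Z); have [k3 k30 H3] := sqnorm_mulmx_le (Xi A Z).
have uY := posdef_unit hZ.2.
exists ((2 + (2 * k2 + 1) * (4 * k1)) * k3); first by rewrite mulr_gt0// addr_gt0// mulr_gt0// ?mulr_gt0// addr_gt0// mulr_gt0.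
move=> v t zt; have yE : ycoord v = ((2 * 'i)^-1 *: toC (invmx (Immx Z))) *m (zeta Z v - conjmx (zeta Z v)).
  rewrite zeta_sub_conj// -scalemxAl -scalemxAr scalerA mulVf ?mulf_neq0 ?two_neq0 ?i_neq0//.
  by rewrite scale1r mulmxA -toCM mulVmx// map_mx1 mul1mx.
have y1 : sqnorm (ycoord v) <= k1 * (4 * sqnorm (zeta Z v)).
  rewrite yE; apply: le_trans (H1 _) _; rewrite ler_pM2l//.
  by apply: le_trans (sqnormD_le _ _) _; rewrite sqnormN sqnorm_conj; lra.
have x1 : sqnorm (xcoord v) <= 2 * sqnorm (zeta Z v) + 2 * (k2 * sqnorm (ycoord v)).
  rewrite -[xcoord v](subrK (conjmx Z *m ycoord v)); apply: le_trans (sqnormD_le _ _) _.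
  by rewrite lerD2l ler_pM2l//; exact: H2.
have z1 : sqnorm (zeta Z v) <= k3 * sqnorm t by rewrite zt.
rewrite vsqrE; apply: (@le_trans _ _ ((2 + (2 * k2 + 1) * (4 * k1)) * sqnorm (zeta Z v))).
  have : (2 * k2 + 1) * sqnorm (ycoord v) <= (2 * k2 + 1) * (k1 * (4 * sqnorm (zeta Z v))).
    by rewrite ler_wpM2l// addr_ge0// mulr_ge0// ltW.
  by move: x1; lra.
rewrite -mulrA ler_wpM2l// addr_ge0// mulr_ge0 ?addr_ge0 ?mulr_ge0 ?ltW//.
Qed.

Lemma exponent_decay A Z al : siegel A -> siegel Z -> exists k c : R, 0 < c /\ forall v,
  complex.Re (- 4^-1 * dot (qcoord A al v) (invmx (Xi A Z) *m qcoord A al v) + lin A al v)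
    <= k - c * vsqr v.
Proof.
move=> hA hZ; have [uX sXi sX] := Xi_facts hA hZ.
have [kv kv0 Hv] := sqnorm_coords hA hZ; have [c c0 Hc] := posdef_coercive hA.2.
pose c1 := toC (sqrtmx (Immx A)) *m conjmx al.
(* With this weight the linear term costs c / 16 out of the available quadratic decay c / 8. *)
pose lam := Num.sqrt (c / 8); have l2 : lam ^+ 2 = c / 8 by rewrite sqr_sqrtr// divr_ge0// ltW.
have lam0 : 0 < lam by rewrite sqrtr_gt0 divr_gt0.
pose k0 := complex.Re (2^-1 * (dot (conjmx al) (conjmx al) - dot c1 (invmx (Xi A Z) *m c1))).
exists (k0 + 2^-1 * sqnorm ((lam^-1)%:C *: c1)), (c / 16 / kv).
have ck : 0 < c / 16 / kv by rewrite !divr_gt0.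
split => // v; have E := exponent_identity (zeta Z v) c1 (conjmx al) sX (mulKmx uX (ycoord v)).
rewrite /qcoord /lin !(coord_facts v hA hZ) /center -/c1 -E {E}.
have [t tE] : exists t, t = invmx (Xi A Z) *m zeta Z v by eexists.
have zt : zeta Z v = Xi A Z *m t by rewrite tE mulKVmx.
have Q := quadratic_decay hA hZ zt; have vt := Hv v t zt.
rewrite -tE; move: Q; set dz := dot (zeta Z v) t; set dy := dot (zeta Z v) _ => Q.
rewrite (_ : _ + 2^-1 * ('i * dy) = 2^-1 * (dot (conjmx al) (conjmx al) - dot c1 (invmx (Xi A Z) *m c1))
  + sq2^-1 * dot c1 t + (- 4^-1 * dz + 2^-1 * ('i * dy))); last by move: (sq2^-1) (dot c1 _) (dot c1 _) (dot _ _) => s0 s1 s2 s3; field.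
rewrite ReD [complex.Re (_ + sq2^-1 * _)]ReD -/k0.
have ht : c * sqnorm t <= hqf (Immx A) t.
  by rewrite sqnorm_sqn mulrDr; apply: lerD; exact: Hc.
have L : complex.Re (sq2^-1 * dot c1 t) <= 2^-1 * sqnorm ((lam^-1)%:C *: c1) + c / 16 * sqnorm t.
  apply: le_trans (le_trans (ler_norm _) (Re_le_normc _)) _.
  rewrite ComplexField.Normc.normcM; apply: (@le_trans _ _ (1 * normc (dot c1 t))).
    rewrite ler_wpM2r ?normc_ge0// /sq2 -real_complexV normc_real ger0_norm ?invr_ge0 ?sqrtr_ge0//.
    by rewrite invf_le1 ?sqrtr_gt0// -[leLHS]sqrtr1 ler_sqrt// ler1n.
  have := normc_dot_le ((lam^-1)%:C *: c1) (lam%:C *: t).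
  rewrite !dot_linear mulrA -real_complexM mulVf ?gt_eqF// (_ : 1%:C = 1 :> C)// mul1r.
  by rewrite [sqnorm (lam%:C *: t)]sqnormZ normc_real real_normK ?num_real// l2; lra.
have vt' : c / 16 / kv * vsqr v <= c / 16 * sqnorm t.
  by rewrite -[leLHS]mulrA ler_pM2l ?divr_gt0// mulrC ler_pdivrMr// mulrC.
by lra.
Qed.

Lemma qcoord_le A al : exists2 k : R, 0 < k & forall v, sqnorm (qcoord A al v) <= k * (1 + vsqr v).
Proof.
have [k k0 H] := sqnorm_mulmx_le A; have s0 := sqnorm_ge0 (center A al).
exists (4 + 4 * k + 2 * sqnorm (center A al)); first by rewrite ltr_wpDr ?mulr_ge0// addr_gt0// mulr_gt0.
move=> v; have v0 : 0 <= vsqr v by exact: vsqr_ge0.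
have x0 := sqnorm_ge0 (xcoord v); have y0 := sqnorm_ge0 (ycoord v).
have h1 := sqnormD_le (xcoord v - A *m ycoord v) (- center A al).
have h2 := sqnormD_le (xcoord v) (- (A *m ycoord v)); rewrite !sqnormN in h1 h2.
have h3 := H (ycoord v); rewrite /qcoord; apply: le_trans h1 _.
have vE := vsqrE v; have h4 : k * sqnorm (ycoord v) <= k * vsqr v by rewrite ler_pM2l//; lra.
have h5 : 0 <= sqnorm (center A al) * vsqr v by rewrite mulr_ge0.
by lra.
Qed.

Lemma transported_gau A Z al : siegel A -> siegel Z -> exists K c : R, [/\ 0 < c, 0 <= K &
  forall v, normc (transported A Z al v) <= K * gau c v].
Proof.
move=> hA hZ; have [k [c [c0 H]]] := exponent_decay al hA hZ.
exists (normc (amp A Z)%:C * expR k), c; split => //; first by rewrite mulr_ge0 ?normc_ge0 ?expR_ge0.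
move=> v; rewrite transportedE// ComplexField.Normc.normcM normc_cexp -mulrA ler_wpM2l ?normc_ge0//.
by rewrite /gau -expRD ler_expR.
Qed.

End gaussian_decay.

Section measurable_vectors.
Context {R : realType} {n : nat}.
Local Notation C := R[i].
Local Notation T := (measurableTypeR R).
Local Notation VT := (n.-tuple T * n.-tuple T)%type.
Local Notation eps := (@eps_omega R n).

Definition mCv (f : VT -> 'cV[C]_n) : Prop := forall i, mC (fun v => f v i 0).

Lemma mCv_cst u : mCv (fun=> u).
Proof. by move=> i; exact: mC_cst. Qed.

Lemma mCvD f g : mCv f -> mCv g -> mCv (fun v => f v + g v).
Proof. by move=> mf mg i; apply: mC_eq (mCD (mf i) (mg i)) => v; rewrite addmxE. Qed.

Lemma mCvN f : mCv f -> mCv (fun v => - f v).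
Proof. by move=> mf i; apply: mC_eq (mCN (mf i)) => v; rewrite oppmxE. Qed.

Lemma mCvM (M : 'M[C]_n) f : mCv f -> mCv (fun v => M *m f v).
Proof.
move=> mf i; apply: (@mC_eq _ _ _ (fun v => \sum_j M i j * f v j 0)) => [v|]; first by rewrite mxE.
by apply: mC_sum => j; apply: mCM => //; exact: mC_cst.
Qed.

Lemma mC_dot f g : mCv f -> mCv g -> mC (fun v => dot (f v) (g v)).
Proof.
move=> mf mg; apply: (@mC_eq _ _ _ (fun v => \sum_i f v i 0 * g v i 0)) => [v|]; first by rewrite dotE.
by apply: mC_sum => i; exact: mCM.
Qed.

Lemma mCv_xcoord : mCv (@xcoord R n).
Proof.
move=> i; apply: (@mC_eq _ _ _ (fun v : VT => (tnth v.1 i : R)%:C)) => [v|]; first by rewrite mxE.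
by apply: mC_real; apply: (measurableT_comp (measurable_tnth i)); exact: measurable_fst.
Qed.

Lemma mCv_ycoord : mCv (@ycoord R n).
Proof.
move=> i; apply: (@mC_eq _ _ _ (fun v : VT => (tnth v.2 i : R)%:C)) => [v|]; first by rewrite mxE.
by apply: mC_real; apply: (measurableT_comp (measurable_tnth i)); exact: measurable_snd.
Qed.

Lemma mCv_qcoord A al : mCv (qcoord A al).
Proof.
apply: mCvD; last by apply: mCvN; exact: mCv_cst.
by apply: mCvD; [exact: mCv_xcoord|apply/mCvN/mCvM; exact: mCv_ycoord].
Qed.

Lemma mC_lin A al : mC (lin A al : VT -> C).
Proof.
apply: mCB; first (apply: mCD; [exact: mC_cst|]).
  by apply: mCM; [exact: mC_cst|apply: mC_dot; [exact: mCv_cst|exact: mCv_ycoord]].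
apply: mCM; first exact: mC_cst.
apply: mC_dot; first exact: mCv_ycoord.
by apply: mCvD; [exact: mCv_xcoord|apply/mCvN/mCvM; exact: mCv_ycoord].
Qed.

Definition gaussian A Z al (v : VT) : C :=
  cexp (- 4^-1 * dot (qcoord A al v) (invmx (Xi A Z) *m qcoord A al v) + lin A al v).

Lemma mC_gaussian A Z al : mC (gaussian A Z al).
Proof.
apply: mC_cexp; apply: mCD; last exact: mC_lin.
by apply: mCM; [exact: mC_cst|apply: mC_dot; [|apply: mCvM]; exact: mCv_qcoord].
Qed.

Lemma transported_gaussian A Z al v : siegel A -> siegel Z ->
  transported A Z al v = (amp A Z)%:C * gaussian A Z al v.
Proof. exact: transportedE. Qed.

Lemma mC_transported A Z al : siegel A -> siegel Z -> mC (transported A Z al : VT -> C).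
Proof.
move=> hA hZ; apply: (@mC_eq _ _ _ (fun v => (amp A Z)%:C * gaussian A Z al v)).
  by move=> v; rewrite transported_gaussian.
by apply: mCM; [exact: mC_cst|exact: mC_gaussian].
Qed.

Lemma fL2_transported A Z al : siegel A -> siegel Z -> fL2 eps (transported A Z al).
Proof.
move=> hA hZ; have [K [c [c0 _ H]]] := transported_gau al hA hZ.
by have [] := fL2_gau c0 (mC_transported al hA hZ) H.
Qed.

End measurable_vectors.

(** * Entire functions *)

Section entire_functions.
Context {R : realType} {n : nat}.
Local Notation C := R[i].
Implicit Types f g : 'cV[C]_n -> C.

Lemma entire_cst c : entire (fun _ : 'cV[C]_n => c).
Proof. by move=> z; exact: differentiable_cst. Qed.

Lemma entireD f g : entire f -> entire g -> entire (fun z => f z + g z).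
Proof. by move=> hf hg z; exact: (differentiableD (hf z) (hg z)). Qed.

Lemma entireM f g : entire f -> entire g -> entire (fun z => f z * g z).
Proof. by move=> hf hg z; exact: (differentiableM (hf z) (hg z)). Qed.

Lemma entire_coord i : entire (fun z : 'cV[C]_n => z i 0).
Proof. by move=> z; exact: differentiable_coord. Qed.

Lemma entire_ext f g : (forall z, f z = g z) -> entire f -> entire g.
Proof. by move=> fg; rewrite (_ : f = g)//; exact/funext. Qed.

Lemma entire_sum (I : Type) (r : seq I) (F : I -> 'cV[C]_n -> C) :
  (forall i, entire (F i)) -> entire (fun z => \sum_(i <- r) F i z).
Proof.
move=> h; elim: r => [|i r IH].
  by apply: entire_ext (entire_cst 0) => z; rewrite big_nil.
by apply: entire_ext (entireD (h i) IH) => z; rewrite big_cons.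
Qed.

(** The error of the difference quotient is cexp w times the second order Taylor remainder divided
    by h. *)
Lemma cexp_differentiable (w : C^o) : differentiable (cexp : C^o -> C^o) w.
Proof.
apply/derivable1_diffP; apply/cvg_ex; exists (cexp w : C^o) => /=.
apply/tendsP => e e0; pose k := normc (cexp w) * expR 1 + 1.
have k0 : 0 < k by rewrite ltr_wpDl// mulr_ge0 ?normc_ge0 ?expR_ge0.
suff H : forall h : C, h != 0 -> normc h < Num.min 1 (e / k) ->
    normc (h^-1 *: (cexp (h%:A + w) - cexp w) - cexp w) < e.
  apply/(@nbhs_normc R 0); exists (Num.min 1 (e / k)); first by rewrite lt_min ltr01 divr_gt0.
  by move=> h; rewrite subr0 => hl h0; exact: H.
move=> h h0; rewrite lt_min => /andP[h1 he].
rewrite (_ : h%:A = h); last by rewrite /GRing.scale /= mulr1.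
have [_ T2 _] := cexp_taylor h.
rewrite cexpD (_ : _ - _ = (cexp h - 1 - h) * cexp w / h); last by rewrite /GRing.scale /=; field.
rewrite ComplexField.Normc.normcM ComplexField.Normc.normcV (ComplexField.Normc.normcM (cexp h - 1 - h)).
have nh : 0 < normc h by rewrite normc_gt0.
apply: (@le_lt_trans _ _ (k * normc h)); last by rewrite mulrC -ltr_pdivlMr.
rewrite ler_pdivrMr//; apply: (@le_trans _ _ (normc h ^+ 2 * expR (normc h) * normc (cexp w))).
  by rewrite ler_wpM2r ?normc_ge0.
apply: (@le_trans _ _ (normc h ^+ 2 * expR 1 * normc (cexp w))).
  by rewrite ler_wpM2r ?normc_ge0// ler_wpM2l ?exprn_ge0 ?normc_ge0// ler_expR ltW.
by rewrite /k; have : 0 <= normc h ^+ 2 by [rewrite exprn_ge0// normc_ge0]; lra.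
Qed.

Lemma entire_cexp f : entire f -> entire (fun z => cexp (f z)).
Proof. by move=> hf z; exact: (differentiable_comp (hf z) (cexp_differentiable (f z))). Qed.

Lemma entire_dot (M : 'M[C]_n) u : entire (fun z => dot u (M *m z)).
Proof.
apply: (@entire_ext (fun z => \sum_i (M^T *m u) i 0 * z i 0)) => [z|]; first by rewrite dot_mulmx dotE.
by apply: entire_sum => i; apply: entireM; [exact: entire_cst|exact: entire_coord].
Qed.

Lemma entire_form (M : 'M[C]_n) : entire (fun z => dot z (M *m z)).
Proof.
apply: (@entire_ext (fun z => \sum_i z i 0 * dot (delta_mx i 0) (M *m z))) => [z|].
  rewrite dotE; apply: eq_bigr => i _; congr (_ * _).
  rewrite dotE (bigD1 i)//= mxE !eqxx mul1r big1 ?addr0// => j ji.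
  by rewrite mxE (negPf ji) mul0r.
by apply: entire_sum => i; apply: entireM; [exact: entire_coord|exact: entire_dot].
Qed.

(** Restriction to complex lines leads from differentiability in n variables to the one-variable
    notion of the contour argument. *)
Lemma entire_line f (u w : 'cV[C]_n) : entire f -> cdiff (fun rho => f (u + rho *: w)).
Proof.
move=> hf z; have D : differentiable (fun rho : C^o => f (u + rho *: w) : C^o) (z : C^o).
  apply: (@differentiable_comp _ C^o 'cV[C^o]_n C^o (fun rho : C^o => u + rho *: w : 'cV[C^o]_n) f); last exact: hf.
  apply: differentiableD; first exact: differentiable_cst.
  by apply: (@differentiableZl _ _ _ (fun z : C^o => z)).
have /derivable1_diffP/cvg_ex[/= l /tendsP Hl] := D.
exists l => e e0; have /(@nbhs_normc R 0)[d d0 Hd] := Hl e e0.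
exists d => // x xz; have [->|xz0] := eqVneq x z.
  by rewrite !subrr mulr0 subr0 ComplexField.Normc.normc0 mulr0.
have x0 : x - z != 0 by rewrite subr_eq0.
have := Hd (x - z); rewrite subr0 => /(_ xz x0) /=.
rewrite (_ : (x - z)%:A + z = x); last by rewrite /GRing.scale /= mulr1 subrK.
move=> /ltW h; rewrite (_ : _ - _ = ((x - z)^-1 *: (f (u + x *: w) - f (u + z *: w)) - l) * (x - z)).
  by rewrite ComplexField.Normc.normcM ler_wpM2r// normc_ge0.
by rewrite /GRing.scale /=; field.
Qed.

End entire_functions.

(** * The Bargmann spaces *)

Section local_limits.
Context {R : realType} {n : nat}.
Local Notation C := R[i].
Local Notation T := (measurableTypeR R).
Local Notation VT := (n.-tuple T * n.-tuple T)%type.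

Definition vnbhs (v : VT) : set_system VT :=
  [set A | exists2 d : R, 0 < d & forall w, vbox v d w -> A w].

Lemma vboxW (v w : VT) (d e : R) : d <= e -> vbox v d w -> vbox v e w.
Proof. by move=> de [h1 h2]; split => i; [apply: lt_le_trans (h1 i) de|apply: lt_le_trans (h2 i) de]. Qed.

#[local] Instance vnbhs_filter v : Filter (vnbhs v).
Proof.
split; first by exists 1.
- move=> A B [d d0 Hd] [e e0 He]; exists (Num.min d e); first by rewrite lt_min d0.
  by move=> w h; split; [apply: Hd|apply: He]; apply: vboxW h; rewrite ge_min lexx ?orbT.
- by move=> A B AB [d d0 Hd]; exists d => // w /Hd /AB.
Qed.

Lemma vcontinuous_tends (f : VT -> C) : (forall v, tends (vnbhs v) f (f v)) -> vcontinuous f.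
Proof. by move=> H v e e0; exact: H. Qed.

Lemma tends_xcoord v i : tends (vnbhs v) (fun w => xcoord w i 0) (xcoord v i 0).
Proof.
move=> e e0; exists e => // w [h _] /=; rewrite !mxE -real_complexB normc_real; exact: h.
Qed.

Lemma tends_ycoord v i : tends (vnbhs v) (fun w => ycoord w i 0) (ycoord v i 0).
Proof.
move=> e e0; exists e => // w [_ h] /=; rewrite !mxE -real_complexB normc_real; exact: h.
Qed.

Lemma tends_cexp (U : Type) (F : set_system U) {FF : Filter F} (f : U -> C) (a : C) :
  tends F f a -> tends F (fun s => cexp (f s)) (cexp a).
Proof.
move=> /tendsP fa; apply/tendsP.
have := differentiable_continuous (cexp_differentiable a).
exact: (cvg_comp f (cexp : C^o -> C^o) fa).
Qed.

Lemma tends_mulmx (U : Type) (F : set_system U) {FF : Filter F} (M : 'M[C]_n) (f : U -> 'cV[C]_n) (a : 'cV[C]_n) :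
  (forall i, tends F (fun s => f s i 0) (a i 0)) ->
  forall i, tends F (fun s => (M *m f s) i 0) ((M *m a) i 0).
Proof.
move=> h i; rewrite mxE (_ : (fun s => _) = fun s => \sum_j M i j * f s j 0); last first.
  by apply/funext => s; rewrite mxE.
by apply: tends_sum => j _; apply: tendsM => //; exact: tends_cst.
Qed.

Lemma tends_zcoord Z v i : tends (vnbhs v) (fun w => zcoord Z w i 0) (zcoord Z v i 0).
Proof.
apply: tends_mulmx => j; rewrite addmxE oppmxE (_ : (fun s => _) = fun w => xcoord w j 0 - (conjmx Z *m ycoord w) j 0).
  apply: tendsD; first exact: tends_xcoord.
  by apply: tendsN; apply: tends_mulmx => k; exact: tends_ycoord.
by apply/funext => w; rewrite addmxE oppmxE.
Qed.

Lemma entire_tends (U : Type) (F : set_system U) {FF : Filter F} (phi : 'cV[C]_n -> C)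
    (f : U -> 'cV[C]_n) (a : 'cV[C]_n) : entire phi ->
  (forall i, tends F (fun s => f s i 0) (a i 0)) -> tends F (fun s => phi (f s)) (phi a).
Proof.
move=> hphi h e e0; have c := differentiable_continuous (hphi a).
have : @nbhs _ ('cV[C^o]_n : topologicalType) a [set w | normc (phi w - phi a) < e].
  by apply: (c [set z | normc (z - phi a) < e]); apply/nbhs_normc; exists e.
move=> /(@nbhs_ballP C ('cV[C^o]_n : pseudoMetricType C))[d /= /gt0_complexP[d' d'0 ->] Hd].
have : F [set s | forall i, normc (f s i 0 - a i 0) < d'].
  by apply: filter_forall => i; exact: h.
apply: filterS => s hs; apply: Hd; split=> [|i j]; first by rewrite ltcR.
rewrite ord1 -ball_normE /ball_ /= normr_normc ltcR normc_subC.
exact: hs.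
Qed.

(** Writing |z|^2 as the sum of z_i conj z_i brings the Gaussian factor under the limit rules.
    Continuity later upgrades equality in L^2 to equality of functions. *)
Lemma HOmega_vcontinuous Z (f : VT -> C) : HOmega Z f -> vcontinuous f.
Proof.
move=> [_ [phi hphi fE]]; apply: vcontinuous_tends => v.
pose g w := phi (zcoord Z w) * cexp (- 2^-1 * \sum_i zcoord Z w i 0 * (zcoord Z w i 0)^*).
have gE w : f w = g w.
  rewrite fE /g; congr (_ * _).
  rewrite (_ : \sum_i _ = (sqnorm (zcoord Z w))%:C); last first.
    by rewrite -dot_sqnorm dotE; apply: eq_bigr => i _; congr (_ * _); rewrite [RHS]mxE.
  by rewrite -cexp_real real_complexN real_complexM real_complexV real_complex_nat mulNr mulrC.
rewrite gE (_ : f = g); last exact/funext.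
apply: tendsM; first by apply: entire_tends => // i; exact: tends_zcoord.
apply: tends_cexp; apply: tendsM; first exact: tends_cst.
by apply: tends_sum => i _; apply: tendsM; [|apply: tends_conj]; exact: tends_zcoord.
Qed.

End local_limits.

Section bargmann_spaces.
Context {R : realType} {n : nat}.
Local Notation C := R[i].
Local Notation V := (@V R n).

(** Without - |z|^2 / 2 the exponent is a polynomial in z, and its exponential is the entire
    factor. *)
Lemma HOmega_transported (A Z : 'M[C]_n) al : siegel A -> siegel Z -> HOmega Z (transported A Z al).
Proof.
move=> hA hZ; split; first by apply/H0_fL2; exact: fL2_transported.
pose S := toC (sqrtmx (Immx A)) : 'M[C]_n; pose S' := toC (sqrtmx (Immx Z)) : 'M[C]_n.
pose X := invmx (Xi A Z); pose a := conjmx al.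
pose E z := dot a ((1%:M - S *m X *m S) *m a) + dot a (S *m X *m S' *m z) +
  dot z (S' *m X *m S *m a) + dot z ((1%:M - S' *m X *m S') *m z).
exists (fun z => (amp A Z)%:C * cexp (2^-1 * E z)).
  apply: entireM; first exact: entire_cst.
  apply: entire_cexp; apply: entireM; first exact: entire_cst.
  apply: entireD; last exact: entire_form.
  apply: entireD.
    by apply: entireD; [exact: entire_cst|exact: entire_dot].
  apply: (@entire_ext _ _ (fun z => dot (S' *m X *m S *m a) (1%:M *m z))); last exact: entire_dot.
  by move=> z; rewrite mul1mx dotC.
move=> v; rewrite /transported -/(amp A Z) block_form -/S -/S' -/X -/a -/(E _) -mulrA -cexp_real -cexpD.
by congr (_ * cexp _); rewrite real_complexN.
Qed.

Lemma Xi_self (A : 'M[C]_n) : Xi A A = toC (Immx A).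
Proof. by rewrite /Xi Immx_sub. Qed.

Lemma amp_self (A : 'M[C]_n) : siegel A -> amp A A = 1.
Proof.
move=> hA; have d0 := posdef_det_gt0 hA.2.
rewrite /amp Xi_self det_map_mx normc_real gtr0_norm// -powRD; last by rewrite gt_eqF// implybT.
rewrite (_ : 4^-1 + 4^-1 = 2^-1 :> R); last by field.
by rewrite divff// gt_eqF// powR_gt0.
Qed.

(** For Xi = Im A the diagonal blocks vanish and the off-diagonal blocks are identities. *)
Lemma transported_self (A : 'M[C]_n) al : siegel A -> transported A A al = coherent A al.
Proof.
move=> hA; apply/funext => v; rewrite /transported -/(amp A A) amp_self// mul1r /coherent; congr cexp.
rewrite block_form Xi_self -toC_sqrtmx//; move: (zcoord A v) => z; have uS : toC (sqrtmx (Immx A)) \in (@unitmx C n).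
  by rewrite toC_unit; have [/posdef_unit] := sqrtmxP hA.2.
move: (toC (sqrtmx (Immx A))) uS => S uS.
have -> : invmx (S *m S) = invmx S *m invmx S.
  have uSS : S *m S \in unitmx by rewrite unitmx_mul uS.
  apply: (can_inj (mulKmx uSS)); rewrite mulmxV// -mulmxA mulKVmx// mulmxV//.
rewrite !mulmxA mulmxV// mul1mx mulVmx// subrr !mul0mx !mul1mx !dot0r add0r addr0.
by rewrite (dotC z) -/(dot _ _); congr (_ - _); field.
Qed.

End bargmann_spaces.

(** * Orthogonality *)

Section orthogonality.
Context {R : realType} {n : nat}.
Local Notation C := R[i].
Local Notation T := (measurableTypeR R).
Local Notation VT := (n.-tuple T * n.-tuple T)%type.
Local Notation eps := (@eps_omega R n).

Lemma cdiff_ext (f h : C -> C) : (forall z, f z = h z) -> cdiff f -> cdiff h.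
Proof. by move=> fh; rewrite (_ : f = h)//; exact/funext. Qed.

Lemma cdiff_cexp_line (k l : C) : cdiff (fun rho => cexp (k + rho * l)).
Proof.
pose f (z : 'cV[C]_1) := cexp (k + z 0 0 * l).
have ef : entire f.
  apply: entire_cexp; apply: entireD; first exact: entire_cst.
  by apply: entireM; [exact: entire_coord|exact: entire_cst].
have := @entire_line _ _ f 0 (const_mx 1) ef.
rewrite (_ : (fun rho => _) = fun rho => cexp (k + rho * l))//.
by apply/funext => rho; rewrite /f !mxE mulr1 add0r.
Qed.

Definition tuple_col (u : 'cV[R]_n) : n.-tuple T := [tuple (u j 0 : T) | j < n].

(** This displacement and the next are the vectors on which x - conj(Z) y takes the values - c and -
    i c. *)
Definition shift_re (c : 'cV[R]_n) : VT := (tuple_col (- c), tuple_col 0).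
Definition shift_im (Z : 'M[C]_n) (c : 'cV[R]_n) : VT :=
  (tuple_col (- (Remx Z *m (invmx (Immx Z) *m c))), tuple_col (- (invmx (Immx Z) *m c))).

(* The real translation realizing zeta |-> zeta - rho c. *)
Lemma zeta_tlin (Z : 'M[C]_n) c rho v : siegel Z ->
  zeta Z (vshift (tlin (shift_re c) (shift_im Z c) rho) v) = zeta Z v - rho *: toC c.
Proof.
move=> hZ; have [r rE] : exists r, r = complex.Re rho by eexists.
have [s sE] : exists s, s = complex.Im rho by eexists.
have [d dE] : exists d, d = invmx (Immx Z) *m c by eexists.
have cE : c = Immx Z *m d by rewrite dE mulKVmx//; exact: posdef_unit hZ.2.
have x' : xcoord (vshift (tlin (shift_re c) (shift_im Z c) rho) v) =
    xcoord v - r%:C *: toC c - s%:C *: toC (Remx Z *m d).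
  apply/matrixP => i j; rewrite (ord1 j) !(addmxE, oppmxE) !mxE !tnth_mktuple -rE -sE -dE !oppmxE !mxE.
  by rewrite !(real_complexD, real_complexM, real_complexN) addrA; ring.
have y' : ycoord (vshift (tlin (shift_re c) (shift_im Z c) rho) v) = ycoord v - s%:C *: toC d.
  apply/matrixP => i j; rewrite (ord1 j) !(addmxE, oppmxE) !mxE !tnth_mktuple -rE -sE -dE !oppmxE !mxE.
  by rewrite mulr0 add0r !(real_complexD, real_complexM, real_complexN); ring.
have Wd : conjmx Z *m toC d = toC (Remx Z *m d) - 'i *: toC c.
  rewrite cE !toCM {1}[Z]ReImmx conjmxD conjmxZ !conjmx_toC conjci mulmxDl -scalemxAl.
  by move: (toC (Immx Z) *m toC d) (toC (Remx Z) *m toC d) => a b; rewrite scaleNr.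
rewrite /zeta x' y' mulmxBr -scalemxAr Wd.
have -> : rho = r%:C + 'i * s%:C by rewrite rE sE -complexE.
move: (toC (Remx Z *m d)) (toC c) (conjmx Z *m ycoord v) (xcoord v) => a b e f.
by apply/matrixP => i j; rewrite !(addmxE, oppmxE, mxE); ring.
Qed.

Variables (A Z : 'M[C]_n) (al : 'cV[C]_n).
Hypotheses (hA : siegel A) (hZ : siegel Z).
Variables (g : VT -> C) (phi : 'cV[C]_n -> C).
Hypotheses (g2 : fL2 eps g) (ephi : entire phi).
Hypothesis gE : forall v,
  g v = phi (zcoord Z v) * (expR (- (sqnorm (zcoord Z v) / 2)))%:C.

Let X := invmx (Xi A Z).
Let q := qcoord A al.
Let c1 := toC (sqrtmx (Immx A)) *m conjmx al.
Let sX : X^T = X. Proof. by have [_ _] := Xi_facts hA hZ. Qed.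

Definition defect : 'M[C]_n := X - toC (invmx (Immx Z)).

(** [weight], [slope] and [mass] below play the roles of P, b and m in the second moment argument.
    The last two are dictated by the requirement that no rho survive in the shifted exponent. *)
Let slope (c : 'cV[R]_n) (v : VT) : C := - 2^-1 * dot (toC c) (X *m q v).
Let weight (v : VT) : C := transported A Z al v * (g v)^*.

Lemma mC_weight : mC weight.
Proof. by apply: mCM; [exact: mC_transported|apply: mC_conj; case: g2]. Qed.

Lemma mC_slope c : mC (slope c).
Proof.
apply: mCM; first exact: mC_cst.
by apply: mC_dot; [exact: mCv_cst|apply: mCvM; exact: mCv_qcoord].
Qed.

Let hol_part (ze : 'cV[C]_n) : C :=
  2^-1 * (dot (conjmx al) (conjmx al) - dot c1 (X *m c1) + 2 * (sq2^-1 * dot c1 (X *m ze))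
          - 2^-1 * dot ze (X *m ze)).

Let Xq v : X *m q v = X *m zeta Z v - (2 * 'i) *: ycoord v - sq2 *: (X *m c1).
Proof.
have [uX _ _] := Xi_facts hA hZ.
by rewrite /q /qcoord (coord_facts v hA hZ) !mulmxBr -!scalemxAr mulKmx.
Qed.

(** The Gaussian factors of the transported function and of g combine into - |z|^2; what remains is
    an exponent holomorphic in z and the conjugate of phi. *)
Let weightE v : weight v = (amp A Z)%:C * cexp (hol_part (zeta Z v)
    + 2^-1 * dot (zcoord Z v) (zcoord Z v) - dot (zcoord Z v) (conjmx (zcoord Z v)))
  * (phi (zcoord Z v))^*.
Proof.
rewrite /weight gE transportedE// conjcM conjc_real.
have [uX _ _] := Xi_facts hA hZ.
have E := exponent_identity (zeta Z v) c1 (conjmx al) sX (mulKmx uX (ycoord v)).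
rewrite /qcoord /lin !(coord_facts v hA hZ) /center -/c1 -E {E} -/(hol_part _).
have zd := dot_zcoord_sub_conj hZ v (zeta Z v); rewrite -zcoordE dotDr dotNr in zd.
rewrite -zd -cexp_real real_complexN.
rewrite (_ : (sqnorm (zcoord Z v) / 2)%:C = 2^-1 * dot (zcoord Z v) (conjmx (zcoord Z v))); last first.
  by rewrite dot_sqnorm real_complexM real_complexV real_complex_nat mulrC.
have aux (a b c d : C) : a * b * (c * d) = a * (b * d) * c by ring.
rewrite aux -cexpD.
by congr (_ * cexp _ * _); field.
Qed.

Let slopeE c v : slope c v = - 2^-1 * dot (toC c) (X *m zeta Z v)
  + dot (rootm Z *m toC c) (zcoord Z v - conjmx (zcoord Z v)) + sq2 / 2 * dot (toC c) (X *m c1).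
Proof.
rewrite /slope Xq (dot_zcoord_sub_conj hZ) !dot_linear.
by move: (dot _ (X *m zeta Z v)) (dot _ (ycoord v)) (dot _ (X *m c1)) => u1 u2 u3; field.
Qed.

Let mass c : C := - 4^-1 * dot (toC c) (defect *m toC c).

Let massE c : mass c = - 4^-1 * dot (toC c) (X *m toC c) + 2^-1 * dot (rootm Z *m toC c) (rootm Z *m toC c).
Proof.
have H : rootm Z *m (rootm Z *m toC c) = 2^-1 *: (toC (invmx (Immx Z)) *m toC c) :> 'cV[C]_n.
  have uY : toC (Immx Z) \in (@unitmx C n) by rewrite toC_unit; exact: posdef_unit hZ.2.
  have H0 (u : 'cV[C]_n) : rootm Z *m (rootm Z *m (toC (Immx Z) *m u)) = 2^-1 *: u.
    by rewrite !mulmxA -[rootm Z *m rootm Z *m _]mulmxA mul_rootm2_Im// mul_scalar_mx.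
  by rewrite -[in LHS](mulKVmx uY (toC c)) H0 toCV.
by rewrite /mass /defect dot_rootm2// H mulmxBl !dot_linear; field.
Qed.

(** After the shift zeta -> zeta - rho c the tilt removes every term of the exponent that contains
    rho, including |rho|^2. Only conj rho is left, in the exponent and in conj phi, so the conjugate
    is holomorphic in rho. *)
Lemma moved_weight_cdiff c v :
  cdiff (fun rho => (moved weight (slope c) (mass c) (shift_re c) (shift_im Z c) v rho)^*).
Proof.
have [w wE] : exists w, w = rootm Z *m toC c by eexists.
have cw : conjmx w = w by rewrite wE conjmxM conj_rootm conjmx_toC.
have [z zE] : exists z, z = zcoord Z v by eexists.
have [ze zeE] : exists ze, ze = zeta Z v by eexists.
have [d dE] : exists d, d = toC c :> 'cV[C]_n by eexists.
pose k := hol_part ze + 2^-1 * dot z z - dot z (conjmx z).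
have E rho : (moved weight (slope c) (mass c) (shift_re c) (shift_im Z c) v rho)^* =
    (amp A Z)%:C * (cexp (k^* + rho * (dot z w)^*) * phi (z + rho *: - w)).
  rewrite /moved /tilt weightE slopeE massE !zcoordE !zeta_tlin// mulmxBr -!scalemxAr -zcoordE -wE -zE -zeE -dE.
  have aux (x y u t : C) : x * y * u * t = x * (y * t) * u by ring.
  rewrite aux -cexpD.
  rewrite conjcM conjcM conjc_real conjc_cexp conjcK mulrA scalerN; congr (_ * cexp _ * _).
  rewrite -[RHS]conjcK; congr (_^*); rewrite conjcD conjcM !conjcK /k /hol_part.
  rewrite !conjmxB !conjmxZ cw !mulmxBr -!scalemxAr !dot_linear.
  have s1 := dot_sym ze d sX; have s2 := dot_sym c1 d sX; rewrite -s1 s2.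
  rewrite (dotC w z) (dotC w (conjmx z)) sq2V.
  move: (dot (conjmx al) _) (dot c1 (X *m c1)) (dot d (X *m c1)) (dot c1 (X *m ze)) (dot ze (X *m d)) (dot ze (X *m ze)) (dot d (X *m d)).
  move: (dot z z) (dot z w) (dot w w) (dot z (conjmx z)) (dot (conjmx z) w) (dot w (conjmx z)) sq2 (rho^*).
  by move=> *; field.
apply: cdiff_ext (fun rho => esym (E rho)) _.
have h0 : cdiff (fun _ : C => (amp A Z)%:C).
  by move=> x; exists 0 => e e0; exists 1 => // y _; rewrite subrr mul0r subrr ComplexField.Normc.normc0 mulr_ge0 ?normc_ge0// ltW.
by apply: cdiffM h0 _; apply: cdiffM; [exact: cdiff_cexp_line|exact: entire_line].
Qed.

(** g is merely square integrable: half of the Gaussian decay of the transported function absorbs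
    exp (4 |slope|), and the other half is a square integrable partner for g. *)
Lemma weight_envelope_lty c : (\int[eps]_v (envelope weight (slope c) v)%:E < +oo)%E.
Proof.
have [K [c0 [c00 K0 HK]]] := transported_gau al hA hZ.
have [k k0 Hk] := qcoord_le A al.
(* As k is the growth constant of |q|^2, d k = c0 / 2 makes the tilt use exactly half of the rate
   c0. *)
pose d := c0 / (2 * k); have d0 : 0 < d by rewrite divr_gt0// mulr_gt0.
pose lam := Num.sqrt d; have lam0 : 0 < lam by rewrite sqrtr_gt0.
have l2 : lam ^+ 2 = d by rewrite sqr_sqrtr// ltW.
pose B := sqnorm ((lam^-1)%:C *: (X *m toC c)) + c0 / 2.
have sl v : 4 * normc (slope c v) <= B + c0 / 2 * vsqr v.
  rewrite /slope ComplexField.Normc.normcM (dot_sym _ _ sX) dotC.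
  have -> : normc (- 2^-1 : C) = 2^-1.
    by rewrite normcN -(real_complex_nat 2) -real_complexV normc_real ger0_norm.
  have := normc_dot_le ((lam^-1)%:C *: (X *m toC c)) (lam%:C *: q v).
  rewrite !dot_linear mulrA -real_complexM mulVf ?gt_eqF// (_ : 1%:C = 1 :> C)// mul1r.
  rewrite [sqnorm (lam%:C *: _)]sqnormZ normc_real real_normK ?num_real// l2.
  have : d * sqnorm (q v) <= d * (k * (1 + vsqr v)) by apply: ler_wpM2l; [exact: ltW|exact: Hk].
  have -> : d * (k * (1 + vsqr v)) = c0 / 2 + c0 / 2 * vsqr v by rewrite /d; field; rewrite gt_eqF.
  by rewrite /B; lra.
pose h := fun v => (gau (c0 / 2) v)%:C * (g v)^*.
have mg : mC (fun v : VT => (gau (c0 / 2) v)%:C) by apply: (mC_real (f := gau (c0 / 2))); exact: measurable_gau.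
have fg : fL2 eps (fun v => (gau (c0 / 2) v)%:C).
  have [] // := @fL2_gau _ _ (c0 / 2) 1 _ _ mg; first by rewrite divr_gt0.
  by move=> v; rewrite normc_real ger0_norm ?expR_ge0// mul1r.
have [[mh ih] _] := fL2_mul ltr01 fg g2.
have Kn : 0 <= K * expR B by rewrite mulr_ge0 ?expR_ge0.
have bd v : envelope weight (slope c) v <= K * expR B * normc (h v).
  have e1 : normc (weight v) = normc (transported A Z al v) * normc (g v).
    by rewrite /weight ComplexField.Normc.normcM normc_conj.
  have e2 : normc (h v) = gau (c0 / 2) v * normc (g v).
    by rewrite /h ComplexField.Normc.normcM normc_conj normc_real ger0_norm ?expR_ge0.
  have e3 : normc (transported A Z al v) * expR (4 * normc (slope c v)) <= K * expR B * gau (c0 / 2) v.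
    apply: (@le_trans _ _ (K * gau c0 v * expR (B + c0 / 2 * vsqr v))).
      by apply: ler_pM; [exact: normc_ge0|exact: expR_ge0|exact: HK|rewrite ler_expR; exact: sl].
    by rewrite -mulrA -[leRHS]mulrA ler_wpM2l// /gau -!expRD ler_expR; lra.
  rewrite /envelope e1 e2 mulrA [_ * normc (g v) * _]mulrAC.
  by apply: ler_wpM2r e3; exact: normc_ge0.
apply: (@le_lt_trans _ _ (\int[eps]_v ((K * expR B)%:E * (normc (h v))%:E))%E).
  apply: ge0_le_integral => //.
  - by move=> v _; rewrite lee_fin envelope_ge0.
  - by apply/measurable_EFinP; apply: measurable_envelope; [exact: mC_weight|exact: mC_slope].
  - by apply: emeasurable_funM => //; apply/measurable_EFinP; exact: mC_normc.
  - by move=> v _; rewrite -EFinM lee_fin.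
rewrite ge0_integralZl//; last 2 first.
- by apply/measurable_EFinP; exact: mC_normc.
- by move=> v _; rewrite lee_fin normc_ge0.
by rewrite lte_mul_pinfty// ?lee_fin// ge0_fin_numE.
Qed.

Let xi v := X *m q v.
Let quad c v : C := weight v * (dot (toC c) (xi v) ^+ 2 - 2 * dot (toC c) (defect *m toC c)).

Let quadE c v : quad c v = 4 * (weight v * (slope c v ^+ 2 + 2 * mass c)).
Proof. rewrite /quad /slope /mass -/(xi v).
by move: (weight v) (dot (toC c) (xi v)) (dot (toC c) (defect *m toC c)) => w a b; field. Qed.

Let quad_int c : intC eps (quad c) /\ cint eps (quad c) = 0.
Proof.
have h := intC_second (mass c) mC_weight (mC_slope c) (weight_envelope_lty c).
have z := second_moment_eq0 mC_weight (mC_slope c) (moved_weight_cdiff c) (weight_envelope_lty c).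
have E : quad c = fun v => 4 * (weight v * (slope c v ^+ 2 + 2 * mass c)) by apply/funext => v; exact: quadE.
by rewrite E; split; [exact: intCZ|rewrite cintZ// z mulr0].
Qed.

Let sdefect : defect^T = defect.
Proof. by have [sY _] := posdefV hZ.2; rewrite /defect linearB /= sX map_trmx sY. Qed.

(** Polarization: the values of [quad] at e_i + e_j and e_i - e_j, subtracted and divided by 4,
    isolate the entry (i, j), so real directions suffice. *)
Lemma orthogonality (M : 'M[C]_n) :
  intC eps (fun v => weight v * (dot (xi v) (M *m xi v) - 2 * \tr (M *m defect))) /\
  cint eps (fun v => weight v * (dot (xi v) (M *m xi v) - 2 * \tr (M *m defect))) = 0.
Proof.
pose e (i : 'I_n) : 'cV[R]_n := delta_mx i 0.
pose F (p : 'I_n * 'I_n) v := M p.1 p.2 / 4 * (quad (e p.1 + e p.2) v - quad (e p.1 - e p.2) v).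
have de i (u : 'cV[C]_n) : dot (toC (e i)) u = u i 0.
  rewrite dotE (bigD1 i)//= !mxE !eqxx mul1r big1 ?addr0// => j ji.
  by rewrite !mxE (negPf ji) mul0r.
have sd i j : defect i j = defect j i by rewrite -[in LHS]sdefect mxE.
have FE p v : F p v = weight v * (M p.1 p.2 * (xi v p.1 0 * xi v p.2 0 - 2 * defect p.1 p.2)).
  rewrite /F /quad map_mxD map_mxB !mulmxDr !mulmxN !dot_linear !de.
  have co i j : (defect *m toC (e j)) i 0 = defect i j.
    by rewrite mxE (bigD1 j)//= !mxE !eqxx mulr1 big1 ?addr0// => k kj; rewrite !mxE (negPf kj) mulr0.
  by rewrite !co -(sd p.1 p.2); field.
have sE v : weight v * (dot (xi v) (M *m xi v) - 2 * \tr (M *m defect)) = \sum_p F p v.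
  under eq_bigr do rewrite FE.
  rewrite -mulr_sumr; congr (_ * _).
  rewrite -(pair_bigA _ (fun i j => M i j * (xi v i 0 * xi v j 0 - 2 * defect i j))) /=.
  rewrite dotE /mxtrace mulr_sumr -sumrB; apply: eq_bigr => i _.
  have m1 : (M *m xi v) i 0 = \sum_j M i j * xi v j 0 by rewrite mxE.
  have m2 : (M *m defect) i i = \sum_j M i j * defect j i by rewrite mxE.
  rewrite m1 m2 !mulr_sumr -sumrB; apply: eq_bigr => j _.
  by rewrite (sd j i); ring.
have iF p : intC eps (F p).
  by apply: intCZ; apply: intCB; have [] := quad_int (e p.1 + e p.2); have [] := quad_int (e p.1 - e p.2).
rewrite (_ : (fun v => _) = fun v => \sum_p F p v); last exact/funext.
split; first exact: intC_sum.
rewrite cint_sum//; apply: big1 => p _.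
have [i1 z1] := quad_int (e p.1 + e p.2); have [i2 z2] := quad_int (e p.1 - e p.2).
by rewrite [LHS](cintZ (M p.1 p.2 / 4) (intCB i1 i2)) (cintB i1 i2) z1 z2 subrr mulr0.
Qed.

End orthogonality.

(** * Families with Gaussian domination *)

Ltac nonneg := repeat first [ exact: expR_ge0 | exact: normc_ge0 | by [] | by apply: ltW
  | apply: addr_ge0 | apply: mulr_ge0 | apply: exprn_ge0 | rewrite invr_ge0 ].

Section gaussian_families.
Context {R : realType} {n : nat}.
Local Notation C := R[i].
Local Notation T := (measurableTypeR R).
Local Notation VT := (n.-tuple T * n.-tuple T)%type.
Local Notation eps := (@eps_omega R n).
Local Notation I01 := (`[0, 1]%classic : set R).

Definition mnorm1 (M : 'M[C]_n) : R := \sum_i \sum_j normc (M i j).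

Lemma mnorm1_ge0 M : 0 <= mnorm1 M.
Proof. by apply: sumr_ge0 => i _; apply: sumr_ge0 => j _; exact: normc_ge0. Qed.

Lemma mnorm1D M N : mnorm1 (M + N) <= mnorm1 M + mnorm1 N.
Proof.
rewrite /mnorm1 -big_split; apply: ler_sum => i _; rewrite -big_split; apply: ler_sum => j _.
by rewrite addmxE; exact: le_normcD.
Qed.

Lemma normc_form_le M (u : 'cV[C]_n) : normc (dot u (M *m u)) <= mnorm1 M * sqnorm u.
Proof.
rewrite dotE; apply: le_trans (normc_sum _ _ _) _.
rewrite /mnorm1 mulr_suml; apply: ler_sum => i _.
rewrite ComplexField.Normc.normcM mxE.
apply: (@le_trans _ _ (normc (u i 0) * \sum_j normc (M i j) * normc (u j 0))).
  rewrite ler_wpM2l ?normc_ge0//; apply: le_trans (normc_sum _ _ _) _.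
  by apply: ler_sum => j _; rewrite ComplexField.Normc.normcM.
rewrite mulr_sumr mulr_suml; apply: ler_sum => j _.
rewrite mulrCA ler_wpM2l ?normc_ge0//.
have sq l : normc (u l 0) ^+ 2 <= sqnorm u.
  by rewrite /sqnorm (bigD1 l)//= lerDl; apply: sumr_ge0 => m _; exact: sqr_ge0.
have := sq i; have := sq j; have := sqr_ge0 (normc (u i 0) - normc (u j 0)); rewrite sqrrB; lra.
Qed.

Lemma tends_mnorm1 (F : set_system R) {FF : Filter F} (X : R -> 'M[C]_n) (L : 'M[C]_n) :
  (forall i j, tends F (fun s => X s i j) (L i j)) ->
  tends F (fun s => (mnorm1 (X s - L))%:C) 0.
Proof.
move=> h; have -> : (0 : C) = \sum_(i < n) \sum_(j < n) 0.
  by rewrite big1// => i _; rewrite big1.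
rewrite (_ : (fun s => _) = fun s => \sum_i \sum_j (normc (X s i j - L i j))%:C); last first.
  apply/funext => s; rewrite /mnorm1 rmorph_sum; apply: eq_bigr => i _.
  by rewrite rmorph_sum; apply: eq_bigr => j _; rewrite addmxE oppmxE.
apply: tends_sum => i _; apply: tends_sum => j _ e e0.
by apply: filterS (h i j e e0) => s /=; rewrite subr0 normc_real ger0_norm// normc_ge0.
Qed.

(** Gaussians whose exponents differ by the quadratic form of X s - X t: domination at the single
    time t controls all nearby times. *)
Variables (G : R -> VT -> C) (q : VT -> 'cV[C]_n) (X : R -> 'M[C]_n) (k : R).
Hypothesis k0 : 0 < k.
Hypothesis qk : forall v, sqnorm (q v) <= k * (1 + vsqr v).
Hypothesis GX : forall s t v, G s v = G t v * cexp (- 4^-1 * dot (q v) ((X s - X t) *m q v)).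

Let r (v : VT) : R := 1 + vsqr v.

(** From 1 + x <= exp x at x = c r / 8, squared. *)
Let r_le (c : R) v : 0 < c -> r v ^+ 2 <= 64 / c ^+ 2 * expR (c / 4 * r v).
Proof.
move=> c0; have r0 : 0 <= r v by rewrite addr_ge0// vsqr_ge0.
have h : r v <= 8 / c * expR (c / 8 * r v).
  have := expR_ge1Dx (c / 8 * r v) => e1.
  have : 8 / c * (c / 8 * r v) <= 8 / c * expR (c / 8 * r v) by rewrite ler_wpM2l ?divr_ge0 ?ltW//; lra.
  by rewrite mulrA (_ : 8 / c * (c / 8) = 1) ?mul1r//; field; rewrite gt_eqF.
apply: (@le_trans _ _ ((8 / c * expR (c / 8 * r v)) ^+ 2)).
  by apply: lerXn2r h; rewrite nnegrE//; nonneg.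
rewrite exprMn -expRM_natl expr_div_n (_ : 8 ^+ 2 = 64 :> R); last by ring.
by rewrite (_ : 2%:R * (c / 8 * r v) = c / 4 * r v)//; field.
Qed.

Lemma poly_gaussian_le t (a : C) (M : 'M[C]_n) (K c : R) : 0 < c -> 0 <= K ->
  (forall v, normc (G t v) <= K * gau c v) -> exists2 K', 0 <= K' &
  forall v, normc ((a + dot (q v) (M *m q v)) * G t v) <= K' * gau (c / 2) v.
Proof.
move=> c0 K0 HG; have ma := normc_ge0 a; have mM := mnorm1_ge0 M.
exists ((normc a + mnorm1 M * k) * (64 / c ^+ 2) * K * expR (c / 4)).
  by nonneg.
move=> v; rewrite ComplexField.Normc.normcM.
have v0 := vsqr_ge0 v; have r1 : 1 <= r v by rewrite /r; lra.
have rr : r v <= r v ^+ 2 by rewrite expr2 -[leLHS]mul1r ler_wpM2r//; lra.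
have b : normc (a + dot (q v) (M *m q v)) <= (normc a + mnorm1 M * k) * (64 / c ^+ 2) * expR (c / 4 * r v).
  apply: (@le_trans _ _ ((normc a + mnorm1 M * k) * r v ^+ 2)); last first.
    by rewrite -mulrA; apply: ler_wpM2l; [nonneg|exact: r_le].
  apply: le_trans (le_normcD _ _) _; rewrite mulrDl; apply: lerD.
    by rewrite -[leLHS]mulr1 ler_wpM2l//; lra.
  apply: le_trans (normc_form_le _ _) _; rewrite -mulrA ler_wpM2l//.
  by apply: le_trans (qk v) _; rewrite ler_wpM2l// ltW.
apply: (@le_trans _ _ ((normc a + mnorm1 M * k) * (64 / c ^+ 2) * expR (c / 4 * r v) * (K * gau c v))).
  by apply: ler_pM => //; exact: normc_ge0.
have -> : (normc a + mnorm1 M * k) * (64 / c ^+ 2) * expR (c / 4 * r v) * (K * gau c v) =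
   (normc a + mnorm1 M * k) * (64 / c ^+ 2) * K * (expR (c / 4 * r v) * gau c v) by ring.
rewrite -[leRHS]mulrA ler_wpM2l//.
  by nonneg.
have cv : 0 <= c * vsqr v by rewrite mulr_ge0// ltW.
by rewrite /gau -!expRD ler_expR /r; lra.
Qed.

(** Near t the exponent changes by at most c r / 4, and the polynomial factors cost another c r / 4;
    the rate c / 2 remains and is weakened to c / 4. *)
Lemma poly_gaussian_cont t (a : R -> C) (M : R -> 'M[C]_n) (K c : R) : 0 < c -> 0 <= K ->
  (forall v, normc (G t v) <= K * gau c v) ->
  tends (punct I01 t) a (a t) -> (forall i j, tends (punct I01 t) (fun s => M s i j) (M t i j)) ->
  (forall i j, tends (punct I01 t) (fun s => X s i j) (X t i j)) ->
  forall e : R, 0 < e -> exists2 d : R, 0 < d & forall s, I01 s -> `|s - t| < d -> forall v,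
    normc ((a s + dot (q v) (M s *m q v)) * G s v - (a t + dot (q v) (M t *m q v)) * G t v)
      <= e * gau (c / 4) v.
Proof.
move=> c0 K0 HG ta tM tX e e0.
have ma := normc_ge0 (a t); have mM := mnorm1_ge0 (M t).
pose K2 := (normc (a t) + 1 + (mnorm1 (M t) + 1) * k) * k + 1 + k.
have K20 : 0 <= K2 by rewrite /K2; nonneg.
pose K3 := K2 * (64 / c ^+ 2) * K * expR (c / 2).
have K30 : 0 <= K3 by rewrite /K3; nonneg.
(* The three requirements: e1 <= 1 for the coefficients, e1 k <= c / 4 for the exponent, e1 K3 <= e
   for the final bound. *)
pose e1 := Num.min 1 (Num.min (c / (4 * k)) (e / (K3 + 1))).
have K31 : 0 < K3 + 1 by rewrite ltr_wpDl.
have e10 : 0 < e1 by rewrite !lt_min ltr01 !divr_gt0 ?mulr_gt0.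
have e11 : e1 <= 1 by rewrite ge_min lexx.
have e1k : e1 * (4 * k) <= c by rewrite -ler_pdivlMr ?mulr_gt0// !ge_min lexx !orbT.
have e1K : e1 * (K3 + 1) <= e by rewrite -ler_pdivlMr// !ge_min lexx !orbT.
pose proof (tends_mnorm1 tM) as tM'; pose proof (tends_mnorm1 tX) as tX'.
have [d1 d10 H1] := (punctP _ _ _).1 (ta e1 e10).
have [d2 d20 H2] := (punctP _ _ _).1 (tM' e1 e10).
have [d3 d30 H3] := (punctP _ _ _).1 (tX' e1 e10).
exists (Num.min d1 (Num.min d2 d3)); first by rewrite !lt_min d10 d20.
move=> s s01; rewrite !lt_min => /andP[l1 /andP[l2 l3]] v.
have [->|st] := eqVneq s t.
  by rewrite subrr ComplexField.Normc.normc0 mulr_ge0 ?expR_ge0 ?ltW.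
have h1 : normc (a s - a t) <= e1 by apply: ltW; exact: H1.
have h2 : mnorm1 (M s - M t) <= e1.
  by have := H2 s s01 st l2; rewrite /= subr0 normc_real ger0_norm ?mnorm1_ge0// => /ltW.
have h3 : mnorm1 (X s - X t) <= e1.
  by have := H3 s s01 st l3; rewrite /= subr0 normc_real ger0_norm ?mnorm1_ge0// => /ltW.
have v0 := vsqr_ge0 v; have r1 : 1 <= r v by rewrite /r; lra.
have rr : r v <= r v ^+ 2 by rewrite expr2 -[leLHS]mul1r ler_wpM2r//; lra.
have form N : normc (dot (q v) (N *m q v)) <= mnorm1 N * (k * r v).
  by apply: le_trans (normc_form_le _ _) _; rewrite ler_wpM2l ?mnorm1_ge0//; exact: qk.
pose w := - 4^-1 * dot (q v) ((X s - X t) *m q v).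
have kr0 : 0 <= k * r v by rewrite mulr_ge0 ?ltW//; lra.
have wle : normc w <= e1 * (k * r v).
  rewrite /w ComplexField.Normc.normcM; apply: (@le_trans _ _ (1 * normc (dot (q v) ((X s - X t) *m q v)))).
    rewrite ler_wpM2r ?normc_ge0// normcN -(real_complex_nat 4) -real_complexV normc_real ger0_norm//.
    by lra.
  by rewrite mul1r; apply: le_trans (form _) _; rewrite ler_wpM2r.
have w4 : normc w <= c / 4 * r v.
  apply: le_trans wle _; rewrite mulrA ler_wpM2r//; [lra|lra].
have [T1 _ _] := cexp_taylor w.
have cw : normc (cexp w - 1) <= e1 * (k * r v) * expR (c / 4 * r v).
  by apply: le_trans T1 _; rewrite ler_pM ?normc_ge0 ?expR_ge0// ler_expR.
have aS : normc (a s) <= normc (a t) + 1.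
  by have := le_normcD (a s - a t) (a t); rewrite subrK; lra.
have MS : mnorm1 (M s) <= mnorm1 (M t) + 1.
  by have := mnorm1D (M s - M t) (M t); rewrite subrK; lra.
rewrite (GX s t) -/w.
rewrite (_ : _ - _ = ((a s + dot (q v) (M s *m q v)) * (cexp w - 1)
   + (a s - a t) + dot (q v) ((M s - M t) *m q v)) * G t v); last first.
  by rewrite mulmxBl dotDr dotNr; ring.
rewrite ComplexField.Normc.normcM.
have E1 : 1 <= expR (c / 4 * r v) by rewrite -[leLHS]expR0 ler_expR mulr_ge0 ?divr_ge0 ?ltW//; lra.
have b : normc ((a s + dot (q v) (M s *m q v)) * (cexp w - 1) + (a s - a t)
    + dot (q v) ((M s - M t) *m q v)) <= e1 * (K2 * (r v ^+ 2 * expR (c / 4 * r v))).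
  apply: le_trans (le_normcD _ _) _.
  have p3 : normc (dot (q v) ((M s - M t) *m q v)) <= e1 * (k * (r v ^+ 2 * expR (c / 4 * r v))).
    apply: le_trans (form _) _; apply: ler_pM => //; first exact: mnorm1_ge0.
    apply: ler_wpM2l; first exact: ltW.
    apply: le_trans rr _; rewrite -[leLHS]mulr1; apply: ler_wpM2l => //.
    by apply: exprn_ge0; lra.
  have p2 : normc (a s - a t) <= e1 * (1 * (r v ^+ 2 * expR (c / 4 * r v))).
    apply: le_trans h1 _; rewrite mul1r -[leLHS]mulr1; apply: ler_wpM2l; first exact: ltW.
    by apply: mulr_ege1 => //; lra.
  have p1 : normc ((a s + dot (q v) (M s *m q v)) * (cexp w - 1)) <=
     e1 * ((normc (a t) + 1 + (mnorm1 (M t) + 1) * k) * k * (r v ^+ 2 * expR (c / 4 * r v))).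
    rewrite ComplexField.Normc.normcM.
    have f1 : normc (a s + dot (q v) (M s *m q v)) <= (normc (a t) + 1 + (mnorm1 (M t) + 1) * k) * r v.
      apply: le_trans (le_normcD _ _) _; rewrite mulrDl; apply: lerD.
        by apply: le_trans aS _; rewrite -[leLHS]mulr1 ler_wpM2l//; lra.
      by apply: le_trans (form _) _; rewrite -mulrA ler_wpM2r.
    apply: (@le_trans _ _ ((normc (a t) + 1 + (mnorm1 (M t) + 1) * k) * r v * (e1 * (k * r v) * expR (c / 4 * r v)))).
      by rewrite ler_pM ?normc_ge0.
    by rewrite le_eqVlt; apply/orP; left; apply/eqP; ring.
  have := le_normcD ((a s + dot (q v) (M s *m q v)) * (cexp w - 1)) (a s - a t).
  move: p1 p2 p3; set u := r v ^+ 2 * _; rewrite /K2; lra.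
apply: (@le_trans _ _ (e1 * (K2 * (64 / c ^+ 2 * expR (c / 4 * r v) * expR (c / 4 * r v))) * (K * gau c v))).
  apply: ler_pM => //; [exact: normc_ge0|exact: normc_ge0|].
  apply: le_trans b _; apply: ler_wpM2l; first exact: ltW.
  apply: ler_wpM2l => //; apply: ler_wpM2r; [exact: expR_ge0|exact: r_le].
have -> : e1 * (K2 * (64 / c ^+ 2 * expR (c / 4 * r v) * expR (c / 4 * r v))) * (K * gau c v) =
  e1 * (K2 * (64 / c ^+ 2) * K * (expR (c / 4 * r v) * expR (c / 4 * r v) * gau c v)) by ring.
have -> : expR (c / 4 * r v) * expR (c / 4 * r v) * gau c v = expR (c / 2) * gau (c / 2) v.
  by rewrite /gau -!expRD; congr expR; rewrite /r; field.
have g24 : gau (c / 2) v <= gau (c / 4) v.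
  have cv : 0 <= c * vsqr v by rewrite mulr_ge0// ltW.
  by rewrite /gau ler_expR; lra.
rewrite [leLHS](_ : _ = e1 * K3 * gau (c / 2) v); last by rewrite /K3; ring.
apply: ler_pM => //; [by nonneg|exact: expR_ge0|lra].
Qed.

End gaussian_families.

Section square_integrable_families.
Context {R : realType} {n : nat}.
Local Notation C := R[i].
Local Notation T := (measurableTypeR R).
Local Notation VT := (n.-tuple T * n.-tuple T)%type.
Local Notation eps := (@eps_omega R n).
Local Notation I01 := (`[0, 1]%classic : set R).

(** Continuity in time, uniform in v up to a Gaussian weight. It implies L^2 continuity and, for a
    pointwise derivative, differentiability in L^2. *)
Definition gau_cont (f : R -> VT -> C) (t : R) : Prop := exists2 c : R, 0 < c &
  forall e : R, 0 < e -> exists2 d : R, 0 < d & forall s, I01 s -> `|s - t| < d ->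
    forall v, normc (f s v - f t v) <= e * gau c v.

Let I (c : R) : R := fine (\int[eps]_v (gau (2 * c) v)%:E).

Let I_ge0 c : 0 <= I c.
Proof. by apply: fine_ge0; apply: integral_ge0 => v _; rewrite lee_fin expR_ge0. Qed.

Lemma L2norm_gau_le (c e h : R) (f : VT -> C) : 0 < c -> 0 < e -> 0 <= h -> mC f ->
  (forall v, normc (f v) <= e / (I c + 1) * h * gau c v) -> (L2norm f <= (e * h)%:E)%E.
Proof.
move=> c0 e0 h0 mf H; have [f2 fN] := fL2_gau c0 mf H.
apply/(L2norm_le _ f2); first by rewrite mulr_ge0// ltW.
apply: le_trans fN _; rewrite -/(I c).
have i1 : 0 < I c + 1 by rewrite ltr_wpDl.
rewrite exprMn expr_div_n exprMn mulrAC [leRHS]mulrC [_ * h ^+ 2]mulrC ler_wpM2l ?sqr_ge0// -mulrA -[leRHS]mulr1.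
rewrite ler_wpM2l ?sqr_ge0// mulrC ler_pdivrMr ?exprn_gt0// mul1r.
by have := I_ge0 c; rewrite expr2; nra.
Qed.

Lemma cont01_gau (f : R -> VT -> C) : (forall t : R, t \in `[0, 1] -> mC (f t)) ->
  (forall t : R, t \in `[0, 1] -> gau_cont f t) -> cont01 L2norm f.
Proof.
move=> mf H t t01 e e0; have [c c0 Hc] := H t t01.
have i1 : 0 < I c + 1 by rewrite ltr_wpDl ?I_ge0.
have [d d0 Hd] := Hc _ (divr_gt0 e0 i1); exists d => // s s01 st.
rewrite -[e]mulr1; apply: (@L2norm_gau_le c) => //.
- by apply: mCB; exact: mf.
- by move=> v; rewrite mulr1; exact: Hd.
Qed.

(** For fixed v the mean value inequality between t and s bounds the increment error by |s - t|
    times the oscillation of f', which carries the Gaussian weight. *)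
Lemma deriv01_gau (f f' : R -> VT -> C) : (forall t : R, t \in `[0, 1] -> mC (f t)) ->
  (forall t : R, t \in `[0, 1] -> mC (f' t)) ->
  (forall (t : R) v, t \in `[0, 1] -> derc I01 (f ^~ v) t (f' t v)) ->
  (forall t : R, t \in `[0, 1] -> gau_cont f' t) -> deriv01 L2norm f f'.
Proof.
move=> mf mf' df H t t01 e e0; have [c c0 Hc] := H t t01.
have i1 : 0 < I c + 1 by rewrite ltr_wpDl ?I_ge0.
have [d d0 Hd] := Hc _ (divr_gt0 e0 i1); exists d => // s s01 st.
apply: (@L2norm_gau_le c) => //.
- apply: mCB; first by apply: mCB; exact: mf.
  by apply: mCM; [exact: mC_cst|exact: mf'].
move=> v; have hv : 0 <= e / (I c + 1) * `|s - t| * gau c v.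
  by nonneg.
pose p (u : R) := f ((s - t) * u + t) v - u%:C * ((s - t)%:C * f' t v).
have in01 (u : R) : I01 u -> I01 ((s - t) * u + t).
  by move: t01 s01; rewrite /= !in_itv /= => /andP[t0 t1] /andP[s0 s1] /andP[u0 u1]; apply/andP; split; nra.
have dp (u : R) : u \in `[0, 1] -> derc I01 p u ((s - t)%:C * (f' ((s - t) * u + t) v - f' t v)).
  move=> u01; have h1 := derc_affine in01 (df ((s - t) * u + t) v (in01 u u01)).
  have h2 := dercM (derc_real I01 u) (derc_cst I01 u ((s - t)%:C * f' t v)).
  by apply: derc_val (dercB h1 h2); ring.
have := derc01_bound hv dp _ (_ : (1 : R) \in `[0, 1]).
rewrite in_itv /= ler01 lexx => /(_ _ isT).
rewrite /p mulr1 subrK mulr0 add0r mul0r subr0 mul1r => b.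
rewrite (_ : (f s - f t - (s - t)%:C *: f' t) v = f s v - (s - t)%:C * f' t v - f t v); last first.
  by rewrite addrAC.
apply: b => u u01; rewrite ComplexField.Normc.normcM normc_real [leRHS]mulrAC mulrC.
rewrite ler_wpM2r//; apply: Hd; first exact: in01.
rewrite addrK normrM; apply: le_lt_trans st; rewrite -[leRHS]mulr1 ler_wpM2l//.
by move: u01; rewrite in_itv /= => /andP[u0 u1]; rewrite ger0_norm.
Qed.

End square_integrable_families.

Section chain_rules.
Context {R : realType}.
Local Notation C := R[i].

Lemma derc_comp (D : set R) (F : R -> C) (x : R -> R) (t l : R) (m : C) :
  derc setT F (x t) m -> derc D (fun s => (x s)%:C) t l%:C ->
  derc D (fun s => F (x s)) t (m * l%:C).
Proof.
move=> /dercP dF /dercP dx; apply/dercP => e e0.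
pose kl := `|l| + 1; pose km := normc m + 1.
have kl0 : 0 < kl by rewrite ltr_wpDl.
have km0 : 0 < km by rewrite ltr_wpDl// normc_ge0.
have [d1 d10 H1] := dF (e / 2 / kl) (divr_gt0 (divr_gt0 e0 (ltr0n _ 2)) kl0).
have e20 : 0 < Num.min 1 (e / 2 / km) by rewrite lt_min ltr01 !divr_gt0.
have [d2 d20 H2] := dx _ e20.
exists (Num.min d2 (d1 / kl)); first by rewrite lt_min d20 divr_gt0.
move=> s Ds; rewrite lt_min => /andP[s2 s1].
have h := H2 s Ds s2; rewrite -!real_complexB -real_complexM -real_complexB normc_real in h.
have st0 : 0 <= `|s - t| by [].
have h1 : `|x s - x t - (s - t) * l| <= 1 * `|s - t|.
  by apply: le_trans h _; rewrite ler_wpM2r// ge_min lexx.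
have h2 : `|x s - x t - (s - t) * l| <= e / 2 / km * `|s - t|.
  by apply: le_trans h _; rewrite ler_wpM2r// ge_min lexx orbT.
have xk : `|x s - x t| <= kl * `|s - t|.
  rewrite -[x s - x t](subrK ((s - t) * l)); apply: le_trans (ler_normD _ _) _.
  by rewrite normrM /kl; lra.
have h3 := H1 (x s) I; rewrite (_ : _ < d1 = true) in h3; last first.
  by apply: le_lt_trans xk _; rewrite mulrC -ltr_pdivlMr.
rewrite (_ : _ - _ = (F (x s) - F (x t) - (x s - x t)%:C * m) + m * (x s - x t - (s - t) * l)%:C); last first.
  by rewrite !(real_complexB, real_complexM); ring.
apply: le_trans (le_normcD _ _) _; rewrite ComplexField.Normc.normcM normc_real.
have a1 : normc (F (x s) - F (x t) - (x s - x t)%:C * m) <= e / 2 * `|s - t|.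
  apply: le_trans (h3 isT) _; apply: (@le_trans _ _ (e / 2 / kl * (kl * `|s - t|))).
    by apply: ler_wpM2l xk; nonneg.
  by rewrite mulrA divfK// gt_eqF.
have a2 : normc m * `|x s - x t - (s - t) * l| <= e / 2 * `|s - t|.
  apply: (@le_trans _ _ (km * (e / 2 / km * `|s - t|))).
    by apply: ler_pM => //; [exact: normc_ge0|rewrite lerDl].
  by rewrite mulrA [km * _]mulrC divfK// gt_eqF.
by lra.
Qed.

(** Stated with the logarithmic derivative l, which the power multiplies by a. *)
Lemma derc_powR (D : set R) (x : R -> R) (a t l : R) : 0 < x t ->
  derc D (fun s => (x s)%:C) t (x t * l)%:C ->
  derc D (fun s => (x s `^ a)%:C) t (a * l * x t `^ a)%:C.
Proof.
move=> x0 dx; have dF := is_derive_derc setT (is_derive1_powR a x0).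
apply: derc_val (derc_comp dF dx); rewrite -real_complexM; congr (_%:C).
rewrite powRB ?powRr1 ?(ltW x0)//; last by apply/implyP => _; rewrite gt_eqF.
by field; rewrite gt_eqF.
Qed.

Lemma derc_det_unit (D : set R) n (F : R -> 'M[C]_n) (t : R) A : F t \in unitmx -> dercmx D F t A ->
  derc D (fun s => \det (F s)) t (\det (F t) * \tr (invmx (F t) *m A)).
Proof.
move=> uF dF; apply: derc_val (derc_det dF).
have d0 : \det (F t) != 0 by move: uF; rewrite unitmxE unitfE.
by rewrite /invmx uF -scalemxAl mxtraceZ mulrA mulfV// mul1r mxtrace_mulC.
Qed.

End chain_rules.

Lemma mxtraceN (K : pzRingType) m (M : 'M[K]_m) : \tr (- M) = - \tr M.
Proof. by rewrite -scaleN1r mxtraceZ mulN1r. Qed.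

(** * Time derivative of the transported family and parallelism *)

Section transported_derivative.
Context {R : realType} {n : nat}.
Local Notation C := R[i].
Local Notation T := (measurableTypeR R).
Local Notation VT := (n.-tuple T * n.-tuple T)%type.
Local Notation eps := (@eps_omega R n).
Local Notation I01 := (`[0, 1]%classic : set R).
Variables (A : 'M[C]_n) (al : 'cV[C]_n) (Z P : R -> 'M[C]_n).
Hypothesis hA : siegel A.
Hypothesis hZ : forall t : R, t \in `[0, 1] -> siegel (Z t).
Hypothesis dZ : forall t : R, t \in `[0, 1] -> dercmx I01 Z t (P t).

Definition dXi (t : R) : 'M[C]_n := - ((2 * 'i)^-1 *: conjmx (P t)).

Lemma dercmx_Xi t : t \in `[0, 1] -> dercmx I01 (fun s => Xi A (Z s)) t (dXi t).
Proof.
move=> t01; have := dercmxZ (2 * 'i)^-1 (dercmxB (dercmx_cst I01 t A) (dercmx_conj (dZ t01))).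
by apply: dercmx_val; rewrite /dXi sub0r scalerN.
Qed.

Let uXi t : t \in `[0, 1] -> Xi A (Z t) \in unitmx.
Proof. by move=> t01; have [] := Xi_facts hA (hZ t01). Qed.

Lemma dercmx_invXi t : t \in `[0, 1] -> dercmx I01 (fun s => invmx (Xi A (Z s))) t
  (- (invmx (Xi A (Z t)) *m dXi t *m invmx (Xi A (Z t)))).
Proof. by move=> t01; apply: dercmx_inv; [exact: t01|move=> s; exact: uXi|exact: dercmx_Xi]. Qed.

(** The logarithmic derivative of [amp]: a quarter of that of det Im Z minus half of that of |det
    Xi|. *)
Definition log_amp (t : R) : R := 4^-1 * \tr (invmx (Immx (Z t)) *m Immx (P t))
  - 2^-1 * complex.Re (\tr (invmx (Xi A (Z t)) *m dXi t)).

Lemma derc_det_Im t : t \in `[0, 1] -> derc I01 (fun s => (\det (Immx (Z s)))%:C) t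
  (\det (Immx (Z t)) * \tr (invmx (Immx (Z t)) *m Immx (P t)))%:C.
Proof.
move=> t01; have uY := posdef_unit (hZ t01).2.
have dY : dercmx I01 (fun s => toC (Immx (Z s))) t (toC (Immx (P t))).
  rewrite Immx_sub; apply: (dercmx_eq _ _ (dercmxZ (2 * 'i)^-1 (dercmxB (dZ t01) (dercmx_conj (dZ t01))))) => //.
  by move=> s _; rewrite Immx_sub.
have uY' : (toC (Immx (Z t)) : 'M[C]_n) \in unitmx by rewrite toC_unit.
have d := derc_det_unit uY' dY.
apply: (derc_val _ (derc_eq _ _ d)) => //; last by move=> s _; rewrite det_map_mx.
by rewrite det_map_mx -toCV -toCM real_complexM -trace_map_mx.
Qed.

(** The modulus enters through its square, which as det times its conjugate is accessible to the
    product rule. *)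
Lemma amp_powR (B : 'M[C]_n) : amp A B = \det (Immx A) `^ 4^-1 * \det (Immx B) `^ 4^-1
  * (normc (\det (Xi A B)) ^+ 2) `^ (- 4^-1).
Proof.
rewrite /amp powRN; congr (_ * _^-1).
rewrite -powR_mulrn ?normc_ge0// -powRrM; congr (_ `^ _).
by field.
Qed.

Lemma derc_amp t : t \in `[0, 1] -> derc I01 (fun s => (amp A (Z s))%:C) t (amp A (Z t) * log_amp t)%:C.
Proof.
move=> t01; have d1 := derc_powR 4^-1 (posdef_det_gt0 (hZ t01).2) (derc_det_Im t01).
have dw := derc_det_unit (uXi t01) (dercmx_Xi t01).
pose w s := \det (Xi A (Z s)); pose tau := \tr (invmx (Xi A (Z t)) *m dXi t).
have w0 : 0 < normc (w t) ^+ 2.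
  by rewrite exprn_gt0// normc_gt0; move: (uXi t01); rewrite unitmxE unitfE.
have d2 : derc I01 (fun s => (normc (w s) ^+ 2)%:C) t (normc (w t) ^+ 2 * (2 * complex.Re tau))%:C.
  apply: (derc_val _ (derc_eq _ _ (dercM dw (derc_conj dw)))) => //; last by move=> s _; rewrite mul_conj.
  rewrite conjcM -/(w t) -/tau real_complexM -mul_conj.
  have -> : (2 * complex.Re tau)%:C = tau + tau^* :> C.
    by apply: complex_ext; rewrite !reimE; ring.
  by ring.
have d3 := derc_powR (x := fun s => normc (w s) ^+ 2) (- 4^-1) w0 d2.
have d4 := dercM (dercM (derc_cst I01 t (\det (Immx A) `^ 4^-1)%:C) d1) d3.
apply: (derc_val _ (derc_eq _ _ d4)) => //; last first.
  by move=> s _; rewrite amp_powR !real_complexM.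
rewrite amp_powR -/(w t) /log_amp -/tau.
rewrite (_ : 4^-1 * _ - _ = 4^-1 * \tr (invmx (Immx (Z t)) *m Immx (P t)) + - 4^-1 * (2 * complex.Re tau)); last by field.
by rewrite !(real_complexM, real_complexD); ring.
Qed.

Definition coefM (t : R) : 'M[C]_n :=
  ((amp A (Z t))%:C / 4) *: (invmx (Xi A (Z t)) *m dXi t *m invmx (Xi A (Z t))).
Definition coefa (t : R) : C := (amp A (Z t) * log_amp t)%:C.

Definition dtransported (t : R) (v : VT) : C :=
  (coefa t + dot (qcoord A al v) (coefM t *m qcoord A al v)) * gaussian A (Z t) al v.

Lemma derc_transported t v : t \in `[0, 1] ->
  derc I01 (fun s => transported A (Z s) al v) t (dtransported t v).
Proof.
move=> t01; pose q := qcoord A al v.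
have dX : derc I01 (fun s => dot q (invmx (Xi A (Z s)) *m q)) t
    (dot q (- (invmx (Xi A (Z t)) *m dXi t *m invmx (Xi A (Z t))) *m q)).
  exact: (dercmxMl q^T (dercmxMr q (dercmx_invXi t01)) 0 0).
have dE := dercD (dercZ (- 4^-1) dX) (derc_cst I01 t (lin A al v)).
have dG := derc_cexp dE.
apply: (derc_val _ (derc_eq _ _ (dercM (derc_amp t01) dG))) => //; last first.
  by move=> s s01; rewrite transported_gaussian//; exact: hZ.
rewrite /dtransported /coefa /coefM /gaussian -/q -scalemxAl dotZr mulNmx dotNr.
move: (dot q _) (cexp _) (_%:C) (_%:C) => *; ring.
Qed.

Hypothesis dP : forall t : R, t \in `[0, 1] -> exists L, dercmx I01 P t L.

Lemma dercmx_Immx (F : R -> 'M[C]_n) t L : I01 t -> dercmx I01 F t L ->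
  dercmx I01 (fun s => toC (Immx (F s))) t (toC (Immx L)).
Proof.
move=> t01 dF; rewrite Immx_sub.
apply: (dercmx_eq _ _ (dercmxZ (2 * 'i)^-1 (dercmxB dF (dercmx_conj dF)))) => //.
by move=> s _; rewrite Immx_sub.
Qed.

Lemma dercmx_dXi t : t \in `[0, 1] -> exists L, dercmx I01 dXi t L.
Proof.
move=> t01; have [L dL] := dP t01; eexists.
exact: (dercmxN (dercmxZ (2 * 'i)^-1 (dercmx_conj dL))).
Qed.

(** Supplies the continuity of the coefficient, needed because parallel families are C^1 in
    [nablaH]. *)
Lemma derc_coefa t : t \in `[0, 1] -> exists l, derc I01 coefa t l.
Proof.
move=> t01; have [L dL] := dP t01; have [L' dL'] := dercmx_dXi t01.
have uY s : I01 s -> (toC (Immx (Z s)) : 'M[C]_n) \in unitmx.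
  by move=> s01; rewrite toC_unit; exact: posdef_unit (hZ s01).2.
have d1 := derc_mxtrace (dercmxM (dercmx_inv t01 uY (dercmx_Immx t01 (dZ t01))) (dercmx_Immx t01 dL)).
have d2 := derc_ReP (derc_mxtrace (dercmxM (dercmx_invXi t01) dL')).
have d3 := dercM (derc_amp t01) (dercB (dercZ 4^-1 d1) (dercZ 2^-1 d2)).
eexists; apply: (derc_eq _ _ d3) => // s s01.
rewrite /coefa /log_amp -toCV -toCM trace_map_mx real_complexM real_complexB !real_complexM.
by rewrite !real_complexV !real_complex_nat.
Qed.

Lemma dercmx_coefM t : t \in `[0, 1] -> exists L, dercmx I01 coefM t L.
Proof.
move=> t01; have [L' dL'] := dercmx_dXi t01.
have dX := dercmx_invXi t01.
have dM := dercmxM (dercmxM dX dL') dX.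
have [da dda] : exists l, derc I01 (fun s => (amp A (Z s))%:C / 4) t l.
  by eexists; exact: (dercM (derc_amp t01) (derc_cst I01 t 4^-1)).
exists (\matrix_(i, j) (da * (invmx (Xi A (Z t)) *m dXi t *m invmx (Xi A (Z t))) i j + (amp A (Z t))%:C / 4 *
 (((- (invmx (Xi A (Z t)) *m dXi t *m invmx (Xi A (Z t)))) *m dXi t + invmx (Xi A (Z t)) *m L') *m invmx (Xi A (Z t)) +
   invmx (Xi A (Z t)) *m dXi t *m (- (invmx (Xi A (Z t)) *m dXi t *m invmx (Xi A (Z t))))) i j)) => i j.
rewrite [(\matrix_(_, _) _) i j]mxE.
apply: (derc_eq _ _ (dercM dda (dM i j))) => // s _.
by rewrite /coefM [RHS]mxE.
Qed.

Lemma mC_dtransported t : mC (dtransported t).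
Proof.
apply: mCM; last exact: mC_gaussian.
apply: mCD; first exact: mC_cst.
by apply: mC_dot; [|apply: mCvM]; exact: mCv_qcoord.
Qed.

Lemma gaussian_change s t v : gaussian A (Z s) al v = gaussian A (Z t) al v *
  cexp (- 4^-1 * dot (qcoord A al v) ((invmx (Xi A (Z s)) - invmx (Xi A (Z t))) *m qcoord A al v)).
Proof.
rewrite /gaussian -cexpD; congr cexp; rewrite mulmxBl dotDr dotNr.
by move: (dot _ _) (dot _ _) (lin _ _ _) => x y z; ring.
Qed.

Lemma gaussian_le t : t \in `[0, 1] -> exists K c : R, [/\ 0 < c, 0 <= K &
  forall v, normc (gaussian A (Z t) al v) <= K * gau c v].
Proof.
move=> t01; have [k [c [c0 H]]] := exponent_decay al hA (hZ t01).
exists (expR k), c; split; [exact: c0|exact: expR_ge0|].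
by move=> v; rewrite normc_cexp /gau -expRD ler_expR.
Qed.

Lemma fL2_dtransported t : t \in `[0, 1] -> fL2 eps (dtransported t).
Proof.
move=> t01; have [K [c [c0 K0 H]]] := gaussian_le t01; have [k k0 Hk] := qcoord_le A al.
have [K' K'0 H'] := poly_gaussian_le (G := fun s => gaussian A (Z s) al)
  k0 Hk (coefa t) (coefM t) c0 K0 H.
by have [] := @fL2_gau _ _ (c / 2) K' _ (divr_gt0 c0 (ltr0n _ 2)) (mC_dtransported t) H'.
Qed.

Lemma gau_cont_dtransported t : t \in `[0, 1] -> gau_cont dtransported t.
Proof.
move=> t01; have [K [c [c0 K0 H]]] := gaussian_le t01; have [k k0 Hk] := qcoord_le A al.
have [la dla] := derc_coefa t01; have [lM dlM] := dercmx_coefM t01.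
exists (c / 4); first exact: divr_gt0.
apply: (poly_gaussian_cont k0 Hk gaussian_change c0 K0 H (derc_tends dla) (fun i j => derc_tends (dlM i j))).
by move=> i j; exact: (derc_tends (dercmx_invXi t01 i j)).
Qed.

Hypothesis phase : forall t : R, t \in `[0, 1] ->
  complex.Im (\tr (invmx (Z t - conjmx A) *m P t)) = - (2^-1 * \tr (invmx (Immx (Z t)) *m Remx (P t))).

(** Here the phase identity enters: the real parts agree by Jacobi's formula alone, and it makes the
    imaginary part of the right side vanish. *)
Lemma log_amp_defect t : t \in `[0, 1] ->
  (log_amp t)%:C = - 2^-1 * \tr (dXi t *m defect A (Z t)).
Proof.
move=> t01; pose tau := \tr (invmx (Xi A (Z t)) *m dXi t).
have c2 : (2 * 'i)^-1 != 0 :> C by rewrite invr_eq0 mulf_neq0 ?two_neq0 ?i_neq0.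
have [_ _ u] := siegel_sub_conj hA (hZ t01).
have [_ _ u'] := siegel_sub_conj (hZ t01) hA.
have tauE : tau^* = \tr (invmx (Z t - conjmx A) *m P t).
  rewrite /tau /Xi invmx_scale// /dXi invrK mulmxN -scalemxAl -scalemxAr scalerA divff; last first.
    by rewrite -invr_eq0.
  rewrite scale1r mxtraceN conjcN -[(\tr _)^*]/(conjc (\tr _)) -trace_map_mx conjmxM conjmxV conjmxB !conjmxK.
  have u2 : conjmx A - Z t \in unitmx by rewrite -opprB -scaleN1r unitmxZ ?unitrN1.
  by rewrite -[in RHS]opprB invmxN// mulNmx mxtraceN.
have Itau : complex.Im tau = 2^-1 * \tr (invmx (Immx (Z t)) *m Remx (P t)).
  by have := phase t01; rewrite -tauE Im_conjc => /eqP; rewrite eqr_opp => /eqP.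
have kap : \tr (dXi t *m toC (invmx (Immx (Z t)))) =
   (2^-1 * \tr (invmx (Immx (Z t)) *m Immx (P t)))%:C + 'i * (2^-1 * \tr (invmx (Immx (Z t)) *m Remx (P t)))%:C.
  rewrite /dXi mulNmx -scalemxAl mxtraceN mxtraceZ {1}[P t]ReImmx conjmxD conjmxZ !conjmx_toC conjci.
  rewrite mulmxDl -scalemxAl mxtraceD mxtraceZ -!toCM !trace_map_mx.
  rewrite (mxtrace_mulC (Remx _)) (mxtrace_mulC (Immx _)) !real_complexM real_complexV real_complex_nat.
  have i2 : 'i * 'i = - 1 :> C by exact: mulii.
  by rewrite invfM invi; rewrite [LHS](_ : _ = 2^-1 * 'i * (\tr (invmx (Immx (Z t)) *m Remx (P t)))%:C
   - ('i * 'i) * 2^-1 * (\tr (invmx (Immx (Z t)) *m Immx (P t)))%:C); [rewrite i2; ring|ring].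
rewrite /defect mulmxBr mxtraceD mxtraceN mxtrace_mulC -/tau kap -Itau /log_amp -/tau.
rewrite [X in _ * (X - _)](_ : tau = (complex.Re tau)%:C + 'i * (complex.Im tau)%:C); last exact: complexE.
move: (complex.Re tau) (complex.Im tau) (\tr _) => r s a.
by rewrite real_complexB !real_complexM !real_complexV !real_complex_nat; field.
Qed.

Lemma HOmega0 (B : 'M[C]_n) : HOmega B (0 : VT -> C).
Proof.
split.
  apply/H0_fL2; have m0 : mC (fun _ : VT => 0 : C) by exact: mC_cst.
  have [] // := fL2_gau (K := 0) ltr01 m0.
  by move=> v; rewrite mul0r ComplexField.Normc.normc0.
by exists (fun=> 0); [exact: entire_cst|move=> v; rewrite mul0r].
Qed.

(** Paired with g, the derivative gives one quarter of the integrand of [orthogonality] for M =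
    [dXi t]. *)
Lemma proj_dtransported t : t \in `[0, 1] -> is_proj (HOmega (Z t)) (dtransported t) 0.
Proof.
move=> t01; split; first exact: HOmega0.
move=> g [/H0_fL2 g2 [phi ephi gE]].
have [_ z] := orthogonality al hA (hZ t01) g2 ephi gE (dXi t).
rewrite -[RHS](mulr0 4^-1) -[in RHS]z -cintZ; last first.
  by have [] := orthogonality al hA (hZ t01) g2 ephi gE (dXi t).
apply: cint_eq => v; have [_ _ sX] := Xi_facts hA (hZ t01).
rewrite (_ : (dtransported t - 0) v = dtransported t v); last by rewrite subr0.
rewrite /dtransported transported_gaussian//; last exact: hZ.
have E : dot (qcoord A al v) (invmx (Xi A (Z t)) *m dXi t *m invmx (Xi A (Z t)) *m qcoord A al v) =
    dot (invmx (Xi A (Z t)) *m qcoord A al v) (dXi t *m (invmx (Xi A (Z t)) *m qcoord A al v)).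
  by rewrite -!mulmxA [LHS]dot_mulmx sX.
rewrite /coefa real_complexM log_amp_defect// /coefM -scalemxAl dotZr E.
by move: (dot _ _) (\tr _) (gaussian _ _ _ _) ((g v)^*) (_%:C) => x y G u w; field.
Qed.

Lemma parallel_transported : parallelH Z (fun t => transported A (Z t) al).
Proof.
split=> [t t01|]; first exact: HOmega_transported (hZ t01).
exists dtransported; split.
- by move=> t t01; apply/H0_fL2; exact: fL2_dtransported.
- apply: deriv01_gau => [t t01|t t01|t v t01|t t01].
  + exact: mC_transported (hZ t01).
  + exact: mC_dtransported.
  + exact: derc_transported.
  + exact: gau_cont_dtransported.
- by apply: cont01_gau => t t01; [exact: mC_dtransported|exact: gau_cont_dtransported].
- exact: proj_dtransported.
Qed.

End transported_derivative.

(** * Uniqueness of parallel sections *)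

Section square_integrable_sections.
Context {R : realType} {n : nat}.
Local Notation C := R[i].
Local Notation T := (measurableTypeR R).
Local Notation VT := (n.-tuple T * n.-tuple T)%type.
Local Notation eps := (@eps_omega R n).
Local Notation I01 := (`[0, 1]%classic : set R).
Implicit Types (f g : R -> VT -> C).

Definition rem f f' (s t : R) : VT -> C := fun v => f s v - f t v - (s - t)%:C * f' t v.

Lemma fL2_rem f f' s t : fL2 eps (f s) -> fL2 eps (f t) -> fL2 eps (f' t) -> fL2 eps (rem f f' s t).
Proof. by move=> h1 h2 h3; apply: (fL2B (fL2B h1 h2).1 (fL2Z _ h3).1).1. Qed.

(** Working with squared norms trades e for its square root once and keeps the later estimates
    polynomial. *)
Lemma deriv01_N2 f f' : (forall t : R, t \in `[0, 1] -> fL2 eps (f t)) ->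
  (forall t : R, t \in `[0, 1] -> fL2 eps (f' t)) ->
  deriv01 L2norm f f' <-> forall t : R, t \in `[0, 1] -> forall e : R, 0 < e -> exists2 d : R, 0 < d &
    forall s : R, s \in `[0, 1] -> `|s - t| < d -> N2 eps (rem f f' s t) <= e * (s - t) ^+ 2.
Proof.
move=> hf hf'.
have E s t : f s - f t - (s - t)%:C *: f' t = rem f f' s t by apply/funext.
split=> H t t01 e e0.
  have s0 : 0 < Num.sqrt e by rewrite sqrtr_gt0.
  have [d d0 Hd] := H t t01 _ s0; exists d => // s s01 st.
  have := Hd s s01 st; rewrite E => /(L2norm_le (mulr_ge0 (sqrtr_ge0 e) (normr_ge0 _))
    (fL2_rem (hf s s01) (hf t t01) (hf' t t01))).
  by rewrite exprMn (sqr_sqrtr (ltW e0)) real_normK ?num_real.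
have [d d0 Hd] := H t t01 _ (exprn_gt0 2 e0); exists d => // s s01 st.
rewrite E; apply/(L2norm_le _ (fL2_rem (hf s s01) (hf t t01) (hf' t t01))).
  by rewrite mulr_ge0// ltW.
by rewrite exprMn real_normK ?num_real//; exact: Hd.
Qed.

Lemma cont01_N2 f : (forall t : R, t \in `[0, 1] -> fL2 eps (f t)) ->
  cont01 L2norm f <-> forall t : R, t \in `[0, 1] -> forall e : R, 0 < e -> exists2 d : R, 0 < d &
    forall s : R, s \in `[0, 1] -> `|s - t| < d -> N2 eps (fun v => f s v - f t v) <= e.
Proof.
move=> hf; have E s t : f s - f t = fun v => f s v - f t v by apply/funext.
split=> H t t01 e e0.
  have s0 : 0 < Num.sqrt e by rewrite sqrtr_gt0.
  have [d d0 Hd] := H t t01 _ s0; exists d => // s s01 st.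
  have := Hd s s01 st; rewrite E => /(L2norm_le (sqrtr_ge0 e) (fL2B (hf s s01) (hf t t01)).1).
  by rewrite (sqr_sqrtr (ltW e0)).
have [d d0 Hd] := H t t01 _ (exprn_gt0 2 e0); exists d => // s s01 st.
by rewrite E; apply/(L2norm_le _ (fL2B (hf s s01) (hf t t01)).1); [exact: ltW|exact: Hd].
Qed.

Lemma rem_increment f f' s t : fL2 eps (f s) -> fL2 eps (f t) -> fL2 eps (f' t) ->
  N2 eps (fun v => f s v - f t v) <= 2 * N2 eps (rem f f' s t) + 2 * ((s - t) ^+ 2 * N2 eps (f' t)).
Proof.
move=> h1 h2 h3; have [fz Nz] := fL2Z (s - t)%:C h3.
have [_] := fL2D (fL2_rem h1 h2 h3) fz.
rewrite Nz normc_real real_normK ?num_real// (_ : (fun v => _) = fun v => f s v - f t v)//.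
by apply/funext => v; rewrite /rem subrK.
Qed.

(** For u = f s - f t the squared norms differ by 2 Re <u, f t> + |u|^2. Orthogonality removes the
    linear part of u from the first term, and the second is of second order. *)
Lemma norm_derivative_zero f f' : (forall t : R, t \in `[0, 1] -> fL2 eps (f t)) ->
  (forall t : R, t \in `[0, 1] -> fL2 eps (f' t)) -> deriv01 L2norm f f' ->
  (forall t : R, t \in `[0, 1] -> cint eps (fun v => f' t v * (f t v)^*) = 0) ->
  forall t : R, t \in `[0, 1] -> N2 eps (f t) = N2 eps (f 0).
Proof.
move=> hf hf' /(deriv01_N2 hf hf') H ort t t01.
suff d0 : forall u : R, u \in `[0, 1] -> derc I01 (fun s => (N2 eps (f s))%:C) u 0.
  by have := congr1 (@complex.Re R) (derc01_constant d0 t01); rewrite !Re_real.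
move=> {t t01} t t01; apply/dercP => e e0.
set a := N2 eps (f t); set b := N2 eps (f' t).
have a0 : 0 <= a by exact: N2_ge0. have b0 : 0 <= b by exact: N2_ge0.
pose k := Num.min 1 (e / (8 * (1 + a))); have k0 : 0 < k by rewrite lt_min ltr01 divr_gt0// mulr_gt0// ltr_wpDr.
have k1 : k <= 1 by rewrite ge_min lexx.
have ke : k * (8 * (1 + a)) <= e by rewrite -ler_pdivlMr ?mulr_gt0 ?ltr_wpDr// ge_min lexx orbT.
have [d dd Hd] := H t t01 _ (exprn_gt0 2 k0).
exists (Num.min d (e / (4 * (1 + b)))); first by rewrite lt_min dd divr_gt0// mulr_gt0// ltr_wpDr.
move=> s s01; rewrite lt_min => /andP[sd se]; rewrite mulr0 subr0 -real_complexB normc_real.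
have [->|st] := eqVneq s t; first by rewrite subrr normr0 mulr_ge0// ltW.
set h := `|s - t| in sd se *; have h0 : 0 < h by rewrite normr_gt0 subr_eq0.
have hh : (s - t) ^+ 2 = h ^+ 2 by rewrite real_normK ?num_real.
have hs := hf s s01; have ht := hf t t01; have ht' := hf' t t01.
have fr := fL2_rem hs ht ht'.
have r2 : N2 eps (rem f f' s t) <= k ^+ 2 * h ^+ 2 by rewrite -hh; exact: Hd.
have u2 := rem_increment hs ht ht'; rewrite hh -/b in u2.
have [fu _] := fL2B hs ht.
pose u v := f s v - f t v.
have ip1 : cint eps (fun v => u v * (f t v)^*) = cint eps (fun v => rem f f' s t v * (f t v)^*).
  have [i1 _] := fL2_mul ltr01 fr ht; have [i2 _] := fL2_mul ltr01 ht' ht.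
  rewrite (@cint_eq _ _ _ _ _ (fun v => rem f f' s t v * (f t v)^* + (s - t)%:C * (f' t v * (f t v)^*))).
    by rewrite cintD//; [rewrite cintZ// ort// mulr0 addr0|exact: intCZ].
  by move=> v; rewrite /u /rem; ring.
(* The weight 1 / (k h) balances the remainder, whose norm is at most k h, against f t. *)
have kh : 0 < (k * h)^-1 by rewrite invr_gt0 mulr_gt0.
have [_] := fL2_mul kh fr ht; rewrite -ip1 invrK -/a => b1.
have b1' : normc (cint eps (fun v => u v * (f t v)^*)) <= k * h * (1 + a).
  apply: le_trans b1 _; rewrite mulrDr mulr1 lerD2r mulrC ler_pdivrMr ?mulr_gt0//.
  by apply: le_trans r2 _; rewrite -exprMn expr2.
have E : (N2 eps (f s) - a)%:C = cint eps (fun v => u v * (f t v)^*) + (cint eps (fun v => u v * (f t v)^*))^*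
    + (N2 eps u)%:C.
  rewrite real_complexB -!cint_sqr//; have [i1 _] := fL2_mul ltr01 fu ht.
  have [i3 _] := fL2_mul ltr01 fu fu; have [i4 _] := fL2_mul ltr01 hs hs; have [i5 _] := fL2_mul ltr01 ht ht.
  rewrite -cint_conj// -cintD//; last exact: intC_conj.
  rewrite -cintD//; last by apply: intCD => //; exact: intC_conj.
  by rewrite -cintB//; apply: cint_eq => v; rewrite /u !conjcM !conjcB !conjcK; ring.
have := congr1 (fun z : C => normc z) E; rewrite normc_real => ->.
apply: le_trans (le_normcD _ _) _; apply: (@le_trans _ _ (2 * (k * h * (1 + a)) + N2 eps u)).
  apply: lerD; last by rewrite normc_real ger0_norm// N2_ge0.
  by apply: le_trans (le_normcD _ _) _; rewrite normc_conj; lra.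
have h3 : h * (4 * (1 + b)) <= e by rewrite -ler_pdivlMr ?mulr_gt0 ?ltr_wpDr// ltW.
have kk : k ^+ 2 <= 1 by rewrite exprn_ile1// ltW.
have p1 : 2 * N2 eps (rem f f' s t) + 2 * (h ^+ 2 * b) <= 2 * (1 + b) * h ^+ 2.
  have : k ^+ 2 * h ^+ 2 <= 1 * h ^+ 2 by rewrite ler_wpM2r// exprn_ge0// ltW.
  by move: r2; lra.
have p2 : h * (4 * (1 + b)) * h <= e * h by rewrite ler_pM2r.
have p3 : k * (8 * (1 + a)) * h <= e * h by rewrite ler_pM2r.
have u2' : N2 eps u <= 2 * N2 eps (rem f f' s t) + 2 * (h ^+ 2 * b) by exact: u2.
have eh : 0 <= e * h by apply: mulr_ge0; exact: ltW.
by move: u2' p1; rewrite expr2; lra.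
Qed.

Lemma HOmega_sub (Z : 'M[C]_n) (f g : VT -> C) : HOmega Z f -> HOmega Z g -> HOmega Z (fun v => f v - g v).
Proof.
move=> [/H0_fL2 hf [p ep fE]] [/H0_fL2 hg [q eq gE]]; split; first by apply/H0_fL2; have [] := fL2B hf hg.
exists (fun z => p z + (- 1) * q z); first by apply: entireD => //; apply: entireM => //; exact: entire_cst.
by move=> v; rewrite fE gE; ring.
Qed.

Lemma HOmega_scale (Z : 'M[C]_n) (f : VT -> C) c : HOmega Z f -> HOmega Z (fun v => f v * c).
Proof.
move=> [/H0_fL2 hf [p ep fE]]; split.
  apply/H0_fL2; rewrite (_ : (fun v => _) = fun v => c * f v); first by have [] := fL2Z c hf.
  by apply/funext => v; rewrite mulrC.
exists (fun z => p z * c); first by apply: entireM => //; exact: entire_cst.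
by move=> v; rewrite fE; ring.
Qed.

Lemma HOmega_add (Z : 'M[C]_n) (f g : VT -> C) : HOmega Z f -> HOmega Z g -> HOmega Z (fun v => f v + g v).
Proof.
move=> hf hg; have := HOmega_sub hf (HOmega_scale (- 1) hg).
by rewrite (_ : (fun v => _) = fun v => f v + g v)//; apply/funext => v; ring.
Qed.

(** Both derivatives are orthogonal to the fibre, hence to the difference of the sections, whose
    norm stays 0; continuity of its values turns this into pointwise equality. *)
Lemma parallelH_unique (Z : R -> 'M[C]_n) f g : parallelH Z f -> parallelH Z g -> f 0 = g 0 ->
  forall t : R, t \in `[0, 1] -> f t = g t.
Proof.
move=> [hf [f' [f'2 df _ pf]]] [hg [g' [g'2 dg _ pg]]] fg0 t t01.
pose h t v := f t v - g t v; pose h' t v := f' t v - g' t v.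
have f2 u : u \in `[0, 1] -> fL2 eps (f u) by move=> /hf[/H0_fL2].
have g2 u : u \in `[0, 1] -> fL2 eps (g u) by move=> /hg[/H0_fL2].
have f2' u : u \in `[0, 1] -> fL2 eps (f' u) by move=> /f'2/H0_fL2.
have g2' u : u \in `[0, 1] -> fL2 eps (g' u) by move=> /g'2/H0_fL2.
have h2 u : u \in `[0, 1] -> fL2 eps (h u) by move=> u01; have [] := fL2B (f2 u u01) (g2 u u01).
have h2' u : u \in `[0, 1] -> fL2 eps (h' u) by move=> u01; have [] := fL2B (f2' u u01) (g2' u u01).
have hh u : u \in `[0, 1] -> HOmega (Z u) (h u) by move=> u01; exact: HOmega_sub (hf u u01) (hg u u01).
have dh : deriv01 L2norm h h'.
  apply/(deriv01_N2 h2 h2') => u u01 e e0; have e4 : 0 < e / 4 by rewrite divr_gt0.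
  have [d1 d10 H1] := (deriv01_N2 f2 f2').1 df u u01 _ e4.
  have [d2 d20 H2] := (deriv01_N2 g2 g2').1 dg u u01 _ e4.
  exists (Num.min d1 d2); first by rewrite lt_min d10.
  move=> s s01; rewrite lt_min => /andP[/(H1 s s01) l1 /(H2 s s01) l2].
  have [_] := fL2B (fL2_rem (f2 s s01) (f2 u u01) (f2' u u01)) (fL2_rem (g2 s s01) (g2 u u01) (g2' u u01)).
  rewrite (_ : (fun v => _) = rem h h' s u); last by apply/funext => v; rewrite /rem /h /h'; ring.
  by move=> l; lra.
have ort u : u \in `[0, 1] -> cint eps (fun v => h' u v * (h u v)^*) = 0.
  move=> u01; have [_ /(_ _ (hh u u01)) z1] := pf u u01; have [_ /(_ _ (hh u u01)) z2] := pg u u01.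
  have w1 : cint eps (fun v => f' u v * (h u v)^*) = 0.
    by rewrite -[RHS]z1; apply: cint_eq => v; rewrite (_ : (f' u - 0) v = f' u v)// subr0.
  have w2 : cint eps (fun v => g' u v * (h u v)^*) = 0.
    by rewrite -[RHS]z2; apply: cint_eq => v; rewrite (_ : (g' u - 0) v = g' u v)// subr0.
  have [i1 _] := fL2_mul ltr01 (f2' u u01) (h2 u u01); have [i2 _] := fL2_mul ltr01 (g2' u u01) (h2 u u01).
  rewrite (@cint_eq _ _ _ _ _ (fun v => f' u v * (h u v)^* - g' u v * (h u v)^*)).
    by rewrite cintB// w1 w2 subrr.
  by move=> v; rewrite /h'; ring.
have := norm_derivative_zero h2 h2' dh ort t01.
have -> : N2 eps (h 0) = 0.
  have -> : h 0 = fun v => 0 * (0 : C) by apply/funext => v; rewrite /h fg0 subrr mul0r.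
  have z01 : (0 : R) \in `[0, 1] by rewrite in_itv /= lexx ler01.
  have f0 : fL2 eps (fun _ : VT => 0 : C).
    by have := h2 0 z01; rewrite (_ : h 0 = fun _ => 0)//; apply/funext => v; rewrite /h fg0 subrr.
  by have [_ ->] := fL2Z 0 f0; rewrite ComplexField.Normc.normc0 expr0n mul0r.
move=> /(vcontinuous_N2_eq0 (HOmega_vcontinuous (hh t t01)) (h2 t t01)) E.
by apply/funext => v; apply/eqP; rewrite -subr_eq0; apply/eqP; exact: E.
Qed.

End square_integrable_sections.

Section scaled_sections.
Context {R : realType} {n : nat}.
Local Notation C := R[i].
Local Notation T := (measurableTypeR R).
Local Notation VT := (n.-tuple T * n.-tuple T)%type.
Local Notation eps := (@eps_omega R n).
Local Notation I01 := (`[0, 1]%classic : set R).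

Lemma fL2Zr (f : VT -> C) c : fL2 eps f -> fL2 eps (fun v => f v * c) /\
  N2 eps (fun v => f v * c) = normc c ^+ 2 * N2 eps f.
Proof.
move=> hf; rewrite (_ : (fun v => _) = fun v => c * f v); first exact: fL2Z.
by apply/funext => v; rewrite mulrC.
Qed.

Lemma deriv01_continuous (f f' : R -> VT -> C) : (forall t : R, t \in `[0, 1] -> fL2 eps (f t)) ->
  (forall t : R, t \in `[0, 1] -> fL2 eps (f' t)) -> deriv01 L2norm f f' ->
  forall t : R, t \in `[0, 1] -> forall e : R, 0 < e -> exists2 d : R, 0 < d &
    forall s : R, s \in `[0, 1] -> `|s - t| < d -> N2 eps (fun v => f s v - f t v) <= e.
Proof.
move=> hf hf' /(deriv01_N2 hf hf') H t t01 e e0; have [d d0 Hd] := H t t01 1 ltr01.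
set b := N2 eps (f' t); have b0 : 0 <= b by exact: N2_ge0.
have k0 : 0 < 2 + 2 * b by rewrite ltr_wpDr// mulr_ge0.
exists (Num.min d (Num.min 1 (e / (2 + 2 * b)))); first by rewrite !lt_min d0 ltr01 divr_gt0.
move=> s s01; rewrite !lt_min => /andP[sd /andP[s1 se]].
have r1 := Hd s s01 sd; rewrite mul1r in r1.
apply: le_trans (rem_increment (hf s s01) (hf t t01) (hf' t t01)) _; rewrite -/b.
have hh : (s - t) ^+ 2 <= `|s - t|.
  by rewrite -real_normK ?num_real// expr2 -[leRHS]mulr1 ler_wpM2l// ltW.
have h2 : `|s - t| * (2 + 2 * b) <= e by rewrite -ler_pdivlMr// ltW.
have h3 : (s - t) ^+ 2 * b <= `|s - t| * b by rewrite ler_wpM2r.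
by lra.
Qed.

Lemma small_exists (k e : R) : 0 <= k -> 0 < e -> exists d : R, [/\ 0 < d, d <= 1 & d * k <= e].
Proof.
move=> k0 e0; have k1 : 0 < k + 1 by rewrite ltr_wpDl.
exists (Num.min 1 (e / (k + 1))); split; first by rewrite lt_min ltr01 divr_gt0.
  by rewrite ge_min lexx.
apply: (@le_trans _ _ (e / (k + 1) * (k + 1))); last by rewrite divfK// gt_eqF.
apply: ler_pM => //; [by rewrite le_min ler01 divr_ge0// ltW|by rewrite ge_min lexx orbT|by rewrite lerDl].
Qed.

Lemma tends_punct_near (c : R -> C) t e : tends (punct I01 t) c (c t) -> 0 < e ->
  exists2 d : R, 0 < d & forall s, I01 s -> `|s - t| < d -> normc (c s - c t) <= e.
Proof.
move=> H e0; have [d d0 Hd] := (punctP _ _ _).1 (H e e0); exists d => // s s01 sd.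
have [->|st] := eqVneq s t; first by rewrite subrr ComplexField.Normc.normc0 ltW.
by apply: ltW; exact: Hd.
Qed.

Lemma sqr_le_small (x e : R) : 0 <= x -> x <= e -> e <= 1 -> x ^+ 2 <= e.
Proof.
move=> x0 xe e1; have : x * x <= 1 * e by apply: ler_pM => //; exact: le_trans e1.
by rewrite mul1r expr2.
Qed.

(** The Leibniz rule for a scalar factor. The covariant derivative D is arbitrary, so that the rule
    serves both to multiply parallel sections by a half-form and to divide general ones by it. *)
Lemma nablaH_scale (Z : R -> 'M[C]_n) (f D : R -> VT -> C) (c c' : R -> C) : nablaH Z f D ->
  (forall t : R, t \in `[0, 1] -> derc I01 c t (c' t)) ->
  (forall t : R, t \in `[0, 1] -> tends (punct I01 t) c' (c' t)) ->
  nablaH Z (fun t v => f t v * c t) (fun t v => D t v * c t + f t v * c' t).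
Proof.
move=> [hf [f' [f'2 df cf pf]]] dc cc; split=> [t t01|]; first exact: HOmega_scale (hf t t01).
have f2 u : u \in `[0, 1] -> fL2 eps (f u) by move=> /hf[/H0_fL2].
have f2' u : u \in `[0, 1] -> fL2 eps (f' u) by move=> /f'2/H0_fL2.
pose g t v := f t v * c t; pose g' t v := f' t v * c t + f t v * c' t.
have g2 u : u \in `[0, 1] -> fL2 eps (g u) by move=> u01; have [] := fL2Zr (c u) (f2 u u01).
have g2' u : u \in `[0, 1] -> fL2 eps (g' u).
  by move=> u01; have [h1 _] := fL2Zr (c u) (f2' u u01); have [h2 _] := fL2Zr (c' u) (f2 u u01); have [] := fL2D h1 h2.
exists g'; split.
- by move=> t /g2' /H0_fL2.
- apply/(deriv01_N2 g2 g2') => t t01 e e0.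
  have ft := f2 t t01; have ft' := f2' t t01.
  set a := N2 eps (f t); set b := N2 eps (f' t); set k := normc (c t) ^+ 2.
  have a0 : 0 <= a by exact: N2_ge0. have b0 : 0 <= b by exact: N2_ge0.
  have k0 : 0 <= k by exact: sqr_ge0.
  (* The three error terms enter with factors 4, 4 and 2, the last being bounded by twice e / 12; in
     total e. *)
  have e12 : 0 < e / 12 by rewrite divr_gt0.
  have [e1 [e10 e11 e1k]] := small_exists k0 e12.
  have [e2 [e20 e21 e2k]] := small_exists a0 e12.
  have [e3 [e30 e31 e3k]] := small_exists (addr_ge0 (ltW e10) b0) e12.
  have [d1 d10 H1] := (deriv01_N2 f2 f2').1 df t t01 e1 e10.
  have [d2 d20 H2] := (dercP _ _ _ _).1 (dc t t01) e2 e20.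
  have [d3 d30 H3] := tends_punct_near (derc_tends (dc t t01)) e30.
  exists (Num.min d1 (Num.min d2 d3)); first by rewrite !lt_min d10 d20.
  move=> s s01; rewrite !lt_min => /andP[/(H1 s s01) h1 /andP[/(H2 s s01) h2 /(H3 s s01) h3]].
  have fs := f2 s s01; have fr := fL2_rem fs ft ft'.
  have [p1 q1] := fL2Zr (c t) fr.
  have [p2 q2] := fL2Zr (c s - c t - (s - t)%:C * c' t) ft.
  have [p3 q3] := fL2Zr (c s - c t) (fL2B fs ft).1.
  have [p12 q12] := fL2D p1 p2; have [_] := fL2D p12 p3.
  (* The remainder of a product: remainder of f times c t, plus f t times the remainder of c, plus
     the product of both increments. *)
  rewrite (_ : (fun v => _) = rem g g' s t); last first.
    by apply/funext => v; rewrite /rem /g /g'; ring.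
  move=> q; apply: le_trans q _; move: q12; rewrite q1 q2 q3 -/a -/k => q12.
  have inc := rem_increment fs ft ft'; rewrite -/b in inc.
  set h := (s - t) ^+ 2 in h1 inc *; have h0 : 0 <= h by exact: sqr_ge0.
  have l2 : normc (c s - c t - (s - t)%:C * c' t) ^+ 2 <= e2 * h.
    apply: (@le_trans _ _ ((e2 * `|s - t|) ^+ 2)); first by rewrite lerXn2r ?nnegrE ?normc_ge0 ?mulr_ge0 // ltW.
    by rewrite exprMn real_normK ?num_real// ler_wpM2r//; apply: sqr_le_small => //; exact: ltW.
  have l3 : normc (c s - c t) ^+ 2 <= e3 by apply: sqr_le_small => //; exact: normc_ge0.
  set N := N2 eps (fun v => f s v - f t v) in inc q12 *; have N0 : 0 <= N by exact: N2_ge0.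
  have t1 : k * N2 eps (rem f f' s t) <= e / 12 * h.
    apply: (@le_trans _ _ (k * (e1 * h))); first by rewrite ler_wpM2l.
    by rewrite mulrA ler_wpM2r// mulrC.
  have t2 : normc (c s - c t - (s - t)%:C * c' t) ^+ 2 * a <= e / 12 * h.
    apply: (@le_trans _ _ (e2 * h * a)); first by rewrite ler_wpM2r.
    by rewrite mulrAC ler_wpM2r.
  have t3 : normc (c s - c t) ^+ 2 * N <= 2 * (e / 12 * h).
    apply: (@le_trans _ _ (e3 * (2 * ((e1 + b) * h)))).
      by apply: ler_pM => //; [exact: sqr_ge0|lra].
    rewrite (_ : e3 * _ = 2 * (e3 * (e1 + b) * h)); last by ring.
    by rewrite ler_wpM2l// ler_wpM2r.
  by have eh : 0 <= e * h by [apply: mulr_ge0 => //; exact: ltW]; lra.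
- apply/(cont01_N2 g2') => t t01 e e0.
  have ft := f2 t t01; have ft' := f2' t t01.
  set a := N2 eps (f t); set b := N2 eps (f' t).
  pose k1 := (normc (c t) + 1) ^+ 2; pose k2 := (normc (c' t) + 1) ^+ 2.
  have a0 : 0 <= a by exact: N2_ge0. have b0 : 0 <= b by exact: N2_ge0.
  have k10 : 0 <= k1 by exact: sqr_ge0. have k20 : 0 <= k2 by exact: sqr_ge0.
  (* Four error terms, each entering with factor 4. *)
  have e16 : 0 < e / 16 by rewrite divr_gt0.
  have [e1 [e10 e11 e1k]] := small_exists k10 e16.
  have [e2 [e20 e21 e2k]] := small_exists b0 e16.
  have [e3 [e30 e31 e3k]] := small_exists k20 e16.
  have [e4 [e40 e41 e4k]] := small_exists a0 e16.
  have [d1 d10 H1] := (cont01_N2 f2').1 cf t t01 e1 e10.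
  have [d2 d20 H2] := tends_punct_near (derc_tends (dc t t01)) e20.
  have [d3 d30 H3] := deriv01_continuous f2 f2' df t01 e30.
  have [d4 d40 H4] := tends_punct_near (cc t t01) e40.
  exists (Num.min (Num.min d1 d2) (Num.min d3 d4)); first by rewrite !lt_min d10 d20 d30.
  move=> s s01; rewrite !lt_min => /andP[/andP[/(H1 s s01) h1 /(H2 s s01) h2] /andP[/(H3 s s01) h3 /(H4 s s01) h4]].
  have fs := f2 s s01; have fs' := f2' s s01.
  have [p1 q1] := fL2Zr (c s) (fL2B fs' ft').1.
  have [p2 q2] := fL2Zr (c s - c t) ft'.
  have [p3 q3] := fL2Zr (c' s) (fL2B fs ft).1.
  have [p4 q4] := fL2Zr (c' s - c' t) ft.
  have [p12 q12] := fL2D p1 p2; have [p34 q34] := fL2D p3 p4; have [_] := fL2D p12 p34.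
  rewrite (_ : (fun v => _) = fun v => g' s v - g' t v); last first.
    by apply/funext => v; rewrite /g'; ring.
  move=> q; apply: le_trans q _; move: q12 q34; rewrite q1 q2 q3 q4 -/a -/b => q12 q34.
  have cs : normc (c s) ^+ 2 <= k1.
    rewrite lerXn2r ?nnegrE ?normc_ge0 ?addr_ge0 ?normc_ge0//.
    by have := le_normcD (c s - c t) (c t); rewrite subrK; lra.
  have cs' : normc (c' s) ^+ 2 <= k2.
    rewrite lerXn2r ?nnegrE ?normc_ge0 ?addr_ge0 ?normc_ge0//.
    by have := le_normcD (c' s - c' t) (c' t); rewrite subrK; lra.
  have l2 : normc (c s - c t) ^+ 2 <= e2 by apply: sqr_le_small => //; exact: normc_ge0.
  have l4 : normc (c' s - c' t) ^+ 2 <= e4 by apply: sqr_le_small => //; exact: normc_ge0.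
  have t1 : normc (c s) ^+ 2 * N2 eps (fun v => f' s v - f' t v) <= e / 16.
    by apply: le_trans e1k; rewrite [leRHS]mulrC; apply: ler_pM => //; [exact: sqr_ge0|exact: N2_ge0].
  have t2 : normc (c s - c t) ^+ 2 * b <= e / 16 by apply: le_trans e2k; rewrite ler_wpM2r.
  have t3 : normc (c' s) ^+ 2 * N2 eps (fun v => f s v - f t v) <= e / 16.
    by apply: le_trans e3k; rewrite [leRHS]mulrC; apply: ler_pM => //; [exact: sqr_ge0|exact: N2_ge0].
  have t4 : normc (c' s - c' t) ^+ 2 * a <= e / 16 by apply: le_trans e4k; rewrite ler_wpM2r.
  by lra.
move=> t t01; have [hD pD] := pf t t01; split.
  exact: HOmega_add (HOmega_scale (c t) hD) (HOmega_scale (c' t) (hf t t01)).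
move=> k hk; have k2 : fL2 eps k by case: hk => /H0_fL2.
have D2 : fL2 eps (D t) by case: hD => /H0_fL2.
have [i1 _] := fL2_mul ltr01 (fL2B (f2' t t01) D2).1 k2.
(* The term with c' is common to the derivative and to its projection, so only (f' - D) c
   remains. *)
transitivity (c t * cint eps (fun v => (f' t v - D t v) * (k v)^*)).
  rewrite -cintZ//; apply: cint_eq => v.
  by rewrite (_ : (g' t - _) v = g' t v - (D t v * c t + f t v * c' t))// /g'; ring.
by rewrite -[RHS](mulr0 (c t)) -[in RHS](pD k hk).
Qed.

End scaled_sections.

(** * The branch of the square root of the determinant *)

Section determinant_branch.
Context {R : realType}.
Local Notation C := R[i].

(* The principal root on the right half-plane; by elimination, the branch of the root of
   the determinant is the product of the principal roots of the pivots. *)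
Definition csqrt (z : C) : C := (z + (normc z)%:C) / (Num.sqrt (2 * (normc z + complex.Re z)))%:C.

Lemma csqrt_den_gt0 (z : C) : 0 < complex.Re z -> 0 < 2 * (normc z + complex.Re z).
Proof. by move=> z0; rewrite mulr_gt0// ltr_wpDl// normc_ge0. Qed.

Lemma csqrt_sqr (z : C) : 0 < complex.Re z -> csqrt z ^+ 2 = z.
Proof.
move=> z0; have d0 := csqrt_den_gt0 z0.
rewrite /csqrt expr_div_n -real_complexX sqr_sqrtr ?ltW//.
have E : (z + (normc z)%:C) ^+ 2 = z * (2 * (normc z + complex.Re z))%:C.
  have zz := mul_conj z; rewrite real_complexX in zz.
  have rz : (2 * complex.Re z)%:C = z + z^* by apply: complex_ext; rewrite !reimE; ring.
  rewrite mulrDr real_complexD rz real_complexM real_complex_nat.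
  rewrite [RHS](_ : _ = z ^+ 2 + 2 * z * (normc z)%:C + z * z^*); last by ring.
  by rewrite zz; ring.
by rewrite E mulfK// real_complex_eq0 gt_eqF.
Qed.

Lemma csqrt_pos (x : R) : 0 < x -> csqrt x%:C = (Num.sqrt x)%:C.
Proof.
move=> x0; rewrite /csqrt normc_real gtr0_norm// Re_real -real_complexD -real_complexV -real_complexM.
congr (_%:C); rewrite (_ : 2 * (x + x) = 2 ^+ 2 * x); last by ring.
rewrite sqrtrM ?exprn_ge0// sqrtr_sqr normr_nat -{1 2}(sqr_sqrtr (ltW x0)).
by field; rewrite sqrtr_eq0 -ltNge.
Qed.

Lemma tends_csqrt (U : Type) (F : set_system U) {FF : Filter F} (f : U -> C) (a : C) :
  0 < complex.Re a -> tends F f a -> tends F (fun s => csqrt (f s)) (csqrt a).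
Proof.
move=> a0 fa.
have n1 : tends F (fun s => (normc (f s))%:C) (normc a)%:C.
  move=> e e0; apply: filterS (fa e e0) => s /=; rewrite -real_complexB normc_real => h.
  apply: le_lt_trans h; rewrite ler_norml; apply/andP; split.
    by have := le_normcD (a - f s) (f s); rewrite subrK normc_subC; lra.
  by have := le_normcD (f s - a) a; rewrite subrK; lra.
apply: tendsM; first exact: tendsD.
apply: tendsV; first by rewrite real_complex_eq0 gt_eqF// sqrtr_gt0 csqrt_den_gt0.
have d : tends F (fun s => (2 * (normc (f s) + complex.Re (f s)))%:C) (2 * (normc a + complex.Re a))%:C.
  rewrite (_ : (fun s => _) = fun s => 2 * (normc (f s))%:C + (f s + (f s)^*)); last first.
    by apply/funext => s; apply: complex_ext; rewrite !reimE; ring.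
  rewrite (_ : (2 * _)%:C = 2 * (normc a)%:C + (a + a^*)); last by apply: complex_ext; rewrite !reimE; ring.
  by apply: tendsD; [apply: tendsM => //; exact: tends_cst|apply: tendsD => //; exact: tends_conj].
move=> e e0; have := @sqrt_continuous R (2 * (normc a + complex.Re a)).
move=> /cvgrPdist_lt /(_ e e0) /nbhs_ballP[r /= r0 Hr].
apply: filterS (d r r0) => s /=; rewrite -!real_complexB !normc_real => h.
by rewrite distrC; apply: Hr; rewrite /ball /= distrC.
Qed.

(** The Schur complement of the upper left entry, which is the first pivot. *)
Definition schur m (M : 'M[C]_m.+1) : 'M[C]_m := \matrix_(i, j)
  (M (lift 0 i) (lift 0 j) - M (lift 0 i) 0 * M 0 (lift 0 j) / M 0 0).

Fixpoint sdet m : 'M[C]_m -> C :=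
  if m is k.+1 then fun M => csqrt (M 0 0) * sdet (schur M) else fun=> 1.

(** A unipotent lower triangular factor clears the first column. *)
Lemma det_schur m (M : 'M[C]_m.+1) : M 0 0 != 0 -> \det M = M 0 0 * \det (schur M).
Proof.
move=> a0; pose a := M 0 0.
pose N : 'M[C]_(1 + m) := M.
pose c : 'cV[C]_m := dlsubmx N; pose r : 'rV[C]_m := ursubmx N.
have ul : ulsubmx N = a%:M.
  by apply/matrixP => i j; rewrite !ord1 !mxE eqxx mulr1n; congr (M _ _); exact: val_inj.
have E : N = block_mx 1%:M 0 (a^-1 *: c) 1%:M *m block_mx a%:M r 0 (schur M).
  rewrite mulmx_block !mul1mx !mul0mx !addr0 mul_mx_scalar scalerA divff// scale1r.
  rewrite -{1}[N]submxK ul; congr block_mx; apply/matrixP => i j.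
  rewrite !mxE big_ord1 !mxE.
  have -> : rshift 1 i = lift 0 i by exact: val_inj. have -> : rshift 1 j = lift 0 j by exact: val_inj.
  have -> : lshift m (0 : 'I_1) = 0 by exact: val_inj.
  by rewrite /N /a; field.
by rewrite -[LHS]/(\det N) E det_mulmx det_lblock !det1 !mul1r det_ublock det_scalar1.
Qed.

(** For real u, extending by w_0 = - b / M_00 annihilates the first coordinate of M w, so the
    Hermitian form of M at w is the form of the Schur complement at u. *)
Lemma posre_schur m (M : 'M[C]_m.+1) : posre M -> 0 < complex.Re (M 0 0) /\ posre (schur M).
Proof.
move=> hM; have [sM pM] := hM.
have pos w : w != 0 -> 0 < complex.Re (dot (conjmx w) (M *m w)).
  by move=> w0; rewrite Re_dot_sym// /hqf; exact: posdef_hform.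
have a0 : 0 < complex.Re (M 0 0).
  have := pos (delta_mx 0 0); rewrite (_ : dot _ _ = M 0 0); last first.
    rewrite dotE (bigD1 0)//= big1 ?addr0 => [|i i0]; last by rewrite !mxE (negPf i0) conjc0 mul0r.
    rewrite !mxE !eqxx conjc1 mul1r (bigD1 0)//= big1 ?addr0 => [|i i0]; last by rewrite !mxE (negPf i0) mulr0.
    by rewrite !mxE !eqxx mulr1.
  by apply; apply/eqP => /matrixP/(_ 0 0); rewrite !mxE !eqxx => /eqP; rewrite oner_eq0.
have an0 : M 0 0 != 0 by apply/eqP => E; rewrite E ltxx in a0.
have sc i j : M i j = M j i by rewrite -[in LHS]sM mxE.
have sS : (schur M)^T = schur M.
  apply/matrixP => i j; rewrite mxE /schur [LHS]mxE [RHS]mxE.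
  rewrite [M (lift 0 j) (lift 0 i)]sc [M (lift 0 j) 0]sc [M 0 (lift 0 i)]sc.
  by rewrite [M 0 (lift 0 j) * _]mulrC.
split => //; split => //.
split; first by rewrite -[in RHS]sS; apply/matrixP => i j; rewrite [LHS]mxE [LHS]mxE [RHS]mxE [in RHS]mxE.
move=> u u0.
pose b := \sum_j M 0 (lift 0 j) * (u j 0)%:C.
pose w : 'cV[C]_m.+1 := \col_i (if unlift 0 i is Some j then (u j 0)%:C else - (b / M 0 0)).
have w0 : w 0 0 = - (b / M 0 0) by rewrite mxE unlift_none.
have wl j : w (lift 0 j) 0 = (u j 0)%:C by rewrite mxE liftK.
have := pos w; rewrite (_ : dot _ _ = \sum_i (u i 0)%:C * \sum_j schur M i j * (u j 0)%:C); last first.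
  rewrite dotE big_ord_recl (_ : (M *m w) 0 0 = 0) ?mulr0 ?add0r; last first.
    rewrite mxE big_ord_recl w0 (_ : \sum_(i < m) _ = b); first by field.
    by apply: eq_bigr => j _; rewrite wl.
  apply: eq_bigr => i _; rewrite mxE wl conjc_real; congr (_ * _).
  rewrite mxE big_ord_recl w0; under eq_bigr do rewrite wl.
  under [RHS]eq_bigr do rewrite mxE mulrBl.
  rewrite sumrB addrC mulrN; congr (_ - _); rewrite /b mulr_suml mulr_sumr.
  by apply: eq_bigr => j _; ring.
have -> : (u^T *m Remx (schur M) *m u) 0 0 = complex.Re (\sum_i (u i 0)%:C * \sum_j schur M i j * (u j 0)%:C).
  rewrite -mulmxA mxE Re_sum; apply: eq_bigr => i _; rewrite !reimE mul0r subr0 mxE; congr (_ * _).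
  by rewrite mxE Re_sum; apply: eq_bigr => j _; rewrite !reimE mulr0 subr0 [in LHS]mxE.
apply; apply/eqP => w00; move/eqP: u0; apply; apply/matrixP => i j; rewrite ord1 !mxE.
by have := congr1 (fun N : 'cV_m.+1 => complex.Re (N (lift 0 i) 0)) w00; rewrite wl Re_real mxE.
Qed.

Lemma sdet_sqr m (M : 'M[C]_m) : posre M -> sdet M ^+ 2 = \det M.
Proof.
elim: m M => [|m IH] M hM /=; first by rewrite expr1n det_mx00.
have [a0 hS] := posre_schur hM; rewrite exprMn csqrt_sqr// IH// det_schur//.
by apply/eqP => E; rewrite E ltxx in a0.
Qed.

Lemma tends_sdet (U : Type) (F : set_system U) {FF : Filter F} m (M : U -> 'M[C]_m) (L : 'M[C]_m) :
  posre L -> (forall i j, tends F (fun s => M s i j) (L i j)) -> tends F (fun s => sdet (M s)) (sdet L).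
Proof.
elim: m M L => [|m IH] M L hL ML /=; first exact: tends_cst.
have [a0 hS] := posre_schur hL; have an0 : L 0 0 != 0 by apply/eqP => E; rewrite E ltxx in a0.
apply: tendsM; first exact: tends_csqrt.
apply: IH => // i j; rewrite mxE (_ : (fun s => _) = fun s =>
    M s (lift 0 i) (lift 0 j) - M s (lift 0 i) 0 * M s 0 (lift 0 j) / M s 0 0); last first.
  by apply/funext => s; rewrite mxE.
by apply: tendsD => //; apply: tendsN; apply: tendsM; [exact: tendsM|exact: tendsV].
Qed.

(** The pivots of a real positive definite matrix are positive reals, and so are their principal
    roots. *)
Lemma sdet_posdef m (Y : 'M[R]_m) : posdef Y -> 0 < sdet (toC Y).
Proof.
elim: m Y => [|m IH] Y hY /=; first exact: ltr01.
have hp : posre (toC Y : 'M[C]_m.+1).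
  by split; [rewrite map_trmx hY.1|rewrite (_ : Remx _ = Y)//; apply/matrixP => i j; rewrite !mxE Re_real].
have [a0 [_ hS]] := posre_schur hp; rewrite mxE Re_real in a0.
have E : schur (toC Y) = toC (Remx (schur (toC Y))).
  by apply/matrixP => i j; rewrite !mxE -real_complexM -real_complexV -real_complexM -real_complexB Re_real.
rewrite mxE csqrt_pos// mulr_gt0 ?ltcR ?sqrtr_gt0// E; exact: IH.
Qed.

Variable n : nat.

(** Continuity is phrased along filters on the line, so that it composes directly with paths of
    matrices. *)
Definition good_branch (s : 'M[C]_n -> C) : Prop :=
  [/\ forall (F : set_system R) (FF : Filter F) (M : R -> 'M[C]_n) (L : 'M[C]_n), posre L ->
        F [set u | posre (M u)] -> (forall i j, tends F (fun u => M u i j) (L i j)) ->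
        tends F (fun u => s (M u)) (s L),
      forall M, posre M -> s M ^+ 2 = \det M & 0 < s 1%:M].

Lemma posre_line (M N : 'M[C]_n) (t : R) : posre M -> posre N -> t \in `[0, 1] ->
  posre (t%:C *: M + (1 - t)%:C *: N).
Proof.
rewrite in_itv /= => [[sM pM] [sN pN]] /andP[t0 t1]; split; first by rewrite linearD !linearZ /= sM sN.
have E : Remx (t%:C *: M + (1 - t)%:C *: N) = t *: Remx M + (1 - t) *: Remx N.
  by apply/matrixP => i j; rewrite !mxE !reimE; ring.
rewrite E; have [->|tn0] := eqVneq t 0; first by rewrite scale0r add0r subr0 scale1r.
have [->|tn1] := eqVneq t 1; first by rewrite subrr scale0r addr0 scale1r.
by apply: posdefD; apply: posdefZ => //; rewrite ?subr_gt0 lt_neqAle ?t0 ?t1 ?andbT// eq_sym.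
Qed.

Lemma posre1 : posre (1%:M : 'M[C]_n).
Proof.
split; first by rewrite trmx1.
rewrite (_ : Remx _ = 1%:M); first exact: posdef1.
by apply/matrixP => i j; rewrite !mxE; case: (i == j).
Qed.

Lemma det_posre_neq0 (M : 'M[C]_n) : posre M -> \det M != 0.
Proof. by move=> /posre_unit; rewrite unitmxE unitfE. Qed.

(* On the segment from 1 to M the quotient of two branches is continuous with
   values in {1, -1}, hence locally constant. *)
Lemma good_branch_unique (s1 s2 : 'M[C]_n -> C) : good_branch s1 -> good_branch s2 ->
  forall M, posre M -> s1 M = s2 M.
Proof.
move=> [c1 q1 p1] [c2 q2 p2] M hM.
pose L (t : R) : 'M[C]_n := t%:C *: M + (1 - t)%:C *: 1%:M.
have hL t : t \in `[0, 1] -> posre (L t) by move=> t01; exact: posre_line posre1 t01.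
have nz t : t \in `[0, 1] -> s2 (L t) != 0.
  move=> t01; apply/eqP => E; have := q2 _ (hL t t01); rewrite E expr0n => /esym/eqP.
  by rewrite (negPf (det_posre_neq0 (hL t t01))).
pose r t := s1 (L t) / s2 (L t).
have r2 t : t \in `[0, 1] -> r t ^+ 2 = 1.
  move=> t01; rewrite expr_div_n q1 ?q2 ?divff//; try exact: hL.
  exact: det_posre_neq0 (hL t t01).
have r1 t : t \in `[0, 1] -> r t = 1 \/ r t = -1.
  by move=> /r2 /eqP; rewrite sqrf_eq1 => /orP[/eqP|/eqP]; [left|right].
have L0 : L 0 = 1%:M by rewrite /L scale0r add0r subr0 scale1r.
have L1 : L 1 = M by rewrite /L subrr scale0r addr0 scale1r.
have z01 : (0 : R) \in `[0, 1] by rewrite in_itv /= lexx ler01.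
have o01 : (1 : R) \in `[0, 1] by rewrite in_itv /= lexx ler01.
have r0 : r 0 = 1.
  (* The value -1 would make the two branches opposite at the identity, where both are positive. *)
  have [//|E] := r1 0 z01; move: p1; rewrite -L0; have := nz 0 z01; move: E p2; rewrite -L0 /r.
  move=> E p2 n2; rewrite (_ : s1 (L 0) = - s2 (L 0)); first by rewrite oppr_gt0 => p; have := lt_trans p p2; rewrite ltxx.
  by rewrite -[s1 _](divfK n2) E mulN1r.
have tL t : t \in `[0, 1] -> forall i j, tends (punct `[0, 1]%classic t) (fun u => L u i j) (L t i j).
  move=> t01 i j; pose proof (dercD (dercM (derc_real `[0, 1]%classic t) (derc_cst `[0, 1]%classic t (M i j)))
    (dercM (dercB (derc_cst `[0, 1]%classic t 1) (derc_real `[0, 1]%classic t)) (derc_cst `[0, 1]%classic t ((1%:M : 'M[C]_n) i j)))) as H.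
  rewrite (_ : (fun u => _) = fun u => u%:C * M i j + (1 - u%:C) * (1%:M : 'M[C]_n) i j); last first.
    by apply/funext => u; rewrite /L mxE [X in X + _]mxE [X in _ + X]mxE real_complexB.
  rewrite (_ : L t i j = t%:C * M i j + (1 - t%:C) * (1%:M : 'M[C]_n) i j); last first.
    by rewrite /L mxE [X in X + _]mxE [X in _ + X]mxE real_complexB.
  exact: (derc_tends H).
have dr t : t \in `[0, 1] -> derc `[0, 1]%classic r t 0.
  move=> t01; have near : punct `[0, 1]%classic t [set u | posre (L u)].
    by apply/punctP; exists 1 => // u u01 _ _; exact: hL.
  pose proof (tendsM (c1 _ _ L (L t) (hL t t01) near (tL t t01))
    (tendsV (nz t t01) (c2 _ _ L (L t) (hL t t01) near (tL t t01)))) as H.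
  (* The values 1 and -1 are at distance 2, so the tolerance 1 already makes the quotient locally
     constant. *)
  have [d d0 Hd] := (punctP _ _ _).1 (H 1 ltr01).
  apply/dercP => e e0; exists d => // u u01 ud; have [->|ut] := eqVneq u t.
    by rewrite !subrr mul0r subr0 ComplexField.Normc.normc0 normr0 mulr0.
  have := Hd u u01 ut ud; rewrite /= -/(r u) -/(r t) => h.
  suff -> : r u = r t by rewrite subrr mulr0 subr0 ComplexField.Normc.normc0 mulr_ge0// ltW.
  have n2 : normc (1 + 1 : C) = 2 by rewrite -real_complexD normc_real ger0_norm ?addr_ge0//.
  move: h; have [->|->] := r1 u u01; have [->|->] := r1 t t01 => //.
    by rewrite opprK n2 (ltr_nat _ 2 1).
  by rewrite -opprD normcN n2 (ltr_nat _ 2 1).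
have := derc01_constant dr o01; rewrite r0 /r L1 => E.
by rewrite -[LHS](divfK (_ : s2 M != 0)) -?L1 ?nz// L1 E mul1r.
Qed.

Lemma within_posreP (s : 'M[C]_n -> C) :
  {within (posre : set 'M[C^o]_n), continuous (s : 'M[C^o]_n -> C^o)} <->
  forall (U : Type) (F : set_system U) (FF : Filter F) (M : U -> 'M[C]_n) (L : 'M[C]_n), posre L ->
        F [set u | posre (M u)] -> (forall i j, tends F (fun u => M u i j) (L i j)) ->
        tends F (fun u => s (M u)) (s L).
Proof.
split.
  move=> /subspace_continuousP H U F FF M L hL near ML e e0.
  have := H L hL; have N : @nbhs _ (C^o : topologicalType) (s L) [set z | normc (z - s L) < e].
    by apply/nbhs_normc; exists e.
  move=> /(_ _ N); rewrite /nbhs /= => /(@nbhs_ballP C ('M[C^o]_n : pseudoMetricType C))[d /= /gt0_complexP[d' d'0 ->] Hd].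
  have near2 : F [set u | forall ij : 'I_n * 'I_n, normc (M u ij.1 ij.2 - L ij.1 ij.2) < d'].
    by apply: filter_forall => ij; exact: ML.
  apply: filterS (filterI near near2) => u [h1 h2]; apply: Hd => //.
  split=> [|i j]; first by rewrite ltcR.
  by rewrite -ball_normE /ball_ /= normr_normc ltcR normc_subC; exact: (h2 (i, j)).
move=> H; apply/subspace_continuousP => L hL.
apply/tendsP; apply: (H _ _ _ id) => //; first exact: withinT.
move=> i j e e0; apply: (@filterS _ (nbhs (L : 'M[C^o]_n)) _ [set N | normc (N i j - L i j) < e]) => //.
apply/(@nbhs_ballP C ('M[C^o]_n : pseudoMetricType C)).
exists e%:C => [|N [_ /(_ i j)]]; first by rewrite /= ltcR.
by rewrite -ball_normE /ball_ /= normr_normc ltcR normc_subC.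
Qed.

(** Elimination exhibits a branch, so the chosen [sqrtdet] is one. *)
Lemma sqrtdet_good : good_branch (@sqrtdet R n).
Proof.
have : is_sqrtdet_branch (@sqrtdet R n).
  apply: (@xgetPex _ (fun _ => 0) (@is_sqrtdet_branch R n)); exists (@sdet n); split.
  - by apply/within_posreP => U F FF M L hL _ ML; exact: tends_sdet.
  - by move=> M; exact: sdet_sqr.
  - have := sdet_posdef (@posdef1 R n); rewrite (_ : toC _ = 1%:M)//.
    by apply/matrixP => i j; rewrite !mxE; case: (i == j).
by move=> [/within_posreP H q p]; split => // F FF M L; exact: H.
Qed.

Lemma sqrtdet_posdef (Y : 'M[R]_n) : posdef Y -> 0 < sqrtdet (toC Y).
Proof.
move=> hY; have hp : posre (toC Y : 'M[C]_n).
  by split; [rewrite map_trmx hY.1|rewrite (_ : Remx _ = Y)//; apply/matrixP => i j; rewrite !mxE Re_real].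
have g : good_branch (@sdet n).
  split; [by move=> F FF M L hL _; exact: tends_sdet|by move=> M; exact: sdet_sqr|].
  have := sdet_posdef (@posdef1 R n); rewrite (_ : toC _ = 1%:M)//.
  by apply/matrixP => i j; rewrite !mxE; case: (i == j).
by rewrite (good_branch_unique sqrtdet_good g hp); exact: sdet_posdef.
Qed.

Lemma posre_conj (M : 'M[C]_n) : posre M -> posre (conjmx M).
Proof.
move=> [sM pM]; split; first by rewrite map_trmx sM.
by rewrite (_ : Remx _ = Remx M)//; apply/matrixP => i j; rewrite !mxE Re_conjc.
Qed.

(** Conjugating both the argument and the value gives a branch again, and branches are unique. *)
Lemma sqrtdet_conj (M : 'M[C]_n) : posre M -> sqrtdet (conjmx M) = (sqrtdet M)^*.
Proof.
move=> hM; have [c q p] := sqrtdet_good.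
have g : good_branch (fun M => (sqrtdet (conjmx M))^*).
  split.
  - move=> F FF N L hL near NL; apply: tends_conj; apply: (c F FF (fun u => conjmx (N u))).
    + exact: posre_conj.
    + by apply: filterS near => u; exact: posre_conj.
    + move=> i j; rewrite mxE (_ : (fun u => _) = fun u => (N u i j)^*); first exact: tends_conj.
      by apply/funext => u; rewrite mxE.
  - by move=> N hN; rewrite -rmorphXn /= q ?det_map_mx ?conjcK//; exact: posre_conj.
  - have -> : conjmx 1%:M = 1%:M :> 'M[C]_n by rewrite map_mx1.
    by move: p; rewrite -[(_)^*]/(conjc _); case: (sqrtdet _) => x y; rewrite !ltcE /= => /andP[/eqP-> ->]; rewrite oppr0 eqxx.
by rewrite (good_branch_unique sqrtdet_good g hM) conjcK.
Qed.

End determinant_branch.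

(** * Half-forms *)

Section half_form_transport.
Context {R : realType} {n : nat}.
Local Notation C := R[i].
Local Notation T := (measurableTypeR R).
Local Notation VT := (n.-tuple T * n.-tuple T)%type.
Local Notation eps := (@eps_omega R n).
Local Notation I01 := (`[0, 1]%classic : set R).

(** Since s u - s t = (w u - w t) / (s u + s t), continuity of the root suffices: the denominator
    tends to 2 s t, which is nonzero. *)
Lemma derc_sqrt (D : set R) (s w : R -> C) (t : R) (l : C) : D t ->
  tends (punct D t) s (s t) -> (forall u, D u -> s u ^+ 2 = w u) -> s t != 0 ->
  derc D w t l -> derc D s t (l / (2 * s t)).
Proof.
move=> Dt cs sw st0 dw; have n0 : 2 * s t != 0 by rewrite mulf_neq0// two_neq0.
pose proof (tendsD cs (tends_cst (F := punct D t) (s t))) as cs2.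
have E2 : s t + s t = 2 * s t by ring.
rewrite E2 in cs2.
have near0 : punct D t [set u | D u /\ s u + s t != 0].
  have near1 : punct D t [set u | D u] by apply/punctP; exists 1.
  apply: filterS (filterI near1 (cs2 _ (_ : 0 < normc (2 * s t)))) => [u [Du /= h]|]; last by rewrite normc_gt0.
  by split=> //; apply/eqP => E; move: h; rewrite E sub0r normcN ltxx.
pose proof (tendsM dw (tendsV n0 cs2)) as H.
apply: (tends_near _ H); apply: filterS near0 => u [Du su] /=.
rewrite -!sw// subr_sqr; move: ((u - t)%:C^-1) => k.
by field; rewrite su.
Qed.

Lemma Xi_conj (A B : 'M[C]_n) : Xi A B = conjmx (Xi B A).
Proof.
apply/matrixP => i j; rewrite !mxE; move: (A i j) (B i j) => a b.
rewrite conjcM conjcB conjcK; have -> : ((2 * 'i)^-1)^* = - (2 * 'i)^-1 :> C.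
  by rewrite invfM invi; apply: complex_ext; rewrite !reimE /=; ring.
by ring.
Qed.

Lemma posre_Xi (A B : 'M[C]_n) : siegel A -> siegel B -> posre (Xi A B).
Proof.
move=> hA hB; have [_ sX _] := Xi_facts hA hB; split=> //.
by rewrite Remx_Xi; apply: posdefZ; [rewrite invr_gt0|exact: posdefD hA.2 hB.2].
Qed.

Definition half_absdet (M : 'M[C]_n) : R := normc (\det M) `^ 2^-1.

Definition half_form (A B : 'M[C]_n) : C := sqrtdet (Xi B A) / (half_absdet (Xi B A))%:C.

Lemma half_absdet_gt0 M : posre M -> 0 < half_absdet M.
Proof. by move=> hM; apply: powR_gt0; rewrite normc_gt0 det_posre_neq0. Qed.

Lemma sqrtdet_neq0 (M : 'M[C]_n) : posre M -> sqrtdet M != 0.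
Proof.
move=> hM; have [_ q _] := @sqrtdet_good R n; apply/eqP => E.
by have /eqP := q M hM; rewrite E expr0n eq_sym (negPf (det_posre_neq0 hM)).
Qed.

Lemma half_form_neq0 A B : siegel A -> siegel B -> half_form A B != 0.
Proof.
move=> hA hB; have hX := posre_Xi hB hA.
by rewrite mulf_neq0 ?sqrtdet_neq0// invr_eq0 real_complex_eq0 gt_eqF// half_absdet_gt0.
Qed.

Lemma half_form_self A : siegel A -> half_form A A = 1.
Proof.
move=> hA; rewrite /half_form Xi_self.
have hp : posre (toC (Immx A)) by rewrite -Xi_self; exact: posre_Xi.
have [_ q _] := @sqrtdet_good R n; have := q _ hp; have p := sqrtdet_posdef hA.2; move: p.
rewrite /half_absdet det_map_mx; case: (sqrtdet _) => a b; rewrite ltcE /= => /andP[/eqP -> a0] E.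
have -> : \det (Immx A) = a ^+ 2.
  by apply: (fmorph_inj (real_complex R)); apply: etrans (esym E) _; exact: esym (real_complexX a 2).
rewrite normc_real ger0_norm ?sqr_ge0// powR12_sqrt ?sqr_ge0// sqrtr_sqr gtr0_norm//.
by rewrite -[_ +i* 0]/(a%:C) divff// real_complex_eq0 gt_eqF.
Qed.

(** Xi A B is the conjugate of Xi B A, and a number of modulus 1 is the inverse of its conjugate. *)
Lemma half_form_swap A B : siegel A -> siegel B ->
  half_form A B = (half_absdet (Xi A B))%:C / sqrtdet (Xi A B).
Proof.
move=> hA hB; have hX := posre_Xi hB hA; rewrite /half_form (Xi_conj A B) sqrtdet_conj//.
have -> : half_absdet (conjmx (Xi B A)) = half_absdet (Xi B A).
  by rewrite /half_absdet det_map_mx normc_conj.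
have [_ q _] := @sqrtdet_good R n; have s0 := sqrtdet_neq0 hX; have r0 := half_absdet_gt0 hX.
have E : (half_absdet (Xi B A)) ^+ 2 = normc (sqrtdet (Xi B A)) ^+ 2.
  by rewrite -normcX q// /half_absdet -powR_mulrn ?powR_ge0// -powRrM mulVf// powRr1// normc_ge0.
have c0 : (sqrtdet (Xi B A))^* != 0 by rewrite conjc_eq0.
have h0 : (half_absdet (Xi B A))%:C != 0 :> C by rewrite real_complex_eq0 gt_eqF.
apply: (mulIf c0); rewrite divfK//; apply: (mulIf h0).
by rewrite mulrAC divfK// mul_conj -E real_complexX expr2.
Qed.

Variables (A : 'M[C]_n) (Z P : R -> 'M[C]_n).
Hypothesis hA : siegel A.
Hypothesis hZ : forall t : R, t \in `[0, 1] -> siegel (Z t).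
Hypothesis dZ : forall t : R, t \in `[0, 1] -> dercmx I01 Z t (P t).
Hypothesis dP : forall t : R, t \in `[0, 1] -> exists L, dercmx I01 P t L.
Hypothesis phase : forall t : R, t \in `[0, 1] ->
  complex.Im (\tr (invmx (Z t - conjmx A) *m P t)) = - (2^-1 * \tr (invmx (Immx (Z t)) *m Remx (P t))).

(** The connection form of sqrt K evaluated on the velocity, that is, the covariant derivative of
    the unitary frame. *)
Definition kappa (t : R) : C := 'i%C / 4 * (\tr (invmx (Immx (Z t)) *m Remx (P t)))%:C.

(** The root has logarithmic derivative tau / 2 and its modulus Re tau / 2; the quotient retains i
    Im tau / 2, which the phase identity equates with - kappa. *)
Lemma derc_half_form t : t \in `[0, 1] ->
  derc I01 (fun s => half_form A (Z s)) t (- kappa t * half_form A (Z t)).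
Proof.
move=> t01.
pose X s := Xi (Z s) A; pose w s := \det (X s).
pose tau := \tr (invmx (Z t - conjmx A) *m P t).
have hX s : s \in `[0, 1] -> posre (X s) by move=> s01; apply: posre_Xi => //; exact: hZ.
have dX : dercmx I01 X t ((2 * 'i)^-1 *: P t).
  have := dercmxZ (2 * 'i)^-1 (dercmxB (dZ t01) (dercmx_cst I01 t (conjmx A))).
  by rewrite subr0.
have c0 : (2 * 'i)^-1 != 0 :> C by rewrite invr_eq0 mulf_neq0 ?two_neq0 ?i_neq0.
have uD : Z t - conjmx A \in unitmx by have [] := siegel_sub_conj (hZ t01) hA.
have dw : derc I01 w t (w t * tau).
  have := derc_det_unit (posre_unit (hX t t01)) dX.
  by rewrite /X /Xi invmx_scale// -scalemxAl -scalemxAr scalerA mulVf// scale1r.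
have w0 s : s \in `[0, 1] -> w s != 0 by move=> /hX; exact: det_posre_neq0.
have [cs q _] := @sqrtdet_good R n.
have ds : derc I01 (fun s => sqrtdet (X s)) t (sqrtdet (X t) * (tau / 2)).
  have near1 : punct I01 t [set s | posre (X s)].
    by apply/punctP; exists 1 => // s s01 _ _; exact: hX.
  have c : tends (punct I01 t) (fun s => sqrtdet (X s)) (sqrtdet (X t)).
    by apply: cs => //; [exact: hX|move=> i j; exact: derc_tends (dX i j)].
  apply: (derc_val _ (derc_sqrt (w := w) _ c _ _ dw)) => //.
  - have s0 := sqrtdet_neq0 (hX t t01).
    rewrite -[w t]/(\det (X t)) -q; last exact: hX.
    by field; rewrite s0.
  - by move=> s s01; apply: q; exact: hX.
  - exact: sqrtdet_neq0 (hX t t01).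
have n0 : 0 < normc (w t) ^+ 2 by rewrite exprn_gt0// normc_gt0 w0.
have d2 : derc I01 (fun s => (normc (w s) ^+ 2)%:C) t (normc (w t) ^+ 2 * (2 * complex.Re tau))%:C.
  apply: (derc_val _ (derc_eq _ _ (dercM dw (derc_conj dw)))) => //; last by move=> s _; rewrite mul_conj.
  rewrite conjcM real_complexM -mul_conj.
  have -> : (2 * complex.Re tau)%:C = tau + tau^* :> C.
    by apply: complex_ext; rewrite !reimE; ring.
  by ring.
have dr : derc I01 (fun s => (half_absdet (X s))%:C) t (4^-1 * (2 * complex.Re tau) * half_absdet (X t))%:C.
  have E s : half_absdet (X s) = (normc (w s) ^+ 2) `^ 4^-1.
    rewrite /half_absdet -powR_mulrn ?normc_ge0// -powRrM; congr (_ `^ _).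
    by field.
  rewrite E; apply: derc_eq (derc_powR (x := fun s => normc (w s) ^+ 2) 4^-1 n0 d2) => //.
  by move=> s _; rewrite E.
have r0 : (half_absdet (X t))%:C != 0 :> C by rewrite real_complex_eq0 gt_eqF// half_absdet_gt0//; exact: hX.
have H := dercM ds (dercV (f := fun s => (half_absdet (X s))%:C) r0 dr).
rewrite -[X in derc _ X]/(fun s => sqrtdet (X s) * (half_absdet (X s))%:C^-1); apply: derc_val H.
rewrite /half_form -/(X t).
have -> : kappa t = - ('i%C / 2 * (complex.Im tau)%:C).
  rewrite /kappa /tau phase// real_complexN real_complexM real_complexV real_complex_nat.
  by field.
have tE : tau = (complex.Re tau)%:C + 'i%C * (complex.Im tau)%:C by exact: complexE.
rewrite {1}tE; clear tE; move: (complex.Re tau) (complex.Im tau) r0 => a b.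
move: (half_absdet (X t)) (sqrtdet (X t)) => r s r0.
rewrite !real_complexM real_complexV !real_complex_nat.
by field.
Qed.

(** Gives continuity of kappa, by which the derivative of the half-form is continuous as
    [nablaH_scale] demands. *)
Lemma derc_kappa t : t \in `[0, 1] -> exists l, derc I01 kappa t l.
Proof.
move=> t01; have [L dL] := dP t01; have uY s : I01 s -> (toC (Immx (Z s)) : 'M[C]_n) \in unitmx.
  by move=> s01; rewrite toC_unit; exact: posdef_unit (hZ s01).2.
have t1 : I01 t by [].
have dre : dercmx I01 (fun s => toC (Remx (P s))) t (toC (Remx L)).
  move=> i j; rewrite [X in derc _ _ _ X]mxE [X in derc _ _ _ X%:C]mxE.
  by apply: derc_eq (derc_ReP (dL i j)) => // s _; rewrite !mxE.
have H := derc_mxtrace (dercmxM (dercmx_inv t1 uY (dercmx_Immx t1 (dZ t01))) dre).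
eexists; apply: derc_eq (dercZ ('i%C / 4) H) => // s _.
by rewrite /kappa -toCV -toCM trace_map_mx.
Qed.

Lemma parallelK_half_form : parallelK Z (fun t => half_form A (Z t)).
Proof.
exists P, (fun t => - kappa t * half_form A (Z t)); split.
- by apply/deriv01mx_dercmx.
- by apply/deriv01C_derc => t; exact: derc_half_form.
- by move=> t t01; rewrite -/(kappa t) mulNr addNr.
Qed.

(** The velocity is existentially quantified in [nablaK]; uniqueness of derivatives identifies it
    with P. *)
Lemma nablaK_kappa f D t : nablaK Z f D -> t \in `[0, 1] ->
  derc I01 f t (D t - kappa t * f t).
Proof.
move=> [P' [f' [/deriv01mx_dercmx dP' /deriv01C_derc df E]]] t01.
apply: derc_val (df t t01); rewrite E// (dercmx_unique t01 (dP' t t01) (dZ t01)) -/(kappa t).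
by rewrite addrK.
Qed.

(** The quotient by the nonvanishing solution [half_form] has derivative 0. *)
Lemma parallelK_unique f : parallelK Z f -> Z 0 = A -> f 0 = 1 ->
  forall t : R, t \in `[0, 1] -> f t = half_form A (Z t).
Proof.
move=> pf Z0 f0 t t01.
have h0 s : s \in `[0, 1] -> half_form A (Z s) != 0 by move=> /hZ; exact: half_form_neq0.
have dq s : s \in `[0, 1] -> derc I01 (fun s => f s / half_form A (Z s)) s 0.
  move=> s01; apply: derc_val (dercM (nablaK_kappa pf s01) (dercV (h0 s s01) (derc_half_form s01))).
  by field; exact: h0.
have := derc01_constant dq t01; rewrite f0 Z0 half_form_self// divr1 => E.
by rewrite -[LHS](divfK (h0 t t01)) E mul1r.
Qed.

(** The derivative of the scalar factor, - kappa times it, cancels the derivative kappa of the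
    frame. *)
Lemma parallelHK_half_form al : parallelHK Z (fun t => tensorHK (transported A (Z t) al) (half_form A (Z t))).
Proof.
have p := parallel_transported al hA hZ dZ dP phase.
have ck t : t \in `[0, 1] -> tends (punct I01 t) (fun s => - kappa s * half_form A (Z s)) (- kappa t * half_form A (Z t)).
  move=> t01; have [l dk] := derc_kappa t01.
  exact: tendsM (tendsN (derc_tends dk)) (derc_tends (derc_half_form t01)).
have q := nablaH_scale p derc_half_form ck.
eexists; exists kappa; split; first exact: q.
- exists P, (fun=> 0); split; first by apply/deriv01mx_dercmx.
    by apply/deriv01C_derc => t _; exact: derc_cst.
  by move=> t t01; rewrite -/(kappa t) add0r mulr1.
- move=> t t01; apply/funext => v.
  by rewrite -[LHS]/0 -[RHS]/((0 * _ + _ * _) * 1 + _ * _ * _); ring.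
Qed.

(** Division by the half-form cancels the contribution of the frame and leaves a parallel section of
    H, where uniqueness is known. *)
Lemma parallelHK_unique al f : parallelHK Z f -> Z 0 = A -> f 0 = tensorHK (coherent A al) 1 ->
  forall t : R, t \in `[0, 1] -> f t = tensorHK (transported A (Z t) al) (half_form A (Z t)).
Proof.
move=> [D1 [a [nf na E]]] Z0 f0 t t01.
have h0 s : s \in `[0, 1] -> half_form A (Z s) != 0 by move=> /hZ; exact: half_form_neq0.
have ak s : s \in `[0, 1] -> a s = kappa s.
  move=> s01; have := derc_unique s01 (nablaK_kappa na s01) (derc_cst I01 s 1).
  by rewrite mulr1 => /eqP; rewrite subr_eq0 => /eqP.
have dh s : s \in `[0, 1] -> derc I01 (fun s => (half_form A (Z s))^-1) s (kappa s / half_form A (Z s)).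
  move=> s01; apply: derc_val (dercV (h0 s s01) (derc_half_form s01)).
  by field; exact: h0.
have ch s : s \in `[0, 1] -> tends (punct I01 s) (fun u => kappa u / half_form A (Z u)) (kappa s / half_form A (Z s)).
  move=> s01; have [l dk] := derc_kappa s01; exact: tendsM (derc_tends dk) (derc_tends (dh s s01)).
have [hf [f' [hf' df cf pf]]] := nablaH_scale nf dh ch.
have p : parallelH Z (fun s v => f s v / half_form A (Z s)).
  split=> //; exists f'; split=> // s s01.
  rewrite (_ : (fun _ => 0) s = fun v => D1 s v / half_form A (Z s) + f s v * (kappa s / half_form A (Z s))); first exact: pf.
  apply/funext => v; have := congr1 (fun g => g v) (E s s01).
  rewrite /= -[X in _ = X -> _]/(D1 s v * 1 + f s v * a s) ak// mulr1 => e.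
  by rewrite mulrA -mulrDl -e mul0r.
have z01 : (0 : R) \in `[0, 1] by rewrite in_itv /= lexx ler01.
have e0 : (fun v => f 0 v / half_form A (Z 0)) = transported A (Z 0) al.
  apply/funext => w; rewrite f0 Z0 half_form_self// transported_self//.
  by rewrite /tensorHK mulr1 divr1.
have u := parallelH_unique p (parallel_transported al hA hZ dZ dP phase) e0 t01.
apply/funext => v; rewrite /tensorHK -u.
by rewrite divfK// h0.
Qed.

End half_form_transport.

(** * Transport in the Hilbert bundle, in the half-form bundle and in their tensor product *)

Theorem theorem3p3 (R : realType) (n : nat) (Omega Omega' : 'M[R[i]]_n)
    (gamma : R -> 'M[R[i]]_n) (alpha : 'cV[R[i]]_n) :
  siegel Omega -> siegel Omega' ->
  is_geodesic gamma -> gamma 0 = Omega -> gamma 1 = Omega' ->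
  let absdet M : R := ComplexField.Normc.normc (\det M) `^ 2^-1 in
  let transportedK := sqrtdet (Xi Omega' Omega) /
                      (absdet (Xi Omega' Omega))%:C%C in
  [/\ transport (parallelH gamma)
        (coherent Omega alpha) (transported Omega Omega' alpha),
      transport (parallelK gamma) 1 transportedK /\
      transportedK = (absdet (Xi Omega Omega'))%:C%C
                     / sqrtdet (Xi Omega Omega')
    & transport (parallelHK gamma)
        (tensorHK (coherent Omega alpha) 1)
        (tensorHK (transported Omega Omega' alpha) transportedK)].
Proof.
move=> hO hO' gg g0 g1 absdet transportedK.
have hZ := gg.1; have [gamma' [d1 sym d2]] := is_geodesic_ode gg.
have phase := geodesic_phase hZ d1 sym d2; rewrite g0 in phase.
have dP (t : R) : t \in `[0, 1] -> exists L, dercmx `[0, 1]%classic gamma' t L.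
  by move=> t01; eexists; exact: d2.
have o01 : (1 : R) \in `[0, 1] by rewrite in_itv /= lexx ler01.
have p := parallel_transported alpha hO hZ d1 dP phase.
have E0 : transported Omega (gamma 0) alpha = coherent Omega alpha by rewrite g0 transported_self.
have h0 : half_form Omega (gamma 0) = 1 by rewrite g0 half_form_self.
have h1 : half_form Omega (gamma 1) = transportedK by rewrite g1.
split; last 2 first.
- split; last by rewrite -h1 g1 half_form_swap.
  split; first by exists (fun t => half_form Omega (gamma t)); split; [exact: parallelK_half_form hO hZ d1 phase|exact: h0|exact: h1].
  by move=> f pf f0; rewrite (parallelK_unique hO hZ d1 phase pf g0 f0 o01).
- split.
    exists (fun t => tensorHK (transported Omega (gamma t) alpha) (half_form Omega (gamma t))).
    by split; [exact: parallelHK_half_form hO hZ d1 dP phase alpha|rewrite E0 h0|rewrite h1 g1].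
  move=> f pf f0; rewrite (parallelHK_unique hO hZ d1 dP phase pf g0 f0 o01).
  by rewrite h1 g1.
- split; first by exists (fun t => transported Omega (gamma t) alpha); split; [exact: p|exact: E0|rewrite g1].
  move=> f pf f0; have e0 : f 0 = transported Omega (gamma 0) alpha by rewrite E0.
  have u := parallelH_unique pf p e0 o01.
  by rewrite g1 in u.
Qed.
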